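(* Let $M=\mathbb{R}$ or $M=\mathbb{T}$, let $\epsilon>0$ and let $s\ge 0$. Then the Cauchy problem $$i\partial_t u+\Delta u-\epsilon^2\Delta^2u=-\big((I-\epsilon^2\Delta)^{-1}(|u|^2)\big)u,\quad (x,t)\in M\times\mathbb{R},\qquad u(0)=u_0\in H^s(M),$$ is globally well-posed in $H^s(M)$. Furthermore, the data-to-solution map $u_0\mapsto u$ is locally Lipschitz in $H^s(M)$.
   Context: Here $\mathbb{T}$ is the one-dimensional torus, $\Delta=\partial_{xx}$, and $(I-\epsilon^2\Delta)^{-1}$ is the Fourier multiplier with symbol $(1+\epsilon^2\xi^2)^{-1}$. Put $w(\xi)=\epsilon^2\xi^4+\xi^2$, $\langle\xi\rangle=(1+|\xi|^2)^{1/2}$, and let $U_\epsilon(t)$ be the Fourier multiplier with symbol $e^{-itw(\xi)}$. A solution is a function satisfying the Duhamel formula $u(t)=U_\epsilon(t)u_0+i\int_0^tU_\epsilon(t-t')\big[\big((I-\epsilon^2\Delta)^{-1}(|u|^2)\big)u\big](t')\,dt'$. For $s,b\in\mathbb{R}$, $\|u\|_{X^{s,b}}=\|\langle\xi\rangle^s\langle\tau+w(\xi)\rangle^b\hat u(\xi,\tau)\|_{L^2_{\xi,\tau}}$, where $\hat u$ is the space-time Fourier transform (with $\xi\in\mathbb{R}$ if $M=\mathbb{R}$; with $\xi\in\mathbb{Z}$ and counting measure in $\xi$ if $M=\mathbb{T}$), and $X^{s,b}_T$ is the restriction space with norm $\|u\|_{X^{s,b}_T}=\inf\{\|\tilde u\|_{X^{s,b}}:\tilde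 u=u\text{ for }t\in[0,T]\}$. For $b>1/2$ one has $X^{s,b}_T\hookrightarrow C([0,T];H^s(M))$. Globally well-posed in $H^s(M)$ means: there is $b>1/2$ such that for every $u_0\in H^s(M)$ and every $T>0$ there is a solution $u\in C([0,T];H^s(M))\cap X^{s,b}_T$, it is unique in $X^{s,b}_T$, and it depends continuously on $u_0$ (negative times are handled by the time-reversal symmetry $u(x,t)\mapsto\overline{u(x,-t)}$). Locally Lipschitz means: for every $T>0$, the map $u_0\mapsto u$ is locally Lipschitz from $H^s(M)$ to $C([0,T];H^s(M))$. *)

(* Defs.v *)
From HB Require Import structures.
From mathcomp Require Import all_boot all_order all_algebra.
From mathcomp Require Import all_classical all_reals all_analysis.
From mathcomp Require Import complex.

Set Implicit Arguments.
Unset Strict Implicit.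
Unset Printing Implicit Defensive.

Import Order.TTheory GRing.Theory Num.Theory.
Import numFieldNormedType.Exports.

Local Open Scope classical_set_scope.
Local Open Scope ring_scope.
Local Open Scope complex_scope.

Inductive manifold := Line | Torus.

(* The torus is R/2piZ, with dual group Z.  A function on it is represented by
   its restriction to [0, 2pi): functions on M are functions on R modulo
   equality [space_measure M]-almost everywhere, so the values outside [0, 2pi)
   are irrelevant. *)
Definition fundamental_domain (R : realType) (M : manifold) :
    set (measurableTypeR R) :=
  if M is Line then setT else `[0, 2 * pi[.
Arguments fundamental_domain : clear implicits.

Lemma measurable_fundamental_domain (R : realType) (M : manifold) :
  measurable (fundamental_domain R M).
Proof. by case: M => /=; [exact: measurableT|exact: measurable_itv]. Qed.
Arguments measurable_fundamental_domain : clear implicits.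

Definition space_measure (R : realType) (M : manifold) :
    set (measurableTypeR R) -> \bar R :=
  mrestr lebesgue_measure (measurable_fundamental_domain R M).
Arguments space_measure : clear implicits.

HB.instance Definition _ (R : realType) (M : manifold) :=
  Measure.on (space_measure R M).

Lemma sigma_finite_space_measure (R : realType) (M : manifold) :
  sigma_finite setT (space_measure R M).
Proof.
have /= [F FT Ffin] := sigma_finiteT (@lebesgue_measure R).
exists F => // n; have [mF Fn] := Ffin n; split => //.
have mD := measurable_fundamental_domain R M.
by apply: le_lt_trans Fn; apply: le_measure; rewrite ?inE//; exact: measurableI.
Qed.
Arguments sigma_finite_space_measure : clear implicits.

HB.instance Definition _ (R : realType) (M : manifold) :=
  Measure_isSigmaFinite.Build _ _ _ (space_measure R M)
    (sigma_finite_space_measure R M).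

Definition integers (R : realType) : set (measurableTypeR R) :=
  range (fun k : int => k%:~R : R).
Arguments integers : clear implicits.

Lemma measurable_integers (R : realType) : measurable (integers R).
Proof.
apply: countable_measurable; first by move=> t; exact: measurable_set1.
by apply: sub_countable (card_image_le _ _) _; exact: countableP.
Qed.
Arguments measurable_integers : clear implicits.

Definition freq_measure (R : realType) (M : manifold) :
    set (measurableTypeR R) -> \bar R :=
  match M with
  | Line => lebesgue_measure
  | Torus => mrestr counting (measurable_integers R)
  end.
Arguments freq_measure : clear implicits.

Section freq_measure_is_measure.
Variables (R : realType) (M : manifold).

Let freq_measure0 : freq_measure R M set0 = 0%E.
Proof. by case: M => /=; exact: measure0. Qed.

Let freq_measure_ge0 A : (0 <= freq_measure R M A)%E.
Proof. by case: M => /=; exact: measure_ge0. Qed.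

Let freq_measure_sigma_additive : semi_sigma_additive (freq_measure R M).
Proof. by case: M; exact: measure_semi_sigma_additive. Qed.

HB.instance Definition _ := isMeasure.Build _ _ _ (freq_measure R M)
  freq_measure0 freq_measure_ge0 freq_measure_sigma_additive.

Lemma sigma_finite_freq_measure : sigma_finite setT (freq_measure R M).
Proof.
case: M => /=; first exact: (sigma_finiteT (@lebesgue_measure R)).
exists (fun n => `[- n%:R, n%:R]%classic).
  apply/seteqP; split => // x _; have [n _ xn] : exists2 n, True & `|x| <= n%:R.
    exists (Num.truncn `|x|).+1 => //; exact/ltW/truncnS_gt.
  by exists n => //=; rewrite in_itv/= -ler_norml.
move=> n; split; first exact: measurable_itv.
have fin : finite_set (`[- n%:R, n%:R]%classic `&` integers R).
  apply: (@sub_finite_set _ _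
    ((fun k : nat => k%:R - n%:R) @` `I_(n + n).+1)).
    move=> x [/=]; rewrite in_itv/= => /andP[nk kn] [k _ kE].
    rewrite -kE in nk kn *.
    have kn0 : 0 <= k + n%:Z by rewrite -lerBlDr sub0r -(ler_int R) intrN.
    exists (absz (k + n%:Z)).
      rewrite /= ltnS -lez_nat gez0_abs// PoszD lerD2r.
      by rewrite -(ler_int R).
    by rewrite pmulrn gez0_abs// intrD addrK.
  exact/finite_image/finite_II.
by rewrite /mrestr /counting asboolT// ltry.
Qed.

HB.instance Definition _ := Measure_isSigmaFinite.Build _ _ _
  (freq_measure R M) sigma_finite_freq_measure.

End freq_measure_is_measure.

Definition cintegral d (T : measurableType d) (R : realType)
    (mu : {measure set T -> \bar R}) (D : set T) (f : T -> R[i]) : R[i] :=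
  (\int[mu]_(x in D) complex.Re (f x)) +i* (\int[mu]_(x in D) complex.Im (f x)).

Definition cintegrable d (T : measurableType d) (R : realType)
    (mu : {measure set T -> \bar R}) (D : set T) (f : T -> R[i]) : Prop :=
  mu.-integrable D (fun x => (complex.Re (f x))%:E) /\
  mu.-integrable D (fun x => (complex.Im (f x))%:E).

Definition cmeasurable d (T : measurableType d) (R : realType)
    (f : T -> R[i]) : Prop :=
  measurable_fun setT (fun x => complex.Re (f x)) /\
  measurable_fun setT (fun x => complex.Im (f x)).

Definition L2norm d (T : measurableType d) (R : realType)
    (mu : {measure set T -> \bar R}) (f : T -> R[i]) : \bar R :=
  Lnorm mu 2%:E (fun x => (Normc.normc (f x))%:E).

Definition L2 d (T : measurableType d) (R : realType)
    (mu : {measure set T -> \bar R}) : set (T -> R[i]) :=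
  [set f | cmeasurable f /\ (L2norm mu f < +oo)%E].

Definition expi (R : realType) (x : R) : R[i] := cos x +i* sin x.

(* Plancherel's extension of f |-> (xi |-> int f(x) exp(-i phase x xi) dmu(x)):
   the truncated integrals over the exhausting sets K n converge in L2 nu.
   The transform is defined up to nu-null sets; one representative is picked. *)
Definition is_plancherel d d' (T : measurableType d) (T' : measurableType d')
    (R : realType) (mu : {measure set T -> \bar R})
    (nu : {measure set T' -> \bar R}) (phase : T -> T' -> R)
    (K : nat -> set T) (f : T -> R[i]) (g : T' -> R[i]) : Prop :=
  L2 nu g /\
  L2norm nu (fun xi => g xi
    - cintegral mu (K n) (fun x => f x * expi (- phase x xi)))
    @[n --> \oo] --> 0%E.

Definition plancherel d d' (T : measurableType d) (T' : measurableType d')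
    (R : realType) (mu : {measure set T -> \bar R})
    (nu : {measure set T' -> \bar R}) (phase : T -> T' -> R)
    (K : nat -> set T) (f : T -> R[i]) : T' -> R[i] :=
  xget (fun=> 0) [set g | is_plancherel mu nu phase K f g].

Definition fourier (R : realType) (M : manifold)
    (f : measurableTypeR R -> R[i]) : measurableTypeR R -> R[i] :=
  plancherel (space_measure R M) (freq_measure R M)
    (fun x xi => x * xi) (fun n => `[- n%:R, n%:R]%classic) f.

Definition spacetime_measure (R : realType) (M : manifold) :
    {measure set (measurableTypeR R * measurableTypeR R) -> \bar R} :=
  (space_measure R M \x lebesgue_measure)%E.

Definition spacetime_freq_measure (R : realType) (M : manifold) :
    {measure set (measurableTypeR R * measurableTypeR R) -> \bar R} :=
  (freq_measure R M \x lebesgue_measure)%E.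

(* Space-time points are pairs (x, t), frequencies are pairs (xi, tau). *)
Definition spacetime_fourier (R : realType) (M : manifold)
    (u : measurableTypeR R * measurableTypeR R -> R[i]) :
    measurableTypeR R * measurableTypeR R -> R[i] :=
  plancherel (spacetime_measure R M) (spacetime_freq_measure R M)
    (fun z zeta => z.1 * zeta.1 + z.2 * zeta.2)
    (fun n => `[- n%:R, n%:R]%classic `*` `[- n%:R, n%:R]%classic) u.

(* The Fourier multiplier with bounded symbol m on L2(M). *)
Definition multiplier (R : realType) (M : manifold) (m : R -> R[i])
    (f : measurableTypeR R -> R[i]) : measurableTypeR R -> R[i] :=
  xget (fun=> 0) [set g | L2 (space_measure R M) g /\
    {ae freq_measure R M, forall xi, fourier M g xi = m xi * fourier M f xi}].

Definition fourierL1 (R : realType) (M : manifold)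
    (f : measurableTypeR R -> R[i]) (xi : measurableTypeR R) : R[i] :=
  cintegral (space_measure R M) setT (fun x => f x * expi (- (x * xi))).

(* (I - eps^2 Laplacian)^-1 on L1(M), by Fourier inversion.  It is applied to
   |u|^2, which for u in L2(M) need not be in L2(M); the symbol times the
   (bounded) Fourier transform of an L1 function is integrable. *)
Definition helmholtz_inv (R : realType) (M : manifold) (eps : R)
    (f : measurableTypeR R -> R[i]) (x : measurableTypeR R) : R[i] :=
  ((2 * pi)^-1)%:C * cintegral (freq_measure R M) setT
    (fun xi => ((1 + eps ^+ 2 * xi ^+ 2)^-1)%:C * fourierL1 M f xi
               * expi (x * xi)).

Definition dispersion (R : realType) (eps xi : R) : R :=
  eps ^+ 2 * xi ^+ 4 + xi ^+ 2.

Definition propagator (R : realType) (M : manifold) (eps t : R) :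
    (measurableTypeR R -> R[i]) -> (measurableTypeR R -> R[i]) :=
  multiplier M (fun xi => expi (- (t * dispersion eps xi))).

Definition nonlinearity (R : realType) (M : manifold) (eps : R)
    (f : measurableTypeR R -> R[i]) (x : measurableTypeR R) : R[i] :=
  helmholtz_inv M eps (fun y => ((Normc.normc (f y)) ^+ 2)%:C) x * f x.

Definition inner d (T : measurableType d) (R : realType)
    (mu : {measure set T -> \bar R}) (f g : T -> R[i]) : R[i] :=
  cintegral mu setT (fun x => f x * conjc (g x)).

(* v is the integral over D of the L2-valued function F, in the weak (Pettis)
   sense; it coincides with the Bochner integral when the latter exists. *)
Definition is_vintegral (R : realType) (M : manifold)
    (D : set (measurableTypeR R))
    (F : measurableTypeR R -> measurableTypeR R -> R[i])
    (v : measurableTypeR R -> R[i]) : Prop :=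
  [/\ L2 (space_measure R M) v,
      forall t, D t -> L2 (space_measure R M) (F t) &
      forall phi, L2 (space_measure R M) phi ->
        cintegrable lebesgue_measure D
          (fun t => inner (space_measure R M) (F t) phi) /\
        inner (space_measure R M) v phi =
        cintegral lebesgue_measure D
          (fun t => inner (space_measure R M) (F t) phi)].

(* Curves in a function space on M are maps u : t |-> x |-> u t x; only the
   values for t in [0, T] matter. *)
Definition is_solution (R : realType) (M : manifold) (eps T : R)
    (u0 : measurableTypeR R -> R[i])
    (u : measurableTypeR R -> measurableTypeR R -> R[i]) : Prop :=
  forall t, 0 <= t <= T ->
    L2 (space_measure R M) (u t) /\
    exists v, is_vintegral M `[0, t]
        (fun t' => propagator M eps (t - t') (nonlinearity M eps (u t'))) v /\
      {ae space_measure R M, forall x,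
        u t x = propagator M eps t u0 x + 'i * v x}.

Definition japanese (R : realType) (x : R) : R := Num.sqrt (1 + x ^+ 2).

Definition Hs_norm (R : realType) (M : manifold) (s : R)
    (f : measurableTypeR R -> R[i]) : \bar R :=
  L2norm (freq_measure R M)
    (fun xi => (japanese xi `^ s)%:C * fourier M f xi).

(* For s >= 0, H^s(M) is contained in L2(M). *)
Definition Hs (R : realType) (M : manifold) (s : R) :
    set (measurableTypeR R -> R[i]) :=
  [set f | L2 (space_measure R M) f /\ (Hs_norm M s f < +oo)%E].

Definition CHs_norm (R : realType) (M : manifold) (s T : R)
    (u : measurableTypeR R -> measurableTypeR R -> R[i]) : \bar R :=
  ereal_sup [set Hs_norm M s (u t) | t in `[0, T]].

Definition CHs (R : realType) (M : manifold) (s T : R) :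
    set (measurableTypeR R -> measurableTypeR R -> R[i]) :=
  [set u | (forall t, 0 <= t <= T -> Hs M s (u t)) /\
    forall t0, 0 <= t0 <= T ->
      Hs_norm M s (fun x => u t x - u t0 x)
        @[t --> within `[0, T] (nbhs (t0 : R))] --> 0%E].

Definition Xsb_norm (R : realType) (M : manifold) (eps s b : R)
    (u : measurableTypeR R * measurableTypeR R -> R[i]) : \bar R :=
  L2norm (spacetime_freq_measure R M)
    (fun z => (japanese z.1 `^ s * japanese (z.2 + dispersion eps z.1) `^ b)%:C
              * spacetime_fourier M u z).

(* The infimum is over extensions in L2(M x R), which contains X^{s,b} when
   s, b >= 0; it is +oo when u has no extension in X^{s,b}. *)
Definition XsbT_norm (R : realType) (M : manifold) (eps s b T : R)
    (u : measurableTypeR R -> measurableTypeR R -> R[i]) : \bar R :=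
  ereal_inf [set Xsb_norm M eps s b w | w in
    [set w | L2 (spacetime_measure R M) w /\
      {ae spacetime_measure R M, forall z,
        0 <= z.2 <= T -> w z = u z.2 z.1}]].

Definition XsbT (R : realType) (M : manifold) (eps s b T : R) :
    set (measurableTypeR R -> measurableTypeR R -> R[i]) :=
  [set u | (XsbT_norm M eps s b T u < +oo)%E].

Definition solves_in_class (R : realType) (M : manifold) (eps s b T : R)
    (u0 : measurableTypeR R -> R[i])
    (u : measurableTypeR R -> measurableTypeR R -> R[i]) : Prop :=
  [/\ CHs M s T u, XsbT M eps s b T u & is_solution M eps T u0 u].

Definition globally_well_posed (R : realType) (M : manifold) (eps s b : R) :
    Prop :=
  [/\ forall T u0, 0 < T -> Hs M s u0 ->
        exists u, solves_in_class M eps s b T u0 u,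
      forall T u0 u v, 0 < T -> Hs M s u0 ->
        XsbT M eps s b T u -> is_solution M eps T u0 u ->
        XsbT M eps s b T v -> is_solution M eps T u0 v ->
        forall t, 0 <= t <= T ->
          {ae space_measure R M, forall x, u t x = v t x} &
      forall T u0 u, 0 < T -> Hs M s u0 -> solves_in_class M eps s b T u0 u ->
        forall e : R, 0 < e -> exists2 delta : R, 0 < delta &
        forall v0 v, Hs M s v0 -> solves_in_class M eps s b T v0 v ->
          (Hs_norm M s (fun x => v0 x - u0 x)%R < delta%:E)%E ->
          (CHs_norm M s T (fun t x => v t x - u t x)%R <= e%:E)%E].

Definition locally_lipschitz_flow (R : realType) (M : manifold)
    (eps s b : R) : Prop :=
  forall T u0, 0 < T -> Hs M s u0 ->
    exists delta L : R, 0 < delta /\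
    forall v0 w0 v w, Hs M s v0 -> Hs M s w0 ->
      (Hs_norm M s (fun x => v0 x - u0 x)%R < delta%:E)%E ->
      (Hs_norm M s (fun x => w0 x - u0 x)%R < delta%:E)%E ->
      solves_in_class M eps s b T v0 v -> solves_in_class M eps s b T w0 w ->
      (CHs_norm M s T (fun t x => v t x - w t x)%R
        <= L%:E * Hs_norm M s (fun x => v0 x - w0 x)%R)%E.

(* Main.v *)
From HB Require Import structures.
Require Import Defs.
From mathcomp Require Import all_boot all_order all_algebra.
From mathcomp Require Import all_classical all_reals all_analysis.
From mathcomp Require Import complex measurable_realfun.
From mathcomp Require Import ring lra zify.

(** Both equations, on the line and on the torus, are treated on the frequency
    side: the unknown is the profile [a t], the Fourier transform of [u t]
    undone by the free evolution, and Duhamel's formula becomes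
    [a t = a 0 + \int_0^t i e^{i s w} N (e^{- i s w} a s) ds], tested against
    every vector of L2 (solution_profile and profile_solution).  The exponent
    [b = 1] works because the nonlinearity loses no derivatives: profiles are
    Lipschitz in time.

    The reason is that the smoother [(1 + eps^2 xi^2)^-1] is integrable in one
    dimension (square summability of the coefficients of a sawtooth gives this on
    the torus).  The nonlinearity is an integral over a frequency [xi] of
    products of two pairings of a function with its translate by [xi]
    (inner_nonlinearity), each bounded by Cauchy-Schwarz.  Hence [N] is locally
    Lipschitz on L2.  A Sobolev weight, truncated to be bounded, satisfies
    [w (x + y) <= C (w x + w y)] with [C] independent of the truncation, so the
    weight can be moved onto one factor; this gives the tame estimates form_tame
    and nonlin_tame, uniformly in the truncation, and in the limit the Sobolev
    norm.

    Existence: with the argument of [N] projected to a ball the field is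
    globally Lipschitz and Picard iteration applies (weak_ode_exists).  The
    potential is real, so the field is orthogonal to its argument and the L2
    norm is conserved (weak_ode_norm); a large ball is thus never left, and the
    solution is global (flow_exists).  By tameness the Sobolev norm obeys a
    linear differential inequality and grows at most exponentially
    (profile_wbound).  Uniqueness and Lipschitz dependence are Gronwall's
    inequality for the difference of two profiles (profile_wlip); a weak
    profile is bounded in L2 by the uniform boundedness principle, which makes
    Gronwall applicable (profile_bounded).

    Plancherel's theorem is derived for an abstract pair of transforms from a
    summability method: Schur's test on the summability kernel gives Bessel's
    inequality, and convergence of the kernel on enough test sets gives
    inversion.  Abel summation serves the line, Fejer sums the torus.

    It remains to realise the profile as a function of space and time and to see
    that it lies in [X^{s,1}].  Step functions that approximate the curve
    uniformly converge almost everywhere in each time slice (curve_realization).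
    For the membership the profile is extended to a compactly supported
    Lipschitz curve in time.  Testing the space-time transform against functions
    modulated in [tau + w(xi)] translates the profile in time; the difference
    quotients of the profile are bounded, which bounds the transform multiplied
    by [k (e^{i sigma / k} - 1)], and Fatou's lemma gives the weight
    [<sigma>] with [sigma = tau + w(xi)] (transform_energy). *)

Set Implicit Arguments.
Unset Strict Implicit.
Unset Printing Implicit Defensive.

Import Order.TTheory GRing.Theory Num.Theory.
Import numFieldNormedType.Exports.

Local Open Scope classical_set_scope.
Local Open Scope ring_scope.
Local Open Scope complex_scope.

Local Notation Re := complex.Re.
Local Notation Im := complex.Im.
Local Notation nc := Normc.normc.

(** * Complete semi-inner product spaces *)

Section RealHelpers.
Variable R : realType.
Implicit Types (a b c x C : R).

Lemma cvg_half_expn : (fun n => 2^-1 ^+ n : R) @ \oo --> (0 : R).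
Proof. by apply: cvg_expr; rewrite ger0_norm//; lra. Qed.

Lemma le0_geometric x C : (forall n, x <= C * 2^-1 ^+ n) -> x <= 0.
Proof.
move=> h; rewrite -(mulr0 C).
have hC : (fun n => C * 2^-1 ^+ n : R) @ \oo --> (C * 0 : R).
  by apply: cvgM; [exact: cvg_cst|exact: cvg_half_expn].
rewrite -(cvg_lim _ hC)//; apply: limr_ge; first by apply/cvg_ex; exists (C * 0).
exact: nearW.
Qed.

Lemma discriminant_le a b c : 0 <= c ->
  (forall r, 0 <= a + r * b *+ 2 + r ^+ 2 * c) -> b ^+ 2 <= a * c.
Proof.
move=> c0 h; have [c_gt0|c_le0] := ltP 0 c.
  have := h (- b / c).
  have -> : a + - b / c * b *+ 2 + (- b / c) ^+ 2 * c = (a * c - b ^+ 2) / c.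
    by field; rewrite gt_eqF.
  by rewrite pmulr_lge0 ?invr_gt0// subr_ge0.
have {c0 c_le0} cE : c = 0 by apply/eqP; rewrite eq_le c_le0 c0.
subst c; rewrite mulr0.
suff -> : b = 0 by rewrite expr0n.
apply/eqP/negPn/negP => b0.
have := h (- (a + 1) / b); rewrite mulr0 addr0.
have -> : a + - (a + 1) / b * b *+ 2 = - a - 2 by field.
have := h 0; rewrite mul0r mul0rn addr0 mulr0 addr0; lra.
Qed.

End RealHelpers.

(** A symmetric semi-inner product on a complex vector space that is only
    required to be bilinear over the reals (it will be the real part of the
    [L2] pairing); vectors at distance zero are not identified, and
    completeness is stated for geometrically fast sequences, which is all that
    the constructions below produce. *)
Record semi_hilbert (R : realType) (V : lmodType R[i]) (ip : V -> V -> R) :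
    Prop := SemiHilbert {
  ipC : forall f g, ip f g = ip g f;
  ipDl : forall f g h, ip (f + g) h = ip f h + ip g h;
  ipZl : forall r f h, ip (r%:C *: f) h = r * ip f h;
  ip_ge0 : forall f, 0 <= ip f f;
  ip_complete : forall (u : nat -> V) (C : R),
    (forall n, Num.sqrt (ip (u n.+1 - u n) (u n.+1 - u n)) <= C * 2^-1 ^+ n) ->
    exists l, forall n,
      Num.sqrt (ip (u n - l) (u n - l)) <= C * 2 * 2^-1 ^+ n }.

Section SemiHilbertTheory.
Variables (R : realType) (V : lmodType R[i]) (ip : V -> V -> R).
Hypothesis ipH : semi_hilbert ip.
Implicit Types (f g h v : V) (r : R).

Definition ipnorm f : R := Num.sqrt (ip f f).
Local Notation nrm := ipnorm.

Let ipC := ipC ipH.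
Let ipDl := ipDl ipH.
Let ipZl := ipZl ipH.
Let ip_ge0 := ip_ge0 ipH.

Lemma ipDr f g h : ip h (f + g) = ip h f + ip h g.
Proof. by rewrite ipC ipDl !(ipC h). Qed.

Lemma ipZr r f h : ip h (r%:C *: f) = r * ip h f.
Proof. by rewrite ipC ipZl (ipC h). Qed.

Lemma ipNl f h : ip (- f) h = - ip f h.
Proof. by rewrite -scaleN1r -[-1]/((- 1%:C)%R) -rmorphN ipZl mulN1r. Qed.

Lemma ipNr f h : ip h (- f) = - ip h f.
Proof. by rewrite ipC ipNl ipC. Qed.

Lemma ipBl f g h : ip (f - g) h = ip f h - ip g h.
Proof. by rewrite ipDl ipNl. Qed.

Lemma ipBr f g h : ip h (f - g) = ip h f - ip h g.
Proof. by rewrite ipDr ipNr. Qed.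

Lemma ip0l f : ip 0 f = 0.
Proof. by have := ipDl 0 0 f; rewrite addr0 => /eqP; rewrite -subr_eq subrr => /eqP. Qed.

Lemma ipnorm_ge0 f : 0 <= nrm f.
Proof. exact: sqrtr_ge0. Qed.

Lemma ipnorm_sq f : nrm f ^+ 2 = ip f f.
Proof. by rewrite sqr_sqrtr. Qed.

Lemma ipnorm0 : nrm 0 = 0.
Proof. by rewrite /nrm ip0l sqrtr0. Qed.

Lemma ipnormN f : nrm (- f) = nrm f.
Proof. by rewrite /nrm ipNl ipNr opprK. Qed.

Lemma ipnormBC f g : nrm (f - g) = nrm (g - f).
Proof. by rewrite -ipnormN opprB. Qed.

Lemma ipnormZ r f : nrm (r%:C *: f) = `|r| * nrm f.
Proof.
rewrite /nrm ipZl ipZr mulrA -expr2 sqrtrM ?sqr_ge0// sqrtr_sqr.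
by [].
Qed.

Lemma ip_normDZ f g r :
  ip (f + r%:C *: g) (f + r%:C *: g) = ip f f + r * ip f g *+ 2 + r ^+ 2 * ip g g.
Proof. rewrite !ipDl !ipDr !ipZl !ipZr (ipC g f); ring. Qed.

Lemma ip_cauchy_schwarz f g : `|ip f g| <= nrm f * nrm g.
Proof.
rewrite -(@ler_pXn2r _ 2)// ?nnegrE ?mulr_ge0 ?ipnorm_ge0//.
rewrite real_normK ?num_real// exprMn !ipnorm_sq.
by apply: discriminant_le => // r; rewrite -ip_normDZ.
Qed.

Lemma ip_le_norm f g : ip f g <= nrm f * nrm g.
Proof. exact: le_trans (ler_norm _) (ip_cauchy_schwarz _ _). Qed.

Lemma ipnormD f g : nrm (f + g) <= nrm f + nrm g.
Proof.
rewrite -(@ler_pXn2r _ 2)// ?nnegrE ?addr_ge0 ?ipnorm_ge0//.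
rewrite sqrrD !ipnorm_sq ipDl !ipDr (ipC g f).
by have := ip_le_norm f g; lra.
Qed.

Lemma ipnormB f g : nrm (f - g) <= nrm f + nrm g.
Proof. by rewrite -(ipnormN g) ipnormD. Qed.

Lemma ipnorm_distD g f h : nrm (f - h) <= nrm (f - g) + nrm (g - h).
Proof. by rewrite (le_trans _ (ipnormD _ _))// addrA subrK. Qed.

Lemma ler_ipnorm_dist f g : `|nrm f - nrm g| <= nrm (f - g).
Proof.
rewrite ler_norml; apply/andP; split.
  have := ipnormD (g - f) f; rewrite subrK (ipnormBC g f); lra.
have := ipnormD (f - g) g; rewrite subrK; lra.
Qed.

Lemma ipnorm_eq0 f : (forall g, ip f g = 0) -> nrm f = 0.
Proof. by move=> h; rewrite /nrm h sqrtr0. Qed.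

(** Used after testing a vector against itself: one factor of the norm cancels. *)
Lemma ipnorm_le_self f C : 0 <= C -> ip f f <= C * nrm f -> nrm f <= C.
Proof.
move=> C0; rewrite -ipnorm_sq expr2 => h.
have [->//|n0] := eqVneq (nrm f) 0.
by move: h; rewrite ler_pM2r// lt_neqAle eq_sym n0 ipnorm_ge0.
Qed.

Lemma ip_complete_norm (u : nat -> V) (C : R) :
  (forall n, nrm (u n.+1 - u n) <= C * 2^-1 ^+ n) ->
  exists l, forall n, nrm (u n - l) <= C * 2 * 2^-1 ^+ n.
Proof. exact: ip_complete. Qed.

(** Riesz representation: minimize [ip v v / 2 - l v]; by the parallelogram
    identity a minimizing sequence is Cauchy, and the first variation at the
    limit vanishes. *)
Lemma riesz (l : V -> R) (C : R) :
  (forall f g, l (f + g) = l f + l g) ->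
  (forall r f, l (r%:C *: f) = r * l f) ->
  (forall f, `|l f| <= C * nrm f) ->
  exists v, forall f, ip v f = l f.
Proof.
move=> lD lZ lC.
pose J v := ip v v - l v *+ 2.
have J_ge v : - C ^+ 2 <= J v.
  have h1 : l v <= C * nrm v := le_trans (ler_norm _) (lC v).
  rewrite /J -ipnorm_sq; have := sqr_ge0 (nrm v - C); rewrite sqrrB; lra.
pose E := [set J v | v in setT].
have Einf : has_inf E.
  by split; [exists (J 0), 0|exists (- C ^+ 2) => _ [v _ <-]].
pose m := inf E.
have mJ v : m <= J v by apply: ge_inf; [case: Einf|exists v].
pose dl n : R := 4^-1 * 4^-1 ^+ n.
have dl0 n : 0 < dl n by rewrite mulr_gt0// ?exprn_gt0// invr_gt0.
have /choice[v vP] n : exists v, J v <= m + dl n.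
  have [_ [v _ <-] /ltW vm] := inf_adherent (dl0 n) Einf.
  by exists v.
have fourE n : (4^-1 : R) ^+ n = (2^-1 ^+ n) ^+ 2.
  by rewrite -exprM mulnC exprM; congr (_ ^+ _); field.
have lB f g : l (f - g) = l f - l g.
  by rewrite -[- g]scaleN1r -[-1]/((- 1%:C)%R) -rmorphN lD lZ mulN1r.
have vS n : nrm (v n.+1 - v n) <= 1 * 2^-1 ^+ n.
  rewrite mul1r -(@ler_pXn2r _ 2)// ?nnegrE ?ipnorm_ge0 ?exprn_ge0//.
  rewrite ipnorm_sq -fourE.
  have hm := mJ ((2^-1)%:C *: (v n.+1 + v n)).
  have := vP n; have := vP n.+1; move: hm.
  rewrite /J ipZl ipZr lZ lD !ipDl !ipDr !ipNl !ipNr (ipC (v n)) /dl exprS.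
  set a := ip _ _; set b := ip _ _; set c := ip _ _.
  have : 0 <= (4^-1 : R) ^+ n by rewrite exprn_ge0.
  set q := 4^-1 ^+ n; lra.
have [w wP] := ip_complete_norm vS.
exists w => f; apply/eqP; rewrite -subr_eq0 -normr_le0.
apply: (@le0_geometric _ _ (nrm f *+ 3)) => n.
have h1 : `|ip (v n) f - l f| <= 2^-1 ^+ n * nrm f.
  rewrite -(@ler_pXn2r _ 2)// ?nnegrE ?mulr_ge0 ?ipnorm_ge0 ?exprn_ge0//.
  rewrite real_normK ?num_real// exprMn -fourE ipnorm_sq.
  apply: (@le_trans _ _ (dl n * ip f f)); last first.
    rewrite /dl; apply: ler_wpM2r => //.
    have : 0 <= (4^-1 : R) ^+ n by rewrite exprn_ge0.
    lra.
  apply: discriminant_le => // r.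
  have := mJ (v n + r%:C *: f); have := vP n.
  by rewrite /J ip_normDZ lD lZ; lra.
have h2 : `|ip (v n) f - ip w f| <= 2 * 2^-1 ^+ n * nrm f.
  rewrite -ipBl (le_trans (ip_cauchy_schwarz _ _))// ler_wpM2r ?ipnorm_ge0//.
  by rewrite (le_trans (wP n))// mul1r.
have := ler_distD (ip (v n) f) (ip w f) (l f); rewrite (distrC (ip w f) (ip (v n) f)).
by move: h1 h2; set q := 2^-1 ^+ n; lra.
Qed.

(** Uniform boundedness, by a gliding hump: moving a point by [4^-n] can make
    the pairing with a vector [a n] of norm at least [8 ^ n] as large as
    [2 ^ n], and the later, smaller moves cannot undo it. *)
Lemma uniform_boundedness (A : set V) :
  (forall f, exists C : R, forall a, A a -> `|ip a f| <= C) ->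
  exists C : R, forall a, A a -> nrm a <= C.
Proof.
move=> Abnd; apply/not_existsP => Aunb.
have /choice[a aP] n : exists a, A a /\ 8 ^+ n < nrm a.
  have /existsNP[a /not_implyP[Aa /negP]] := Aunb (8 ^+ n).
  by rewrite -ltNge => h; exists a.
pose q n : R := 4^-1 ^+ n.
have q0 n : 0 <= q n by rewrite exprn_ge0.
have step n x : exists x', nrm (x' - x) <= q n /\ q n * nrm (a n) <= `|ip (a n) x'|.
  have [aA alt] := aP n.
  have a0 : 0 < nrm (a n) by rewrite (le_lt_trans _ alt)// exprn_ge0.
  pose y := (q n / nrm (a n))%:C *: a n.
  have yn : nrm y = q n.
    rewrite ipnormZ ger0_norm ?divr_ge0 ?(ltW a0)// divfK// gt_eqF//.
  have ay : ip (a n) y = q n * nrm (a n).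
    rewrite ipZr -ipnorm_sq expr2 mulrA divfK// gt_eqF//.
  have [h|h] := leP 0 (ip (a n) x).
    exists (x + y); rewrite addrC addKr yn; split => //.
    by rewrite ipDr ay (le_trans _ (ler_norm _))// lerDr.
  exists (x - y); rewrite addrC addKr ipnormN yn; split => //.
  rewrite ipBr ay -normrN opprB (le_trans _ (ler_norm _))// lerDl oppr_ge0.
  exact: ltW.
have /choice[nxt nxtP] : forall p : nat * V, exists x', nrm (x' - p.2) <= q p.1 /\
    q p.1 * nrm (a p.1) <= `|ip (a p.1) x'|.
  by move=> [n x]; exact: step.
pose x := fix x n := if n is m.+1 then nxt (m, x m) else 0.
have xS n : nrm (x n.+1 - x n) <= q n by have [] := nxtP (n, x n).
have ax n : q n * nrm (a n) <= `|ip (a n) (x n.+1)| by have [] := nxtP (n, x n).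
have qle n : q n <= 2^-1 ^+ n.
  by apply: lerXn2r; rewrite ?nnegrE; lra.
have [w wP] : exists l, forall n, nrm (x n - l) <= 1 * 2 * 2^-1 ^+ n.
  by apply: ip_complete_norm => n; rewrite mul1r (le_trans (xS n)).
have tailk n k : nrm (x (n + k).+1 - x n.+1) <= (q n - q (n + k)%N) / 3.
  elim: k => [|k ih]; first by rewrite addn0 !subrr mul0r ipnorm0.
  apply: le_trans (ipnorm_distD (x (n + k).+1) _ _) _.
  rewrite addnS; have := xS (n + k).+1.
  have -> : q (n + k).+1 = 4^-1 * q (n + k)%N by rewrite /q exprS.
  by have := q0 (n + k)%N; lra.
have tail n : nrm (w - x n.+1) <= q n / 3.
  rewrite -subr_le0; apply: (@le0_geometric _ _ 2) => k.
  have := wP (n + k).+1; have := tailk n k.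
  have := ipnorm_distD (x (n + k).+1) w (x n.+1); rewrite (ipnormBC w (x (n + k).+1)).
  have := q0 (n + k)%N.
  have : 2^-1 ^+ (n + k).+1 <= 2^-1 ^+ k :> R.
    by apply: ler_wiXn2l; [lra|lra|rewrite leqW// leq_addl].
  lra.
have [C CP] := Abnd w.
have big n : 2 ^+ n * (2 / 3) <= C.
  apply: le_trans (CP _ (aP n).1).
  have -> : w = x n.+1 + (w - x n.+1) by rewrite addrC subrK.
  rewrite ipDr.
  have h1 := ip_cauchy_schwarz (a n) (w - x n.+1).
  have h2 : nrm (a n) * nrm (w - x n.+1) <= nrm (a n) * (q n / 3).
    by rewrite ler_wpM2l// ipnorm_ge0.
  have h3 : 2 ^+ n <= q n * nrm (a n).
    apply: le_trans (_ : q n * 8 ^+ n <= _); last first.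
      by rewrite ler_wpM2l// ltW//; case: (aP n).
    by rewrite /q -exprMn; have -> : 4^-1 * 8 = 2 :> R by field.
  have h4 := ax n.
  have := lerB_normD (ip (a n) (x n.+1)) (ip (a n) (w - x n.+1)).
  have : nrm (a n) * (q n / 3) = q n * nrm (a n) / 3 by ring.
  lra.
have [n _ nP] : exists2 n, True & C < n%:R.
  by exists (Num.truncn C).+1 => //; exact: truncnS_gt.
have := big n.+1; apply/negP; rewrite -ltNge.
have : (n%:R : R) <= 2 ^+ n by rewrite -natrX ler_nat ltnW// ltn_expl.
have : (0 : R) <= n%:R by [].
rewrite exprS; lra.
Qed.

End SemiHilbertTheory.

(** * Weak integral equations in a semi-Hilbert space *)

Section IntervalIntegral.
Variable R : realType.
Implicit Types (f g : R -> R) (t s : R).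
Local Notation leb := (@lebesgue_measure R).

Lemma continuous_itv_integrable f s t :
  continuous f -> leb.-integrable `[s, t] (EFin \o f).
Proof.
move=> cf; apply: continuous_compact_integrable; first exact: segment_compact.
by apply: continuous_subspaceT => x; exact: cf.
Qed.

Lemma ler_norm_itv_integral f g t :
  leb.-integrable `[0, t] (EFin \o f) -> leb.-integrable `[0, t] (EFin \o g) ->
  (forall s, 0 <= s <= t -> `|f s| <= g s) ->
  `|\int[leb]_(s in `[0, t]) f s| <= \int[leb]_(s in `[0, t]) g s.
Proof.
move=> intf intg fg; apply: le_trans (le_normr_Rintegral _ intf) _ => //.
apply: le_Rintegral => //.
exact: integrable_norm.
Qed.

Lemma Rintegral_itv_cst t (c : R) : 0 <= t ->
  \int[leb]_(s in `[0, t]) c = c * t.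
Proof.
move=> t0; rewrite Rintegral_cst//= lebesgue_measure_itv/= lte_fin.
by case: (ltP 0 t) => h /=; [rewrite subr0|congr (_ * _); lra].
Qed.

Lemma Rintegral_itv_lt0 f t : t < 0 -> \int[leb]_(s in `[0, t]) f s = 0.
Proof. by move=> t0; rewrite set_itv_ge ?Rintegral_set0// -leNgt bnd_simp; lra. Qed.

Lemma Rintegral_expR_le (l t : R) : 0 < l ->
  \int[leb]_(s in `[0, t]) expR (l * s) <= expR (l * t) / l.
Proof.
move=> l0; have [t0|t0|<-] := ltgtP t 0.
- by rewrite Rintegral_itv_lt0// divr_ge0 ?expR_ge0// ltW.
- rewrite /Rintegral (@continuous_FTC2 _ _ (fun x => expR (l * x) / l))//.
  + rewrite mulr0 expR0 /= lerBlDr lerDl divr_ge0// ltW//.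
  + apply: continuous_subspaceT => x.
    by apply: continuous_comp; [exact: mulrl_continuous|exact: continuous_expR].
  + have cF : continuous (fun x : R => expR (l * x) / l).
      move=> x; apply: cvgMl; apply: continuous_comp; last exact: continuous_expR.
      exact: mulrl_continuous.
    split => //; first by apply: cvg_at_right_filter; exact: cF.
    by apply: cvg_at_left_filter; exact: cF.
  + move=> x _; rewrite derive1E.
    have -> : (fun x => expR (l * x) / l) = (fun x => l^-1 *: expR (l * x)).
      by apply/funext => y /=; rewrite mulrC.
    rewrite derive_val.
    by rewrite /GRing.scale/= mulr1 mulrCA mulVf ?mulr1// gt_eqF.
- by rewrite set_itv1 Rintegral_set1 divr_ge0 ?expR_ge0// ltW.
Qed.

Lemma Rintegral_itv_dist f t t' (K : R) : continuous f -> t' <= t ->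
  (forall s, t' <= s <= t -> `|f s| <= K) -> 0 <= K ->
  `|\int[leb]_(s in `[0, t]) f s - \int[leb]_(s in `[0, t']) f s|
    <= K * (t - t').
Proof.
move=> cf tt fK K0.
have [t0|t0] := ltP t 0.
  rewrite !Rintegral_itv_lt0//; last exact: le_lt_trans t0.
  by rewrite subrr normr0 mulr_ge0// subr_ge0.
have [t'0|t'0] := ltP t' 0.
  rewrite (Rintegral_itv_lt0 _ t'0) subr0.
  apply: le_trans (ler_norm_itv_integral (g := cst K) _ _ _) _.
  - exact: continuous_itv_integrable.
  - by apply: continuous_itv_integrable => x; exact: cvg_cst.
  - by move=> s /andP[s0 st]; apply: fK; rewrite st andbT; lra.
  - by rewrite Rintegral_itv_cst// ler_wpM2l//; lra.
rewrite Rintegral_itvB//; first last.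
- exact: continuous_itv_integrable.
- have oc g : continuous g -> leb.-integrable `]t', t] (EFin \o g).
    move=> cg; apply: (integrableS (mu := leb) (E := `[t', t]%classic)) => //.
      by apply: subset_itvr; rewrite bnd_simp.
    exact: continuous_itv_integrable.
  apply: le_trans (le_normr_Rintegral _ (oc _ cf)) _ => //.
  apply: (@le_trans _ _ (\int[leb]_(s in `]t', t]) K)).
    apply: le_Rintegral => //; first by apply: integrable_norm; exact: oc.
      by apply: oc => x; exact: cvg_cst.
    by move=> s /=; rewrite in_itv/= => /andP[/ltW s0 st]; apply: fK; rewrite s0.
  rewrite Rintegral_cst//= lebesgue_measure_itv/= lte_fin.
  by case: (ltP t' t) => h //=; rewrite mulr0 mulr_ge0// subr_ge0.
Qed.

(** The hypothesis is applied to exponential majorants of [p] only: the best constant of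
    such a majorant is compared with itself, so that [p] is never integrated. *)
Lemma gronwall_sup (p : R -> R) (T A l M : R) :
  (forall t, 0 <= t <= T -> 0 <= p t <= M) -> 0 <= A -> 0 <= l ->
  (forall S, 0 <= S -> (forall s, 0 <= s <= T -> p s <= S * expR (l * s)) ->
    forall t, 0 <= t <= T -> p t <= A + S / 2 * expR (l * t)) ->
  forall t, 0 <= t <= T -> p t <= 2 * A * expR (l * t).
Proof.
move=> pM A0 l0 h t0 t0T.
have M0 : 0 <= M by have /andP[a b] := pM _ t0T; exact: le_trans b.
have e1 t : 0 <= t -> 1 <= expR (l * t).
  by move=> t_ge0; rewrite -expR0 ler_expR mulr_ge0.
have H n : forall t, 0 <= t <= T -> p t <= (2 * A + M * 2^-1 ^+ n) * expR (l * t).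
  elim: n => [|n ih] t tT.
    have /andP[_ pt] := pM _ tT; apply: le_trans pt _.
    rewrite expr0 mulr1; have /andP[t_ge0 _] := tT.
    have := e1 _ t_ge0; nra.
  have S0 : 0 <= 2 * A + M * 2^-1 ^+ n.
    by rewrite addr_ge0 ?mulr_ge0// exprn_ge0.
  have := h _ S0 ih _ tT; have /andP[t_ge0 _] := tT.
  have := e1 _ t_ge0; rewrite exprS.
  have : 0 <= (2^-1 : R) ^+ n by rewrite exprn_ge0.
  set e := expR _; set q := 2^-1 ^+ n => q0 e0.
  have := ler_wpM2l A0 e0; lra.
rewrite -subr_le0; apply: (@le0_geometric _ _ (M * expR (l * t0))) => n.
by have := H n _ t0T; set q := 2^-1 ^+ n; set e := expR _; lra.
Qed.

Lemma quadratic_increments_constant (h : R -> R) (K : R) : 0 <= K ->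
  (forall s t, `|h t - h s| <= K * (t - s) ^+ 2) -> forall t, h t = h 0.
Proof.
move=> K0 hK t.
have H n : `|h t - h 0| <= K * t ^+ 2 / n.+1%:R.
  have step k : (k <= n.+1)%N ->
      `|h (k%:R * (t / n.+1%:R)) - h 0| <= k%:R * (K * (t / n.+1%:R) ^+ 2).
    elim: k => [|k ih kn]; first by rewrite !mul0r subrr normr0.
    apply: le_trans (ler_distD (h (k%:R * (t / n.+1%:R))) _ _) _.
    rewrite -natr1 mulrDl mul1r [X in _ <= X]mulrDl mul1r [X in _ <= X]addrC.
    apply: lerD; last by apply: ih; exact: ltnW.
    by apply: le_trans (hK _ _) _; rewrite addrC addKr.
  have := step n.+1 (leqnn _).
  rewrite mulrC divfK ?pnatr_eq0// => /le_trans; apply.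
  rewrite le_eqVlt; apply/orP; left; apply/eqP.
  have : (n.+1%:R : R) != 0 by rewrite pnatr_eq0.
  by move: (n.+1%:R : R) => x x0; field.
apply/eqP; rewrite -subr_eq0 -normr_le0.
apply/ler_addgt0Pl => e e0; rewrite addr0.
have [n nP] : exists n : nat, K * t ^+ 2 / e < n%:R.
  by exists (Num.truncn (K * t ^+ 2 / e)).+1; exact: truncnS_gt.
apply: le_trans (H n) _; rewrite ler_pdivrMr//.
move: nP; rewrite ltr_pdivrMr// => /ltW /le_trans; apply.
by rewrite mulrC ler_wpM2l ?(ltW e0)// ler_nat.
Qed.

End IntervalIntegral.

Section WeakIntegral.
Variables (R : realType) (V : lmodType R[i]) (ip : V -> V -> R).
Hypothesis ipH : semi_hilbert ip.
Implicit Types (f g v : V) (r s t : R).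
Local Notation leb := (@lebesgue_measure R).
Local Notation nrm := (ipnorm ip).

(** The Pettis form of [d t = d0 + \int_0^t F]; it makes sense for curves [F] that
    are only weakly integrable. *)
Definition weak_primitive (T : R) (d0 : V) (F d : R -> V) : Prop :=
  forall t, 0 <= t <= T -> forall phi,
    leb.-integrable `[0, t] (fun s => (ip (F s) phi)%:E) /\
    ip (d t) phi = ip d0 phi + \int[leb]_(s in `[0, t]) ip (F s) phi.

Lemma weak_primitiveB T d0 F d e0 G e :
  weak_primitive T d0 F d -> weak_primitive T e0 G e ->
  weak_primitive T (d0 - e0) (fun s => F s - G s) (fun s => d s - e s).
Proof.
move=> dP eP t tT phi; have [i1 e1] := dP t tT phi; have [i2 e2] := eP t tT phi.
split.
  rewrite (_ : (fun s => _) = (fun s => (ip (F s) phi)%:E) \- (fun s => (ip (G s) phi)%:E))%E.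
    exact: integrableB.
  by apply/funext => s /=; rewrite (ipBl ipH) EFinB.
under eq_Rintegral do rewrite (ipBl ipH).
by rewrite RintegralB// (ipBl ipH) e1 e2 (ipBl ipH); ring.
Qed.

(** An operator [W] such that [ip f (W f)] is the square of a seminorm [q]
    transports the weak equation to [q]. *)
Lemma gronwall_weak (T L M : R) (q : V -> R) (W : V -> V) d0 F d :
  0 < L -> (forall f, 0 <= q f) -> (forall f, ip f (W f) = q f ^+ 2) ->
  (forall f g, `|ip g (W f)| <= q g * q f) ->
  weak_primitive T d0 F d ->
  (forall t, 0 <= t <= T -> q (F t) <= L * q (d t)) ->
  (forall t, 0 <= t <= T -> q (d t) <= M) ->
  forall t, 0 <= t <= T -> q (d t) <= 2 * q d0 * expR (2 * L * t).
Proof.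
move=> L0 q0 Wq Wcs dP FL dM.
apply: (@gronwall_sup R (q \o d) T (q d0) (2 * L) M) => //=.
- by move=> t tT; rewrite q0 dM.
- by rewrite mulr_ge0// ltW.
move=> S S0 hS t tT; have [int e] := dP t tT (W (d t)).
have [->|qn0] := eqVneq (q (d t)) 0.
  by rewrite addr_ge0// mulr_ge0 ?expR_ge0// divr_ge0.
have qpos : 0 < q (d t) by rewrite lt_neqAle eq_sym qn0 q0.
rewrite -(ler_pM2r qpos) -expr2 -Wq e mulrDl.
apply: lerD; first by apply: le_trans (ler_norm _) (Wcs _ _).
have cE : continuous (fun s => q (d t) * (L * S) * expR (2 * L * s)).
  move=> s; apply: cvgMr; apply: continuous_comp; last exact: continuous_expR.
  exact: mulrl_continuous.
apply: le_trans (ler_norm _) _.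
apply: le_trans (ler_norm_itv_integral (g := fun s => q (d t) * (L * S) * expR (2 * L * s)) int _ _) _.
- exact: continuous_itv_integrable.
- move=> s /andP[s0 st]; apply: le_trans (Wcs _ _) _.
  rewrite mulrC -!mulrA ler_wpM2l//.
  have sT : 0 <= s <= T by rewrite s0 (le_trans st)//; case/andP: tT.
  by apply: le_trans (FL _ sT) _; rewrite ler_wpM2l ?(ltW L0)// mulrA; exact: hS.
rewrite RintegralZl//; last first.
  apply: continuous_itv_integrable => s; apply: continuous_comp; last exact: continuous_expR.
  exact: mulrl_continuous.
have L20 : 0 < 2 * L by rewrite mulr_gt0.
have := Rintegral_expR_le t L20; set J := Rintegral _ _ _ => hJ.
apply: le_trans (_ : q (d t) * (L * S) * (expR (2 * L * t) / (2 * L)) <= _).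
  by rewrite ler_wpM2l// mulr_ge0// mulr_ge0// ltW.
rewrite le_eqVlt; apply/orP; left; apply/eqP; field.
by rewrite gt_eqF.
Qed.

End WeakIntegral.

Section WeakODE.
Variables (R : realType) (V : lmodType R[i]) (ip : V -> V -> R).
Hypothesis ipH : semi_hilbert ip.
Implicit Types (f g v : V) (r s t : R).
Local Notation leb := (@lebesgue_measure R).
Local Notation nrm := (ipnorm ip).

(** The integral of the pairings is a bounded functional, represented by Riesz. *)
Lemma ex_weak_integral (F : R -> V) (B t : R) (v0 : V) :
  (forall phi, continuous (fun s => ip (F s) phi)) ->
  (forall s, nrm (F s) <= B) ->
  exists v, forall phi,
    ip v phi = ip v0 phi + \int[leb]_(s in `[0, t]) ip (F s) phi.
Proof.
move=> cF FB.
have B0 : 0 <= B by apply: le_trans (FB 0); exact: ipnorm_ge0.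
have iF phi := @continuous_itv_integrable R _ 0 t (cF phi).
pose l phi := \int[leb]_(s in `[0, t]) ip (F s) phi.
have [] := @riesz _ _ _ ipH l (B * `|t|).
- move=> f g; rewrite /l -RintegralD//.
  by apply: eq_Rintegral => s _; rewrite (ipDr ipH).
- move=> r f; rewrite /l -RintegralZl//.
  by apply: eq_Rintegral => s _; rewrite (ipZr ipH).
- move=> f; rewrite /l.
  have [t0|t0] := ltP t 0.
    by rewrite Rintegral_itv_lt0// normr0 !mulr_ge0// ipnorm_ge0.
  apply: le_trans (ler_norm_itv_integral (g := cst (B * nrm f)) _ _ _) _ => //.
  + by apply: continuous_itv_integrable => x; exact: cvg_cst.
  + move=> s _; apply: le_trans (ip_cauchy_schwarz ipH _ _) _.
    by rewrite ler_wpM2r// ipnorm_ge0.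
  + by rewrite Rintegral_itv_cst// ger0_norm// mulrAC.
by move=> v vP; exists (v0 + v) => phi; rewrite (ipDl ipH) vP.
Qed.

Variables (G : R -> V -> V) (L B : R) (a0 : V).
Hypothesis L_gt0 : 0 < L.
Hypothesis G_lip : forall t f g, nrm (G t f - G t g) <= L * nrm (f - g).
Hypothesis G_bnd : forall t f, nrm (G t f) <= B.
Hypothesis G_cts : forall f phi, continuous (fun t => ip (G t f) phi).

Let B_ge0 : 0 <= B.
Proof. by apply: le_trans (G_bnd 0 0); exact: ipnorm_ge0. Qed.

Let lipschitz (a : R -> V) := forall s t, nrm (a t - a s) <= B * `|t - s|.

Let G_continuous (a : R -> V) phi : lipschitz a ->
  continuous (fun s => ip (G s (a s)) phi).
Proof.
move=> aL s0.
apply/cvgrPdist_le => e e0.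
have K0 : 0 < L * B * nrm phi + 1.
  by rewrite ltr_wpDl// !mulr_ge0 ?ipnorm_ge0// ltW.
have /cvgrPdist_le /(_ (e / 2)) := @G_cts (a s0) phi s0.
rewrite divr_gt0// => /(_ isT) h.
near=> s.
have h1 : `|ip (G s0 (a s0)) phi - ip (G s (a s0)) phi| <= e / 2.
  by near: s; exact: h.
have h2 : `|s0 - s| <= (e / 2) / (L * B * nrm phi + 1).
  near: s; exists (e / 2 / (L * B * nrm phi + 1)) => /=; first by rewrite !divr_gt0.
  by move=> x /ltW.
apply: le_trans (ler_distD (ip (G s (a s0)) phi) _ _) _.
suff : `|ip (G s (a s0)) phi - ip (G s (a s)) phi| <= e / 2 by move: h1; lra.
rewrite -(ipBl ipH); apply: le_trans (ip_cauchy_schwarz ipH _ _) _.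
have h3 : nrm (G s (a s0) - G s (a s)) <= L * (B * `|s0 - s|).
  by apply: le_trans (G_lip _ _ _) _; rewrite ler_wpM2l ?(ltW L_gt0).
have n0 := ipnorm_ge0 ip phi.
apply: le_trans (ler_wpM2r n0 h3) _.
apply: le_trans (_ : (L * B * nrm phi + 1) * `|s0 - s| <= _).
  have := normr_ge0 (s0 - s); nra.
by rewrite mulrC -ler_pdivlMr.
Unshelve. all: by end_near. Qed.

Let next_spec (a : R -> V) : lipschitz a -> exists b : R -> V, lipschitz b /\
  forall t phi, ip (b t) phi = ip a0 phi +
    \int[leb]_(s in `[0, t]) ip (G s (a s)) phi.
Proof.
move=> aL.
have /choice[b bP] t : exists v, forall phi, ip v phi = ip a0 phi +
    \int[leb]_(s in `[0, t]) ip (G s (a s)) phi.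
  by apply: (@ex_weak_integral _ B) => [phi|s]; [exact: G_continuous|exact: G_bnd].
exists b; split=> // s t.
wlog st : s t / s <= t.
  move=> h; have [/h//|/ltW /h] := leP s t.
  by rewrite (ipnormBC ipH) distrC.
apply: (ipnorm_le_self ipH); first by rewrite mulr_ge0.
rewrite {1}(ipBl ipH) !bP opprD addrACA subrr add0r.
apply: le_trans (ler_norm _) _.
apply: le_trans (Rintegral_itv_dist (K := B * nrm (b t - b s)) _ st _ _) _.
- exact: G_continuous.
- move=> x _; apply: le_trans (ip_cauchy_schwarz ipH _ _) _.
  by rewrite ler_wpM2r// ipnorm_ge0.
- by rewrite mulr_ge0// ipnorm_ge0.
- by rewrite ger0_norm ?subr_ge0// mulrAC.
Qed.

(** Picard iteration; consecutive iterates get closer by a factor two in the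
    norm weighted by [expR (- 2 L t)]. *)
Lemma weak_ode_exists : exists a : R -> V,
  [/\ forall s t, nrm (a t - a s) <= B * `|t - s|,
      forall phi, continuous (fun s => ip (G s (a s)) phi) &
      forall t phi, ip (a t) phi = ip a0 phi +
        \int[leb]_(s in `[0, t]) ip (G s (a s)) phi].
Proof.
pose lipT := {a : R -> V | lipschitz a}.
have /choice[nxt nxtP] (a : lipT) : exists b : lipT, forall t phi,
    ip (sval b t) phi = ip a0 phi +
      \int[leb]_(s in `[0, t]) ip (G s (sval a s)) phi.
  by have [b [bL bP]] := next_spec (svalP a); exists (exist _ b bL).
have L0 : lipschitz (fun _ => a0).
  by move=> s t; rewrite subrr ipnorm0// mulr_ge0.
pose w := fix w n : lipT := if n is m.+1 then nxt (w m) else exist _ _ L0.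
pose a n t := sval (w n) t.
have aL n : lipschitz (a n) := svalP (w n).
have aS n t phi : ip (a n.+1 t) phi = ip a0 phi +
    \int[leb]_(s in `[0, t]) ip (G s (a n s)) phi by exact: nxtP.
have [C CE] : exists C, C = B / (2 * L) by eexists.
have C0 : 0 <= C by rewrite CE divr_ge0// mulr_ge0// ltW.
have L20 : 0 < 2 * L by rewrite mulr_gt0.
have aC n t : nrm (a n.+1 t - a n t) <= C * 2^-1 ^+ n * expR (2 * L * t).
  elim: n t => [|n ih] t.
    rewrite expr0 mulr1; apply: (ipnorm_le_self ipH).
      by rewrite mulr_ge0// expR_ge0.
    rewrite {1}(ipBl ipH) aS addrC addKr.
    have [t0|t0] := ltP t 0.
      by rewrite Rintegral_itv_lt0// !mulr_ge0 ?expR_ge0 ?ipnorm_ge0.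
    apply: le_trans (ler_norm _) _.
    apply: le_trans (ler_norm_itv_integral (g := cst (B * nrm (a 1%N t - a0))) _ _ _) _.
    - by apply: continuous_itv_integrable; exact: G_continuous.
    - by apply: continuous_itv_integrable => x; exact: cvg_cst.
    - move=> s _; apply: le_trans (ip_cauchy_schwarz ipH _ _) _.
      by rewrite ler_wpM2r// ipnorm_ge0.
    rewrite Rintegral_itv_cst// mulrAC ler_wpM2r ?ipnorm_ge0//.
    rewrite CE -mulrA ler_wpM2l// ler_pdivlMl//.
    by apply: le_trans (expR_ge1Dx _); rewrite lerDr.
  apply: (ipnorm_le_self ipH).
    by rewrite !mulr_ge0 ?exprn_ge0 ?expR_ge0.
  rewrite {1}(ipBl ipH) !aS opprD addrACA subrr add0r.
  set phi := a n.+2 t - a n.+1 t.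
  have i1 k : leb.-integrable `[0, t] (EFin \o (fun s => ip (G s (a k s)) phi)).
    by apply: continuous_itv_integrable; exact: G_continuous.
  rewrite -RintegralB//.
  pose g s := nrm phi * (L * (C * 2^-1 ^+ n)) * expR (2 * L * s).
  have ce : continuous (fun s => expR (2 * L * s)).
    move=> s; apply: continuous_comp; last exact: continuous_expR.
    exact: mulrl_continuous.
  have cg : continuous g by move=> s; apply: cvgMr; exact: ce.
  apply: le_trans (ler_norm _) _.
  apply: le_trans (ler_norm_itv_integral (g := g) _ _ _) _.
  - exact: (integrableB _ (i1 _) (i1 _)).
  - exact: continuous_itv_integrable.
  - move=> s _; rewrite -(ipBl ipH) /g.
    apply: le_trans (ip_cauchy_schwarz ipH _ _) _.
    rewrite mulrC -mulrA ler_wpM2l ?ipnorm_ge0//.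
    by apply: le_trans (G_lip _ _ _) _; rewrite -mulrA ler_wpM2l ?(ltW L_gt0).
  rewrite RintegralZl//; last exact: continuous_itv_integrable.
  have := Rintegral_expR_le t L20; set J := Rintegral _ _ _ => hJ.
  apply: le_trans (_ : nrm phi * (L * (C * 2^-1 ^+ n)) * (expR (2 * L * t) / (2 * L)) <= _).
    by rewrite ler_wpM2l// !mulr_ge0 ?ipnorm_ge0 ?exprn_ge0// ltW.
  rewrite le_eqVlt; apply/orP; left; apply/eqP; rewrite exprS; field.
  by rewrite gt_eqF.
have /choice[b bP] t : exists l, forall n,
    nrm (a n t - l) <= C * expR (2 * L * t) * 2 * 2^-1 ^+ n.
  by apply: (ip_complete_norm ipH) => n; rewrite mulrAC.
have bL : lipschitz b.
  move=> s t; rewrite -subr_le0.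
  apply: (@le0_geometric _ _ (C * expR (2 * L * s) * 2 + C * expR (2 * L * t) * 2)) => n.
  have h1 := bP s n; have h2 := bP t n; have h3 := aL n s t.
  have h4 := ipnorm_distD ipH (a n t) (b t) (b s).
  have h5 := ipnorm_distD ipH (a n s) (a n t) (b s).
  by rewrite (ipnormBC ipH (b t) (a n t)) in h4; lra.
exists b; split => //; first by move=> phi; exact: G_continuous.
move=> t phi; apply/eqP; rewrite -subr_eq0 -normr_le0.
have [E EE] : exists E, E = C * expR (2 * L * `|t|) * 2 by eexists.
apply: (@le0_geometric _ _ (nrm phi * E + (L * E * nrm phi) * `|t|)) => n.
have := aS n t phi.
have E0 : 0 <= E by rewrite EE !mulr_ge0 ?expR_ge0.
have eE s : s <= `|t| -> C * expR (2 * L * s) * 2 <= E.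
  move=> st; rewrite EE ler_wpM2r// ler_wpM2l// ler_expR ler_wpM2l//.
  exact: ltW.
have h1 : `|ip (a n.+1 t) phi - ip (b t) phi| <= nrm phi * E * 2^-1 ^+ n.
  rewrite -(ipBl ipH); apply: le_trans (ip_cauchy_schwarz ipH _ _) _.
  rewrite mulrC -mulrA ler_wpM2l ?ipnorm_ge0//.
  apply: le_trans (bP _ _) _.
  apply: (@le_trans _ _ (E * 2^-1 ^+ n.+1)).
    by rewrite ler_wpM2r ?exprn_ge0// eE// ler_norm.
  rewrite ler_wpM2l// exprS.
  have : 0 <= (2^-1 : R) ^+ n by rewrite exprn_ge0.
  lra.
have i1 x : lipschitz x -> leb.-integrable `[0, t] (EFin \o (fun s => ip (G s (x s)) phi)).
  by move=> xL; apply: continuous_itv_integrable; exact: G_continuous.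
have h2 : `|\int[leb]_(s in `[0, t]) ip (G s (a n s)) phi -
    \int[leb]_(s in `[0, t]) ip (G s (b s)) phi| <= L * E * nrm phi * `|t| * 2^-1 ^+ n.
  rewrite -RintegralB//; [|exact: i1|exact: i1].
  have [t0|t0] := ltP t 0.
    by rewrite Rintegral_itv_lt0// normr0 !mulr_ge0 ?ipnorm_ge0 ?exprn_ge0// ltW.
  apply: le_trans (ler_norm_itv_integral (g := cst (L * E * nrm phi * 2^-1 ^+ n)) _ _ _) _.
  - exact: (integrableB _ (i1 _ (aL n)) (i1 _ bL)).
  - by apply: continuous_itv_integrable => x; exact: cvg_cst.
  - move=> s /andP[s0 st]; rewrite -(ipBl ipH).
    apply: le_trans (ip_cauchy_schwarz ipH _ _) _.
    rewrite mulrAC ler_wpM2r ?ipnorm_ge0//.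
    apply: le_trans (G_lip _ _ _) _; rewrite -mulrA ler_wpM2l ?(ltW L_gt0)//.
    apply: le_trans (bP _ _) _; rewrite ler_wpM2r ?exprn_ge0// eE//.
    by rewrite (le_trans st) ?ler_norm.
  - by rewrite Rintegral_itv_cst// (ger0_norm t0) mulrAC.
move: h1 h2; set I1 := Rintegral _ _ _; set I2 := Rintegral _ _ _ => h1 h2 h3.
have -> : ip (b t) phi - (ip a0 phi + I2) =
    (I1 - I2) - (ip (a n.+1 t) phi - ip (b t) phi) by rewrite h3; ring.
by apply: le_trans (ler_normB _ _) _; lra.
Qed.

(** A field that is everywhere orthogonal to its argument preserves the norm:
    the first-order increment of the squared norm vanishes at every time. *)
Lemma weak_ode_norm (a : R -> V) :
  (forall t f, ip (G t f) f = 0) ->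
  (forall s t, nrm (a t - a s) <= B * `|t - s|) ->
  (forall phi, continuous (fun s => ip (G s (a s)) phi)) ->
  (forall t phi, ip (a t) phi = ip a0 phi +
     \int[leb]_(s in `[0, t]) ip (G s (a s)) phi) ->
  forall t, nrm (a t) = nrm a0.
Proof.
move=> Gorth aL cG aP t.
have a00 : nrm (a 0 - a0) = 0.
  apply: ipnorm_eq0 => phi.
  by rewrite (ipBl ipH) aP set_itv1 Rintegral_set1 addr0 subrr.
have -> : nrm a0 = nrm (a 0).
  by have := ler_ipnorm_dist ipH (a 0) a0; rewrite a00 normr_le0 subr_eq0 => /eqP.
suff : ip (a t) (a t) = ip (a 0) (a 0) by rewrite /ipnorm => ->.
apply: (@quadratic_increments_constant _ (fun t => ip (a t) (a t)) (3 * B ^+ 2)).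
  by rewrite mulr_ge0// exprn_ge0.
suff main s u : s <= u ->
    `|ip (a u) (a u) - ip (a s) (a s)| <= 3 * B ^+ 2 * (u - s) ^+ 2.
  move=> s u; have [/main//|/ltW /main] := leP s u.
  by rewrite distrC -[u - s]opprB sqrrN.
move=> su.
have -> : ip (a u) (a u) - ip (a s) (a s) =
    ip (a u - a s) (a s) *+ 2 + nrm (a u - a s) ^+ 2.
  rewrite (ipnorm_sq ipH) !(ipBl ipH) !(ipBr ipH) (ipC ipH (a s) (a u)); ring.
have us0 : 0 <= u - s by rewrite subr_ge0.
have h1 : nrm (a u - a s) ^+ 2 <= B ^+ 2 * (u - s) ^+ 2.
  rewrite -exprMn ler_pXn2r ?nnegrE ?ipnorm_ge0 ?mulr_ge0//.
  by have := aL s u; rewrite ger0_norm.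
have h2 : `|ip (a u - a s) (a s)| <= B * (B * (u - s)) * (u - s).
  rewrite (ipBl ipH) (aP u) (aP s) opprD addrACA subrr add0r.
  apply: Rintegral_itv_dist => //.
    move=> x /andP[sx xu].
    have -> : ip (G x (a x)) (a s) = ip (G x (a x)) (a s - a x).
      by rewrite (ipBr ipH) Gorth subr0.
    apply: le_trans (ip_cauchy_schwarz ipH _ _) _.
    apply: ler_pM; rewrite ?ipnorm_ge0//.
    apply: le_trans (aL _ _) _; rewrite ler_wpM2l//.
    by rewrite distrC ger0_norm ?subr_ge0//; lra.
  by rewrite !mulr_ge0.
apply: le_trans (ler_normD _ _) _.
rewrite normrMn (ger0_norm (sqr_ge0 _)).
by move: h1 h2; rewrite !expr2; lra.
Qed.

End WeakODE.

(** * Complex-valued functions, integrals and square integrability *)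

Section ComplexNumbers.
Variable R : realType.
Implicit Types (z w : R[i]) (x y : R).

Lemma ReD z w : Re (z + w) = Re z + Re w. Proof. by case: z; case: w. Qed.
Lemma ImD z w : Im (z + w) = Im z + Im w. Proof. by case: z; case: w. Qed.
Lemma ReN z : Re (- z) = - Re z. Proof. by case: z. Qed.
Lemma ImN z : Im (- z) = - Im z. Proof. by case: z. Qed.
Lemma ReM z w : Re (z * w) = Re z * Re w - Im z * Im w.
Proof. by case: z; case: w. Qed.
Lemma ImM z w : Im (z * w) = Re z * Im w + Im z * Re w.
Proof. by case: z; case: w. Qed.
Lemma ReJ z : Re (conjc z) = Re z. Proof. by case: z. Qed.
Lemma ImJ z : Im (conjc z) = - Im z. Proof. by case: z. Qed.
Definition ReImE := (ReD, ImD, ReN, ImN, ReM, ImM, ReJ, ImJ).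

Lemma complex_eqP z w : Re z = Re w -> Im z = Im w -> z = w.
Proof. by case: z => a b; case: w => c e /= -> ->. Qed.

Lemma normc_sq z : nc z ^+ 2 = Re z ^+ 2 + Im z ^+ 2.
Proof. by case: z => a b; rewrite sqr_sqrtr// addr_ge0// sqr_ge0. Qed.

Lemma normc_ge0 z : 0 <= nc z.
Proof. by case: z => a b; exact: sqrtr_ge0. Qed.

Lemma normcD_le z w : nc (z + w) <= nc z + nc w.
Proof. exact: le_normcD. Qed.

Lemma normc_opp z : nc (- z) = nc z.
Proof. exact: normcN. Qed.

Lemma normc_conj z : nc (conjc z) = nc z.
Proof. by case: z => a b /=; rewrite sqrrN. Qed.

Lemma normc_real x : nc x%:C = `|x|.
Proof. by rewrite /= expr0n addr0 sqrtr_sqr. Qed.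

Lemma normc_expi x : nc (expi x) = 1.
Proof. by rewrite /= cos2Dsin2 sqrtr1. Qed.

Lemma normRe_le z : `|Re z| <= nc z.
Proof.
rewrite -(@ler_pXn2r _ 2)// ?nnegrE ?normc_ge0// normc_sq real_normK ?num_real//.
by rewrite lerDl sqr_ge0.
Qed.

Lemma normIm_le z : `|Im z| <= nc z.
Proof.
rewrite -(@ler_pXn2r _ 2)// ?nnegrE ?normc_ge0// normc_sq real_normK ?num_real//.
by rewrite lerDr sqr_ge0.
Qed.

Lemma Re_le_normc z : Re z <= nc z.
Proof. exact: le_trans (ler_norm _) (normRe_le _). Qed.

Lemma expiD x y : expi (x + y) = expi x * expi y.
Proof. by apply: complex_eqP; rewrite ?ReM ?ImM /= ?cosD ?sinD//; ring. Qed.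

Lemma expi0 : expi (0 : R) = 1.
Proof. by rewrite /expi cos0 sin0. Qed.

Lemma conjc_expi x : conjc (expi x) = expi (- x).
Proof. by rewrite /expi cosN sinN. Qed.

Lemma conjM z w : conjc (z * w) = conjc z * conjc w.
Proof. exact: rmorphM. Qed.

Lemma mulJ_normc z : z * conjc z = (nc z ^+ 2)%:C.
Proof. by apply: complex_eqP; rewrite ?normc_sq ?ReImE/=; ring. Qed.

Lemma conjD z w : conjc (z + w) = conjc z + conjc w.
Proof. exact: rmorphD. Qed.

Lemma conjB z w : conjc (z - w) = conjc z - conjc w.
Proof. exact: rmorphB. Qed.

(** Rotating a complex integral reduces bounds on its modulus to bounds on its real part. *)
Lemma ex_phase z : exists c, nc c = 1 /\ c * z = (nc z)%:C.
Proof.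
have [->|z0] := eqVneq z 0.
  by exists 1; rewrite Normc.normc1 mulr0 Normc.normc0.
have n0 : nc z != 0 by apply: contra z0 => /eqP/Normc.eq0_normc ->.
exists ((nc z)^-1%:C * conjc z); split.
  by rewrite Normc.normcM normc_real normc_conj ger0_norm ?invr_ge0 ?normc_ge0// mulVf.
rewrite -mulrA [_^* * _]mulrC mulJ_normc -rmorphM.
by congr (_%:C); rewrite expr2 mulKf.
Qed.

End ComplexNumbers.

Section ComplexMeasurable.
Context d (T : measurableType d) (R : realType).
Implicit Types (f g : T -> R[i]) (h : T -> R).

Lemma cmeasurable_cst (c : R[i]) : cmeasurable (fun _ : T => c).
Proof. by split; exact: measurable_cst. Qed.

Lemma cmeasurableD f g : cmeasurable f -> cmeasurable g ->
  cmeasurable (fun x => f x + g x).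
Proof.
move=> [f1 f2] [g1 g2]; split.
- by under eq_fun do rewrite ReD; exact: measurable_funD.
- by under eq_fun do rewrite ImD; exact: measurable_funD.
Qed.

Lemma cmeasurableM f g : cmeasurable f -> cmeasurable g ->
  cmeasurable (fun x => f x * g x).
Proof.
move=> [f1 f2] [g1 g2]; split.
- under eq_fun do rewrite ReM.
  by apply: measurable_funB; exact: measurable_funM.
- under eq_fun do rewrite ImM.
  by apply: measurable_funD; exact: measurable_funM.
Qed.

Lemma cmeasurableN f : cmeasurable f -> cmeasurable (fun x => - f x).
Proof.
move=> [f1 f2]; split.
- by under eq_fun do rewrite ReN; exact: measurableT_comp.
- by under eq_fun do rewrite ImN; exact: measurableT_comp.
Qed.

Lemma cmeasurableB f g : cmeasurable f -> cmeasurable g ->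
  cmeasurable (fun x => f x - g x).
Proof. by move=> mf mg; apply: cmeasurableD => //; exact: cmeasurableN. Qed.

Lemma cmeasurableJ f : cmeasurable f -> cmeasurable (fun x => conjc (f x)).
Proof.
move=> [f1 f2]; split; first by under eq_fun do rewrite ReJ.
by under eq_fun do rewrite ImJ; exact: measurableT_comp.
Qed.

Lemma cmeasurable_real h : measurable_fun setT h ->
  cmeasurable (fun x => (h x)%:C).
Proof. by move=> mh; split => //=; exact: measurable_cst. Qed.

Lemma cmeasurable_expi h : measurable_fun setT h ->
  cmeasurable (fun x => expi (h x)).
Proof.
move=> mh; split => /=; apply: measurableT_comp => //.
- by apply: continuous_measurable_fun; exact: continuous_cos.
- by apply: continuous_measurable_fun; exact: continuous_sin.
Qed.

Lemma measurable_normc_sq f : cmeasurable f ->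
  measurable_fun setT (fun x => nc (f x) ^+ 2).
Proof.
move=> [f1 f2]; under eq_fun do rewrite normc_sq.
by apply: measurable_funD; exact: measurable_funX.
Qed.

Lemma measurable_normc f : cmeasurable f -> measurable_fun setT (fun x => nc (f x)).
Proof.
move=> mf.
rewrite (_ : (fun x => _) = Num.sqrt \o (fun x => nc (f x) ^+ 2)).
  apply: measurableT_comp; last exact: measurable_normc_sq.
  by apply: continuous_measurable_fun; exact: sqrt_continuous.
by apply/funext => x /=; rewrite sqrtr_sqr ger0_norm// normc_ge0.
Qed.

Lemma cmeasurable_comp d' (T' : measurableType d') f (k : T' -> T) :
  cmeasurable f -> measurable_fun setT k -> cmeasurable (f \o k).
Proof. by move=> [f1 f2] mk; split; [exact: (measurableT_comp f1 mk)|exact: (measurableT_comp f2 mk)]. Qed.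

End ComplexMeasurable.

Section ComplexIntegral.
Context d (T : measurableType d) (R : realType).
Variable mu : {measure set T -> \bar R}.
Implicit Types (f g : T -> R[i]) (h : T -> R) (D : set T).
Local Notation int := (cintegral mu setT).

Lemma eq_cintegral D f g : (forall x, D x -> f x = g x) ->
  cintegral mu D f = cintegral mu D g.
Proof.
move=> fg; rewrite /cintegral; congr (_ +i* _); apply: eq_Rintegral => x;
  by rewrite inE => /fg ->.
Qed.

Lemma cintegral_mkcond D f : measurable D ->
  cintegral mu D f = int (fun x => f x * (\1_D x)%:C).
Proof.
move=> mD; rewrite /cintegral !(Rintegral_mkcond _ D); congr (_ +i* _);
  apply: eq_Rintegral => x _; rewrite patchE indicE;
  by rewrite -[point]/(0 : R); case: (f x) => a b; case: (x \in D) => /=; ring.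
Qed.

Lemma ReIntegral D f : Re (cintegral mu D f) = \int[mu]_(x in D) Re (f x).
Proof. by []. Qed.

Lemma integrable_dominated h (g : T -> R) : measurable_fun setT h ->
  mu.-integrable setT (EFin \o g) -> (forall x, `|h x| <= g x) ->
  mu.-integrable setT (EFin \o h).
Proof.
move=> mh ig hg; apply: le_integrable ig => //; first exact/measurable_EFinP.
by move=> x _ /=; rewrite lee_fin (le_trans (hg x))// ler_norm.
Qed.

Lemma cintegrable_dominated f (g : T -> R) : cmeasurable f ->
  mu.-integrable setT (EFin \o g) -> (forall x, nc (f x) <= g x) ->
  cintegrable mu setT f.
Proof.
move=> [f1 f2] ig fg; split; apply: (integrable_dominated _ ig) => // x.
- exact: le_trans (normRe_le _) _.
- exact: le_trans (normIm_le _) _.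
Qed.

Lemma cintegrable_cmeasurable f : cintegrable mu setT f -> cmeasurable f.
Proof.
by move=> [/measurable_int/measurable_EFinP f1 /measurable_int/measurable_EFinP f2].
Qed.

Lemma cintegrable_normc f : cintegrable mu setT f ->
  mu.-integrable setT (fun x => (nc (f x))%:E).
Proof.
move=> fi; have mf := cintegrable_cmeasurable fi; case: fi => f1 f2.
have := integrableD measurableT (integrable_abse f1) (integrable_abse f2).
apply: le_integrable => //; first exact/measurable_EFinP/measurable_normc.
move=> x _ /=; rewrite !lee_fin ger0_norm ?normc_ge0// ger0_norm ?addr_ge0//.
rewrite -(@ler_pXn2r _ 2)// ?nnegrE ?normc_ge0 ?addr_ge0// normc_sq sqrrD.
rewrite !real_normK ?num_real//.
have : 0 <= `|Re (f x)| * `|Im (f x)| by rewrite mulr_ge0.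
lra.
Qed.

Lemma cintegrableP f : cmeasurable f ->
  (\int[mu]_x (nc (f x))%:E < +oo)%E -> cintegrable mu setT f.
Proof.
move=> mf fi; apply: (@cintegrable_dominated _ (fun x => nc (f x))) => //.
apply/integrableP; split; first exact/measurable_EFinP/measurable_normc.
by under eq_integral do rewrite /= ger0_norm ?normc_ge0//.
Qed.

Lemma cintegrableD f g : cintegrable mu setT f -> cintegrable mu setT g ->
  cintegrable mu setT (fun x => f x + g x).
Proof.
move=> [f1 f2] [g1 g2]; split.
- by under eq_fun do rewrite ReD EFinD; exact: integrableD.
- by under eq_fun do rewrite ImD EFinD; exact: integrableD.
Qed.

Lemma cintegrableMb f g (c : R) : cmeasurable g -> (forall x, nc (g x) <= c) ->
  cintegrable mu setT f -> cintegrable mu setT (fun x => g x * f x).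
Proof.
move=> mg gc fi; apply: (@cintegrable_dominated _ (fun x => c * nc (f x))).
- by apply: cmeasurableM => //; exact: cintegrable_cmeasurable.
- have := integrableZl measurableT c (cintegrable_normc fi).
  by apply: eq_integrable => // x _.
- by move=> x; rewrite Normc.normcM ler_wpM2r ?normc_ge0.
Qed.

Lemma cintegrableZ f (c : R[i]) : cintegrable mu setT f ->
  cintegrable mu setT (fun x => c * f x).
Proof. by apply: (@cintegrableMb _ _ (nc c)) => //; exact: cmeasurable_cst. Qed.

Lemma cintegrableB f g : cintegrable mu setT f -> cintegrable mu setT g ->
  cintegrable mu setT (fun x => f x - g x).
Proof.
move=> fi gi; apply: cintegrableD => //.
by under eq_fun do rewrite -mulN1r; exact: cintegrableZ.
Qed.

Lemma cintegrableJ f : cintegrable mu setT f ->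
  cintegrable mu setT (fun x => conjc (f x)).
Proof.
move=> [f1 f2]; split; first by under eq_fun do rewrite ReJ.
by under eq_fun do rewrite ImJ EFinN; exact: integrableN.
Qed.

Lemma cintegralD f g : cintegrable mu setT f -> cintegrable mu setT g ->
  int (fun x => f x + g x) = int f + int g.
Proof.
move=> [f1 f2] [g1 g2]; rewrite /cintegral; apply: complex_eqP => /=.
- by under eq_Rintegral do rewrite ReD; rewrite RintegralD.
- by under eq_Rintegral do rewrite ImD; rewrite RintegralD.
Qed.

Lemma cintegralZ f (c : R[i]) : cintegrable mu setT f ->
  int (fun x => c * f x) = c * int f.
Proof.
move=> [f1 f2]; rewrite /cintegral; apply: complex_eqP; rewrite ?ReM ?ImM /=.
- under eq_Rintegral do rewrite ReM.
  rewrite RintegralB ?RintegralZl//.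
  + exact: (integrableZl _ _ f1).
  + exact: (integrableZl _ _ f2).
- under eq_Rintegral do rewrite ImM.
  rewrite RintegralD ?RintegralZl//.
  + exact: (integrableZl _ _ f2).
  + exact: (integrableZl _ _ f1).
Qed.

Lemma cintegralB f g : cintegrable mu setT f -> cintegrable mu setT g ->
  int (fun x => f x - g x) = int f - int g.
Proof.
move=> fi gi; under eq_cintegral => x _ do rewrite -[- g x]mulN1r.
by rewrite cintegralD ?cintegralZ ?mulN1r//; exact: cintegrableZ.
Qed.

Lemma cintegralJ f : cintegrable mu setT f ->
  int (fun x => conjc (f x)) = conjc (int f).
Proof.
move=> [f1 f2]; apply: complex_eqP; rewrite ?ReJ ?ImJ /=.
  by apply: eq_Rintegral => x _; rewrite ReJ.
under eq_Rintegral do rewrite ImJ -mulN1r.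
by rewrite RintegralZl// mulN1r.
Qed.

Lemma le_normc_cintegral f : cintegrable mu setT f ->
  nc (int f) <= \int[mu]_x nc (f x).
Proof.
move=> fi; have [c [c1 cE]] := ex_phase (int f).
have -> : nc (int f) = Re (c * int f) by rewrite cE.
have cfi := cintegrableZ c fi.
rewrite -cintegralZ// ReIntegral; apply: le_Rintegral => //.
- by case: cfi.
- exact: cintegrable_normc.
- by move=> x _; apply: le_trans (Re_le_normc _) _; rewrite Normc.normcM c1 mul1r.
Qed.

Lemma le_normc_cintegral_dom f (g : T -> R) : cmeasurable f ->
  mu.-integrable setT (EFin \o g) -> (forall x, nc (f x) <= g x) ->
  nc (int f) <= \int[mu]_x g x.
Proof.
move=> mf ig fg; have fi := cintegrable_dominated mf ig fg.
apply: le_trans (le_normc_cintegral fi) _; apply: le_Rintegral => //.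
exact: cintegrable_normc.
Qed.

Lemma ae_eq_cintegral f g : cmeasurable f -> cmeasurable g ->
  {ae mu, forall x, f x = g x} -> int f = int g.
Proof.
move=> [f1 f2] [g1 g2] fg; rewrite /cintegral; congr (_ +i* _);
  rewrite /Rintegral; congr fine; apply: ae_eq_integral => //;
  try exact/measurable_EFinP.
- by apply: filterS fg => x /= -> _.
- by apply: filterS fg => x /= -> _.
Qed.

End ComplexIntegral.

Section ComplexFubini.
Context d1 d2 (T1 : measurableType d1) (T2 : measurableType d2) (R : realType).
Variables (m1 : {sigma_finite_measure set T1 -> \bar R}).
Variables (m2 : {sigma_finite_measure set T2 -> \bar R}).
Implicit Types (f : T1 * T2 -> R[i]) (h : T1 * T2 -> R).

Lemma measurable_partial_integral h : measurable_fun setT h ->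
  measurable_fun setT (fun x => \int[m2]_y h (x, y)).
Proof.
move=> mh; apply: measurableT_comp; first exact: fine_measurable.
under eq_fun do rewrite integralE.
have mE : measurable_fun setT (EFin \o h) by exact/measurable_EFinP.
apply: emeasurable_funB.
- rewrite (_ : (fun x => _) = fubini_F m2 ((EFin \o h)^\+)%E).
    by apply: measurable_fun_fubini_tonelli_F => //; exact: measurable_funepos.
  by apply/funext => x; apply: eq_integral => y _; rewrite !funeposE.
- rewrite (_ : (fun x => _) = fubini_F m2 ((EFin \o h)^\-)%E).
    by apply: measurable_fun_fubini_tonelli_F => //; exact: measurable_funeneg.
  by apply/funext => x; apply: eq_integral => y _; rewrite !funenegE.
Qed.

Lemma cmeasurable_partial_cintegral f : cmeasurable f ->
  cmeasurable (fun x => cintegral m2 setT (fun y => f (x, y))).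
Proof.
by move=> [f1 f2]; split => /=; apply: (@measurable_partial_integral (fun z => _ (f z))).
Qed.

Lemma integrable_partial_integral h :
  (m1 \x m2)%E.-integrable setT (EFin \o h) ->
  m1.-integrable setT (fun x => (\int[m2]_y h (x, y))%:E) /\
  \int[m1]_x \int[m2]_y h (x, y) = fine (\int[(m1 \x m2)%E]_z (h z)%:E)%E.
Proof.
move=> ih; have iF := integrable_fubini_F ih.
have mh : measurable_fun setT h.
  by apply/measurable_EFinP; exact: (measurable_int _ ih).
have aeF : ae_eq m1 setT (fun x => (\int[m2]_y h (x, y))%:E)
    (fubini_F m2 (EFin \o h)).
  by apply: filterS (integrable_ae measurableT iF) => x /(_ I) hx _; rewrite fineK.
have mF : measurable_fun setT (fun x => (\int[m2]_y h (x, y))%:E).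
  exact/measurable_EFinP/measurable_partial_integral.
split.
  apply: le_integrable iF => // x _; rewrite /Rintegral /fubini_F /=.
  by case: (\int[m2]_y _)%E => [r| |]//=; rewrite normr0 leey.
rewrite {1}/Rintegral; congr fine.
rewrite (ae_eq_integral (fubini_F m2 (EFin \o h)))//.
  by rewrite (integral12_prod_meas1 ih).
exact: measurable_int iF.
Qed.

Lemma cintegrable_prod f : cmeasurable f ->
  (\int[m1]_x \int[m2]_y (nc (f (x, y)))%:E < +oo)%E ->
  cintegrable (m1 \x m2)%E setT f.
Proof.
move=> mf fi; apply: cintegrableP => //.
rewrite fubini_tonelli1//; first exact/measurable_EFinP/measurable_normc.
by move=> z; rewrite lee_fin normc_ge0.
Qed.

Lemma cintegrable_partial f : cintegrable (m1 \x m2)%E setT f ->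
  cintegrable m1 setT (fun x => cintegral m2 setT (fun y => f (x, y))).
Proof.
move=> [f1 f2]; split => /=.
- exact: (integrable_partial_integral f1).1.
- exact: (integrable_partial_integral f2).1.
Qed.

Lemma cintegral_prod f : cintegrable (m1 \x m2)%E setT f ->
  cintegral m1 setT (fun x => cintegral m2 setT (fun y => f (x, y))) =
  cintegral (m1 \x m2)%E setT f.
Proof.
move=> [f1 f2]; rewrite /cintegral; congr (_ +i* _) => /=.
- exact: (integrable_partial_integral f1).2.
- exact: (integrable_partial_integral f2).2.
Qed.

End ComplexFubini.

Section ComplexFubiniSwap.
Context d1 d2 (T1 : measurableType d1) (T2 : measurableType d2) (R : realType).
Variables (m1 : {sigma_finite_measure set T1 -> \bar R}).
Variables (m2 : {sigma_finite_measure set T2 -> \bar R}).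
Implicit Types (f : T1 * T2 -> R[i]).

Lemma cintegrable_swap f : cintegrable (m1 \x m2)%E setT f ->
  cintegrable (m2 \x m1)%E setT (fun z => f (z.2, z.1)).
Proof.
move=> fi; have mf := cintegrable_cmeasurable fi.
have mfs : cmeasurable (fun z : T2 * T1 => f (z.2, z.1)).
  apply: (@cmeasurable_comp _ _ _ _ _ f (fun z : T2 * T1 => (z.2, z.1))) => //.
  by apply/measurable_fun_pairP; split; [exact: measurable_snd|exact: measurable_fst].
apply: cintegrable_prod => //=.
have mn : measurable_fun setT (fun z => (nc (f z))%:E).
  exact/measurable_EFinP/measurable_normc.
have n0 z : (0 <= (nc (f z))%:E)%E by rewrite lee_fin normc_ge0.
have E1 := @fubini_tonelli1 _ _ _ _ _ m1 m2 _ mn n0.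
have E2 := @fubini_tonelli _ _ _ _ _ m1 m2 _ mn n0.
move: E1 E2; rewrite /fubini_F /fubini_G => E1 <-; rewrite -E1.
have /integrableP[_] := cintegrable_normc fi.
by under eq_integral do rewrite /= ger0_norm ?normc_ge0//.
Qed.

Lemma cFubini f : cintegrable (m1 \x m2)%E setT f ->
  cintegral m1 setT (fun x => cintegral m2 setT (fun y => f (x, y))) =
  cintegral m2 setT (fun y => cintegral m1 setT (fun x => f (x, y))).
Proof.
move=> fi.
have fRI (h : T1 * T2 -> R) : (m1 \x m2)%E.-integrable setT (EFin \o h) ->
    (m2 \x m1)%E.-integrable setT (fun z => (h (z.2, z.1))%:E) ->
    \int[m1]_x \int[m2]_y h (x, y) = \int[m2]_y \int[m1]_x h (x, y).
  move=> i1 i2; rewrite (integrable_partial_integral i1).2.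
  rewrite (integrable_partial_integral i2).2 -!integral12_prod_meas1//.
  by rewrite /fubini_F /= (Fubini i1).
have [s1 s2] := cintegrable_swap fi; case: fi => f1 f2.
rewrite /cintegral /=; congr (_ +i* _).
- exact: (fRI (fun z => Re (f z))).
- exact: (fRI (fun z => Im (f z))).
Qed.

End ComplexFubiniSwap.

Section L2Norm.
Context d (T : measurableType d) (R : realType).
Variable mu : {measure set T -> \bar R}.
Implicit Types (f g : T -> R[i]).
Local Open Scope ereal_scope.

Definition sqnorm f : \bar R := \int[mu]_x ((nc (f x) ^+ 2)%R)%:E.

Lemma sqnorm_ge0 f : 0 <= sqnorm f.
Proof. by apply: integral_ge0 => x _; rewrite lee_fin sqr_ge0. Qed.

Lemma L2normE f : L2norm mu f = sqrte (sqnorm f).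
Proof.
rewrite /L2norm unlock poweR12_sqrt; last by apply: integral_ge0 => x _; exact: poweR_ge0.
congr sqrte; apply: eq_integral => x _.
by rewrite /= ger0_norm ?normc_ge0// powR_mulrn// normc_ge0.
Qed.

Lemma L2norm_le f (c : R) : (0 <= c)%R ->
  (L2norm mu f <= c%:E) = (sqnorm f <= (c ^+ 2)%:E).
Proof.
move=> c0; rewrite L2normE -(lee_sqrt _ (y := (c ^+ 2)%:E)) ?lee_fin ?sqr_ge0//.
by rewrite EFin_expe sqrte_sqr /= ger0_norm.
Qed.

Lemma sqnorm_lty f : (sqnorm f < +oo) = (L2norm mu f < +oo).
Proof.
rewrite L2normE; have := sqnorm_ge0 f.
case: (sqnorm f) => [r| |]//=; by rewrite ?ltry ?ltxx.
Qed.

Lemma L2norm_ge0 f : 0 <= L2norm mu f.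
Proof. by rewrite L2normE sqrte_ge0. Qed.

Lemma L2norm_triangle f g : cmeasurable f -> cmeasurable g ->
  L2norm mu (fun x => f x + g x)%R <= L2norm mu f + L2norm mu g.
Proof.
move=> mf mg.
have := @eminkowski _ _ _ mu (fun x => nc (f x)) (fun x => nc (g x)) 2%:E
  (measurable_normc mf) (measurable_normc mg) _.
rewrite lee_fin ler1n => /(_ isT); apply: le_trans.
rewrite /L2norm unlock !poweR12_sqrt; try by apply: integral_ge0 => x _; exact: poweR_ge0.
rewrite lee_sqrt; last by apply: integral_ge0 => x _; exact: poweR_ge0.
under eq_integral do rewrite /= ger0_norm ?normc_ge0// powR_mulrn ?normc_ge0//.
under [leRHS]eq_integral do
  rewrite /= ger0_norm ?addr_ge0 ?normc_ge0// powR_mulrn ?addr_ge0 ?normc_ge0//.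
apply: ge0_le_integral => //.
- by move=> x _; rewrite lee_fin sqr_ge0.
- by apply/measurable_EFinP; apply: measurable_normc_sq; exact: cmeasurableD.
- apply/measurable_EFinP; apply: measurable_funX.
  by apply: measurable_funD; exact: measurable_normc.
- move=> x _; rewrite lee_fin ler_pXn2r ?nnegrE ?addr_ge0 ?normc_ge0//.
  exact: normcD_le.
Qed.

Lemma le_sqnorm f g : cmeasurable f -> cmeasurable g ->
  (forall x, nc (f x) <= nc (g x))%R -> sqnorm f <= sqnorm g.
Proof.
move=> mf mg fg; apply: ge0_le_integral => //.
- by move=> x _; rewrite lee_fin sqr_ge0.
- exact/measurable_EFinP/measurable_normc_sq.
- exact/measurable_EFinP/measurable_normc_sq.
- by move=> x _; rewrite lee_fin ler_pXn2r ?nnegrE ?normc_ge0.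
Qed.

Lemma le_L2norm f g : cmeasurable f -> cmeasurable g ->
  (forall x, nc (f x) <= nc (g x))%R -> L2norm mu f <= L2norm mu g.
Proof. by move=> mf mg fg; rewrite !L2normE lee_sqrt ?sqnorm_ge0// le_sqnorm. Qed.

Lemma sqnormZ (c : R[i]) f : cmeasurable f ->
  sqnorm (fun x => c * f x)%R = ((nc c) ^+ 2)%:E * sqnorm f.
Proof.
move=> mf; rewrite -ge0_integralZl//; last 3 first.
- exact/measurable_EFinP/measurable_normc_sq.
- by move=> x _; rewrite lee_fin sqr_ge0.
- by rewrite lee_fin sqr_ge0.
by apply: eq_integral => x _; rewrite Normc.normcM exprMn EFinM.
Qed.

Lemma ae_eq_sqnorm f g : cmeasurable f -> cmeasurable g ->
  {ae mu, forall x, f x = g x} -> sqnorm f = sqnorm g.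
Proof.
move=> mf mg fg; apply: ae_eq_integral => //.
- exact/measurable_EFinP/measurable_normc_sq.
- exact/measurable_EFinP/measurable_normc_sq.
- by apply: filterS fg => x /= -> _.
Qed.

Lemma ae_eq_L2norm f g : cmeasurable f -> cmeasurable g ->
  {ae mu, forall x, f x = g x} -> L2norm mu f = L2norm mu g.
Proof. by move=> mf mg fg; rewrite !L2normE (ae_eq_sqnorm mf mg fg). Qed.

End L2Norm.

(** The Riesz-Fischer theorem for geometrically fast sequences.  The limit is a
    pointwise formula, so that for functions of two variables it can be taken in
    each slice and remains jointly measurable. *)
Section RieszFischer.
Context d (T : measurableType d) (R : realType).
Variable mu : {measure set T -> \bar R}.
Implicit Types (u : nat -> T -> R[i]).

Definition pointwise_limit u (x : T) : R[i] :=
  fine (limn_esup (fun n => (Re (u n x))%:E)) +i*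
  fine (limn_esup (fun n => (Im (u n x))%:E)).

Lemma cmeasurable_pointwise_limit u : (forall n, cmeasurable (u n)) ->
  cmeasurable (pointwise_limit u).
Proof.
move=> mu_; split => /=; apply: measurableT_comp; try exact: fine_measurable;
  apply: measurable_fun_limn_esup => n; apply/measurable_EFinP; by case: (mu_ n).
Qed.

Lemma fast_cvgn (r : nat -> R) (K q : R) : 0 <= q < 1 ->
  (forall n, `|r n.+1 - r n| <= K * q ^+ n) -> cvgn r.
Proof.
move=> /andP[q0 q1] h.
have q10 : 0 < 1 - q by rewrite subr_gt0.
pose K' := K / (1 - q).
have KE : K' * (1 - q) = K by rewrite /K' divfK// gt_eqF.
have K0 : 0 <= K.
  by have := le_trans (normr_ge0 _) (h 0%N); rewrite expr0 mulr1.
have K'0 : 0 <= K' by rewrite divr_ge0// ltW.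
have h1 n : r n.+1 + K' * q ^+ n.+1 <= r n + K' * q ^+ n.
  have := le_trans (ler_norm _) (h n); rewrite -KE exprS.
  have -> : K' * (q * q ^+ n) = K' * q * q ^+ n by rewrite mulrA.
  by set a := q ^+ n; lra.
have h2 n : r 0%N - K' <= r n - K' * q ^+ n.
  elim: n => [|n ih]; first by rewrite expr0 mulr1.
  apply: le_trans ih _; have := h n; rewrite ler_norml -KE exprS => /andP[+ _].
  have -> : K' * (q * q ^+ n) = K' * q * q ^+ n by rewrite mulrA.
  by set a := q ^+ n; lra.
have c1 : cvgn (fun n => r n + K' * q ^+ n).
  apply: nonincreasing_is_cvgn; first by apply/nonincreasing_seqP.
  exists (r 0%N - K') => _ [n _ <-]; apply: le_trans (h2 n) _.
  have : 0 <= K' * q ^+ n by rewrite mulr_ge0// exprn_ge0.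
  lra.
have c2 : cvgn (fun n => K' * q ^+ n).
  apply: is_cvgMr; apply/cvg_ex; exists 0; apply: cvg_expr.
  by rewrite ger0_norm.
rewrite (_ : r = (fun n => (r n + K' * q ^+ n) - K' * q ^+ n)).
  exact: is_cvgB.
by apply/funext => n; rewrite addrK.
Qed.

Lemma cvg_pointwise_limit u x : cvgn (fun n => Re (u n x)) ->
  cvgn (fun n => Im (u n x)) ->
  (fun n => Re (u n x)) @ \oo --> Re (pointwise_limit u x) /\
  (fun n => Im (u n x)) @ \oo --> Im (pointwise_limit u x).
Proof.
have H (r : nat -> R) : cvgn r -> r @ \oo --> fine (limn_esup (EFin \o r)).
  move=> /cvg_ex[l rl].
  have rE : (EFin \o r) @ \oo --> l%:E by apply: cvg_EFin => //; exact: nearW.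
  by rewrite is_cvg_limn_esupE ?(cvg_lim _ rE)//; apply: cvgP rE.
by move=> /H h1 /H h2.
Qed.

Lemma fast_ae_cvg u (C : R) : (forall n, cmeasurable (u n)) ->
  (forall n, sqnorm mu (fun x => u n.+1 x - u n x)%R <= ((C * 2^-1 ^+ n) ^+ 2)%:E)%E ->
  {ae mu, forall x, cvgn (fun n => Re (u n x)) /\ cvgn (fun n => Im (u n x))}.
Proof.
move=> mu_ hu.
pose g n x := ((2 ^+ n * nc (u n.+1 x - u n x) ^+ 2)%:E : \bar R).
have mg n : measurable_fun setT (g n).
  apply/measurable_EFinP; apply: measurable_funM; first exact: measurable_cst.
  by apply: measurable_normc_sq; exact: cmeasurableB.
have g0 n x : (0 <= g n x)%E by rewrite lee_fin mulr_ge0 ?exprn_ge0 ?normc_ge0.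
have sumfin : (\int[mu]_x (\sum_(0 <= n <oo) g n x) < +oo)%E.
  rewrite integral_nneseries//.
  apply: (@le_lt_trans _ _ ((C ^+ 2 * 2)%:E)); last exact: ltry.
  apply: lime_le; first by apply: is_cvg_nneseries => n _ _; exact: integral_ge0.
  apply: nearW => k.
  have : (\sum_(0 <= n < k) \int[mu]_x g n x <= (C ^+ 2 * (2 - 2 * 2^-1 ^+ k))%:E)%E.
    elim: k => [|k ih]; first by rewrite big_geq// expr0 mulr1 subrr mulr0.
    rewrite big_nat_recr//=; apply: le_trans (leeD ih (_ : _ <= (C ^+ 2 * 2^-1 ^+ k)%:E)%E) _.
      rewrite /g; under eq_integral do rewrite EFinM.
      rewrite ge0_integralZl//; last 2 first.
      - by apply/measurable_EFinP/measurable_normc_sq; exact: cmeasurableB.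
      - by move=> x _; rewrite lee_fin sqr_ge0.
      apply: le_trans (lee_wpmul2l _ (hu k)) _; first by rewrite lee_fin exprn_ge0.
      rewrite -EFinM lee_fin exprMn -exprM mulrCA ler_wpM2l ?sqr_ge0//.
      by rewrite exprM expr2 mulrA -exprMn mulfV ?expr1n ?mul1r.
    rewrite -EFinD lee_fin (exprS _ k) -mulrDr ler_wpM2l ?sqr_ge0//.
    by set a := 2^-1 ^+ k; lra.
  move=> /le_trans; apply; rewrite lee_fin ler_wpM2l ?sqr_ge0//.
  have : 0 <= (2^-1 : R) ^+ k by rewrite exprn_ge0.
  lra.
have mS : measurable_fun setT (fun x => \sum_(0 <= n <oo) g n x)%E.
  exact: ge0_emeasurable_sum.
have iS : mu.-integrable setT (fun x => \sum_(0 <= n <oo) g n x)%E.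
  apply/integrableP; split => //.
  by under eq_integral do rewrite gee0_abs ?nneseries_ge0//.
apply: filterS (integrable_ae measurableT iS) => x /(_ I) fx.
pose K := fine (\sum_(0 <= n <oo) g n x)%E.
have gK n : 2 ^+ n * nc (u n.+1 x - u n x) ^+ 2 <= K.
  rewrite -lee_fin fineK//.
  have := @nneseries_lim_ge R (g ^~ x) xpredT 0 n.+1 (fun n _ _ => g0 n x).
  apply: le_trans; rewrite big_nat_recr//= leeDr//.
  by apply: sume_ge0 => k _.
have K0 : 0 <= K by apply: le_trans (gK 0%N); rewrite mulr_ge0// sqr_ge0.
pose q : R := Num.sqrt 2^-1.
have q01 : 0 <= q < 1.
  by rewrite sqrtr_ge0 -[ltRHS]sqrtr1 ltr_sqrt//; lra.
have uK n : nc (u n.+1 x - u n x) <= Num.sqrt K * q ^+ n.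
  rewrite -(@ler_pXn2r _ 2)// ?nnegrE ?normc_ge0 ?mulr_ge0 ?exprn_ge0 ?sqrtr_ge0//.
  rewrite exprMn sqr_sqrtr// -exprM mulnC exprM sqr_sqrtr ?invr_ge0//.
  rewrite exprVn ler_pdivlMr ?exprn_gt0// mulrC; exact: gK.
split; apply: (fast_cvgn q01) => n; apply: le_trans (uK n).
- by apply: le_trans (normRe_le _); rewrite ReD ReN.
- by apply: le_trans (normIm_le _); rewrite ImD ImN.
Qed.

Lemma fast_L2_limit u (C : R) : 0 <= C -> (forall n, cmeasurable (u n)) ->
  (forall n, L2norm mu (fun x => u n.+1 x - u n x)%R <= (C * 2^-1 ^+ n)%:E)%E ->
  forall n, (L2norm mu (fun x => u n x - pointwise_limit u x)%R
    <= (C * 2 * 2^-1 ^+ n)%:E)%E.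
Proof.
move=> C0 mu_ hu n.
have q0 k : 0 <= (2^-1 : R) ^+ k by rewrite exprn_ge0.
have hd k : (L2norm mu (fun x => u n x - u (n + k)%N x)%R
    <= (C * 2 * (2^-1 ^+ n - 2^-1 ^+ (n + k)))%:E)%E.
  elim: k => [|k ih].
    rewrite addn0 subrr mulr0 L2norm_le// expr0n /=.
    rewrite /sqnorm; under eq_integral do rewrite subrr Normc.normc0 expr0n /=.
    by rewrite integral0.
  have -> : (fun x => u n x - u (n + k.+1)%N x) =
      (fun x => (u n x - u (n + k)%N x) + - (u (n + k).+1 x - u (n + k)%N x)).
    by apply/funext => x; rewrite addnS opprB addrA subrK.
  apply: le_trans (L2norm_triangle _ _ _) _.
  - exact: cmeasurableB.
  - by apply: cmeasurableN; exact: cmeasurableB.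
  apply: le_trans (leeD ih (_ : _ <= (C * 2^-1 ^+ (n + k))%:E)%E) _.
    apply: le_trans (hu _); apply: le_L2norm.
    - by apply: cmeasurableN; exact: cmeasurableB.
    - exact: cmeasurableB.
    - by move=> x; rewrite normc_opp.
  rewrite -EFinD lee_fin addnS exprS.
  by set a := 2^-1 ^+ (n + k); set b := 2^-1 ^+ n; lra.
have mP := cmeasurable_pointwise_limit mu_.
have hae := @fast_ae_cvg u C mu_.
have {}hae : {ae mu, forall x, cvgn (fun n => Re (u n x)) /\ cvgn (fun n => Im (u n x))}.
  by apply: hae => k; rewrite -L2norm_le// mulr_ge0.
rewrite L2norm_le ?mulr_ge0//.
pose h k x := ((nc (u n x - u k x) ^+ 2)%:E : \bar R).
have mh k : measurable_fun setT (h k).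
  by apply/measurable_EFinP/measurable_normc_sq; exact: cmeasurableB.
have -> : sqnorm mu (fun x => u n x - pointwise_limit u x) =
    (\int[mu]_x limn_einf (h ^~ x))%E.
  apply: ae_eq_integral => //.
  - by apply/measurable_EFinP/measurable_normc_sq; exact: cmeasurableB.
  - rewrite (_ : (fun x => _) = (fun x => - limn_esup (fun k => - h k x)))%E.
      apply: measurableT_comp => //; apply: measurable_fun_limn_esup => k.
      exact: measurableT_comp.
    apply/funext => x; rewrite -limn_einfN; congr limn_einf.
    by apply/funext => k; rewrite /comp oppeK.
  apply: filterS hae => x [cR cI] _.
  have [lR lI] := cvg_pointwise_limit cR cI.
  have hx : (h ^~ x) @ \oo --> (nc (u n x - pointwise_limit u x) ^+ 2)%:E.
    apply: cvg_EFin; first exact: nearW.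
    rewrite /h /comp/= normc_sq !ReImE.
    under eq_fun do rewrite normc_sq !ReImE.
    apply: cvgD; rewrite !expr2.
      by apply: cvgM; (apply: cvgB; [exact: cvg_cst|exact: lR]).
    by apply: cvgM; (apply: cvgB; [exact: cvg_cst|exact: lI]).
  by rewrite is_cvg_limn_einfE ?(cvg_lim _ hx)//; apply: cvgP hx.
apply: le_trans (fatou mu measurableT mh _) _.
  by move=> k x _; rewrite lee_fin sqr_ge0.
rewrite limn_einf_lim; apply: lime_le; first exact: is_cvg_einfs.
apply: nearW => m; rewrite /einfs/=.
apply: (@le_trans _ _ (\int[mu]_x h (n + m)%N x)%E).
  by apply: ereal_inf_lbound; exists (n + m)%N => //=; exact: leq_addl.
rewrite -[X in (X <= _)%E]/(sqnorm mu (fun x => u n x - u (n + m)%N x)).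
rewrite -L2norm_le ?mulr_ge0//; apply: le_trans (hd m) _.
by rewrite lee_fin ler_wpM2l ?mulr_ge0//; have := q0 (n + m)%N; lra.
Qed.

End RieszFischer.

(** * The space L2 as a semi-Hilbert space *)

Section L2Closure.
Context d (T : measurableType d) (R : realType).
Variable mu : {measure set T -> \bar R}.
Implicit Types (f g : T -> R[i]).

Lemma L2_sqnorm f : L2 mu f <-> cmeasurable f /\ (sqnorm mu f < +oo)%E.
Proof. by rewrite /L2 /= sqnorm_lty. Qed.

Lemma L2_cmeasurable f : L2 mu f -> cmeasurable f.
Proof. by case. Qed.

Lemma integrable_normc_sq f : L2 mu f ->
  mu.-integrable setT (fun x => (nc (f x) ^+ 2)%:E).
Proof.
move=> /L2_sqnorm[mf fi]; apply/integrableP; split.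
  exact/measurable_EFinP/measurable_normc_sq.
by under eq_integral do rewrite /= ger0_norm ?sqr_ge0//.
Qed.

Lemma sqnorm_cst0 : sqnorm mu (fun=> 0) = 0%E.
Proof.
by rewrite /sqnorm; under eq_integral do rewrite Normc.normc0 expr0n /=;
  rewrite integral0.
Qed.

Lemma L2_cst0 : L2 mu (fun=> 0).
Proof.
by apply/L2_sqnorm; split; [exact: cmeasurable_cst|rewrite sqnorm_cst0].
Qed.

Lemma L2_add f g : L2 mu f -> L2 mu g -> L2 mu (fun x => f x + g x).
Proof.
move=> [mf fi] [mg gi]; split; first exact: cmeasurableD.
by apply: le_lt_trans (L2norm_triangle mu mf mg) _; exact: lte_add_pinfty.
Qed.

Lemma L2_mul_bounded f g (c : R) : L2 mu f -> cmeasurable g ->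
  (forall x, nc (g x) <= c) -> L2 mu (fun x => g x * f x).
Proof.
move=> [mf fi] mg gc; have mgf := cmeasurableM mg mf; split => //.
have mcf := cmeasurableM (cmeasurable_cst T c%:C) mf.
apply: le_lt_trans (le_L2norm _ mgf mcf _) _.
  move=> x; rewrite !Normc.normcM normc_real ler_wpM2r ?normc_ge0//.
  exact: le_trans (gc x) (ler_norm _).
rewrite -sqnorm_lty sqnormZ//; apply: lte_mul_pinfty => //.
- by rewrite lee_fin sqr_ge0.
- by rewrite sqnorm_lty.
Qed.

Lemma L2_scale f (c : R[i]) : L2 mu f -> L2 mu (fun x => c * f x).
Proof.
by move=> fi; apply: (@L2_mul_bounded _ _ (nc c)) => //; exact: cmeasurable_cst.
Qed.

Lemma L2_opp f : L2 mu f -> L2 mu (fun x => - f x).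
Proof. by move=> /(L2_scale (-1)); under eq_fun do rewrite mulN1r. Qed.

Lemma L2_sub f g : L2 mu f -> L2 mu g -> L2 mu (fun x => f x - g x).
Proof. by move=> fi gi; apply: L2_add => //; exact: L2_opp. Qed.

Lemma cintegrable_inner f g : L2 mu f -> L2 mu g ->
  cintegrable mu setT (fun x => f x * conjc (g x)).
Proof.
move=> fi gi.
apply: (@cintegrable_dominated _ _ _ _ _ (fun x => nc (f x) ^+ 2 + nc (g x) ^+ 2)).
- apply: cmeasurableM; [exact: L2_cmeasurable fi|].
  by apply: cmeasurableJ; exact: L2_cmeasurable gi.
- exact: (integrableD measurableT (integrable_normc_sq fi) (integrable_normc_sq gi)).
- move=> x; rewrite Normc.normcM normc_conj.
  have := sqr_ge0 (nc (f x) - nc (g x)); have := sqr_ge0 (nc (f x)).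
  have := sqr_ge0 (nc (g x)); rewrite sqrrB; lra.
Qed.

Lemma inner_addl f g h : L2 mu f -> L2 mu g -> L2 mu h ->
  inner mu (fun x => f x + g x) h = inner mu f h + inner mu g h.
Proof.
move=> fi gi hi; rewrite /inner -cintegralD; try exact: cintegrable_inner.
by apply: eq_cintegral => x _; rewrite mulrDl.
Qed.

Lemma inner_scalel f h (c : R[i]) : L2 mu f -> L2 mu h ->
  inner mu (fun x => c * f x) h = c * inner mu f h.
Proof.
move=> fi hi; rewrite /inner -cintegralZ; last exact: cintegrable_inner.
by apply: eq_cintegral => x _; rewrite mulrA.
Qed.

Lemma inner_conj f g : L2 mu f -> L2 mu g -> inner mu g f = conjc (inner mu f g).
Proof.
move=> fi gi; rewrite /inner -cintegralJ; last exact: cintegrable_inner.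
by apply: eq_cintegral => x _; rewrite conjM conjcK mulrC.
Qed.

Lemma ae_eq_innerr f g h : cmeasurable f -> cmeasurable g -> cmeasurable h ->
  {ae mu, forall x, f x = g x} -> inner mu h f = inner mu h g.
Proof.
move=> mf mg mh fg; apply: ae_eq_cintegral.
- by apply: cmeasurableM => //; exact: cmeasurableJ.
- by apply: cmeasurableM => //; exact: cmeasurableJ.
- by apply: filterS fg => x ->.
Qed.

Lemma L2norm_eq0_ae f : L2 mu f -> (L2norm mu f <= 0)%E ->
  {ae mu, forall x, f x = 0}.
Proof.
move=> fi; have mf := L2_cmeasurable fi.
rewrite (L2norm_le _ _ (lexx 0)) expr0n /= => f0.
have f00 : sqnorm mu f = 0%E by apply/eqP; rewrite eq_le f0 sqnorm_ge0.
have /ae_eq_integral_abs : measurable_fun setT (fun x => (nc (f x) ^+ 2)%:E : \bar R).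
  exact/measurable_EFinP/measurable_normc_sq.
move=> /(_ mu measurableT)[+ _].
under eq_integral do rewrite /= ger0_norm ?sqr_ge0//.
move=> /(_ f00); apply: filterS => x /(_ I) /= [] /eqP.
by rewrite sqrf_eq0 => /eqP/Normc.eq0_normc.
Qed.

End L2Closure.

Section Ltwo.
Context d (T : measurableType d) (R : realType).
Variable mu : {measure set T -> \bar R}.

Definition L2_pred : {pred T -> R[i]} := mem (L2 mu).

Record Ltwo := MkLtwo { ltwo_fun :> T -> R[i]; _ : ltwo_fun \in L2_pred }.

HB.instance Definition _ := [isSub for ltwo_fun].
HB.instance Definition _ := [Choice of Ltwo by <:].

Lemma L2_submod_closed : submod_closed L2_pred.
Proof.
split; first by rewrite inE; exact: L2_cst0.
by move=> a f g; rewrite !inE => fi gi; apply: L2_add => //; exact: L2_scale.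
Qed.

HB.instance Definition _ := GRing.isSubmodClosed.Build _ _ L2_pred
  L2_submod_closed.
HB.instance Definition _ := [SubChoice_isSubLmodule of Ltwo by <:].

Lemma ltwoP (f : Ltwo) : L2 mu f.
Proof. by have := valP f; rewrite inE. Qed.

Definition toL2 (f : T -> R[i]) : Ltwo := insubd 0 f.

Lemma toL2E (f : T -> R[i]) : L2 mu f -> toL2 f = f :> (T -> R[i]).
Proof.
by move=> fi; have := @insubdK _ _ Ltwo 0 f; apply; rewrite inE.
Qed.

Lemma ltwoD (f g : Ltwo) : (f + g : Ltwo) = (fun x => f x + g x) :> (T -> R[i]).
Proof. by []. Qed.

Lemma ltwoB (f g : Ltwo) : (f - g : Ltwo) = (fun x => f x - g x) :> (T -> R[i]).
Proof. by []. Qed.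

Lemma ltwoZ c (f : Ltwo) : (c *: f : Ltwo) = (fun x => c * f x) :> (T -> R[i]).
Proof. by []. Qed.

Lemma ltwo0 : (0 : Ltwo) = (fun=> 0) :> (T -> R[i]).
Proof. by []. Qed.

Definition rip (f g : Ltwo) : R := Re (inner mu f g).

Lemma sqnorm_rip (f : Ltwo) : sqnorm mu f = (rip f f)%:E.
Proof.
have fi := integrable_normc_sq (ltwoP f).
rewrite /rip ReIntegral /Rintegral (_ : \int[mu]_(x in _) _ = sqnorm mu f)%E.
  by rewrite fineK//; apply: integrable_fin_num fi.
by apply: eq_integral => x _; rewrite mulJ_normc.
Qed.

Lemma rip_semi_hilbert : semi_hilbert rip.
Proof.
split.
- by move=> f g; rewrite /rip (inner_conj (ltwoP g) (ltwoP f)) ReJ.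
- by move=> f g h; rewrite /rip inner_addl ?ReD//; exact: ltwoP.
- move=> r f h; rewrite /rip inner_scalel ?ReM; try exact: ltwoP.
  by rewrite /= mul0r subr0.
- by move=> f; rewrite -lee_fin -sqnorm_rip sqnorm_ge0.
- move=> u C hu.
  have C0 : 0 <= C.
    by have := le_trans (sqrtr_ge0 _) (hu 0%N); rewrite expr0 mulr1.
  have NE (f : Ltwo) : L2norm mu f = (Num.sqrt (rip f f))%:E.
    by rewrite L2normE sqnorm_rip.
  have hn n : (L2norm mu (fun x => u n.+1 x - u n x)%R <= (C * 2^-1 ^+ n)%:E)%E.
    by have := NE (u n.+1 - u n); rewrite ltwoB => ->; rewrite lee_fin.
  have mu_ n : cmeasurable (u n) by exact: L2_cmeasurable (ltwoP _).
  have hl := fast_L2_limit C0 mu_ hn.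
  pose l := pointwise_limit (fun n => u n : T -> R[i]).
  have li : L2 mu l.
    have ml : cmeasurable l by exact: cmeasurable_pointwise_limit.
    have dl : L2 mu (fun x => u 0%N x - l x).
      split; first exact: cmeasurableB.
      by apply: le_lt_trans (hl 0%N) _; exact: ltry.
    have -> : l = (fun x => u 0%N x - (u 0%N x - l x)).
      by apply/funext => x; rewrite subKr.
    by apply: L2_sub => //; exact: ltwoP.
  exists (toL2 l) => n; rewrite -lee_fin -NE ltwoB toL2E//; exact: hl.
Qed.

Local Notation nrm := (ipnorm rip).

Lemma L2norm_rip (f : Ltwo) : L2norm mu f = (nrm f)%:E.
Proof. by rewrite L2normE sqnorm_rip. Qed.

Lemma nrm_le (f : Ltwo) (c : R) : (nrm f <= c) = (L2norm mu f <= c%:E)%E.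
Proof. by rewrite L2norm_rip lee_fin. Qed.

Lemma ltwo_ae_eq (f g : Ltwo) : nrm (f - g) = 0 -> {ae mu, forall x, f x = g x}.
Proof.
move=> h; have := @L2norm_eq0_ae _ _ _ mu (f - g : Ltwo) (ltwoP _).
rewrite L2norm_rip h lexx => /(_ isT); apply: filterS => x.
by rewrite ltwoB => /eqP; rewrite subr_eq0 => /eqP.
Qed.

Lemma ltwo_eq_ae (f g : Ltwo) : {ae mu, forall x, f x = g x} -> nrm (f - g) = 0.
Proof.
move=> fg; apply/eqP; rewrite eq_le ipnorm_ge0 andbT nrm_le.
rewrite (@ae_eq_L2norm _ _ _ mu _ (fun=> 0)).
- by rewrite (L2norm_le _ _ (lexx 0)) sqnorm_cst0 lee_fin sqr_ge0.
- exact: L2_cmeasurable (ltwoP _).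
- exact: cmeasurable_cst.
- by apply: filterS fg => x; rewrite ltwoB => ->; rewrite subrr.
Qed.

Lemma innerDl (f g h : Ltwo) : inner mu (f + g : Ltwo) h = inner mu f h + inner mu g h.
Proof. by apply: inner_addl; exact: ltwoP. Qed.

Lemma innerZl c (f h : Ltwo) : inner mu (c *: f : Ltwo) h = c * inner mu f h.
Proof. by apply: inner_scalel; exact: ltwoP. Qed.

Lemma innerC (f g : Ltwo) : inner mu g f = conjc (inner mu f g).
Proof. by apply: inner_conj; exact: ltwoP. Qed.

Lemma innerNl (f h : Ltwo) : inner mu (- f : Ltwo) h = - inner mu f h.
Proof. by rewrite -scaleN1r innerZl mulN1r. Qed.

Lemma innerBl (f g h : Ltwo) : inner mu (f - g : Ltwo) h = inner mu f h - inner mu g h.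
Proof. by rewrite innerDl innerNl. Qed.

Lemma innerDr (f g h : Ltwo) : inner mu h (f + g : Ltwo) = inner mu h f + inner mu h g.
Proof. by rewrite (innerC _ h) innerDl conjD -!innerC. Qed.

Lemma innerBr (f g h : Ltwo) : inner mu h (f - g : Ltwo) = inner mu h f - inner mu h g.
Proof. by rewrite (innerC _ h) innerBl conjB -!innerC. Qed.

Lemma innerZr c (f h : Ltwo) : inner mu h (c *: f : Ltwo) = conjc c * inner mu h f.
Proof. by rewrite (innerC _ h) innerZl conjM -innerC. Qed.

Lemma inner_self (f : Ltwo) : inner mu f f = (nrm f ^+ 2)%:C.
Proof.
apply: complex_eqP; first by rewrite (ipnorm_sq rip_semi_hilbert).
have := innerC f f; case: (inner mu f f) => a b [] /eqP.
by rewrite -subr_eq0 opprK -mulr2n mulrn_eq0 => /eqP.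
Qed.

Lemma nrm_scale c (f : Ltwo) : nrm (c *: f) = nc c * nrm f.
Proof.
apply/eqP; rewrite -(@eqrXn2 _ 2)// ?mulr_ge0 ?ipnorm_ge0 ?normc_ge0//.
rewrite (ipnorm_sq rip_semi_hilbert) exprMn /rip innerZl innerZr inner_self.
by rewrite mulrA mulJ_normc /= mul0r subr0.
Qed.

Lemma inner_cauchy_schwarz (f g : Ltwo) : nc (inner mu f g) <= nrm f * nrm g.
Proof.
have [c [c1 cE]] := ex_phase (inner mu f g).
have -> : nc (inner mu f g) = rip (c *: f) g by rewrite /rip innerZl cE.
apply: le_trans (ip_le_norm rip_semi_hilbert _ _) _.
by rewrite nrm_scale c1 mul1r.
Qed.

Definition bounded_symbol (m : T -> R[i]) : Prop :=
  cmeasurable m /\ exists c : R, forall x, nc (m x) <= c.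

Definition ltwo_mul (m : T -> R[i]) (f : Ltwo) : Ltwo := toL2 (fun x => m x * f x).

Lemma ltwo_mulE m f : bounded_symbol m ->
  ltwo_mul m f = (fun x => m x * f x) :> (T -> R[i]).
Proof.
by move=> [mm [c mc]]; apply: toL2E; apply: (L2_mul_bounded _ mm mc); exact: ltwoP.
Qed.

Lemma inner_mull m f g : bounded_symbol m ->
  inner mu (ltwo_mul m f) g = cintegral mu setT (fun x => m x * f x * conjc (g x)).
Proof. by move=> bm; rewrite /inner ltwo_mulE. Qed.

Lemma bounded_symbolJ m : bounded_symbol m -> bounded_symbol (fun x => conjc (m x)).
Proof.
by move=> [mm [c mc]]; split; [exact: cmeasurableJ|exists c => x; rewrite normc_conj].
Qed.

Lemma inner_mul_adj m (f g : Ltwo) : bounded_symbol m ->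
  inner mu (ltwo_mul m f) g = inner mu f (ltwo_mul (fun x => conjc (m x)) g).
Proof.
move=> bm; rewrite /inner (ltwo_mulE _ bm) (ltwo_mulE _ (bounded_symbolJ bm)).
by apply: eq_cintegral => x _; rewrite conjM conjcK mulrCA mulrA.
Qed.

Lemma ltwo_mulB m (f g : Ltwo) : bounded_symbol m ->
  ltwo_mul m (f - g) = ltwo_mul m f - ltwo_mul m g.
Proof.
move=> bm; apply: val_inj => /=; rewrite ltwo_mulE// ltwoB !ltwo_mulE//.
by apply/funext => x; rewrite mulrBr.
Qed.

Lemma nrm_mul_le m c (f : Ltwo) : bounded_symbol m -> (forall x, nc (m x) <= c) ->
  nrm (ltwo_mul m f) <= c * nrm f.
Proof.
move=> bm mc.
have c0 : 0 <= c := le_trans (normc_ge0 _) (mc point).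
have -> : c * nrm f = nrm (c%:C *: f) by rewrite nrm_scale normc_real ger0_norm.
rewrite -lee_fin -!L2norm_rip; apply: le_L2norm.
- exact: L2_cmeasurable (ltwoP _).
- exact: L2_cmeasurable (ltwoP _).
- move=> x; rewrite ltwo_mulE// ltwoZ !Normc.normcM normc_real ger0_norm//.
  by rewrite ler_wpM2r ?normc_ge0.
Qed.

Lemma nrm_mul_unit m (f : Ltwo) : bounded_symbol m -> (forall x, nc (m x) = 1) ->
  nrm (ltwo_mul m f) = nrm f.
Proof.
move=> bm m1; have : (nrm (ltwo_mul m f))%:E = (nrm f)%:E.
  rewrite -!L2norm_rip !L2normE /sqnorm; congr sqrte; apply: eq_integral => x _.
  by rewrite ltwo_mulE// Normc.normcM m1 mul1r.
by case.
Qed.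

End Ltwo.

Arguments rip {d T R} mu.
Arguments toL2 {d T R} mu.

(* Keeps unification from comparing unrelated elements of [Ltwo] by unfolding. *)
Global Opaque toL2 ltwo_mul.

(** * Oscillatory transforms between two L2 spaces *)

Lemma integralZ_ge0 d (T : measurableType d) (R : realType)
    (mu : {measure set T -> \bar R}) (k : R) (h : T -> R) :
  0 <= k -> (forall x, 0 <= h x) -> measurable_fun setT h ->
  (\int[mu]_x (k * h x)%:E = k%:E * \int[mu]_x (h x)%:E)%E.
Proof.
move=> k0 h0 mh; under eq_integral do rewrite EFinM.
by apply: ge0_integralZl => //; [exact/measurable_EFinP|move=> x _; rewrite lee_fin].
Qed.

Section Transform.
Context d1 d2 (X : measurableType d1) (Y : measurableType d2) (R : realType).
Variables (mu : {sigma_finite_measure set X -> \bar R}).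
Variables (nu : {sigma_finite_measure set Y -> \bar R}).
Variable phase : X -> Y -> R.
Hypothesis mphase : measurable_fun setT (fun z : X * Y => phase z.1 z.2).
Implicit Types (f g : X -> R[i]).

Definition ft f (y : Y) : R[i] :=
  cintegral mu setT (fun x => f x * expi (- phase x y)).

Lemma measurable_phase1 y : measurable_fun setT (phase ^~ y).
Proof. exact: (measurableT_comp mphase (pair2_measurable y)). Qed.

Lemma measurable_phase2 x : measurable_fun setT (phase x).
Proof. exact: (measurableT_comp mphase (pair1_measurable x)). Qed.

Lemma cintegrable_expi (h : X -> R) f : measurable_fun setT h ->
  cintegrable mu setT f -> cintegrable mu setT (fun x => f x * expi (h x)).
Proof.
move=> mh fi; under eq_fun do rewrite mulrC.
apply: (@cintegrableMb _ _ _ _ _ _ 1) => //; first exact: cmeasurable_expi.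
by move=> x; rewrite normc_expi.
Qed.

Lemma ft_cmeasurable f : cmeasurable f -> cmeasurable (ft f).
Proof.
move=> mf; apply: (@cmeasurable_partial_cintegral _ _ _ _ _ mu
  (fun z : Y * X => f z.2 * expi (- phase z.2 z.1))).
apply: cmeasurableM; first exact: (cmeasurable_comp mf measurable_snd).
apply: cmeasurable_expi; apply: measurableT_comp => //.
apply: (measurableT_comp (f := fun z : X * Y => phase z.1 z.2)
  (g := fun z : Y * X => (z.2, z.1))) => //.
by apply/measurable_fun_pairP; split; [exact: measurable_snd|exact: measurable_fst].
Qed.

Lemma ftB f g : cintegrable mu setT f -> cintegrable mu setT g ->
  ft (fun x => f x - g x) = (fun y => ft f y - ft g y).
Proof.
move=> fi gi; apply/funext => y; rewrite /ft -cintegralB.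
- by apply: eq_cintegral => x _; rewrite mulrBl.
- by apply: cintegrable_expi => //; apply: measurableT_comp => //; exact: measurable_phase1.
- by apply: cintegrable_expi => //; apply: measurableT_comp => //; exact: measurable_phase1.
Qed.

Lemma ft_bounded f y : cintegrable mu setT f -> nc (ft f y) <= \int[mu]_x nc (f x).
Proof.
move=> fi; apply: le_trans (le_normc_cintegral _) _.
  by apply: cintegrable_expi => //; apply: measurableT_comp => //; exact: measurable_phase1.
rewrite le_eqVlt; apply/orP; left; apply/eqP; apply: eq_Rintegral => x _.
by rewrite Normc.normcM normc_expi mulr1.
Qed.

(** Fubini; the kernel is bounded, so integrability of [a] and [b] is enough. *)
Lemma ft_duality (a : X -> R[i]) (b : Y -> R[i]) :
  cintegrable mu setT a -> cintegrable nu setT b ->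
  cintegral nu setT (fun y => b y * ft a y) =
  cintegral mu setT (fun x => a x * cintegral nu setT (fun y => b y * expi (- phase x y))).
Proof.
move=> ai bi.
have ma := cintegrable_cmeasurable ai; have mb := cintegrable_cmeasurable bi.
pose k (z : X * Y) := a z.1 * b z.2 * expi (- phase z.1 z.2).
have mk : cmeasurable k.
  apply: cmeasurableM; last by apply: cmeasurable_expi; exact: measurableT_comp.
  apply: cmeasurableM; first exact: (cmeasurable_comp ma measurable_fst).
  exact: (cmeasurable_comp mb measurable_snd).
have ki : cintegrable (mu \x nu)%E setT k.
  apply: cintegrable_prod => //.
  under eq_integral => x _.
    under eq_integral do
      rewrite /k /= !Normc.normcM normc_expi mulr1 EFinM.
    rewrite ge0_integralZl//=; last 3 first.
    - exact/measurable_EFinP/measurable_normc.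
    - by move=> y _; rewrite lee_fin normc_ge0.
    - by rewrite lee_fin normc_ge0.
    over.
  rewrite ge0_integralZr//=; last 3 first.
  - exact/measurable_EFinP/measurable_normc.
  - by move=> y _; rewrite lee_fin normc_ge0.
  - by apply: integral_ge0 => y _; rewrite lee_fin normc_ge0.
  have /integrable_fin_num ia := cintegrable_normc ai.
  have /integrable_fin_num ib := cintegrable_normc bi.
  have [] := (ia measurableT, ib measurableT).
  by move=> {}ia {}ib; rewrite -(fineK ia) -(fineK ib) -EFinM ltry.
have := cFubini ki; rewrite /k /= => E.
transitivity (cintegral nu setT (fun y => cintegral mu setT
    (fun x => a x * b y * expi (- phase x y)))).
  apply: eq_cintegral => y _; rewrite /ft -cintegralZ.
    by apply: eq_cintegral => x _; rewrite mulrCA mulrA.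
  by apply: cintegrable_expi => //; apply: measurableT_comp => //; exact: measurable_phase1.
rewrite -E; apply: eq_cintegral => x _; rewrite -cintegralZ.
  by apply: eq_cintegral => y _; rewrite mulrA.
under eq_fun do rewrite mulrC.
apply: (@cintegrableMb _ _ _ _ _ _ 1) => //.
  by apply: cmeasurable_expi; apply: measurableT_comp => //; exact: measurable_phase2.
by move=> y; rewrite normc_expi.
Qed.

Definition bessel (C : R) : Prop := forall f, L2 mu f -> cintegrable mu setT f ->
  (sqnorm nu (ft f) <= C%:E * sqnorm mu f)%E.

Lemma bessel_L2 C f : bessel C -> L2 mu f -> cintegrable mu setT f -> L2 nu (ft f).
Proof.
move=> bC fL fi; apply/L2_sqnorm; split; first by apply: ft_cmeasurable; case: fL.
apply: le_lt_trans (bC _ fL fi) _.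
have /L2_sqnorm[_] := fL; have := sqnorm_ge0 mu f.
by case: (sqnorm mu f) => [r _ _| _ |]//; rewrite -EFinM ltry.
Qed.

(** Summability kernel: the weighted energy of [ft f] is a quadratic form in [f]
    with kernel [P], which Schur's test bounds. *)
Section Kernel.
Variable chi : Y -> R.
Hypothesis chi_int : nu.-integrable setT (EFin \o chi).

Definition summability_kernel (x x' : X) : R[i] :=
  cintegral nu setT (fun y => (chi y)%:C * expi (phase x' y - phase x y)).
Local Notation P := summability_kernel.

Let cchi : cintegrable nu setT (fun y => (chi y)%:C).
Proof. by split => //=; exact: integrable0. Qed.

Let mchi : measurable_fun setT chi.
Proof. exact/measurable_EFinP/(measurable_int _ chi_int). Qed.

Lemma kernelC x x' : P x' x = conjc (P x x').
Proof.
rewrite /P -cintegralJ.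
  apply: eq_cintegral => y _; rewrite conjM conjc_expi opprB; congr (_ * _).
  by apply: complex_eqP; rewrite ?ReJ ?ImJ //= oppr0.
under eq_fun do rewrite mulrC.
apply: (@cintegrableMb _ _ _ _ _ _ 1) => //.
  by apply: cmeasurable_expi; apply: measurable_funB; exact: measurable_phase2.
by move=> y; rewrite normc_expi.
Qed.

Lemma kernel_cmeasurable : cmeasurable (fun z : X * X => P z.1 z.2).
Proof.
apply: (@cmeasurable_partial_cintegral _ _ _ _ _ nu
  (fun w : (X * X) * Y => (chi w.2)%:C * expi (phase w.1.2 w.2 - phase w.1.1 w.2))).
apply: cmeasurableM.
  by apply: cmeasurable_real; exact: (measurableT_comp mchi measurable_snd).
apply: cmeasurable_expi; apply: measurable_funB.
- apply: (measurableT_comp (f := fun z : X * Y => phase z.1 z.2)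
    (g := fun w : (X * X) * Y => (w.1.2, w.2))) => //.
  apply/measurable_fun_pairP; split; last exact: measurable_snd.
  exact: (measurableT_comp measurable_snd measurable_fst).
- apply: (measurableT_comp (f := fun z : X * Y => phase z.1 z.2)
    (g := fun w : (X * X) * Y => (w.1.1, w.2))) => //.
  apply/measurable_fun_pairP; split; last exact: measurable_snd.
  exact: (measurableT_comp measurable_fst measurable_fst).
Qed.

Lemma ft_kernel f g : cintegrable mu setT f -> cintegrable mu setT g ->
  cintegral nu setT (fun y => (chi y)%:C * (ft f y * conjc (ft g y))) =
  cintegral mu setT (fun x => f x * cintegral mu setT (fun x' => conjc (g x') * P x x')).
Proof.
move=> fi gi.
pose b y := (chi y)%:C * conjc (ft g y).
have bi : cintegrable nu setT b.
  rewrite /b; under eq_fun do rewrite mulrC.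
  apply: (@cintegrableMb _ _ _ _ _ _ (\int[mu]_x nc (g x))) => //.
    by apply: cmeasurableJ; apply: ft_cmeasurable; exact: (cintegrable_cmeasurable gi).
  by move=> y; rewrite normc_conj; exact: ft_bounded.
transitivity (cintegral nu setT (fun y => b y * ft f y)).
  by apply: eq_cintegral => y _; rewrite /b -mulrA; congr (_ * _); rewrite mulrC.
rewrite ft_duality//; apply: eq_cintegral => x _; congr (_ * _).
pose c y := (chi y)%:C * expi (phase x y).
have ci : cintegrable nu setT c.
  rewrite /c; under eq_fun do rewrite mulrC.
  apply: (@cintegrableMb _ _ _ _ _ _ 1) => //.
    by apply: cmeasurable_expi; exact: measurable_phase2.
  by move=> y; rewrite normc_expi.
have mfg y : cintegrable mu setT (fun x => g x * expi (- phase x y)).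
  by apply: cintegrable_expi => //; apply: measurableT_comp => //; exact: measurable_phase1.
have cg : cintegrable nu setT (fun y => c y * ft g y).
  under eq_fun do rewrite mulrC.
  apply: (@cintegrableMb _ _ _ _ _ _ (\int[mu]_x nc (g x))) => //.
    by apply: ft_cmeasurable; exact: (cintegrable_cmeasurable gi).
  by move=> y; exact: ft_bounded.
transitivity (conjc (cintegral nu setT (fun y => c y * ft g y))).
  rewrite -cintegralJ//; apply: eq_cintegral => y _.
  rewrite /b /c !conjM conjc_expi mulrAC; congr (_ * _ * _).
  by apply: complex_eqP; rewrite ?ReJ ?ImJ //= oppr0.
rewrite ft_duality// -cintegralJ.
  apply: eq_cintegral => x' _; rewrite conjM; congr (_ * _).
  rewrite kernelC; congr conjc; apply: eq_cintegral => y _.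
  by rewrite /c -mulrA -expiD.
have mgc : cmeasurable g := cintegrable_cmeasurable gi.
under eq_fun do rewrite mulrC.
apply: (@cintegrableMb _ _ _ _ _ _ (\int[nu]_y nc (c y))) => //.
- apply: (@cmeasurable_partial_cintegral _ _ _ _ _ nu
    (fun z : X * Y => c z.2 * expi (- phase z.1 z.2))).
  apply: cmeasurableM.
    exact: (cmeasurable_comp (cintegrable_cmeasurable ci) measurable_snd).
  by apply: cmeasurable_expi; exact: measurableT_comp.
- move=> x'; apply: le_normc_cintegral_dom.
  + apply: cmeasurableM; first exact: (cintegrable_cmeasurable ci).
    by apply: cmeasurable_expi; apply: measurableT_comp => //; exact: measurable_phase2.
  + exact: cintegrable_normc.
  + by move=> y; rewrite Normc.normcM normc_expi mulr1.
Qed.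

Variables (S : set X) (C : R).
Hypothesis mS : measurable S.
Hypothesis S_full : mu (~` S) = 0%E.
Hypothesis C_ge0 : 0 <= C.
Hypothesis schur : forall x, S x ->
  (\int[mu]_x' (nc (P x x'))%:E <= C%:E)%E.

Let aeS : {ae mu, forall x, S x}.
Proof. by exists (~` S); split => //; exact: measurableC. Qed.

Lemma kernel_energy_le f : L2 mu f -> cintegrable mu setT f ->
  (\int[nu]_y (chi y * nc (ft f y) ^+ 2)%:E <= C%:E * sqnorm mu f)%E.
Proof.
move=> fL fi; have mf := cintegrable_cmeasurable fi.
have mP := kernel_cmeasurable.
have mft := ft_cmeasurable mf.
pose h y := (chi y)%:C * (ft f y * conjc (ft f y)).
have hi : cintegrable nu setT h.
  rewrite /h; under eq_fun do rewrite mulrC.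
  apply: (@cintegrableMb _ _ _ _ _ _ ((\int[mu]_x nc (f x)) ^+ 2)) => //.
    by apply: cmeasurableM => //; exact: cmeasurableJ.
  by move=> y; rewrite Normc.normcM normc_conj expr2 ler_pM ?normc_ge0// ft_bounded.
have hE y : h y = (chi y * nc (ft f y) ^+ 2)%:C.
  by rewrite /h mulJ_normc -rmorphM.
have -> : (\int[nu]_y (chi y * nc (ft f y) ^+ 2)%:E = (Re (cintegral nu setT h))%:E)%E.
  rewrite ReIntegral fineK; last first.
    by case: hi => h1 _; exact: integrable_fin_num h1.
  by apply: eq_integral => y _; rewrite hE.
rewrite ft_kernel//.
have [q qE] : exists q : X -> X -> R, forall x x',
    q x x' = nc (f x) * nc (f x') * nc (P x x') by eexists.
have q0 x x' : (0 <= (q x x')%:E)%E by rewrite lee_fin qE !mulr_ge0 ?normc_ge0.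
have mq : measurable_fun setT (fun z : X * X => (q z.1 z.2)%:E).
  apply/measurable_EFinP; under eq_fun do rewrite qE.
  apply: measurable_funM; last exact: measurable_normc.
  apply: measurable_funM.
  - exact: (measurableT_comp (measurable_normc mf) measurable_fst).
  - exact: (measurableT_comp (measurable_normc mf) measurable_snd).
have [r1 r1E] : exists r1 : X * X -> R, forall z,
    r1 z = nc (f z.1) ^+ 2 * nc (P z.1 z.2) by eexists.
have mr1 : measurable_fun setT (fun z : X * X => (r1 z)%:E).
  rewrite (funext r1E : r1 = _); apply/measurable_EFinP.
  apply: measurable_funM; last exact: measurable_normc.
  apply: measurable_funX; exact: (measurableT_comp (measurable_normc mf) measurable_fst).
have r10 z : (0 <= (r1 z)%:E)%E by rewrite lee_fin r1E mulr_ge0 ?sqr_ge0 ?normc_ge0.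
have mP2 x : measurable_fun setT (fun x' => nc (P x x')).
  apply: measurable_normc.
  exact: (cmeasurable_comp mP (pair1_measurable x)).
have R1 : (\int[mu]_x \int[mu]_x' (r1 (x, x'))%:E <= C%:E * sqnorm mu f)%E.
  rewrite -ge0_integralZl//; last 2 first.
  - exact/measurable_EFinP/measurable_normc_sq.
  - by move=> x _; rewrite lee_fin sqr_ge0.
  apply: ae_ge0_le_integral => //.
  - by move=> x _; exact: integral_ge0.
  - exact: (measurable_fun_fubini_tonelli_F _ mr1 r10).
  - by move=> x _; rewrite mule_ge0 ?lee_fin ?sqr_ge0.
  - apply: measurable_funeM; exact/measurable_EFinP/measurable_normc_sq.
  apply: filterS aeS => x Sx _.
  have -> : (\int[mu]_x' (r1 (x, x'))%:E =
      (nc (f x) ^+ 2)%:E * \int[mu]_x' (nc (P x x'))%:E)%E.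
    under eq_integral do rewrite r1E /fst /snd.
    exact: (@integralZ_ge0 _ _ _ mu (nc (f x) ^+ 2) (fun x' => nc (P x x'))
      (sqr_ge0 _) (fun x' => normc_ge0 _) (mP2 x)).
  by rewrite muleC; apply: lee_wpmul2r; [rewrite lee_fin sqr_ge0|exact: schur].
have R2 : (\int[mu]_x \int[mu]_x' (r1 (x', x))%:E =
    \int[mu]_x \int[mu]_x' (r1 (x, x'))%:E)%E.
  exact: (esym (@fubini_tonelli _ _ _ _ _ mu mu _ mr1 r10)).
have mr2 : measurable_fun setT (fun z : X * X => (r1 (z.2, z.1))%:E).
  apply: (measurableT_comp (f := fun z => (r1 z)%:E) (g := fun z : X * X => (z.2, z.1))) => //.
  by apply/measurable_fun_pairP; split; [exact: measurable_snd|exact: measurable_fst].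
have Q : (\int[mu]_x \int[mu]_x' (q x x')%:E <= C%:E * sqnorm mu f)%E.
  apply: (@le_trans _ _ (\int[mu]_x \int[mu]_x'
      ((2^-1)%:E * (r1 (x, x'))%:E + (2^-1)%:E * (r1 (x', x))%:E))%E).
    apply: ge0_le_integral => //.
    - by move=> x _; exact: integral_ge0.
    - exact: (measurable_fun_fubini_tonelli_F (fun z : X * X => (q z.1 z.2)%:E) mq (fun z => q0 z.1 z.2)).
    - apply: (measurable_fun_fubini_tonelli_F (fun z : X * X =>
        (2^-1)%:E * (r1 (z.1, z.2))%:E + (2^-1)%:E * (r1 (z.2, z.1))%:E)%E).
        apply: emeasurable_funD; apply: measurable_funeM => //.
        by apply: eq_measurable_fun mr1 => -[].
      by move=> z; rewrite adde_ge0// mule_ge0// lee_fin; lra.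
    move=> x _; apply: ge0_le_integral => //.
    - exact: (measurableT_comp mq (pair1_measurable x)).
    - apply: emeasurable_funD; apply: measurable_funeM.
      + exact: (measurableT_comp mr1 (pair1_measurable x)).
      + exact: (measurableT_comp mr1 (pair2_measurable x)).
    move=> x' _; rewrite -!EFinM -EFinD lee_fin qE !r1E /fst /snd.
    have -> : nc (P x' x) = nc (P x x') by rewrite kernelC normc_conj.
    have p0 := normc_ge0 (P x x').
    have := sqr_ge0 (nc (f x) - nc (f x')); rewrite sqrrB => h2.
    rewrite !mulrA -mulrDl ler_wpM2r//; lra.
  have half0 : (0 <= (2^-1 : R)%:E)%E by rewrite lee_fin invr_ge0.
  have mr1x x := measurableT_comp mr1 (pair1_measurable x).
  have mr1y x := measurableT_comp mr1 (pair2_measurable x).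
  have h0 (z : X * X) : (0 <= (2^-1)%:E * (r1 z)%:E)%E by rewrite mule_ge0.
  have mF1 : measurable_fun setT (fun x => \int[mu]_x' (r1 (x, x'))%:E)%E.
    exact: (measurable_fun_fubini_tonelli_F _ mr1 r10).
  have mF2 : measurable_fun setT (fun x => \int[mu]_x' (r1 (x', x))%:E)%E.
    exact: (measurable_fun_fubini_tonelli_F (fun z : X * X => (r1 (z.2, z.1))%:E) mr2 (fun z => r10 (z.2, z.1))).
  have F0 x : (0 <= \int[mu]_x' (r1 (x, x'))%:E)%E by apply: integral_ge0 => x' _; exact: r10.
  have F0' x : (0 <= \int[mu]_x' (r1 (x', x))%:E)%E by apply: integral_ge0 => x' _; exact: r10.
  under eq_integral => x _.
    rewrite ge0_integralD; [|exact: measurableT|by move=> x' _; exact: h0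
      |by apply: measurable_funeM; exact: mr1x|by move=> x' _; exact: h0
      |by apply: measurable_funeM; exact: mr1y].
    rewrite ge0_integralZl; [|exact: measurableT|exact: mr1x|by move=> x' _; exact: r10|exact: half0].
    rewrite ge0_integralZl; [|exact: measurableT|exact: mr1y|by move=> x' _; exact: r10|exact: half0].
    over.
  rewrite ge0_integralD; [|exact: measurableT|by move=> x _; rewrite mule_ge0
    |by apply: measurable_funeM; exact: mF1|by move=> x _; rewrite mule_ge0
    |by apply: measurable_funeM; exact: mF2].
  rewrite ge0_integralZl; [|exact: measurableT|exact: mF1|by move=> x _; exact: F0|exact: half0].
  rewrite ge0_integralZl; [|exact: measurableT|exact: mF2|by move=> x _; exact: F0'|exact: half0].
  rewrite R2 -ge0_muleDl// -EFinD.
  have -> : 2^-1 + 2^-1 = 1 :> R by field.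
  by rewrite mul1e.
have mq2 x : measurable_fun setT (fun x' => (q x x')%:E).
  exact: (measurableT_comp mq (pair1_measurable x)).
pose k (z : X * X) := f z.1 * (conjc (f z.2) * P z.1 z.2).
have mk : cmeasurable k.
  apply: cmeasurableM; first exact: (cmeasurable_comp mf measurable_fst).
  apply: cmeasurableM => //; apply: cmeasurableJ.
  exact: (cmeasurable_comp mf measurable_snd).
have kq x x' : nc (k (x, x')) = q x x'.
  by rewrite /k qE /fst /snd !Normc.normcM normc_conj mulrA.
have Qfin : (C%:E * sqnorm mu f < +oo)%E.
  have /L2_sqnorm[_] := fL; have := sqnorm_ge0 mu f.
  by case: (sqnorm mu f) => [r _ _| _ |]//; rewrite -EFinM ltry.
have ki : cintegrable (mu \x mu)%E setT k.
  apply: cintegrable_prod => //; under eq_integral do under eq_integral do rewrite kq.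
  exact: le_lt_trans Q Qfin.
have kpart := cintegrable_partial ki.
apply: le_trans Q.
have pull x : S x -> f x * cintegral mu setT (fun x' => conjc (f x') * P x x') =
    cintegral mu setT (fun x' => k (x, x')).
  move=> Sx; rewrite -cintegralZ//.
  under eq_fun do rewrite mulrC.
  apply: (@cintegrableMb _ _ _ _ _ _ (\int[nu]_y `|chi y|)); last exact: cintegrableJ.
    exact: (cmeasurable_comp mP (pair1_measurable x)).
  move=> x'; apply: le_normc_cintegral_dom.
  - apply: cmeasurableM; first exact: cmeasurable_real.
    by apply: cmeasurable_expi; apply: measurable_funB; exact: measurable_phase2.
  - exact: integrable_abse chi_int.
  - by move=> y; rewrite Normc.normcM normc_expi mulr1 normc_real.
rewrite (@ae_eq_cintegral _ _ _ _ _ (fun x => cintegral mu setT (fun x' => k (x, x')))).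
- apply: (@le_trans _ _ (\int[mu]_x nc (cintegral mu setT (fun x' => k (x, x'))))%:E).
    by rewrite lee_fin; apply: le_trans (Re_le_normc _) _; exact: le_normc_cintegral.
  rewrite fineK; last by apply: integrable_fin_num => //; exact: cintegrable_normc.
  apply: ae_ge0_le_integral => //.
  + by move=> x _; rewrite lee_fin normc_ge0.
  + apply/measurable_EFinP/measurable_normc; exact: (cintegrable_cmeasurable kpart).
  + by move=> x _; exact: integral_ge0.
  + exact: (measurable_fun_fubini_tonelli_F (fun z : X * X => (q z.1 z.2)%:E) mq (fun z => q0 z.1 z.2)).
  have [_ /integrableP[_ _]] := ki.
  have iq : (mu \x mu)%E.-integrable setT (fun z : X * X => (q z.1 z.2)%:E).
    have := cintegrable_normc ki; apply: eq_integrable => // -[x x'] _.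
    by rewrite kq.
  have := ae_integrable1 iq.
  apply: filterS => x ix _.
  apply: (@le_trans _ _ (\int[mu]_x' q x x')%:E).
    rewrite lee_fin; apply: le_normc_cintegral_dom => //.
    + exact: (cmeasurable_comp mk (pair1_measurable x)).
    + by move=> x'; rewrite kq.
  by rewrite fineK//; exact: integrable_fin_num ix.
- apply: cmeasurableM => //.
  apply: (@cmeasurable_partial_cintegral _ _ _ _ _ mu (fun z => conjc (f z.2) * P z.1 z.2)).
  apply: cmeasurableM => //; apply: cmeasurableJ.
  exact: (cmeasurable_comp mf measurable_snd).
- exact: (cintegrable_cmeasurable kpart).
- by apply: filterS aeS => x /pull.
Qed.

End Kernel.

End Transform.

Section CauchyComplete.
Variables (R : realType) (V : lmodType R[i]) (ip : V -> V -> R).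
Hypothesis ipH : semi_hilbert ip.
Local Notation nrm := (ipnorm ip).

Lemma le0_cvg0 (e : nat -> R) (x : R) : e @ \oo --> 0 -> (forall n, x <= e n) -> x <= 0.
Proof.
move=> e0 xe; rewrite -(cvg_lim _ e0)//; apply: limr_ge; first exact: cvgP e0.
exact: nearW.
Qed.

Lemma ip_cauchy_complete (u : nat -> V) (e : nat -> R) : e @ \oo --> 0 ->
  (forall m n, nrm (u m - u n) <= e m + e n) ->
  exists l, forall n, nrm (u n - l) <= e n.
Proof.
move=> e0 ue.
have /choice[N NP] k : exists N, e N <= 2^-1 ^+ k.
  have q0 : 0 < (2^-1 : R) ^+ k by rewrite exprn_gt0 ?invr_gt0.
  have /cvgrPdist_le/(_ _ q0) [N _ /(_ N (leqnn N)) /=] := e0.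
  by rewrite sub0r normrN => h; exists N; exact: le_trans (ler_norm _) h.
have [l lP] : exists l, forall k, nrm (u (N k) - l) <= 2 * 2 * 2^-1 ^+ k.
  apply: (ip_complete_norm ipH (u := fun k => u (N k))) => k.
  apply: le_trans (ue _ _) _; have := NP k; have := NP k.+1; rewrite exprS.
  have : 0 <= (2^-1 : R) ^+ k by rewrite exprn_ge0.
  lra.
exists l => n; rewrite -subr_le0; apply: (@le0_geometric _ _ 5) => k.
have := lP k; have := ue n (N k); have := NP k.
have := ipnorm_distD ipH (u (N k)) (u n) l; lra.
Qed.

End CauchyComplete.

Section L2Limits.
Context d (T : measurableType d) (R : realType).
Variable mu : {measure set T -> \bar R}.
Local Notation nrm := (ipnorm (rip mu)).
Local Notation H := (rip_semi_hilbert mu).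

Lemma inner_cvg (u v : nat -> Ltwo mu) (u0 v0 : Ltwo mu) :
  (fun n => nrm (u n - u0)) @ \oo --> 0 -> (fun n => nrm (v n - v0)) @ \oo --> 0 ->
  (fun n => nc (inner mu (u n) (v n) - inner mu u0 v0)) @ \oo --> 0.
Proof.
move=> hu hv.
apply: (@squeeze_cvgr _ _ _ _ (fun=> 0)
  (fun n => nrm (u n - u0) * (nrm (v n - v0) + nrm v0) + nrm u0 * nrm (v n - v0))).
- apply: nearW => n; apply/andP; split; first exact: normc_ge0.
  have -> : inner mu (u n) (v n) - inner mu u0 v0 =
      inner mu (u n - u0 : Ltwo mu) (v n) + inner mu u0 (v n - v0 : Ltwo mu).
    by rewrite innerBl innerBr addrA subrK.
  apply: le_trans (normcD_le _ _) _; apply: lerD.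
    apply: le_trans (inner_cauchy_schwarz _ _) _; rewrite ler_wpM2l ?ipnorm_ge0//.
    by have := ipnormD H (v n - v0) v0; rewrite subrK.
  exact: inner_cauchy_schwarz.
- exact: cvg_cst.
- rewrite -[0](_ : 0 * (0 + nrm v0) + nrm u0 * 0 = 0); last by rewrite mul0r mulr0 addr0.
  apply: cvgD; apply: cvgM => //; last exact: cvg_cst.
  by apply: cvgD => //; exact: cvg_cst.
Qed.

Lemma complex_eq_cvg (a : nat -> R[i]) (x y : R[i]) :
  (fun n => nc (a n - x)) @ \oo --> 0 -> (fun n => nc (a n - y)) @ \oo --> 0 -> x = y.
Proof.
move=> ax ay; apply/eqP; rewrite -subr_eq0; apply/eqP/Normc.eq0_normc/eqP.
rewrite eq_le normc_ge0 andbT.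
apply: (@le0_cvg0 _ (fun n => nc (a n - x) + nc (a n - y))).
  by rewrite -[0](addr0 0); exact: cvgD.
move=> n; have -> : x - y = (a n - y) + - (a n - x) by ring.
by apply: le_trans (normcD_le _ _) _; rewrite normc_opp addrC.
Qed.

Lemma dominated_cvg0 (h : nat -> T -> R) (g : T -> R) :
  (forall n, measurable_fun setT (h n)) -> mu.-integrable setT (EFin \o g) ->
  {ae mu, forall x, (fun n => h n x) @ \oo --> 0} ->
  {ae mu, forall x, forall n, `|h n x| <= g x} ->
  (fun n => \int[mu]_x h n x) @ \oo --> 0.
Proof.
move=> mh ig hc hd.
have mh' n : measurable_fun setT (EFin \o h n) by exact/measurable_EFinP.
have m0 : measurable_fun [set: T] (fun=> 0%E : \bar R) by exact: measurable_cst.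
have hc' : {ae mu, forall x, setT x -> (fun n => (EFin \o h n) x) @ \oo --> 0%E}.
  by apply: filterS hc => x hx _; apply: cvg_EFin => //; exact: nearW.
have hd' : {ae mu, forall x n, setT x -> (`|(EFin \o h n) x| <= (EFin \o g) x)%E}.
  by apply: filterS hd => x hx n _; rewrite /= lee_fin.
have [_ _] := dominated_convergence measurableT mh' m0 hc' ig hd'.
by rewrite integral0 => /fine_cvg.
Qed.

Lemma cdominated (f : nat -> T -> R[i]) (f0 : T -> R[i]) (g : T -> R) :
  (forall n, cmeasurable (f n)) -> cmeasurable f0 ->
  mu.-integrable setT (EFin \o g) ->
  {ae mu, forall x, (fun n => nc (f n x - f0 x)) @ \oo --> 0} ->
  {ae mu, forall x, (forall n, nc (f n x) <= g x) /\ nc (f0 x) <= g x} ->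
  (fun n => nc (cintegral mu setT (f n) - cintegral mu setT f0)) @ \oo --> 0.
Proof.
move=> mf mf0 ig hc hd.
have fint h : cmeasurable h -> {ae mu, forall x, nc (h x) <= g x} ->
    cintegrable mu setT h.
  move=> mh hg; apply: cintegrableP => //.
  apply: (@le_lt_trans _ _ (\int[mu]_x `|(g x)%:E|)%E); last by have /integrableP[] := ig.
  apply: ae_ge0_le_integral => //.
  - by move=> x _; rewrite lee_fin normc_ge0.
  - exact/measurable_EFinP/measurable_normc.
  - by apply: measurableT_comp => //; exact: (measurable_int _ ig).
  - by apply: filterS hg => x h1 _; rewrite lee_fin (le_trans h1)// ler_norm.
have fi n : cintegrable mu setT (f n) by apply: fint => //; apply: filterS hd => x [].
have f0i : cintegrable mu setT f0 by apply: fint => //; apply: filterS hd => x [].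
have dc : (fun n => \int[mu]_x nc (f n x - f0 x)) @ \oo --> 0.
  apply: (@dominated_cvg0 _ (fun x => 2 * g x)) => //.
  - by move=> n; apply: measurable_normc; exact: cmeasurableB.
  - by have := integrableZl measurableT 2 ig.
  - apply: filterS hd => x [h1 h2] n.
    rewrite ger0_norm ?normc_ge0// (le_trans (normcD_le _ _))// normc_opp.
    by have := h1 n; lra.
apply: squeeze_cvgr dc; last exact: cvg_cst.
apply: nearW => n; apply/andP; split; first exact: normc_ge0.
rewrite -cintegralB//; by apply: le_normc_cintegral; exact: cintegrableB.
Qed.

Lemma bounded_symbol_indic (A : set T) : measurable A ->
  bounded_symbol (fun x => (\1_A x)%:C : R[i]).
Proof.
move=> mA; split; first by apply: cmeasurable_real; exact: measurable_indic.
exists 1 => x; rewrite normc_real indicE.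
by case: (x \in A); rewrite ?normr1 ?normr0.
Qed.

Lemma sqr_indic (A : set T) x : (\1_A x : R) ^+ 2 = \1_A x.
Proof. by rewrite indicE; case: (x \in A); rewrite ?expr1n ?expr0n. Qed.

Lemma L2_indic (A : set T) : measurable A -> (mu A < +oo)%E ->
  L2 mu (fun x => (\1_A x)%:C : R[i]).
Proof.
move=> mA Afin; apply/L2_sqnorm; split; first by have [] := bounded_symbol_indic mA.
rewrite /sqnorm; under eq_integral do
  rewrite normc_real ger0_norm ?indicE// -indicE sqr_indic.
by rewrite integral_indic// setIT.
Qed.

Lemma cintegrable_indic (A : set T) : measurable A -> (mu A < +oo)%E ->
  cintegrable mu setT (fun x => (\1_A x)%:C : R[i]).
Proof.
move=> mA Afin; split; last exact: integrable0.
apply/integrableP; split; first exact/measurable_EFinP/measurable_indic.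
under eq_integral do rewrite /= ger0_norm ?indicE// -indicE.
by rewrite integral_indic// setIT.
Qed.

Definition ltwo_cut (A : set T) (f : Ltwo mu) : Ltwo mu :=
  ltwo_mul (fun x => (\1_A x)%:C) f.

Lemma ltwo_cutE A f : measurable A ->
  ltwo_cut A f = (fun x => (\1_A x)%:C * f x) :> (T -> R[i]).
Proof. by move=> mA; apply: ltwo_mulE; exact: bounded_symbol_indic. Qed.

Lemma cintegrable_cut A (f : Ltwo mu) : measurable A -> (mu A < +oo)%E ->
  cintegrable mu setT (ltwo_cut A f).
Proof.
move=> mA Afin; rewrite ltwo_cutE//.
have := cintegrable_inner (ltwoP f) (L2_indic mA Afin).
by under eq_fun do rewrite conjc_real mulrC.
Qed.

Lemma ltwo_cut_cvg (K : nat -> set T) (f : Ltwo mu) :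
  (forall n, measurable (K n)) -> (forall x, \forall n \near \oo, K n x) ->
  (fun n => nrm (ltwo_cut (K n) f - f)) @ \oo --> 0.
Proof.
move=> mK Kc.
have i2 : mu.-integrable setT (fun x => (nc (f x) ^+ 2)%:E).
  exact: integrable_normc_sq (ltwoP f).
have mf := L2_cmeasurable (ltwoP f).
have mcut n : cmeasurable (fun x => (\1_(K n) x)%:C * f x - f x).
  by apply: cmeasurableB => //; apply: cmeasurableM => //; have [] := bounded_symbol_indic (mK n).
have dc : (fun n => \int[mu]_x (nc ((\1_(K n) x)%:C * f x - f x) ^+ 2)) @ \oo --> 0.
  apply: (@dominated_cvg0 _ (fun x => nc (f x) ^+ 2)) => //.
  - by move=> n; apply: measurable_normc_sq.
  - apply/aeW => x; apply: cvg_near_cst; near=> n.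
    rewrite indicE (_ : x \in K n) ?mul1r ?subrr ?Normc.normc0 ?expr0n//.
    by rewrite inE; near: n; exact: Kc.
  - apply/aeW => x n; rewrite ger0_norm ?sqr_ge0// indicE.
    case: (x \in K n); first by rewrite mul1r subrr Normc.normc0 expr0n sqr_ge0.
    by rewrite mul0r sub0r normc_opp.
have {}dc : (fun n => Num.sqrt (\int[mu]_x (nc ((\1_(K n) x)%:C * f x - f x) ^+ 2)))
    @ \oo --> (0 : R).
  rewrite -[X in _ --> X](@sqrtr0 R).
  by apply: (cvg_comp _ _ dc); exact: sqrt_continuous.
rewrite (_ : (fun n => _) = (fun n =>
  Num.sqrt (\int[mu]_x (nc ((\1_(K n) x)%:C * f x - f x) ^+ 2))))//.
apply/funext => n; rewrite /ipnorm; congr Num.sqrt.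
have := sqnorm_rip (ltwo_cut (K n) f - f); by rewrite /sqnorm ltwoB ltwo_cutE// /Rintegral => ->.
Unshelve. all: by end_near. Qed.

End L2Limits.

Global Opaque ltwo_cut.

(** Plancherel's extension exists as soon as Bessel's inequality holds for
    integrable functions. *)
Section PlancherelExtension.
Context d1 d2 (X : measurableType d1) (Y : measurableType d2) (R : realType).
Variables (mu : {sigma_finite_measure set X -> \bar R}).
Variables (nu : {sigma_finite_measure set Y -> \bar R}).
Variable phase : X -> Y -> R.
Hypothesis mphase : measurable_fun setT (fun z : X * Y => phase z.1 z.2).
Variable K : nat -> set X.
Hypothesis mK : forall n, measurable (K n).
Hypothesis K_fin : forall n, (mu (K n) < +oo)%E.
Hypothesis K_cover : forall x, \forall n \near \oo, K n x.
Variable C : R.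
Hypothesis C_ge0 : 0 <= C.
Hypothesis bC : bessel mu nu phase C.
Local Notation nrm := (ipnorm (rip mu)).
Local Notation nrm' := (ipnorm (rip nu)).

Definition ft_cut n (f : Ltwo mu) : Ltwo nu := toL2 nu (ft mu phase (ltwo_cut (K n) f)).

Lemma ft_cutE n f : ft_cut n f = ft mu phase (ltwo_cut (K n) f) :> (Y -> R[i]).
Proof.
apply: toL2E; apply: (bessel_L2 mphase bC); first exact: ltwoP.
exact: (cintegrable_cut f (mK _) (K_fin _)).
Qed.

Opaque ft_cut.

Lemma ft_cut_truncated n (f : Ltwo mu) y : ft_cut n f y =
  cintegral mu (K n) (fun x => f x * expi (- phase x y)).
Proof.
rewrite ft_cutE cintegral_mkcond// /ft ltwo_cutE//.
by apply: eq_cintegral => x _; rewrite -mulrA mulrC.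
Qed.

Lemma ft_cut_dist m n f :
  nrm' (ft_cut m f - ft_cut n f) <= Num.sqrt C * nrm (ltwo_cut (K m) f - ltwo_cut (K n) f).
Proof.
have c0 := mulr_ge0 (sqrtr_ge0 C) (ipnorm_ge0 (rip mu) (ltwo_cut (K m) f - ltwo_cut (K n) f)).
rewrite nrm_le (L2norm_le _ _ c0).
have -> : (ft_cut m f - ft_cut n f : Ltwo nu) =
    ft mu phase (ltwo_cut (K m) f - ltwo_cut (K n) f : Ltwo mu) :> (Y -> R[i]).
  rewrite [in RHS]ltwoB (ftB mphase); [|exact: (cintegrable_cut f (mK _) (K_fin _))..].
  apply/funext => y; congr (_ - _); first exact: (congr1 (@^~ y) (ft_cutE m f)).
  exact: (congr1 (@^~ y) (ft_cutE n f)).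
rewrite exprMn sqr_sqrtr// (ipnorm_sq (rip_semi_hilbert mu)) EFinM -sqnorm_rip ltwoB.
apply: bC; first exact: ltwoP (ltwo_cut (K m) f - ltwo_cut (K n) f).
by apply: cintegrableB; exact: (cintegrable_cut f (mK _) (K_fin _)).
Qed.

Lemma ex_ft_limit f : exists F : Ltwo nu, forall n,
  nrm' (ft_cut n f - F) <= Num.sqrt C * nrm (ltwo_cut (K n) f - f).
Proof.
apply: (@ip_cauchy_complete _ _ _ (rip_semi_hilbert nu) (fun n => ft_cut n f)
  (fun n => Num.sqrt C * nrm (ltwo_cut (K n) f - f))).
  rewrite -[0](mulr0 (Num.sqrt C)); apply: cvgM; first exact: cvg_cst.
  exact: ltwo_cut_cvg.
move=> m n; apply: le_trans (ft_cut_dist _ _ _) _.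
rewrite -mulrDr ler_wpM2l ?sqrtr_ge0//.
apply: le_trans (ipnorm_distD (rip_semi_hilbert mu) f _ _) _.
by rewrite lerD2l (ipnormBC (rip_semi_hilbert mu)).
Qed.

Lemma is_plancherelP (f : Ltwo mu) (g : Ltwo nu) :
  is_plancherel mu nu phase K f g <->
  (fun n => nrm' (ft_cut n f - g)) @ \oo --> 0.
Proof.
have E n : L2norm nu (fun y => g y - cintegral mu (K n)
    (fun x => f x * expi (- phase x y))) = (nrm' (ft_cut n f - g))%:E.
  rewrite (ipnormBC (rip_semi_hilbert nu)) -L2norm_rip ltwoB; congr (L2norm nu _).
  by apply/funext => y; rewrite ft_cut_truncated.
rewrite /is_plancherel (funext E); split => [[_ /fine_cvg]//|h].
by split; [exact: ltwoP|apply: cvg_EFin => //; exact: nearW].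
Qed.

Definition transform (f : Ltwo mu) : Ltwo nu := toL2 nu (plancherel mu nu phase K f).

Lemma plancherel_spec (f : Ltwo mu) :
  is_plancherel mu nu phase K f (plancherel mu nu phase K f).
Proof.
have [F FP] := ex_ft_limit f.
have FPl : is_plancherel mu nu phase K f F.
  apply/is_plancherelP; apply: (@squeeze_cvgr _ _ _ _ (fun=> 0)
    (fun n => Num.sqrt C * nrm (ltwo_cut (K n) f - f))).
  - by apply: nearW => n; rewrite ipnorm_ge0 FP.
  - exact: cvg_cst.
  - rewrite -[0](mulr0 (Num.sqrt C)); apply: cvgM; first exact: cvg_cst.
    exact: ltwo_cut_cvg.
exact: (xgetPex (fun=> 0) (ex_intro _ (F : Y -> R[i]) FPl)).
Qed.

Lemma transformE (f : Ltwo mu) :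
  transform f = plancherel mu nu phase K f :> (Y -> R[i]).
Proof. by apply: toL2E; have [] := plancherel_spec f. Qed.

Opaque transform.

Lemma transform_cvg (f : Ltwo mu) :
  (fun n => nrm' (ft_cut n f - transform f)) @ \oo --> 0.
Proof. by apply/is_plancherelP; rewrite transformE; exact: plancherel_spec. Qed.

Lemma transform_unique (f : Ltwo mu) (g : Ltwo nu) :
  is_plancherel mu nu phase K f g -> nrm' (transform f - g) = 0.
Proof.
move=> /is_plancherelP h1; have h2 := transform_cvg f.
apply/eqP; rewrite eq_le ipnorm_ge0 andbT.
apply: (@le0_cvg0 _ (fun n => nrm' (ft_cut n f - transform f) + nrm' (ft_cut n f - g))).
  by rewrite -[0](addr0 0); exact: cvgD.
move=> n; apply: le_trans (ipnorm_distD (rip_semi_hilbert nu) (ft_cut n f) _ _) _.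
by rewrite (ipnormBC (rip_semi_hilbert nu) (transform f)).
Qed.

(** The truncations converge to the transform pointwise as well as in L2. *)
Lemma transform_integrable (f : Ltwo mu) : cintegrable mu setT f ->
  {ae nu, forall y, transform f y = ft mu phase f y}.
Proof.
move=> fi; have fL := bessel_L2 mphase bC (ltwoP f) fi.
have -> : ft mu phase f = toL2 nu (ft mu phase f) by rewrite toL2E.
apply: ltwo_ae_eq; apply: transform_unique; apply/is_plancherelP.
apply: (@squeeze_cvgr _ _ _ _ (fun=> 0)
  (fun n => Num.sqrt C * nrm (ltwo_cut (K n) f - f))).
- apply: nearW => n; apply/andP; split; first exact: ipnorm_ge0.
  have c0 := mulr_ge0 (sqrtr_ge0 C) (ipnorm_ge0 (rip mu) (ltwo_cut (K n) f - f)).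
  rewrite nrm_le (L2norm_le _ _ c0) ltwoB (toL2E fL) (ft_cutE n).
  rewrite -(ftB mphase)//; last exact: (cintegrable_cut f (mK _) (K_fin _)).
  rewrite exprMn sqr_sqrtr// (ipnorm_sq (rip_semi_hilbert mu)) EFinM -sqnorm_rip ltwoB.
  apply: bC; first exact: ltwoP (ltwo_cut (K n) f - f).
  by apply: cintegrableB => //; exact: (cintegrable_cut f (mK _) (K_fin _)).
- exact: cvg_cst.
- rewrite -[0](mulr0 (Num.sqrt C)); apply: cvgM; first exact: cvg_cst.
  exact: ltwo_cut_cvg.
Qed.

End PlancherelExtension.

Global Opaque ft_cut transform.

(** * Inversion from a summability method *)

Lemma limn_einf_le (R : realType) (u : nat -> \bar R) (c : \bar R) :
  (forall n, (u n <= c)%E) -> (limn_einf u <= c)%E.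
Proof.
move=> uc; rewrite limn_einf_lim; apply: lime_le; first exact: is_cvg_einfs.
apply: nearW => m; apply: le_trans (uc m).
by apply: ereal_inf_lbound; exists m => /=.
Qed.

(** A summability method: weights [chi n] that increase to one and whose kernels
    satisfy Schur's test with the constant [C]. *)
Record summability d1 d2 (X : measurableType d1) (Y : measurableType d2)
    (R : realType) (mu : {sigma_finite_measure set X -> \bar R})
    (nu : {sigma_finite_measure set Y -> \bar R}) (phase : X -> Y -> R)
    (chi : nat -> Y -> R) (S : set X) (C : R) : Prop := Summability {
  summ_ge0 : forall n y, 0 <= chi n y;
  summ_le1 : forall n y, chi n y <= 1;
  summ_int : forall n, nu.-integrable setT (EFin \o chi n);
  summ_cvg : {ae nu, forall y, (fun n => chi n y) @ \oo --> (1 : R)};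
  summ_mS : measurable S;
  summ_full : mu (~` S) = 0%E;
  summ_C : 0 < C;
  summ_schur : forall n x, S x ->
    (\int[mu]_x' (nc (summability_kernel nu phase (chi n) x x'))%:E <= C%:E)%E }.

(** The weighted kernels act as an approximate identity on the indicators of the
    sets of [J], which are rich enough to separate square integrable functions. *)
Record approximate_identity d1 d2 (X : measurableType d1) (Y : measurableType d2)
    (R : realType) (mu : {sigma_finite_measure set X -> \bar R})
    (nu : {sigma_finite_measure set Y -> \bar R}) (phase : X -> Y -> R)
    (chi : nat -> Y -> R) (C : R) (J : set (set X)) : Prop := ApproximateIdentity {
  appr_meas : forall A, J A -> measurable A;
  appr_fin : forall A, J A -> (mu A < +oo)%E;
  appr_cvg : forall A, J A -> {ae mu, forall x,
    (fun n => nc (cintegral mu setT (fun x' => (\1_A x')%:C *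
       summability_kernel nu phase (chi n) x x') - (C * \1_A x)%:C)) @ \oo --> 0};
  appr_total : forall r : Ltwo mu,
    (forall A, J A -> cintegral mu A r = 0) -> ipnorm (rip mu) r = 0 }.

Section BesselKernels.
Context d1 d2 (X : measurableType d1) (Y : measurableType d2) (R : realType).
Variables (mu : {sigma_finite_measure set X -> \bar R}).
Variables (nu : {sigma_finite_measure set Y -> \bar R}).
Variable phase : X -> Y -> R.
Hypothesis mphase : measurable_fun setT (fun z : X * Y => phase z.1 z.2).
Variables (chi : nat -> Y -> R) (S : set X) (C : R).
Hypothesis H : summability mu nu phase chi S C.

Let mchi n : measurable_fun setT (chi n).
Proof. exact/measurable_EFinP/(measurable_int _ (summ_int H n)). Qed.

(** Fatou, as the weights increase to one. *)
Lemma summability_bessel : bessel mu nu phase C.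
Proof.
move=> f fL fi.
have mft := ft_cmeasurable mu mphase (L2_cmeasurable fL).
pose h n y := ((chi n y * nc (ft mu phase f y) ^+ 2)%:E : \bar R).
have mh n : measurable_fun setT (h n).
  apply/measurable_EFinP; apply: measurable_funM; first exact: mchi.
  exact: measurable_normc_sq.
have -> : sqnorm nu (ft mu phase f) = (\int[nu]_y limn_einf (h ^~ y))%E.
  apply: ae_eq_integral => //.
  - by apply/measurable_EFinP; exact: measurable_normc_sq.
  - rewrite /limn_einf; apply: measurableT_comp => //.
    apply: (measurable_fun_limn_esup (D := setT)) => n.
    by apply: (measurableT_comp (f := -%E)).
  apply: filterS (summ_cvg H) => y cy _.
  have hy : (h ^~ y) @ \oo --> (nc (ft mu phase f y) ^+ 2)%:E.
    apply: cvg_EFin; first exact: nearW.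
    by rewrite -[X in _ --> X]mul1r; apply: cvgM; [exact: cy|exact: cvg_cst].
  by rewrite is_cvg_limn_einfE ?(cvg_lim _ hy)//; apply: cvgP hy.
apply: le_trans (fatou nu measurableT mh _) _.
  by move=> n y _; rewrite lee_fin mulr_ge0 ?sqr_ge0// (summ_ge0 H).
apply: limn_einf_le => n.
exact: (kernel_energy_le mphase (summ_int H n) (summ_mS H) (summ_full H)
  (ltW (summ_C H)) (summ_schur H n) fL fi).
Qed.

Let P n := summability_kernel nu phase (chi n).

(** Inserting the weights [chi n] turns the left side into a double integral with
    the summability kernel, which tends to [C] times the indicator. *)
Lemma ft_inner_test (f : Ltwo mu) (A : set X) :
  cintegrable mu setT f -> measurable A -> (mu A < +oo)%E ->
  {ae mu, forall x, (fun n => nc (cintegral mu setT (fun x' => (\1_A x')%:C *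
      P n x x') - (C * \1_A x)%:C)) @ \oo --> 0} ->
  inner nu (ft mu phase f) (ft mu phase (fun x => (\1_A x)%:C)) =
  C%:C * inner mu f (fun x => (\1_A x)%:C).
Proof.
move=> fi mA Afin Acvg.
have AL := L2_indic mA Afin.
have Ai := cintegrable_indic mA Afin.
have mf := L2_cmeasurable (ltwoP f).
have bes := summability_bessel.
have F1 := bessel_L2 mphase bes (ltwoP f) fi.
have F2 := bessel_L2 mphase bes AL Ai.
have FF := cintegrable_inner F1 F2.
pose a n := cintegral nu setT (fun y => (chi n y)%:C *
  (ft mu phase f y * conjc (ft mu phase (fun x => (\1_A x)%:C) y))).
pose w n x := cintegral mu setT (fun x' => (\1_A x')%:C * P n x x').
have mP n : cmeasurable (fun z : X * X => P n z.1 z.2).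
  exact: (kernel_cmeasurable mphase (summ_int H n)).
apply: (@complex_eq_cvg _ a).
- apply: cdominated.
  + move=> n; apply: cmeasurableM; first exact: cmeasurable_real.
    exact: (cintegrable_cmeasurable FF).
  + exact: (cintegrable_cmeasurable FF).
  + exact: cintegrable_normc FF.
  + apply: filterS (summ_cvg H) => y cy.
    set z := (_ * conjc _).
    rewrite (_ : (fun n => _) = (fun n => `|chi n y - 1| * nc z)).
      rewrite -[0](mul0r (nc z)); apply: cvgM; last exact: cvg_cst.
      rewrite -[0](@normr0 _ R); apply: cvg_norm.
      by rewrite -(subrr (1 : R)); apply: cvgB; [exact: cy|exact: cvg_cst].
    apply/funext => n; rewrite -{2}[z]mul1r -mulrBl Normc.normcM.
    by rewrite -(rmorph1 (real_complex R)) -rmorphB normc_real.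
  + apply/aeW => y; split => // n.
    rewrite Normc.normcM normc_real ger0_norm ?(summ_ge0 H)//.
    by rewrite ler_piMl ?normc_ge0// (summ_le1 H).
- have aE n : a n = cintegral mu setT (fun x => f x * w n x).
    rewrite /a (ft_kernel mphase (summ_int H n) fi Ai); apply: eq_cintegral => x _.
    by congr (_ * _); apply: eq_cintegral => x' _; rewrite conjc_real.
  rewrite (funext aE) -cintegralZ; last exact: (cintegrable_inner (ltwoP f) AL).
  have ig : mu.-integrable setT (fun x => (C * nc (f x))%:E).
    by have := integrableZl measurableT C (cintegrable_normc fi).
  apply: (cdominated _ _ ig).
  + move=> n; apply: cmeasurableM => //.
    apply: (@cmeasurable_partial_cintegral _ _ _ _ _ mu
      (fun z => (\1_A z.2)%:C * P n z.1 z.2)).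
    apply: cmeasurableM => //; apply: cmeasurable_real.
    by apply: (measurableT_comp (f := \1_A : X -> R)) => //; exact: measurable_indic.
  + apply: cmeasurableM; first exact: cmeasurable_cst.
    exact: (cintegrable_cmeasurable (cintegrable_inner (ltwoP f) AL)).
  + apply: filterS Acvg => x hx.
    rewrite (_ : (fun n => _) = (fun n => nc (f x) * nc (w n x - (C * \1_A x)%:C))).
      by rewrite -[0](mulr0 (nc (f x))); apply: cvgM => //; exact: cvg_cst.
    apply/funext => n; rewrite -Normc.normcM mulrBr conjc_real rmorphM.
    by congr (nc (_ - _)); rewrite mulrCA.
  + have aeS : {ae mu, forall x, S x}.
      by exists (~` S); split => //; [apply: measurableC; exact: summ_mS H|exact: summ_full H].
    apply: filterS aeS => x Sx; split => [n|]; rewrite !Normc.normcM mulrC.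
      rewrite ler_wpM2r ?normc_ge0//.
      have nP0 := summ_schur H n Sx.
      have Pi : cintegrable mu setT (P n x).
        apply: cintegrableP.
          exact: (cmeasurable_comp (mP n) (pair1_measurable x)).
        exact: le_lt_trans nP0 (ltry _).
      apply: (@le_trans _ _ (\int[mu]_x' nc (P n x x'))).
        apply: le_normc_cintegral_dom.
        * apply: cmeasurableM; last exact: (cintegrable_cmeasurable Pi).
          by apply: cmeasurable_real; exact: measurable_indic.
        * exact: cintegrable_normc Pi.
        * move=> x'; rewrite Normc.normcM normc_real indicE.
          by case: (x' \in A); rewrite ?normr1 ?normr0 ?mul1r ?mul0r ?normc_ge0.
      rewrite -lee_fin /Rintegral fineK//.
      exact: integrable_fin_num (cintegrable_normc Pi).
    rewrite conjc_real mulrC !normc_real mulrCA ger0_norm ?(ltW (summ_C H))//.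
    rewrite mulrCA ler_wpM2l ?(ltW (summ_C H))// indicE.
    by case: (x \in A); rewrite ?normr1 ?normr0 ?mulr1 ?mulr0 ?normc_ge0.
Qed.

End BesselKernels.

Section TransformPair.
Context d1 d2 (X : measurableType d1) (Y : measurableType d2) (R : realType).
Variables (mu : {sigma_finite_measure set X -> \bar R}).
Variables (nu : {sigma_finite_measure set Y -> \bar R}).
Variable phase : X -> Y -> R.
Let phase' y x := - phase x y.
Hypothesis mphase : measurable_fun setT (fun z : X * Y => phase z.1 z.2).
Hypothesis mphase' : measurable_fun setT (fun z : Y * X => phase' z.1 z.2).
Variables (K : nat -> set X) (K' : nat -> set Y).
Hypothesis mK : forall n, measurable (K n).
Hypothesis K_fin : forall n, (mu (K n) < +oo)%E.
Hypothesis K_cover : forall x, \forall n \near \oo, K n x.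
Hypothesis mK' : forall n, measurable (K' n).
Hypothesis K'_fin : forall n, (nu (K' n) < +oo)%E.
Hypothesis K'_cover : forall x, \forall n \near \oo, K' n x.
Variable C : R.
Hypothesis C_ge0 : 0 <= C.
Hypothesis bC : bessel mu nu phase C.
Hypothesis bC' : bessel nu mu phase' C.

Local Notation F := (transform nu phase K).
Local Notation G := (transform mu phase' K').
Local Notation FP := (transform_cvg mphase mK K_fin K_cover C_ge0 bC).
Local Notation GP := (transform_cvg mphase' mK' K'_fin K'_cover C_ge0 bC').

Lemma ft_adjoint (f : Ltwo mu) (g : Ltwo nu) :
  cintegrable mu setT f -> cintegrable nu setT g ->
  inner nu (ft mu phase f) g = inner mu f (ft nu phase' g).
Proof.
move=> fi gi; have := ft_duality mphase fi (cintegrableJ gi) => E.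
transitivity (cintegral nu setT (fun y => conjc (g y) * ft mu phase f y)).
  by apply: eq_cintegral => y _; rewrite mulrC.
rewrite E; apply: eq_cintegral => x _; congr (_ * _).
rewrite /ft -cintegralJ.
  by apply: eq_cintegral => y _; rewrite conjM conjc_expi /phase' opprK.
apply: cintegrable_expi => //; apply: measurableT_comp => //.
exact: (measurable_phase1 mphase').
Qed.

Lemma transform_adjoint (f : Ltwo mu) (g : Ltwo nu) :
  inner nu (F f) g = inner mu f (G g).
Proof.
have fi n := cintegrable_cut f (mK n) (K_fin n).
have gi n := cintegrable_cut g (mK' n) (K'_fin n).
apply: (@complex_eq_cvg _ (fun n => inner nu (ft_cut nu phase K n f) (ltwo_cut (K' n) g))).
  by apply: inner_cvg; [exact: FP|exact: ltwo_cut_cvg].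
rewrite (_ : (fun n => _) = (fun n =>
  nc (inner mu (ltwo_cut (K n) f) (ft_cut mu phase' K' n g) - inner mu f (G g)))).
  by apply: inner_cvg; [exact: ltwo_cut_cvg|exact: GP].
apply/funext => n; congr (nc (_ - _)).
have E1 := ft_cutE mphase mK K_fin bC n f; have E2 := ft_cutE mphase' mK' K'_fin bC' n g.
by rewrite /inner E1 E2; exact: ft_adjoint.
Qed.

Variables (chi : nat -> Y -> R) (S : set X) (J : set (set X)).
Hypothesis summ : summability mu nu phase chi S C.
Hypothesis appr : approximate_identity mu nu phase chi C J.

(** It suffices to test against the indicators of [J], where the kernels converge;
    the truncations of [f] make the integrals absolutely convergent. *)
Lemma transform_inversion (f : Ltwo mu) :
  ipnorm (rip mu) (G (F f) - C%:C *: f) = 0.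
Proof.
apply: (appr_total appr) => A JA.
have mA := appr_meas appr JA; have Afin := appr_fin appr JA.
have AL := L2_indic mA Afin.
pose t := toL2 mu (fun x => (\1_A x)%:C : R[i]).
have tE : t = (fun x => (\1_A x)%:C) :> (X -> R[i]) by rewrite /t toL2E.
have ti : cintegrable mu setT t by rewrite tE; exact: cintegrable_indic.
have -> (r : Ltwo mu) : cintegral mu A r = inner mu r t.
  rewrite cintegral_mkcond// /inner tE; apply: eq_cintegral => x _.
  by rewrite conjc_real.
rewrite innerBl innerZl (innerC t) -transform_adjoint -innerC.
apply/eqP; rewrite subr_eq0; apply/eqP.
apply: (@complex_eq_cvg _ (fun n => inner nu (ft_cut nu phase K n f) (F t))).
  by apply: inner_cvg; [exact: FP|rewrite subrr ipnorm0; [exact: cvg_cst|exact: rip_semi_hilbert]].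
rewrite (_ : (fun n => _) = (fun n => nc C%:C *
    nc (inner mu (ltwo_cut (K n) f) t - inner mu f t))).
  rewrite -[0](mulr0 (nc C%:C)); apply: cvgM; first exact: cvg_cst.
  apply: inner_cvg; first exact: ltwo_cut_cvg.
  by rewrite subrr ipnorm0; [exact: cvg_cst|exact: rip_semi_hilbert].
apply/funext => n; rewrite -Normc.normcM mulrBr; congr (nc (_ - _)).
have fi := cintegrable_cut f (mK n) (K_fin n).
have := ft_inner_test mphase summ fi mA Afin (appr_cvg appr JA).
rewrite -tE => <-; rewrite /inner (ft_cutE mphase mK K_fin bC n f).
apply: ae_eq_innerr.
- exact: L2_cmeasurable (ltwoP _).
- by apply: ft_cmeasurable => //; exact: (cintegrable_cmeasurable ti).
- by apply: ft_cmeasurable => //; exact: (cintegrable_cmeasurable fi).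
- exact: (transform_integrable mphase mK K_fin K_cover C_ge0 bC ti).
Qed.

Lemma transform_parseval (f h : Ltwo mu) :
  inner nu (F f) (F h) = C%:C * inner mu f h.
Proof.
rewrite transform_adjoint.
have -> : inner mu f (G (F h)) = inner mu f (G (F h) - C%:C *: h : Ltwo mu) +
    inner mu f (C%:C *: h : Ltwo mu) by rewrite -innerDr subrK.
have -> : inner mu f (G (F h) - C%:C *: h : Ltwo mu) = 0.
  apply/Normc.eq0_normc/eqP; rewrite eq_le normc_ge0 andbT.
  by apply: le_trans (inner_cauchy_schwarz _ _) _; rewrite transform_inversion mulr0.
by rewrite add0r innerZr conjc_real.
Qed.

End TransformPair.

(** * Abel summation on the line *)

Section EqualMeasures.
Context d (T : measurableType d) (R : realType).
Variables m1 m2 : {measure set T -> \bar R}.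
Hypothesis m12 : forall A, measurable A -> m1 A = m2 A.

Lemma eq_measure_Rintegral D (h : T -> R) : \int[m1]_(x in D) h x = \int[m2]_(x in D) h x.
Proof. by rewrite /Rintegral (eq_measure_integral m2)// => A mA _; exact: m12. Qed.

Lemma eq_measure_cintegral D f : cintegral m1 D f = cintegral m2 D f.
Proof. by rewrite /cintegral !eq_measure_Rintegral. Qed.

Lemma eq_measure_int D (h : T -> \bar R) :
  (\int[m1]_(x in D) h x = \int[m2]_(x in D) h x)%E.
Proof. by rewrite (eq_measure_integral m2)// => A mA _; exact: m12. Qed.

Lemma eq_measure_integrable D (h : T -> \bar R) : m2.-integrable D h -> m1.-integrable D h.
Proof.
by move=> /integrableP[mh hi]; apply/integrableP; split => //; rewrite eq_measure_int.
Qed.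

End EqualMeasures.

Lemma ae_imp2 d (T : measurableType d) (R : realType)
    (mu : {measure set T -> \bar R}) (P Q S : T -> Prop) :
  {ae mu, forall x, P x} -> {ae mu, forall x, Q x} ->
  (forall x, P x -> Q x -> S x) -> {ae mu, forall x, S x}.
Proof. by move=> hP hQ PQS; apply: filterS2 hP hQ => x; exact: PQS. Qed.

Section InvariantMap.
Context d (T : measurableType d) (R : realType).
Variable mu : {measure set T -> \bar R}.
Variable phi : T -> T.
Hypothesis mphi : measurable_fun setT phi.
Hypothesis phi_inv : forall A, measurable A -> mu (phi @^-1` A) = mu A.

Lemma ge0_integral_invariant (f : T -> \bar R) : measurable_fun setT f ->
  (forall x, (0 <= f x)%E) -> (\int[mu]_x f (phi x) = \int[mu]_x f x)%E.
Proof.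
move=> mf f0.
have H := ge0_integral_pushforward mphi mu measurableT mf (fun x _ => f0 x).
rewrite preimage_setT in H; rewrite -[LHS]H.
by apply: eq_measure_integral => A mA _; exact: phi_inv.
Qed.

Lemma integrable_invariant (f : T -> \bar R) : mu.-integrable setT f ->
  mu.-integrable setT (f \o phi).
Proof.
move=> /integrableP[mf fi]; apply/integrableP; split; first exact: measurableT_comp.
have ma : measurable_fun setT (abse \o f) by exact: measurableT_comp.
have E := ge0_integral_invariant ma (fun x => abse_ge0 (f x)).
by rewrite -[X in (X < _)%E]/(\int[mu]_x (abse \o f) (phi x))%E E.
Qed.

Lemma Rintegral_invariant (h : T -> R) : mu.-integrable setT (EFin \o h) ->
  \int[mu]_x h (phi x) = \int[mu]_x h x.
Proof.
move=> hi; have mh : measurable_fun setT (EFin \o h) := measurable_int _ hi.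
have H := integral_pushforward mphi mh (integrable_invariant hi) measurableT.
rewrite preimage_setT in H; rewrite /Rintegral -[X in fine X = _]H; congr fine.
by apply: eq_measure_integral => A mA _; exact: phi_inv.
Qed.

Lemma cintegral_invariant (f : T -> R[i]) : cintegrable mu setT f ->
  cintegral mu setT (f \o phi) = cintegral mu setT f.
Proof.
move=> [f1 f2]; rewrite /cintegral; congr (_ +i* _).
- exact: (Rintegral_invariant f1).
- exact: (Rintegral_invariant f2).
Qed.

End InvariantMap.

Section LineIntegrals.
Variable R : realType.
Local Notation leb := (@lebesgue_measure R).
Implicit Types (h : R -> R) (z dl : R).

Lemma Rintegral_reflection h : leb.-integrable setT (EFin \o h) ->
  \int[leb]_x h (- x) = \int[leb]_x h x.
Proof.
apply: Rintegral_invariant; first exact: oppr_measurable.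
by move=> A mA; exact: lebesgue_measureN.
Qed.

Definition abel_weight dl (y : R) : R := expR (- (dl * `|y|)).

Lemma continuous_abel_weight dl : continuous (abel_weight dl).
Proof.
move=> y; apply: continuous_comp; last exact: continuous_expR.
by apply: continuousN; apply: continuousM; [exact: cvg_cst|exact: norm_continuous].
Qed.

Lemma continuous_cosM z : continuous (fun y => cos (z * y)).
Proof.
move=> y; apply: continuous_comp; last exact: continuous_cos.
exact: mulrl_continuous.
Qed.

Lemma continuous_sinM z : continuous (fun y => sin (z * y)).
Proof.
move=> y; apply: continuous_comp; last exact: continuous_sin.
exact: mulrl_continuous.
Qed.

Definition poisson_kernel dl z : R := 2 * dl / (dl ^+ 2 + z ^+ 2).

Let f1 dl z y := abel_weight dl y * (1 + cos (z * y)).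

(** The constant one is added to the cosine to make the integrand nonnegative, so that
    its integral over the line is the limit of a primitive. *)
Lemma abel_integral_shifted dl z : 0 < dl ->
  (\int[leb]_y (abel_weight dl y * (1 + cos (z * y)))%:E =
   (2 / dl + poisson_kernel dl z)%:E)%E.
Proof.
move=> d0; have dn0 : dl != 0 by rewrite gt_eqF.
have D0 : 0 < dl ^+ 2 + z ^+ 2 by rewrite ltr_pwDl ?exprn_gt0// sqr_ge0.
have Dn0 : dl ^+ 2 + z ^+ 2 != 0 by rewrite gt_eqF.
have f0 y : 0 <= f1 dl z y.
  by rewrite mulr_ge0 ?expR_ge0//; have := cos_geN1 (z * y); lra.
have cf : continuous (f1 dl z).
  move=> y; apply: continuousM; first exact: continuous_abel_weight.
  by apply: continuousD; [exact: cvg_cst|exact: continuous_cosM].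
rewrite (@ge0_symfun_integralT R (f1 dl z))//; last first.
  by move=> y; rewrite /f1 /abel_weight /= normrN mulrN cosN.
rewrite -set_itvcy.
pose F (y : R) : R := - expR (- dl * y) / dl +
  expR (- dl * y) * ((z * sin (z * y) - dl * cos (z * y)) / (dl ^+ 2 + z ^+ 2)).
have cE : continuous (fun y : R => expR (- dl * y) : R).
  by move=> y; apply: continuous_comp; [exact: mulrl_continuous|exact: continuous_expR].
have cF : continuous F.
  move=> y; apply: cvgD.
    by apply: cvgM; [apply: cvgN; exact: cE|exact: cvg_cst].
  apply: cvgM; first exact: cE.
  apply: cvgM; last exact: cvg_cst.
  by apply: cvgB; (apply: cvgM; first exact: cvg_cst);
    [exact: continuous_sinM|exact: continuous_cosM].
have dF (y : R) : is_derive y 1 F (expR (- dl * y) * (1 + cos (z * y))).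
  have dM (k : R) : is_derive y 1 (fun y => k * y) k.
    have h : is_derive y 1 (k *: (@id R)) (k *: (1 : R)) by exact: is_deriveZ.
    by apply: (is_derive_eq h); rewrite /GRing.scale /= mulr1.
  have dE := is_derive1_comp (is_derive_expR _) (dM (- dl)).
  have dS := is_derive1_comp (is_derive_sin _) (dM z).
  have dC := is_derive1_comp (is_derive_cos _) (dM z).
  have d1 := is_deriveZ (- dl^-1) dE.
  have d2 := is_deriveZ (dl ^+ 2 + z ^+ 2)^-1 (is_deriveB (is_deriveZ z dS) (is_deriveZ dl dC)).
  have d3 := is_deriveD d1 (is_deriveM dE d2).
  have FE : F = (fun t => - dl^-1 * expR (- dl * t) + expR (- dl * t) *
      ((dl ^+ 2 + z ^+ 2)^-1 * (z * sin (z * t) - dl * cos (z * t)))).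
    by apply/funext => t; rewrite /F; field; rewrite Dn0 dn0.
  rewrite FE.
  apply: (is_derive_eq d3).
  change (- dl^-1 * (expR (- dl * y) * - dl) + (expR (- dl * y) *
    ((dl ^+ 2 + z ^+ 2)^-1 * (z * (cos (z * y) * z) - dl * (- sin (z * y) * z))) +
    ((dl ^+ 2 + z ^+ 2)^-1 * (z * sin (z * y) - dl * cos (z * y))) *
    (expR (- dl * y) * - dl)) = expR (- dl * y) * (1 + cos (z * y))).
  field.
  by rewrite Dn0 dn0.
rewrite (@ge0_continuous_FTC2y R _ F 0 0).
- rewrite sub0e -EFinN -EFinM; congr (_%:E).
  rewrite /F !mulr0 sin0 cos0 expR0 /poisson_kernel; field.
  by rewrite Dn0 dn0.
- by move=> y _; exact: f0.
- by apply: continuous_subspaceT => y; exact: cf.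
- have e0 : expR (- dl * y) @[y --> +oo] --> (0 : R).
    have c1 : (dl * y : R) @[y --> +oo%R] --> +oo%R.
      by apply: gt0_cvgMry => //; exact: cvg_id.
    have := cvg_comp _ _ c1 (@cvgr_expR R); apply: cvg_trans; apply: near_eq_cvg.
    by apply: nearW => y /=; rewrite mulNr.
  rewrite -[X in _ --> X](addr0 0); apply: cvgD.
    rewrite -[X in _ --> X](mul0r dl^-1); apply: cvgM; last exact: cvg_cst.
    by rewrite -[X in _ --> X]oppr0; exact: cvgN.
  pose K := (`|z| + `|dl|) / (dl ^+ 2 + z ^+ 2).
  apply/norm_cvg0P.
  apply: (@squeeze_cvgr _ _ _ _ (fun=> 0) (fun y => expR (- dl * y) * K)).
  + apply: nearW => y; rewrite normr_ge0 /= normrM ger0_norm ?expR_ge0//.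
    rewrite ler_wpM2l ?expR_ge0// normrM [`|_^-1|]ger0_norm ?invr_ge0 ?(ltW D0)//.
    rewrite ler_wpM2r ?invr_ge0 ?(ltW D0)//.
    apply: le_trans (ler_normB _ _) _; rewrite !normrM; apply: lerD.
    * by rewrite ler_piMr// sin_max.
    * by rewrite ler_piMr// cos_max.
  + exact: cvg_cst.
  + by rewrite -[X in _ --> X](mul0r K); apply: cvgM => //; exact: cvg_cst.
- by move=> y _; apply: ex_derive.
- by apply: cvg_at_right_filter; exact: cF.
- move=> y; rewrite in_itv/= andbT => y0.
  by rewrite derive1E derive_val /f1 /abel_weight gtr0_norm// mulNr.
Qed.

Lemma abel_weight_integrable dl : 0 < dl -> leb.-integrable setT (EFin \o abel_weight dl).
Proof.
move=> d0; apply/integrableP; split.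
  by apply/measurable_EFinP; apply: continuous_measurable_fun; exact: continuous_abel_weight.
under eq_integral do rewrite /= ger0_norm ?expR_ge0//.
have := abel_integral_shifted 0 d0; move=> E.
apply: (@le_lt_trans _ _ (\int[leb]_y (abel_weight dl y * (1 + cos (0 * y)))%:E)%E).
  apply: ge0_le_integral => //.
  - by move=> y _; rewrite lee_fin expR_ge0.
  - by apply/measurable_EFinP; apply: continuous_measurable_fun; exact: continuous_abel_weight.
  - apply/measurable_EFinP; apply: continuous_measurable_fun => y.
    apply: continuousM; first exact: continuous_abel_weight.
    by apply: continuousD; [exact: cvg_cst|exact: continuous_cosM].
  - by move=> y _; rewrite lee_fin mul0r cos0; have := expR_ge0 (- (dl * `|y|)); rewrite /abel_weight; lra.
by rewrite E ltry.
Qed.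

Lemma abel_transform dl z : 0 < dl ->
  cintegral leb setT (fun y => (abel_weight dl y)%:C * expi (z * y)) =
  (poisson_kernel dl z)%:C.
Proof.
move=> d0; have wi := abel_weight_integrable d0.
have bi (g : R -> R) : continuous g -> (forall y, `|g y| <= 1) ->
    leb.-integrable setT (EFin \o (fun y => abel_weight dl y * g y)).
  move=> cg g1; apply: (integrable_dominated _ wi).
    apply: continuous_measurable_fun => y.
    by apply: continuousM; [exact: continuous_abel_weight|exact: cg].
  by move=> y; rewrite normrM ger0_norm ?expR_ge0// ler_piMr// expR_ge0.
have ci := bi _ (@continuous_cosM z) (fun y => cos_max _).
have si := bi _ (@continuous_sinM z) (fun y => sin_max _).
have two0 : (\int[leb]_y (abel_weight dl y)%:E = (2 / dl)%:E)%E.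
  have := abel_integral_shifted 0 d0.
  under eq_integral do rewrite mul0r cos0 mulrC.
  rewrite integralZ_ge0; [|lra|by move=> y; exact: expR_ge0
    |by apply: continuous_measurable_fun; exact: continuous_abel_weight].
  have i0 := integrable_fin_num measurableT wi.
  rewrite -(fineK i0) -EFinM => -[] E; congr (_%:E); move: E.
  rewrite /poisson_kernel expr0n /= addr0.
  have -> : 2 * dl / dl ^+ 2 = 2 / dl by field; rewrite gt_eqF.
  lra.
rewrite /cintegral; apply: complex_eqP => /=.
- have E := abel_integral_shifted z d0.
  have : \int[leb]_y (abel_weight dl y * (1 + cos (z * y))) = 2 / dl + poisson_kernel dl z.
    by rewrite /Rintegral E.
  under eq_Rintegral do rewrite mulrDr mulr1.
  rewrite RintegralD// {1}/Rintegral two0 /= => /addrI <-.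
  by apply: eq_Rintegral => y _; rewrite mul0r subr0.
- under eq_Rintegral do rewrite mul0r addr0.
  have := Rintegral_reflection si.
  have -> : \int[leb]_y (abel_weight dl (- y) * sin (z * - y)) =
      \int[leb]_y (-1 * (abel_weight dl y * sin (z * y))).
    by apply: eq_Rintegral => y _; rewrite /abel_weight normrN mulrN sinN mulrN mulN1r.
  rewrite RintegralZl//; set I := Rintegral _ _ _ => E.
  by rewrite -[RHS]/0; lra.
Qed.

Lemma poisson_kernel_ge0 dl z : 0 < dl -> 0 <= poisson_kernel dl z.
Proof.
by move=> d0; rewrite divr_ge0 ?mulr_ge0 ?(ltW d0)// addr_ge0// sqr_ge0.
Qed.

Lemma continuous_poisson_kernel dl x : 0 < dl ->
  continuous (fun y : R => poisson_kernel dl (y - x)).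
Proof.
move=> d0 y; apply: cvgM; first exact: cvg_cst.
apply: cvgV; first by rewrite gt_eqF// ltr_pwDl ?exprn_gt0// sqr_ge0.
apply: cvgD; first exact: cvg_cst.
have c : (fun y : R => y - x) @ y --> y - x by apply: cvgB; [exact: cvg_id|exact: cvg_cst].
by under eq_fun do rewrite expr2; rewrite expr2; exact: cvgM.
Qed.

Lemma poisson_kernel_itv dl x a b : 0 < dl -> a < b ->
  (\int[leb]_(y in `[a, b]) (poisson_kernel dl (y - x))%:E =
  (2 * atan ((b - x) / dl) - 2 * atan ((a - x) / dl))%:E)%E.
Proof.
move=> d0 ab; have dn0 : dl != 0 by rewrite gt_eqF.
pose F (y : R) : R := 2 * atan ((y - x) / dl).
have cF : continuous F.
  move=> y; apply: cvgM; first exact: cvg_cst.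
  have c1 : (fun y : R => (y - x) / dl) @ y --> (y - x) / dl.
    by apply: cvgM; [apply: cvgB; [exact: cvg_id|exact: cvg_cst]|exact: cvg_cst].
  exact: (cvg_comp _ _ c1 (@continuous_atan R ((y - x) / dl))).
have dF (y : R) : is_derive y 1 F (poisson_kernel dl (y - x)).
  have h : is_derive y 1 (fun y => (y - x) / dl) (dl^-1).
    have h0 := is_deriveZ dl^-1 (is_deriveB (is_derive_id y 1) (is_derive_cst x y 1)).
    rewrite (_ : (fun y => _) = (fun y => dl^-1 * (y - x))).
      by apply: (is_derive_eq h0); rewrite subr0 /GRing.scale /= mulr1.
    by apply/funext => t; rewrite mulrC.
  have g := @is_derive1_comp R _ (fun y => (y - x) / dl) y _ _ (is_derive1_atan ((y - x) / dl)) h.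
  have k : is_derive y 1 (fun y => 2 *: (atan \o (fun y => (y - x) / dl)) y)
      (2 *: ((1 + ((y - x) / dl) ^+ 2)^-1 * dl^-1)) by exact: is_deriveZ.
  apply: (is_derive_eq k); rewrite /GRing.scale /= /poisson_kernel; field.
  have p0 : dl ^+ 2 + (y - x) ^+ 2 != 0.
    by rewrite gt_eqF// ltr_pwDl ?exprn_gt0// sqr_ge0.
  by rewrite p0 dn0.
rewrite (@continuous_FTC2 _ _ F)//.
- by apply: continuous_subspaceT => y; exact: continuous_poisson_kernel.
- split; first by move=> y _; apply: ex_derive.
  + by apply: cvg_at_right_filter; exact: cF.
  + by apply: cvg_at_left_filter; exact: cF.
- by move=> y _; rewrite derive1E derive_val.
Qed.

(** On a bounded interval the integral is a difference of two arctangents. *)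
Lemma poisson_kernel_total dl x : 0 < dl ->
  (\int[leb]_y (poisson_kernel dl (y - x))%:E <= (2 * pi)%:E)%E.
Proof.
move=> d0.
pose g (n : nat) y := (poisson_kernel dl (y - x) * \1_(`[- n%:R, n%:R]%classic) y)%:E : \bar R.
have g0 n y : (0 <= g n y)%E.
  by rewrite lee_fin mulr_ge0 ?poisson_kernel_ge0// indicE.
have mp : measurable_fun setT (fun y : R => poisson_kernel dl (y - x)).
  by apply: continuous_measurable_fun; exact: continuous_poisson_kernel.
have -> : (\int[leb]_y (poisson_kernel dl (y - x))%:E =
    \int[leb]_y limn_einf (g ^~ y))%E.
  apply: eq_integral => y _.
  have hy : (g ^~ y) @ \oo --> (poisson_kernel dl (y - x))%:E.
    apply: cvg_near_cst; near=> n; rewrite /g indicE (_ : y \in _) ?mulr1//.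
    rewrite inE /= in_itv/= -ler_norml.
    by near: n; exact: nbhs_infty_ger.
  by rewrite is_cvg_limn_einfE ?(cvg_lim _ hy)//; apply: cvgP hy.
apply: le_trans (fatou _ measurableT _ _) _ => //.
  move=> n; apply/measurable_EFinP.
  by apply: (measurable_funM mp); exact: (measurable_indic (measurable_itv _)).
apply: limn_einf_le => n.
have -> : (\int[leb]_y g n y =
    \int[leb]_(y in (`[(- n%:R)%R, n%:R%R])%classic) (poisson_kernel dl (y - x))%:E)%E.
  rewrite [RHS]integral_mkcond; apply: eq_integral => y _.
  by rewrite patchE /g indicE; case: (y \in _); rewrite ?mulr1 ?mulr0.
case: n => [|n]; first by rewrite oppr0 set_itv1 integral_set1 lee_fin mulr_ge0 ?pi_ge0.
rewrite poisson_kernel_itv// ?gtrN// lee_fin.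
have := atan_ltpi2 ((n.+1%:R - x) / dl); have := atan_gtNpi2 ((- n.+1%:R - x) / dl).
lra.
Unshelve. all: by end_near. Qed.

End LineIntegrals.

Section PrimitiveTest.
Variable R : realType.
Local Notation leb := (@lebesgue_measure R).

(** Lebesgue differentiation of the primitive, which vanishes identically. *)
Lemma ae_eq0_primitive (h : R -> R) (a b : R) :
  leb.-integrable `[a, b]%classic (EFin \o h) ->
  (forall x, a < x <= b -> \int[leb]_(y in `[a, x]) h y = 0) ->
  {ae leb, forall x, a < x < b -> h x = 0}.
Proof.
move=> hi h0; have mab : measurable (`[a, b]%classic : set (measurableTypeR R)) by exact: measurable_itv.
pose g := h \_ `[a, b]%classic.
have gi : leb.-integrable setT (EFin \o g).
  by have := (@integrable_mkcond _ (measurableTypeR R) _ leb _ (EFin \o h) mab).1 hi; rewrite restrict_EFin.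
have F0 y : \int[leb]_(t in [set` Interval (BLeft a) (BRight y)]) g t = 0.
  have [ya|ay] := leP y a.
    rewrite -[LHS]/(fine _); move: ya; rewrite le_eqVlt => /orP[/eqP ->|ya].
      by rewrite set_itv1 integral_set1.
    by rewrite set_itv_ge ?integral_set0//= bnd_simp -ltNge.
  rewrite /Rintegral /g.
  under eq_integral do rewrite -[_%:E]/((EFin \o (h \_ `[a, b]%classic)) _) -restrict_EFin.
  rewrite -integral_mkcondr.
  have [yb|/ltW yb] := leP y b.
    rewrite (_ : _ `&` _ = `[a, y]%classic); first by rewrite -/(Rintegral _ _ _) h0// ay.
    apply/seteqP; split => x /=; rewrite !in_itv/=; first by case.
    by move=> /andP[ax xy]; rewrite ax xy (le_trans xy yb).
  rewrite (_ : _ `&` _ = `[a, b]%classic); last first.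
    apply/seteqP; split => x /=; rewrite !in_itv/=; first by case.
    by move=> /andP[ax xb]; rewrite ax xb (le_trans xb yb).
  have [ab|ba] := ltP a b; first by rewrite -/(Rintegral _ _ _) h0// ab lexx.
  move: ba; rewrite le_eqVlt => /orP[/eqP ->|ba]; first by rewrite set_itv1 integral_set1.
  by rewrite set_itv_ge ?integral_set0//= bnd_simp -ltNge.
have gl : locally_integrable setT g by apply: integrable_locally => //; exact: measurable_itv.
have gy y : leb.-integrable [set` Interval (BLeft a) (BRight y)] (EFin \o g).
  by apply: (@integrableS _ _ _ leb setT) => //; exact: measurable_itv.
have := FTC1 gy gl; rewrite /= (funext F0) => H.
apply: (@filterS _ _ (ae_filter_ringOfSetsType leb) _ _ _ H) => x + /andP[ax xb].
rewrite lte_fin ax => /(_ isT)[_].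
rewrite derive1E derive_cst /g patchE ifT//.
by rewrite inE /= in_itv/= !ltW.
Qed.

(** All primitives of a function orthogonal to the closed subintervals vanish, hence
    so does the function almost everywhere. *)
Lemma interval_total (mu : {sigma_finite_measure set (measurableTypeR R) -> \bar R})
    (D : set (measurableTypeR R)) (I : nat -> R * R) (r : Ltwo mu) :
  (forall A, measurable A -> mu A = leb (A `&` D)) -> measurable D ->
  (forall n, `[(I n).1, (I n).2]%classic `<=` D) ->
  leb (D `\` \bigcup_n `](I n).1, (I n).2[%classic) = 0%E ->
  (forall n x, (I n).1 < x <= (I n).2 -> cintegral mu `[(I n).1, x]%classic r = 0) ->
  ipnorm (rip mu) r = 0.
Proof.
move=> muE mD ID D0 r0.
have eqI A : A `<=` D -> forall B, measurable B -> B `<=` A -> mu B = leb B.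
  by move=> AD B mB BA; rewrite muE// (setIidl (subset_trans BA AD)).
have mrr := L2_cmeasurable (ltwoP r).
have key (h : measurableTypeR R -> R) n : measurable_fun setT h ->
    mu.-integrable `[(I n).1, (I n).2]%classic (EFin \o h) ->
    (forall x, (I n).1 < x <= (I n).2 -> \int[mu]_(y in `[(I n).1, x]) h y = 0) ->
    {ae leb, forall x, (I n).1 < x < (I n).2 -> h x = 0}.
  move=> mh hi h0; apply: ae_eq0_primitive.
    move/integrableP : hi => [mh' hi]; apply/integrableP; split => //.
    by rewrite -(eq_measure_integral _ (eqI _ (ID n))).
  move=> x /andP[ax xb]; rewrite -[RHS](h0 x) ?ax ?xb//; rewrite /Rintegral; congr fine.
  apply: eq_measure_integral => B mB BA; symmetry; apply: (eqI `[(I n).1, x]%classic) => //.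
  apply: subset_trans (ID n) => y /=; rewrite !in_itv/= => /andP[-> yx].
  exact: le_trans yx xb.
have int_re n : mu.-integrable `[(I n).1, (I n).2]%classic (EFin \o (fun x => Re (r x))) /\
    mu.-integrable `[(I n).1, (I n).2]%classic (EFin \o (fun x => Im (r x))).
  have mI : measurable (`[(I n).1, (I n).2]%classic : set (measurableTypeR R)).
    exact: measurable_itv.
  have fin : (mu `[(I n).1, (I n).2]%classic < +oo)%E.
    rewrite (eqI _ (ID n))// lebesgue_measure_itv.
    by case: ifP => _; rewrite -?EFinB ltry.
  have [h1 h2] := cintegrable_inner (ltwoP r) (L2_indic mI fin).
  split; [apply: (@integrable_mkcond _ (measurableTypeR R) _ mu _ (EFin \o (fun x => Re (r x))) mI).2|
    apply: (@integrable_mkcond _ (measurableTypeR R) _ mu _ (EFin \o (fun x => Im (r x))) mI).2].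
  - rewrite (_ : _ \_ _ = (fun x => (Re (r x * conjc
      (\1_(`[(I n).1, (I n).2]%classic : set (measurableTypeR R)) x)%:C))%:E))//.
    apply/funext => x; rewrite patchE conjc_real indicE.
    by case: (x \in _) => /=; case: (r x) => u v /=; congr (_%:E); ring.
  - rewrite (_ : _ \_ _ = (fun x => (Im (r x * conjc
      (\1_(`[(I n).1, (I n).2]%classic : set (measurableTypeR R)) x)%:C))%:E))//.
    apply/funext => x; rewrite patchE conjc_real indicE.
    by case: (x \in _) => /=; case: (r x) => u v /=; congr (_%:E); ring.
have aeR : {ae leb, forall x, forall n, (I n).1 < x < (I n).2 -> Re (r x) = 0}.
  apply: ae_foralln => n; apply: key; first exact: (mrr.1).
    exact: (int_re n).1.
  by move=> x hx; have := congr1 (fun z => Re z) (r0 _ _ hx).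
have aeI : {ae leb, forall x, forall n, (I n).1 < x < (I n).2 -> Im (r x) = 0}.
  apply: ae_foralln => n; apply: key; first exact: (mrr.2).
    exact: (int_re n).2.
  by move=> x hx; have := congr1 (fun z => Im z) (r0 _ _ hx).
rewrite -[r]subr0; apply: ltwo_eq_ae.
have [N [mN N0 hN]] : {ae leb, forall x, forall n, (I n).1 < x < (I n).2 -> r x = 0}.
  apply: (ae_imp2 aeR aeI) => x h1 h2 n hx.
  by apply: complex_eqP; rewrite ?(h1 n)// (h2 n).
pose U : set (measurableTypeR R) := \bigcup_n `](I n).1, (I n).2[%classic.
have mU : measurable U by apply: bigcup_measurable => n _; exact: measurable_itv.
have mDU : measurable (D `\` U) by exact: measurableD.
exists (N `|` (~` D `|` (D `\` U))); split.
- by apply: measurableU => //; apply: measurableU => //; exact: measurableC.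
- apply: etrans (muE _ _) _.
    by apply: measurableU => //; apply: measurableU => //; exact: measurableC.
  apply/eqP; rewrite eq_le measure_ge0 andbT.
  apply: (@le_trans _ _ (leb (N `|` (D `\` U)))).
    apply: le_measure; rewrite ?inE.
    + by apply: measurableI => //; apply: measurableU => //;
        apply: measurableU => //; exact: measurableC.
    + exact: measurableU.
    + by move=> x [[Nx|[nD|DU]] Dx]; [left|case: (nD Dx)|right].
  have e1 : (leb N <= 0)%E by rewrite N0.
  have e2 : (leb (D `\` U) <= 0)%E by rewrite D0.
  apply: le_trans (measureU2 _ mN mDU) _.
  by apply: le_trans (leeD e1 e2) _; rewrite adde0.
- move=> x; apply: contra_notP; rewrite -/(_ \/ _) => /not_orP[nN /not_orP[/contrapT Dx nDU]].
  have [n _ hx] : U x by apply: contrapT => nU; apply: nDU.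
  rewrite ltwo0; apply: contrapT => nr; apply: nN; apply: hN => h; apply: nr; apply: (h n).
  by move: hx; rewrite /= in_itv.
Qed.

End PrimitiveTest.

Section LineSummability.
Variable R : realType.
Local Notation leb := (@lebesgue_measure R).
Variables (mu nu : {sigma_finite_measure set (measurableTypeR R) -> \bar R}).
Hypothesis muE : forall A, measurable A -> mu A = leb A.
Hypothesis nuE : forall A, measurable A -> nu A = leb A.
Variables (c : R) (phase : measurableTypeR R -> measurableTypeR R -> R).
Hypothesis c2 : c ^+ 2 = 1.
Hypothesis phaseE : forall x y, phase x y = c * (x * y).

Definition abel_chi (n : nat) : measurableTypeR R -> R := abel_weight n.+1%:R^-1.

Lemma abel_kernelE n x x' : summability_kernel nu phase (abel_chi n) x x' =
  (poisson_kernel n.+1%:R^-1 (x' - x))%:C.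
Proof.
rewrite /summability_kernel (eq_measure_cintegral nuE).
rewrite (_ : poisson_kernel _ _ = poisson_kernel n.+1%:R^-1 (c * (x' - x))); last first.
  by rewrite /poisson_kernel exprMn c2 mul1r.
rewrite -abel_transform ?invr_gt0//; apply: eq_cintegral => y _.
by rewrite !phaseE; congr (_ * expi _); ring.
Qed.

Lemma line_summability : summability mu nu phase abel_chi setT (2 * pi).
Proof.
split.
- by move=> n y; exact: expR_ge0.
- by move=> n y; rewrite -expR0 ler_expR oppr_le0 mulr_ge0.
- by move=> n; apply: (eq_measure_integrable nuE); exact: abel_weight_integrable.
- apply/aeW => y.
  have c0 : (fun n => - (n.+1%:R^-1 * `|y|)) @ \oo --> (0 : R).
    rewrite -[X in _ --> X]oppr0; apply: cvgN; rewrite -[X in _ --> X](mul0r `|y|).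
    by apply: cvgM; [exact: cvg_harmonic|exact: cvg_cst].
  have := cvg_comp _ _ c0 (@continuous_expR R 0); rewrite expR0; exact.
- exact: measurableT.
- by rewrite setCT measure0.
- by rewrite mulr_gt0 ?pi_gt0.
- move=> n x _; rewrite (eq_measure_int muE).
  have d0 : 0 < n.+1%:R^-1 :> R by rewrite invr_gt0.
  apply: le_trans (poisson_kernel_total x d0).
  rewrite le_eqVlt; apply/orP; left; apply/eqP; apply: eq_integral => x' _.
  by rewrite abel_kernelE normc_real ger0_norm// poisson_kernel_ge0.
Qed.

Lemma atan_scaled_cvg (u : R) : u != 0 ->
  (fun n => atan (u * n.+1%:R)) @ \oo --> Num.sg u * (pi / 2).
Proof.
have pos (v : R) : 0 < v -> (fun n => atan (v * n.+1%:R)) @ \oo --> (pi / 2 : R).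
  move=> v0; apply: (@cvg_comp _ _ _ (fun n => v * n.+1%:R) _ _ +oo%R _ _ (@cvgy_atan R)).
  apply/cvgryPge => A; near=> n.
  rewrite mulrC -ler_pdivrMr//; apply: le_trans (_ : n%:R <= _); last by rewrite ler_nat.
  by near: n; exact: nbhs_infty_ger.
rewrite neq_lt => /orP[u0|u0]; last by rewrite gtr0_sg// mul1r; exact: pos.
rewrite ltr0_sg// mulN1r.
have := pos (- u); rewrite oppr_gt0 => /(_ u0) /cvgN.
rewrite (_ : - _ = (fun n => atan (u * n.+1%:R)))//.
by apply/funext => n; rewrite -[LHS]/(- atan (- u * n.+1%:R)) mulNr atanN opprK.
Unshelve. all: by end_near. Qed.

Definition closed_intervals : set (set (measurableTypeR R)) :=
  [set `[ab.1, ab.2]%classic | ab in [set ab : R * R | ab.1 < ab.2]].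

Lemma line_approximate_identity :
  approximate_identity mu nu phase abel_chi (2 * pi) closed_intervals.
Proof.
split.
- by move=> A [[a b] /= ab <-]; exact: measurable_itv.
- move=> A [[a b] /= ab <-]; rewrite muE; last exact: measurable_itv.
  by rewrite lebesgue_measure_itv; case: ifP => _; rewrite -?EFinB ltry.
- move=> A [[a b] + <-]; rewrite [X in X -> _]/= => ab; rewrite -[`[(a, b).1, _]]/(`[a, b]).
  have nz (z : R) : {ae mu, forall x, x != z}.
    exists [set z]; split; first exact: measurable_set1.
      by rewrite muE; [exact: lebesgue_measure_set1|exact: measurable_set1].
    by move=> x /= /negP; rewrite negbK => /eqP.
  apply: (ae_imp2 (nz a) (nz b)) => x xa xb.
  pose q n : R := 2 * atan ((b - x) * n.+1%:R) - 2 * atan ((a - x) * n.+1%:R).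
  have qc : q @ \oo --> 2 * pi * (\1_`[a, b] x : R).
    have -> : 2 * pi * (\1_`[a, b] x : R) =
        2 * (Num.sg (b - x) * (pi / 2)) - 2 * (Num.sg (a - x) * (pi / 2)).
      rewrite indicE; case: (boolP (x \in _)) => [|/negP]; rewrite inE /= in_itv/=.
        move=> /andP[ax xb']; rewrite gtr0_sg ?ltr0_sg ?subr_gt0 ?subr_lt0.
        - by field.
        - by rewrite lt_neqAle eq_sym xa.
        - by rewrite lt_neqAle xb.
      move=> /negP; rewrite negb_and -!ltNge => /orP[xa'|bx].
        by rewrite !gtr0_sg ?subr_gt0// ?(lt_trans xa')//; ring.
      by rewrite !ltr0_sg ?subr_lt0// ?(lt_trans ab)//; ring.
    by apply: cvgB; (apply: cvgM; [exact: cvg_cst|apply: atan_scaled_cvg]);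
      rewrite subr_eq0 eq_sym.
  rewrite (_ : (fun n => _) = (fun n => `|q n - 2 * pi * (\1_`[a, b] x : R)|)).
    rewrite -[0](@normr0 _ R); apply: cvg_norm; rewrite -(subrr (2 * pi * \1_`[a, b] x)).
    by apply: cvgB => //; exact: cvg_cst.
  apply/funext => n; rewrite -normc_real rmorphB; congr (nc (_ - _)).
  have d0 : 0 < n.+1%:R^-1 :> R by rewrite invr_gt0.
  rewrite (eq_measure_cintegral muE).
  have E := poisson_kernel_itv x d0 ab; rewrite invrK in E.
  transitivity (cintegral leb `[a, b]%classic (fun y => (poisson_kernel n.+1%:R^-1 (y - x))%:C)).
    have mI : measurable (`[a, b]%classic : set (measurableTypeR R)) by exact: measurable_itv.
    rewrite (cintegral_mkcond leb _ mI).
    by apply: eq_cintegral => y _; rewrite abel_kernelE mulrC.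
  rewrite /cintegral /= /Rintegral E integral0_eq//.
- move=> r H; apply: (@interval_total _ mu setT (fun n => (- n.+1%:R, n.+1%:R))).
  + by move=> A mA; rewrite setIT muE.
  + exact: measurableT.
  + by move=> n x.
  + rewrite (_ : _ `\` _ = set0) ?measure0//; apply/seteqP; split => // x [_]; apply.
    exists (Num.truncn `|x|) => //=; rewrite in_itv/= -ltr_norml.
    exact: truncnS_gt.
  + by move=> n x /= /andP[nx _]; apply: H; exists (- n.+1%:R, x).
Qed.

End LineSummability.

(** * Fejer summation on the torus *)

Section FiniteSums.
Context d (T : measurableType d) (R : realType) (mu : {measure set T -> \bar R}).

Lemma cintegrable_sum (I : Type) (s : seq I) (F : I -> T -> R[i]) :
  (forall i, cintegrable mu setT (F i)) ->
  cintegrable mu setT (fun x => \sum_(i <- s) F i x).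
Proof.
move=> Fi; elim: s => [|i s IH].
  under eq_fun do rewrite big_nil.
  by split; [have := integrable0 mu setT|have := integrable0 mu setT].
by under eq_fun do rewrite big_cons; exact: cintegrableD.
Qed.

Lemma cintegral_sum (I : Type) (s : seq I) (F : I -> T -> R[i]) :
  (forall i, cintegrable mu setT (F i)) ->
  cintegral mu setT (fun x => \sum_(i <- s) F i x) =
  \sum_(i <- s) cintegral mu setT (F i).
Proof.
move=> Fi; elim: s => [|i s IH].
  under eq_fun do rewrite big_nil.
  by rewrite big_nil /cintegral /Rintegral !integral0.
under eq_fun do rewrite big_cons.
by rewrite big_cons cintegralD ?IH//; exact: cintegrable_sum.
Qed.

Lemma cintegral_indic (A : set T) : measurable A ->
  cintegral mu setT (fun x => (\1_A x)%:C) = (fine (mu A))%:C.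
Proof.
move=> mA; apply: complex_eqP.
  by rewrite /= /Rintegral integral_indic// setIT.
by rewrite /= /Rintegral integral0.
Qed.

Lemma cintegral_point (A : set T) (x0 : T) (g : T -> R[i]) :
  measurable A -> (mu A = 1)%E -> (forall x, A x -> x = x0) ->
  cintegrable mu setT (fun x => (\1_A x)%:C * g x) /\
  cintegral mu setT (fun x => (\1_A x)%:C * g x) = g x0.
Proof.
move=> mA A1 Ax.
have -> : (fun x => (\1_A x)%:C * g x) = (fun x => g x0 * (\1_A x)%:C).
  apply/funext => x; rewrite indicE; case: (boolP (x \in A)) => xA.
    by rewrite (Ax x (set_mem xA)) mulrC.
  by rewrite mul0r mulr0.
have i1 : cintegrable mu setT (fun x => (\1_A x)%:C : R[i]).
  by apply: cintegrable_indic => //; rewrite A1 ltry.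
by split; [exact: cintegrableZ|rewrite cintegralZ// cintegral_indic// A1 mulr1].
Qed.

Lemma finite_bounded_cintegrable (f : T -> R[i]) (c : R) : (mu setT < +oo)%E ->
  cmeasurable f -> (forall x, nc (f x) <= c) -> cintegrable mu setT f.
Proof.
move=> fin mf fc; apply: (@cintegrable_dominated _ _ _ mu f (fun=> c)) => //.
have := integrableZl measurableT c (integrable_normc_sq (L2_indic measurableT fin)).
apply: eq_integrable => // x _.
by rewrite indicE in_setT normc_real normr1 expr1n mule1.
Qed.

End FiniteSums.

Section TorusMeasures.
Variable R : realType.
Local Notation leb := (@lebesgue_measure R).
Local Notation mu := (space_measure R Torus).
Local Notation nu := (freq_measure R Torus).

Lemma integer_int (k : int) : integers R (k%:~R : R).
Proof. by exists k. Qed.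

Lemma freq_measure_set1 (k : int) : nu [set (k%:~R : R)] = 1%E.
Proof.
rewrite /freq_measure /mrestr setIidl; last by move=> x ->; exact: integer_int.
by rewrite /counting asboolT// fset_set1 finmap.cardfs1.
Qed.

Lemma freq_measure_integers : {ae nu, forall y, integers R y}.
Proof.
exists (~` integers R); split => //; first by apply: measurableC; exact: measurable_integers.
by rewrite /freq_measure /mrestr setICl measure0.
Qed.

Lemma space_measure_torus (A : set (measurableTypeR R)) :
  mu A = leb (A `&` `[0, 2 * pi[%classic).
Proof. by []. Qed.

Lemma space_measure_torus_fin : (mu setT < +oo)%E.
Proof.
rewrite space_measure_torus setTI lebesgue_measure_itv.
by case: ifP => _; rewrite -?EFinB ltry.
Qed.

Lemma Rintegral_torus (h : measurableTypeR R -> R) : measurable_fun setT h ->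
  \int[mu]_x h x = \int[leb]_(x in `[0, 2 * pi]) h x.
Proof.
move=> mh; rewrite /Rintegral; congr fine.
have mD : measurable (`[0, 2 * pi[%classic : set (measurableTypeR R)) by exact: measurable_itv.
transitivity (\int[mu]_(x in `[0%R, (2 * pi)%R[) (h x)%:E)%E.
  rewrite [RHS]integral_mkcond; apply: ae_eq_integral => //.
  - exact/measurable_EFinP.
  - by apply/(measurable_restrictT _ mD)/measurable_EFinP; exact: measurable_funS mh.
  - exists (~` `[0, 2 * pi[%classic); split; first exact: measurableC.
      by apply: etrans (space_measure_torus _) _; rewrite setICl measure0.
    move=> x /= H D; apply: H => _; by rewrite patchE ifT// inE.
transitivity (\int[leb]_(x in `[0%R, (2 * pi)%R[) (h x)%:E)%E.
  apply: eq_measure_integral => A mA AD.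
  by apply: etrans (space_measure_torus _) _; rewrite setIidl.
apply: integral_itv_bndo_bndc; apply/measurable_EFinP.
exact: measurable_funS mh.
Qed.

Lemma expi_nat (n : nat) (x : R) : expi (n%:R * x) = expi x ^+ n.
Proof.
elim: n => [|n IH]; first by rewrite mul0r expi0 expr0.
by rewrite -natr1 mulrDl mul1r expiD IH exprSr.
Qed.

Lemma expi_int_period (k : int) : expi (k%:~R * (2 * pi)) = 1 :> R[i].
Proof.
have e1 : expi (2 * pi) = 1 :> R[i].
  by rewrite mulr2n mulrDl mul1r -mulr2n /expi cos2pi sin2pi.
case: k => n; first by rewrite -pmulrn expi_nat e1 expr1n.
by rewrite NegzE mulrNz mulNr -conjc_expi -pmulrn expi_nat e1 expr1n conjc1.
Qed.

Lemma is_derive_affine (k x : R) : is_derive x 1 (fun y => k * y) k.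
Proof.
have h : is_derive x 1 (k *: (@id R)) (k *: (1 : R)) by exact: is_deriveZ.
by apply: (is_derive_eq h); rewrite /GRing.scale /= mulr1.
Qed.

Lemma expi_cmeasurable (k c : R) : cmeasurable (fun x : measurableTypeR R => expi (k * x + c)).
Proof.
by apply: cmeasurable_expi; apply: measurable_funD => //; exact: mulrl_measurable.
Qed.

Lemma torus_orthogonality (k : int) :
  cintegral mu setT (fun x => expi (k%:~R * x)) = if k == 0 then (2 * pi)%:C else 0.
Proof.
have p0 : 0 < 2 * pi :> R by rewrite mulr_gt0 ?pi_gt0.
have [mc ms] : cmeasurable (fun x : measurableTypeR R => expi (k%:~R * x)).
  by have := expi_cmeasurable k%:~R 0; under eq_fun do rewrite addr0.
rewrite /cintegral !Rintegral_torus//; case: (eqVneq k 0) => [->|k0].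
  apply: complex_eqP.
    transitivity (\int[leb]_(x in `[0, 2 * pi]) (1 : R)).
      by apply: eq_Rintegral => x _; rewrite mul0r /= cos0.
    by rewrite Rintegral_itv_cst /= ?subr0 ?mul1r ?mulr1 ?(ltW p0).
  transitivity (\int[leb]_(x in `[0, 2 * pi]) (0 : R)).
    by apply: eq_Rintegral => x _; rewrite mul0r /= sin0.
  by rewrite Rintegral_itv_cst /= ?mulr0 ?mul0r ?(ltW p0).
have kn0 : k%:~R != 0 :> R by rewrite intr_eq0.
have /(congr1 (@complex.Re R)) /= cp := expi_int_period k.
have /(congr1 (@complex.Im R)) /= sp := expi_int_period k.
apply: complex_eqP; rewrite /= /Rintegral.
- rewrite (@continuous_FTC2 _ _ (fun x => k%:~R^-1 * sin (k%:~R * x)))//.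
  + by rewrite sp !mulr0 sin0 mulr0 subee.
  + by apply: continuous_subspaceT => y; exact: continuous_cosM.
  + have cF : continuous (fun x : R => k%:~R^-1 * sin (k%:~R * x) : R).
      by move=> y; apply: cvgM; [exact: cvg_cst|exact: continuous_sinM].
    split.
    * move=> x _.
      have := is_deriveZ k%:~R^-1 (is_derive1_comp (is_derive_sin _) (is_derive_affine k%:~R x)).
      by move=> [].
    * by apply: cvg_at_right_filter; exact: cF.
    * by apply: cvg_at_left_filter; exact: cF.
  + move=> x _; rewrite derive1E.
    have := is_deriveZ k%:~R^-1 (is_derive1_comp (is_derive_sin _) (is_derive_affine k%:~R x)).
    move=> [_ E]; apply: etrans E _.
    by rewrite /GRing.scale /= mulrCA mulVf// mulr1.
- rewrite (@continuous_FTC2 _ _ (fun x => - k%:~R^-1 * cos (k%:~R * x)))//.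
  + by rewrite cp !mulr0 cos0 subee.
  + by apply: continuous_subspaceT => y; exact: continuous_sinM.
  + have cF : continuous (fun x : R => - k%:~R^-1 * cos (k%:~R * x) : R).
      by move=> y; apply: cvgM; [exact: cvg_cst|exact: continuous_cosM].
    split.
    * move=> x _.
      have := is_deriveZ (- k%:~R^-1) (is_derive1_comp (is_derive_cos _) (is_derive_affine k%:~R x)).
      by move=> [].
    * by apply: cvg_at_right_filter; exact: cF.
    * by apply: cvg_at_left_filter; exact: cF.
  + move=> x _; rewrite derive1E.
    have := is_deriveZ (- k%:~R^-1) (is_derive1_comp (is_derive_cos _) (is_derive_affine k%:~R x)).
    move=> [_ E]; apply: etrans E _.
    by rewrite /GRing.scale /= mulNr mulNr mulrN opprK mulrCA mulVf// mulr1.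
Qed.

End TorusMeasures.

Section FejerKernel.
Variable R : realType.
Local Notation leb := (@lebesgue_measure R).
Local Notation mu := (space_measure R Torus).
Local Notation nu := (freq_measure R Torus).

Definition fejer_chi (n : nat) (y : measurableTypeR R) : R :=
  n.+1%:R^-1 * \sum_(j < n.+1) \sum_(l < n.+1)
    \1_[set ((Posz j - Posz l)%:~R : R)] y.

Definition fejer_sum (n : nat) (z : R) : R[i] := \sum_(j < n.+1) expi (j%:R * z).

Definition fejer_kernel (n : nat) (z : R) : R := n.+1%:R^-1 * nc (fejer_sum n z) ^+ 2.

Lemma fejer_kernelE n z : (fejer_kernel n z)%:C =
  n.+1%:R^-1%:C * \sum_(j < n.+1) \sum_(l < n.+1) expi ((Posz j - Posz l)%:~R * z).
Proof.
transitivity (n.+1%:R^-1%:C * (fejer_sum n z * conjc (fejer_sum n z))).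
  by rewrite mulJ_normc -rmorphM.
congr (_ * _); rewrite /fejer_sum.
rewrite rmorph_sum mulr_suml; apply: eq_bigr => j _; rewrite mulr_sumr.
apply: eq_bigr => l _.
transitivity (expi (j%:R * z) * conjc (expi (l%:R * z))); first exact: erefl.
rewrite conjc_expi -expiD; congr expi.
by rewrite intrD mulrNz -!pmulrn mulrDl mulNr.
Qed.

Let point_integrable (k : int) (g : measurableTypeR R -> R[i]) :
  cintegrable nu setT (fun y => (\1_[set (k%:~R : R)] y)%:C * g y) /\
  cintegral nu setT (fun y => (\1_[set (k%:~R : R)] y)%:C * g y) = g k%:~R.
Proof.
apply: cintegral_point; first exact: measurable_set1.
  exact: freq_measure_set1.
by move=> x ->.
Qed.

Lemma fejer_summability_kernel n x x' :
  summability_kernel nu (fun x xi : measurableTypeR R => x * xi) (fejer_chi n) x x' =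
  (fejer_kernel n (x' - x))%:C.
Proof.
rewrite /summability_kernel fejer_kernelE.
pose g (y : measurableTypeR R) : R[i] := n.+1%:R^-1%:C * expi (y * (x' - x)).
transitivity (cintegral nu setT (fun y => \sum_(j < n.+1) \sum_(l < n.+1)
    (\1_[set ((Posz j - Posz l)%:~R : R)] y)%:C * g y)).
  apply: eq_cintegral => y _; rewrite /fejer_chi /g rmorphM rmorph_sum mulr_sumr mulr_suml.
  apply: eq_bigr => j _; rewrite rmorph_sum mulr_sumr mulr_suml; apply: eq_bigr => l _.
  by rewrite mulrBr !(mulrC y) mulrCA mulrA.
rewrite cintegral_sum; last first.
  by move=> j; apply: cintegrable_sum => l; exact: (point_integrable _ _).1.
rewrite mulr_sumr; apply: eq_bigr => j _.
rewrite cintegral_sum; last by move=> l; exact: (point_integrable _ _).1.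
by rewrite mulr_sumr; apply: eq_bigr => l _; rewrite (point_integrable _ _).2.
Qed.

Lemma fejer_chi_integrable n : nu.-integrable setT (EFin \o fejer_chi n).
Proof.
have h : cintegrable nu setT (fun y => \sum_(j < n.+1) \sum_(l < n.+1)
    (\1_[set ((Posz j - Posz l)%:~R : R)] y)%:C * (n.+1%:R^-1)%:C).
  by apply: cintegrable_sum => j; apply: cintegrable_sum => l; exact: (point_integrable _ _).1.
have [+ _] := h; congr (integrable _ _ _); apply/funext => y /=; congr (_%:E).
rewrite /fejer_chi mulr_sumr (raddf_sum (@complex.Re R)).
apply: eq_bigr => j _; rewrite mulr_sumr (raddf_sum (@complex.Re R)).
by apply: eq_bigr => l _; rewrite mulrC -rmorphM.
Qed.

Lemma fejer_inner_le1 n (j : 'I_n.+1) (y : R) :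
  0 <= \sum_(l < n.+1) (\1_[set ((Posz j - Posz l)%:~R : R)] y : R) <= 1.
Proof.
apply/andP; split; first by apply: sumr_ge0 => l _; rewrite indicE.
have [[l yl]|no] := pselect (exists l : 'I_n.+1, y = (Posz j - Posz l)%:~R).
  rewrite (bigD1 l)//= big1 => [|l' l'l]; first by rewrite addr0 indicE; case: (_ \in _).
  rewrite indicE; case: (boolP (y \in _)) => //; rewrite inE /= yl => /intr_inj.
  by move=> /addrI /oppr_inj [] /val_inj ll'; move: l'l; rewrite ll' eqxx.
rewrite big1// => l _; rewrite indicE; case: (boolP (y \in _)) => //.
by rewrite inE /= => yl; case: no; exists l.
Qed.

Lemma fejer_chi_bounds n y : 0 <= fejer_chi n y <= 1.
Proof.
apply/andP; split.
  rewrite mulr_ge0// sumr_ge0// => j _; by have /andP[] := fejer_inner_le1 j y.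
rewrite /fejer_chi mulrC ler_pdivrMr// mul1r.
apply: (@le_trans _ _ (\sum_(j < n.+1) (1 : R))).
  by apply: ler_sum => j _; have /andP[] := fejer_inner_le1 j y.
by rewrite sumr_const card_ord.
Qed.

Lemma fejer_chi_cvg (k : int) :
  (fun n => fejer_chi n k%:~R) @ \oo --> (1 : R).
Proof.
pose m := absz k.
have count N : (\sum_(j < N) (j < m) <= m)%N.
  suff : (\sum_(j < N) (j < m) <= minn N m)%N by move/leq_trans; apply; exact: geq_minr.
  elim: N => [|N IH]; first by rewrite big_ord0.
  rewrite big_ord_recr /=; apply: leq_trans (leq_add IH (leqnn _)) _.
  by rewrite /minn; case: (ltnP N m) => h; case: ltnP => h'; rewrite ?addn0 ?addn1//; apply: ltnW.
have lb n : 1 - (2 * m)%:R * n.+1%:R^-1 <= fejer_chi n k%:~R.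
  rewrite lerBlDr -[X in X <= _](@mulVf R n.+1%:R) ?pnatr_eq0// (mulrC _%:R).
  rewrite /fejer_chi -mulrDr ler_wpM2l// -[X in X <= _](_ : \sum_(j < n.+1) (1 : R) = _).
    pose c (j : 'I_n.+1) : nat := ((j < m) + (n - j < m))%N.
    have c2 : (\sum_(j < n.+1) c j <= 2 * m)%N.
      rewrite big_split /= mul2n -addnn; apply: leq_add; first exact: count.
      rewrite (reindex_inj rev_ord_inj) /=.
      apply: leq_trans (count n.+1); apply: leq_sum => j _.
      by rewrite subSS subKn// -ltnS.
    apply: (@le_trans _ _ (\sum_(j < n.+1) \sum_(l < n.+1)
        (\1_[set ((Posz j - Posz l)%:~R : R)] (k%:~R : R) : R) + \sum_(j < n.+1) (c j)%:R)); last first.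
      by rewrite lerD2l -natr_sum ler_nat.
    rewrite -big_split /=; apply: ler_sum => j _.
    have /andP[s0 _] := fejer_inner_le1 j (k%:~R : R).
    have [jm|jm] := ltnP j m.
      by rewrite -[X in X <= _]add0r lerD// /c jm add1n -natr1 lerDr.
    have [njm|njm] := ltnP (n - j) m.
      by rewrite -[X in X <= _]add0r lerD// /c njm addn1 -natr1 lerDr.
    have l1 : (absz (Posz j - k) < n.+1)%N.
      by have := ltn_ord j; rewrite /m in jm njm *; lia.
    rewrite -[X in X <= _]addr0 lerD//.
    rewrite (bigD1 (Ordinal l1))//= indicE mem_set /=.
      by rewrite lerDl sumr_ge0// => l _; rewrite indicE.
    by congr intmul; rewrite gez0_abs; [ring|rewrite /m in jm *; lia].
  by rewrite sumr_const card_ord.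
apply: (@squeeze_cvgr _ _ _ _ (fun n => 1 - (2 * m)%:R * n.+1%:R^-1) (fun=> 1)).
- by apply: nearW => n; rewrite lb; have /andP[_ ->] := fejer_chi_bounds n k%:~R.
- rewrite -[X in _ --> X](subr0 1); apply: cvgB; first exact: cvg_cst.
  rewrite -[X in _ --> X](mulr0 (2 * m)%:R); apply: cvgM; first exact: cvg_cst.
  exact: cvg_harmonic.
- exact: cvg_cst.
Qed.

Lemma fejer_kernel_ge0 n z : 0 <= fejer_kernel n z.
Proof. by rewrite mulr_ge0// sqr_ge0. Qed.

Lemma fejer_kernel_bound n (z : R) : fejer_kernel n z * (2 - 2 * cos z) <= 4 / n.+1%:R.
Proof.
rewrite /fejer_kernel -mulrA mulrC ler_wpM2r//.
have h : nc (fejer_sum n z * (expi z - 1)) <= 2.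
  rewrite mulrC (_ : _ * _ = expi z ^+ n.+1 - 1); last first.
    by rewrite subrX1; congr (_ * _); apply: eq_bigr => j _; rewrite expi_nat.
  apply: le_trans (normcD_le _ _) _.
  rewrite -expi_nat normc_expi normc_opp -(rmorph1 (real_complex R)) normc_real normr1; lra.
have -> : 2 - 2 * cos z = nc (expi z - 1) ^+ 2.
  rewrite normc_sq /= oppr0 addr0; have := cos2Dsin2 z; rewrite !expr2; lra.
rewrite -exprMn -Normc.normcM (_ : 4 = 2 ^+ 2); last by rewrite expr2; lra.
by apply: lerXn2r => //; rewrite nnegrE ?normc_ge0//; lra.
Qed.

Lemma cos_le_gap (eta z : R) : 0 < eta -> eta <= `|z| <= 2 * pi - eta ->
  cos z <= cos eta /\ cos eta < 1.
Proof.
move=> e0 /andP[ez ze].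
have epi : eta <= pi by lra.
have einI : eta \in `[0, pi] by rewrite in_itv/= (ltW e0) epi.
have c0 : cos eta < 1.
  by rewrite -(@cos0 R) ltr_cos ?in_itv/= ?lexx ?pi_ge0 ?(ltW e0)//; lra.
split => //.
have cz : cos z = cos `|z|.
  by case: (ger0P z) => // _; rewrite cosN.
rewrite cz; have [zp|zp] := leP `|z| pi.
  by rewrite leNgt ltr_cos// ?in_itv/= ?normr_ge0 ?zp// -leNgt.
have -> : cos `|z| = cos (2 * pi - `|z|).
  by rewrite -(cosN (2 * pi - _)) opprB -[RHS]cosD2pi; congr cos; rewrite mulr2n; ring.
have h : 2 * pi - `|z| \in `[0, pi] by rewrite in_itv/=; apply/andP; split; lra.
by rewrite leNgt ltr_cos// -leNgt; lra.
Qed.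

Lemma fejer_kernel_gap n (eta z : R) : 0 < eta -> eta <= `|z| <= 2 * pi - eta ->
  fejer_kernel n z <= 2 / (1 - cos eta) / n.+1%:R.
Proof.
move=> e0 ez; have [cz ce] := cos_le_gap e0 ez.
have h := fejer_kernel_bound n z.
have h2 : fejer_kernel n z * (2 - 2 * cos eta) <= 4 / n.+1%:R.
  by apply: le_trans h; rewrite ler_wpM2l ?fejer_kernel_ge0//; lra.
have p : 0 < 2 - 2 * cos eta by lra.
move: h2; rewrite -ler_pdivlMr// => /le_trans; apply.
rewrite le_eqVlt; apply/orP; left; apply/eqP; field.
by apply/and3P; split; rewrite gt_eqF//; have := ler0n R n; lra.
Qed.

End FejerKernel.

Section TorusInstance.
Variable R : realType.
Local Notation leb := (@lebesgue_measure R).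
Local Notation mu := (space_measure R Torus).
Local Notation nu := (freq_measure R Torus).
Local Notation phase := (fun x xi : measurableTypeR R => x * xi).
Local Notation phase' := (fun xi x : measurableTypeR R => - (x * xi)).

Lemma expi_torus_cintegrable (k c : R) : cintegrable mu setT (fun x => expi (k * x + c)).
Proof.
apply: (@finite_bounded_cintegrable _ _ _ _ _ 1); first exact: space_measure_torus_fin.
  exact: expi_cmeasurable.
by move=> x; rewrite normc_expi.
Qed.

Lemma torus_orthogonality_shift (k : int) (x : R) :
  cintegral mu setT (fun x' => expi (k%:~R * (x' - x))) = if k == 0 then (2 * pi)%:C else 0.
Proof.
transitivity (cintegral mu setT (fun x' => expi (- (k%:~R * x)) * expi (k%:~R * x'))).
  by apply: eq_cintegral => x' _; rewrite -expiD; congr expi; ring.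
rewrite cintegralZ; last first.
  by have := expi_torus_cintegrable k%:~R 0; under eq_fun do rewrite addr0.
rewrite torus_orthogonality; case: eqVneq => [->|_]; last by rewrite mulr0.
by rewrite mul0r oppr0 expi0 mul1r.
Qed.

Let shift_int (k : int) x : cintegrable mu setT (fun x' => expi (k%:~R * (x' - x))).
Proof.
have := expi_torus_cintegrable k%:~R (- (k%:~R * x)).
by under eq_fun do rewrite -mulrBr.
Qed.

Lemma fejer_total n x :
  cintegrable mu setT (fun x' => (fejer_kernel n (x' - x))%:C : R[i]) /\
  cintegral mu setT (fun x' => (fejer_kernel n (x' - x))%:C) = (2 * pi)%:C.
Proof.
pose f x' : R[i] := \sum_(j < n.+1) \sum_(l < n.+1) expi ((Posz j - Posz l)%:~R * (x' - x)).
have E : (fun x' => (fejer_kernel n (x' - x))%:C) = (fun x' => n.+1%:R^-1%:C * f x').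
  by apply/funext => x'; exact: fejer_kernelE.
have fi : cintegrable mu setT f by apply: cintegrable_sum => j; exact: cintegrable_sum.
rewrite E; split; first exact: cintegrableZ.
rewrite cintegralZ// cintegral_sum; last by move=> j; exact: cintegrable_sum.
under eq_bigr => j _.
  rewrite cintegral_sum//; under eq_bigr do rewrite torus_orthogonality_shift.
  rewrite (bigD1 j)//= subrr eqxx big1; last first.
    by move=> l lj; rewrite subr_eq0 eqz_nat ifF//; apply/negbTE; rewrite eq_sym; exact: lj.
  rewrite addr0; over.
rewrite (_ : \sum_j _ = (2 * pi)%:C *+ n.+1); last by rewrite sumr_const card_ord.
rewrite mulrnAr -mulrnAl (_ : n.+1%:R^-1%:C *+ n.+1 = 1) ?mul1r//.
by rewrite -(rmorphMn (real_complex R)) /= -mulr_natr mulVf ?pnatr_eq0// rmorph1.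
Qed.

Lemma fejer_kernel_measurable n (x : R) :
  measurable_fun setT (fun x' : measurableTypeR R => fejer_kernel n (x' - x)).
Proof. exact: (cintegrable_cmeasurable (fejer_total n x).1).1. Qed.

Lemma fejer_summability : summability mu nu phase (@fejer_chi R) setT (2 * pi).
Proof.
split.
- by move=> n y; have /andP[] := fejer_chi_bounds n y.
- by move=> n y; have /andP[] := fejer_chi_bounds n y.
- by move=> n; exact: fejer_chi_integrable.
- apply: filterS (freq_measure_integers R) => y [k _ <-]; exact: fejer_chi_cvg.
- exact: measurableT.
- by rewrite setCT measure0.
- by rewrite mulr_gt0 ?pi_gt0.
- move=> n x _.
  have [ki kE] := fejer_total n x.
  under eq_integral => x' _.
    rewrite fejer_summability_kernel normc_real ger0_norm ?fejer_kernel_ge0//; over.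
  have := congr1 (@complex.Re R) kE; rewrite ReIntegral /Rintegral => E.
  rewrite -[X in (X <= _)%E]fineK; first by rewrite lee_fin E.
  exact: integrable_fin_num ki.1.
Qed.

Definition initial_intervals : set (set (measurableTypeR R)) :=
  [set `[0, b]%classic | b in [set b : R | 0 < b < 2 * pi]].

Lemma fejer_approximate_identity :
  approximate_identity mu nu phase (@fejer_chi R) (2 * pi) initial_intervals.
Proof.
have p0 : 0 < pi :> R := pi_gt0 R.
have mI b : measurable (`[0, b]%classic : set (measurableTypeR R)) by exact: measurable_itv.
split.
- by move=> A [b _ <-].
- move=> A [b _ <-]; apply: le_lt_trans (space_measure_torus_fin R).
  by apply: le_measure; rewrite ?inE//; exact: mI.
- move=> A [b + <-]; rewrite [X in X -> _]/= => /andP[b0 bp].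
  have nz (z : R) : {ae mu, forall x, x != z}.
    exists [set z]; split; first exact: measurable_set1.
      apply: etrans (space_measure_torus _) _; apply/eqP.
      rewrite eq_le measure_ge0 andbT -(lebesgue_measure_set1 z).
      apply: le_measure; rewrite ?inE; [|exact: measurable_set1|by move=> y []].
      by apply: measurableI; [exact: measurable_set1|exact: measurable_itv].
    by move=> x /= /negP; rewrite negbK => /eqP.
  have dom : {ae mu, forall x : measurableTypeR R, 0 <= x < 2 * pi}.
    exists (~` `[0, 2 * pi[%classic); split.
    + by apply: measurableC; exact: measurable_itv.
    + by apply: etrans (space_measure_torus _) _; rewrite setICl measure0.
    + by move=> x; apply: contra_not; rewrite /= in_itv.
  have dom' : {ae mu, forall x : measurableTypeR R, 0 < x < 2 * pi}.
    apply: (ae_imp2 dom (nz 0)) => x /andP[x0 ->] xn0.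
    by rewrite lt_neqAle eq_sym xn0 x0.
  apply: (ae_imp2 dom' (nz b)) => x /andP[x0 xp] xb.
  pose eta := Num.min `|b - x| (Num.min x (2 * pi - x)).
  have e0 : 0 < eta.
    by rewrite !lt_min x0 subr_gt0 xp normr_gt0 subr_eq0 eq_sym xb.
  pose c n := 2 / (1 - cos eta) / n.+1%:R.
  pose h n x' : R := ((\1_`[0, b] x' : R) - (\1_`[0, b] x : R)) * fejer_kernel n (x' - x).
  have c0 n : 0 <= c n.
    by rewrite !mulr_ge0// invr_ge0 subr_ge0 cos_le1.
  have hb n x' : 0 <= x' <= 2 * pi -> `|h n x'| <= c n.
    move=> /andP[x'0 x'p]; rewrite /h normrM [`|fejer_kernel _ _|]ger0_norm ?fejer_kernel_ge0//.
    have xI : (\1_`[0, b] x : R) = ((x < b)%R : bool)%:R.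
      by rewrite indicE; congr (nat_of_bool _)%:R; rewrite mem_setE in_itv/= (ltW x0) le_eqVlt (negbTE xb).
    have x'I : (\1_`[0, b] x' : R) = ((x' <= b)%R : bool)%:R.
      by rewrite indicE; congr (nat_of_bool _)%:R; rewrite mem_setE in_itv/= x'0.
    have eb : eta <= `|b - x| by rewrite /eta ge_min lexx.
    have ex : eta <= x by rewrite /eta !ge_min lexx orbT.
    have ex' : eta <= 2 * pi - x by rewrite /eta !ge_min lexx !orbT.
    have gap : eta <= `|x' - x| <= 2 * pi - eta -> fejer_kernel n (x' - x) <= c n.
      exact: fejer_kernel_gap.
    rewrite xI x'I; case: (ltP x b) => xb'; case: (leP x' b) => x'b.
    + by rewrite subrr normr0 mul0r.
    + rewrite sub0r normrN normr1 mul1r; apply: gap.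
      rewrite gtr0_norm in eb; last by rewrite subr_gt0.
      by rewrite ger0_norm; [apply/andP; split; lra|lra].
    + rewrite subr0 normr1 mul1r; apply: gap.
      have xb2 : b < x by rewrite lt_neqAle eq_sym xb.
      rewrite ltr0_norm in eb; last by rewrite subr_lt0.
      by rewrite ler0_norm; [apply/andP; split; lra|lra].
    + by rewrite subrr normr0 mul0r.
  have mI1 : measurable_fun setT (\1_`[0, b] : measurableTypeR R -> R) by exact: measurable_indic.
  have mh n : measurable_fun setT (h n : measurableTypeR R -> R).
    apply: measurable_funM; last exact: fejer_kernel_measurable.
    by apply: measurable_funB => //.
  have ih n : leb.-integrable `[0, 2 * pi]%classic (EFin \o h n).
    apply: measurable_bounded_integrable.
    + exact: measurable_itv.
    + by rewrite /= lebesgue_measure_itv; case: ifP => _; rewrite -?EFinB ltry.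
    + exact: measurable_funS (mh n).
    + exists (c n); split; first by rewrite num_real.
      by move=> M cM x' /=; rewrite in_itv/= => /hb /le_trans; apply; exact: ltW.
  have wE n : cintegral mu setT (fun x' => (\1_`[0, b] x')%:C *
      summability_kernel nu phase (@fejer_chi R n) x x') - (2 * pi * \1_`[0, b] x)%:C =
      (\int[mu]_x' h n x')%:C.
    have [ki kE] := fejer_total n x.
    have Ki : mu.-integrable setT (EFin \o (fun x' => fejer_kernel n (x' - x))) := ki.1.
    have Kb (g : measurableTypeR R -> R) : measurable_fun setT g -> (forall y, `|g y| <= 1) ->
        mu.-integrable setT (EFin \o (fun x' => g x' * fejer_kernel n (x' - x))).
      move=> mg g1; apply: (integrable_dominated _ Ki).
        by apply: measurable_funM => //; exact: fejer_kernel_measurable.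
      by move=> y; rewrite normrM [`|fejer_kernel _ _|]ger0_norm ?fejer_kernel_ge0//
        ler_piMl ?fejer_kernel_ge0.
    have i1 : mu.-integrable setT (EFin \o (fun x' => (\1_`[0, b] x' : R) * fejer_kernel n (x' - x))).
      by apply: Kb => // y; rewrite indicE; case: (_ \in _); rewrite ?normr1 ?normr0.
    have i2 : mu.-integrable setT (EFin \o (fun x' => (\1_`[0, b] x : R) * fejer_kernel n (x' - x))).
      by apply: Kb => // y; rewrite indicE; case: (_ \in _); rewrite ?normr1 ?normr0.
    have E1 : \int[mu]_x' fejer_kernel n (x' - x) = 2 * pi.
      by have := congr1 (@complex.Re R) kE; rewrite ReIntegral.
    have -> : \int[mu]_x' h n x' =
        \int[mu]_x' ((\1_`[0, b] x' : R) * fejer_kernel n (x' - x)) - 2 * pi * \1_`[0, b] x.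
      rewrite /h; under eq_Rintegral do rewrite mulrBl.
      by rewrite RintegralB// RintegralZl// E1 [X in _ - X]mulrC.
    rewrite [RHS]rmorphB; congr (_ - _).
    transitivity (cintegral mu setT (fun x' =>
        ((\1_`[0, b] x' : R) * fejer_kernel n (x' - x))%:C)).
      by apply: eq_cintegral => x' _; rewrite fejer_summability_kernel -rmorphM.
    by apply: complex_eqP; rewrite /= /Rintegral ?integral0.
  apply: (@squeeze_cvgr _ _ _ _ (fun=> 0) (fun n => c n * (2 * pi))).
  + apply: nearW => n; rewrite normc_ge0 andTb wE normc_real (Rintegral_torus (mh n)).
    apply: le_trans (@ler_norm_itv_integral _ (h n) (fun=> c n) _ (ih n) _ _) _.
    * apply: measurable_bounded_integrable => //.
        by rewrite /= lebesgue_measure_itv; case: ifP => _; rewrite -?EFinB ltry.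
      exists (c n); split; first by rewrite num_real.
      by move=> M cM x' /= _; rewrite ger0_norm ?c0// ltW.
    * by move=> x' hx'; exact: hb.
    * by rewrite Rintegral_itv_cst//; lra.
  + exact: cvg_cst.
  + rewrite -[X in _ --> X](mul0r (2 * pi)); apply: cvgM; last exact: cvg_cst.
    rewrite /c -[X in _ --> X](mulr0 (2 / (1 - cos eta))).
    by apply: cvgM; [exact: cvg_cst|exact: cvg_harmonic].
- move=> r H.
  apply: (@interval_total _ mu `[0, 2 * pi[%classic (fun n => (0, 2 * pi - n.+1%:R^-1))).
  + by [].
  + exact: measurable_itv.
  + move=> n x /=; rewrite !in_itv/= => /andP[-> xp]; apply: le_lt_trans xp _.
    by rewrite ltrBlDr ltrDl invr_gt0.
  + apply/eqP; rewrite eq_le measure_ge0 andbT -(lebesgue_measure_set1 (0 : R)).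
    apply: le_measure; rewrite ?inE; [|exact: measurable_set1|].
      apply: measurableD; first exact: measurable_itv.
      by apply: bigcup_measurable => n _; exact: measurable_itv.
    move=> x [] /=; rewrite in_itv/= => /andP[x0 xp] nU; apply: contrapT => xn0; apply: nU.
    exists (Num.truncn (2 * pi - x)^-1) => //=; rewrite in_itv/= lt_neqAle eq_sym.
    move/eqP: xn0 => ->; rewrite x0 /= ltrBrDr -ltrBrDl.
    rewrite -[X in _ < X]invrK ltf_pV2 ?posrE ?invr_gt0 ?subr_gt0//.
    exact: truncnS_gt.
  + move=> n x /= /andP[x0 xn]; apply: H; exists x => //=; rewrite x0 /=.
    by apply: le_lt_trans xn _; rewrite ltrBlDr ltrDl invr_gt0.
Qed.

End TorusInstance.

Section TorusCoefficients.
Variable R : realType.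
Local Notation leb := (@lebesgue_measure R).
Local Notation mu := (space_measure R Torus).
Local Notation nu := (freq_measure R Torus).
Local Notation phase := (fun x xi : measurableTypeR R => x * xi).
Local Notation phase' := (fun xi x : measurableTypeR R => - (x * xi)).

Definition unit_chi (_ : nat) (_ : measurableTypeR R) : R := 1.

Lemma coefficient_kernelE n (k k' : int) :
  summability_kernel mu phase' (unit_chi n) (k%:~R : R) (k'%:~R : R) =
  if k == k' then (2 * pi)%:C else 0.
Proof.
rewrite -subr_eq0 -torus_orthogonality; apply: eq_cintegral => x _.
by rewrite mul1r; congr expi; rewrite intrB; ring.
Qed.

Lemma freq_torus_integral (h : measurableTypeR R -> R) (k : int) : measurable_fun setT h ->
  (forall k' : int, k' != k -> h k'%:~R = 0) ->
  (\int[nu]_y (h y)%:E = (h k%:~R)%:E)%E.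
Proof.
move=> mh h0.
have mS : measurable ([set k%:~R] : set (measurableTypeR R)) by exact: measurable_set1.
transitivity (\int[nu]_y (h k%:~R * \1_[set k%:~R : R] y)%:E)%E.
  apply: ae_eq_integral => //.
  - exact/measurable_EFinP.
  - by apply/measurable_EFinP; apply: measurable_funM => //; exact: measurable_indic.
  - apply: filterS (freq_measure_integers R) => y [k' _ <-] _; congr (_%:E).
    rewrite indicE; case: (eqVneq k' k) => [->|kk'].
      by rewrite mem_set ?mulr1.
    by rewrite h0// memNset ?mulr0//= => /intr_inj /eqP; rewrite (negbTE kk').
under eq_integral do rewrite EFinM.
rewrite integralZl//.
  rewrite integral_indic// setIT; apply: etrans (mule1 _); congr (_ * _)%E.
  exact: freq_measure_set1.
have fin : (nu [set k%:~R : R] < +oo)%E by rewrite freq_measure_set1 ltry.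
exact: (@cintegrable_indic _ _ _ nu _ mS fin).1.
Qed.

Lemma kernel_unit_measurable n (k : R) :
  cmeasurable (fun k' => summability_kernel mu phase' (unit_chi n) k k').
Proof.
have mphase' : measurable_fun setT (fun z : measurableTypeR R * measurableTypeR R =>
    phase' z.1 z.2).
  apply: measurableT_comp => //; apply: measurable_funM.
    exact: measurable_snd.
  exact: measurable_fst.
have ci : mu.-integrable setT (EFin \o unit_chi n).
  have := (expi_torus_cintegrable 0 0 : cintegrable mu setT _).1.
  by under eq_fun do rewrite mul0r addr0 expi0.
have mk := @kernel_cmeasurable _ _ _ _ _ mu phase' mphase' _ ci.
exact: (cmeasurable_comp mk (pair1_measurable k)).
Qed.

Lemma coefficient_summability : summability nu mu phase' unit_chi (integers R) (2 * pi).
Proof.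
have p0 : 0 < 2 * pi :> R by rewrite mulr_gt0 ?pi_gt0.
split => //.
- move=> n; have := (expi_torus_cintegrable 0 0 : cintegrable mu setT _).1.
  by under eq_fun do rewrite mul0r addr0 expi0.
- by apply/aeW => y; exact: cvg_cst.
- exact: measurable_integers.
- transitivity (mrestr (@counting _ R) (measurable_integers R) (~` integers R)); first exact: erefl.
  by rewrite /mrestr setICl measure0.
- move=> n x [k _ <-].
  rewrite (@freq_torus_integral _ k).
  + by rewrite coefficient_kernelE eqxx normc_real ger0_norm ?(ltW p0).
  + by apply: measurable_normc; exact: kernel_unit_measurable.
  + by move=> k' kk'; rewrite coefficient_kernelE eq_sym (negbTE kk') Normc.normc0.
Qed.

Definition integer_points : set (set (measurableTypeR R)) :=
  [set [set (k%:~R : R)] | k in [set: int]].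

Lemma coefficient_approximate_identity :
  approximate_identity nu mu phase' unit_chi (2 * pi) integer_points.
Proof.
have mS (k : int) : measurable ([set k%:~R] : set (measurableTypeR R)) by exact: measurable_set1.
split.
- by move=> A [k _ <-].
- move=> A [k _ <-]; have fin : (nu [set k%:~R : R] < +oo)%E by rewrite freq_measure_set1 ltry.
  exact: fin.
- move=> A [k _ <-]; apply: filterS (freq_measure_integers R) => y [k' _ <-].
  rewrite (_ : (fun n => _) = (fun=> 0)); first exact: cvg_cst.
  apply/funext => n.
  have [_ ->] := @cintegral_point _ _ _ nu [set k%:~R : R] k%:~R
    (summability_kernel mu phase' (unit_chi n) k'%:~R) (mS k) (freq_measure_set1 R k)
    (fun x => id).
  rewrite coefficient_kernelE indicE; case: (eqVneq k' k) => [->|kk'].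
    by rewrite mem_set ?mulr1// subrr Normc.normc0.
  rewrite memNset ?mulr0 ?subrr ?Normc.normc0//=.
  by move=> /intr_inj /eqP; rewrite (negbTE kk').
- move=> r H; rewrite -[r]subr0; apply: ltwo_eq_ae.
  apply: filterS (freq_measure_integers R) => y [k _ <-]; rewrite ltwo0.
  have := H _ (ex_intro2 _ _ k I erefl); rewrite (cintegral_mkcond _ _ (mS k)).
  have [_ E] := @cintegral_point _ _ _ nu [set k%:~R : R] k%:~R r (mS k) (freq_measure_set1 R k)
    (fun x => id).
  by move=> <-; rewrite -[LHS]E; apply: eq_cintegral => x _; exact: mulrC.
Qed.

End TorusCoefficients.

(** * The Fourier transform on the line and on the torus *)

Section FourierPair.
Variables (R : realType) (M : manifold).
Local Notation leb := (@lebesgue_measure R).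
Local Notation mu := (space_measure R M).
Local Notation nu := (freq_measure R M).

Definition fphase (x xi : measurableTypeR R) : R := x * xi.
Definition bphase (xi x : measurableTypeR R) : R := - fphase x xi.
Definition box (n : nat) : set (measurableTypeR R) := `[- n%:R, n%:R]%classic.

Lemma measurable_fphase :
  measurable_fun setT (fun z : measurableTypeR R * measurableTypeR R => fphase z.1 z.2).
Proof. by apply: measurable_funM; [exact: measurable_fst|exact: measurable_snd]. Qed.

Lemma measurable_bphase :
  measurable_fun setT (fun z : measurableTypeR R * measurableTypeR R => bphase z.1 z.2).
Proof.
apply: measurableT_comp => //.
by apply: measurable_funM; [exact: measurable_snd|exact: measurable_fst].
Qed.

Lemma bphaseN : (fun x xi => - bphase xi x) = fphase.
Proof. by apply/funext => x; apply/funext => xi; rewrite /bphase opprK. Qed.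

Lemma measurable_box n : measurable (box n).
Proof. exact: measurable_itv. Qed.

Lemma box_cover x : \forall n \near \oo, box n x.
Proof.
near=> n; rewrite /box /= in_itv/= -ler_norml; near: n; exact: nbhs_infty_ger.
Unshelve. all: by end_near. Qed.

Lemma lebesgue_box n : (leb (box n) < +oo)%E.
Proof. by rewrite lebesgue_measure_itv; case: ifP => _; rewrite -?EFinB ltry. Qed.

Lemma space_box n : (mu (box n) < +oo)%E.
Proof.
apply: le_lt_trans (lebesgue_box n); apply: le_measure; rewrite ?inE.
- by apply: measurableI; [exact: measurable_box|exact: measurable_fundamental_domain].
- exact: measurable_box.
- by move=> x [].
Qed.

Lemma fourier_summability : exists chi S J,
  summability mu nu fphase chi S (2 * pi) /\
  approximate_identity mu nu fphase chi (2 * pi) J.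
Proof.
rewrite /space_measure; case: M => /=.
- exists (@abel_chi R), setT, (@closed_intervals R).
  have muE A : measurable A -> space_measure R Line A = leb A.
    by move=> mA; rewrite /space_measure /mrestr setIT.
  have nuE A : measurable A -> freq_measure R Line A = leb A by [].
  have pE x y : fphase x y = 1 * (x * y) by rewrite mul1r.
  have c2 : (1 : R) ^+ 2 = 1 by rewrite expr1n.
  by split; [exact: (line_summability muE nuE c2 pE)|
             exact: (line_approximate_identity muE nuE c2 pE)].
- exists (@fejer_chi R), setT, (@initial_intervals R).
  by split; [exact: fejer_summability|exact: fejer_approximate_identity].
Qed.

Lemma inverse_fourier_summability : exists chi S J,
  summability nu mu bphase chi S (2 * pi) /\
  approximate_identity nu mu bphase chi (2 * pi) J.
Proof.
case: M => /=.
- exists (@abel_chi R), setT, (@closed_intervals R).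
  have muE A : measurable A -> space_measure R Line A = leb A.
    by move=> mA; rewrite /space_measure /mrestr setIT.
  have nuE A : measurable A -> freq_measure R Line A = leb A by [].
  have pE x y : bphase x y = -1 * (x * y) by rewrite mulN1r mulrC.
  have c2 : (-1 : R) ^+ 2 = 1 by rewrite sqrrN expr1n.
  by split; [exact: (line_summability nuE muE c2 pE)|
             exact: (line_approximate_identity nuE muE c2 pE)].
- exists (@unit_chi R), (integers R), (@integer_points R).
  by split; [exact: coefficient_summability|exact: coefficient_approximate_identity].
Qed.

Lemma fourier_bessel : bessel mu nu fphase (2 * pi).
Proof.
have [chi [S [J [H _]]]] := fourier_summability.
exact: (@summability_bessel _ _ _ _ _ _ _ fphase measurable_fphase _ _ _ H).
Qed.

Lemma inverse_fourier_bessel : bessel nu mu bphase (2 * pi).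
Proof.
have [chi [S [J [H _]]]] := inverse_fourier_summability.
exact: (@summability_bessel _ _ _ _ _ _ _ bphase measurable_bphase _ _ _ H).
Qed.

Lemma two_pi_gt0 : 0 < 2 * pi :> R.
Proof. by rewrite mulr_gt0 ?pi_gt0. Qed.

Definition japanese_inv2 (y : measurableTypeR R) : R := (1 + y ^+ 2)^-1.

Lemma measurable_japanese_inv2 : measurable_fun setT japanese_inv2.
Proof.
apply: continuous_measurable_fun => y; apply: cvgV.
  by rewrite gt_eqF// ltr_pwDl// sqr_ge0.
apply: cvgD; first exact: cvg_cst.
by under eq_fun do rewrite expr2; rewrite expr2; apply: cvgM; exact: cvg_id.
Qed.

End FourierPair.

Section FrequencyDecay.
Variable R : realType.
Local Notation leb := (@lebesgue_measure R).

Lemma line_japanese_inv2 : (\int[freq_measure R Line]_y (japanese_inv2 y)%:E < +oo)%E.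
Proof.
apply: (@le_lt_trans _ _ (2 * pi)%:E); last exact: ltry.
apply: le_trans (@poisson_kernel_total R 1 0 ltr01).
apply: ge0_le_integral => //.
- by move=> y _; rewrite lee_fin invr_ge0 addr_ge0// sqr_ge0.
- by apply/measurable_EFinP; exact: measurable_japanese_inv2.
- by apply/measurable_EFinP; apply: continuous_measurable_fun; exact: continuous_poisson_kernel.
- move=> y _; rewrite lee_fin /poisson_kernel subr0 expr1n mulr1.
  by rewrite ler_peMl ?ler1n// invr_ge0 addr_ge0// sqr_ge0.
Qed.

Let saw (x : measurableTypeR R) : R[i] := (x * \1_`[0, 2 * pi] x)%:C.

Let saw_L2 : L2 (space_measure R Torus) saw /\ cintegrable (space_measure R Torus) setT saw.
Proof.
have p0 := two_pi_gt0 R.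
have mI : measurable (`[0, 2 * pi]%classic : set (measurableTypeR R)) by exact: measurable_itv.
have msaw : cmeasurable saw.
  apply: cmeasurable_real; apply: measurable_funM; first exact: measurable_id.
  exact: measurable_indic.
have sb x : nc (saw x) <= 2 * pi.
  rewrite normc_real indicE; case: (boolP (x \in _)) => [|_]; last by rewrite mulr0 normr0 ltW.
  by rewrite inE /= in_itv/= => /andP[x0 xp]; rewrite mulr1 ger0_norm.
have i := finite_bounded_cintegrable (space_measure_torus_fin R) msaw sb.
split => //.
have := L2_mul_bounded (L2_indic measurableT (space_measure_torus_fin R)) msaw sb.
by congr (L2 _ _); apply/funext => x; rewrite indicT mulr1.
Qed.

Let saw_coefficient (k : int) : k != 0 ->
  Im (ft (space_measure R Torus) (@fphase R) saw (k%:~R : R)) = 2 * pi / k%:~R.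
Proof.
move=> k0; have kn0 : k%:~R != 0 :> R by rewrite intr_eq0.
have p0 := two_pi_gt0 R.
have /(congr1 (@complex.Re R)) /= cp := expi_int_period R k.
have /(congr1 (@complex.Im R)) /= sp := expi_int_period R k.
have mft : cmeasurable (fun x => saw x * expi (- fphase x (k%:~R : R))).
  apply: cmeasurableM; first exact: L2_cmeasurable saw_L2.1.
  have := expi_cmeasurable (- k%:~R) (0 : R); congr cmeasurable; apply/funext => x.
  by rewrite addr0 mulNr mulrC.
rewrite /ft /cintegral /= (Rintegral_torus mft.2).
transitivity (\int[leb]_(x in `[0, 2 * pi]) (- (x * sin (k%:~R * x)))).
  apply: eq_Rintegral => x; rewrite inE /= => xI.
  rewrite indicE mem_set// mulr1 mul0r addr0 /fphase sinN mulrN.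
  by congr (- (_ * sin _)); exact: mulrC.
rewrite /Rintegral (@continuous_FTC2 _ _
  (fun x => k%:~R^-1 * (x * cos (k%:~R * x)) - k%:~R^-2 * sin (k%:~R * x)))//.
- by rewrite cp sp !(mulr0, sin0, mul0r, mulr1, subr0) sube0 /= mulrC.
- apply: continuous_subspaceT => y; apply: cvgN; apply: cvgM; first exact: cvg_id.
  exact: continuous_sinM.
- have cF : continuous (fun x : R =>
      k%:~R^-1 * (x * cos (k%:~R * x)) - k%:~R^-2 * sin (k%:~R * x)).
    move=> y; apply: cvgB; (apply: cvgM; first exact: cvg_cst); last exact: continuous_sinM.
    by apply: cvgM; [exact: cvg_id|exact: continuous_cosM].
  split; [move=> x _|apply: cvg_at_right_filter; exact: cF|apply: cvg_at_left_filter; exact: cF].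
  have dC := is_derive1_comp (is_derive_cos _) (is_derive_affine k%:~R x).
  have dS := is_derive1_comp (is_derive_sin _) (is_derive_affine k%:~R x).
  have := is_deriveB (is_deriveZ k%:~R^-1 (is_deriveM (is_derive_id x 1) dC)) (is_deriveZ (k%:~R^-2) dS).
  by move=> [].
- move=> x _; rewrite derive1E.
  have dC := is_derive1_comp (is_derive_cos _) (is_derive_affine k%:~R x).
  have dS := is_derive1_comp (is_derive_sin _) (is_derive_affine k%:~R x).
  have := is_deriveB (is_deriveZ k%:~R^-1 (is_deriveM (is_derive_id x 1) dC)) (is_deriveZ (k%:~R^-2) dS).
  move=> [_ E]; apply: etrans E _.
  change (k%:~R^-1 * (x * (- sin (k%:~R * x) * k%:~R) + cos (k%:~R * x) * 1) -
    k%:~R^-2 * (cos (k%:~R * x) * k%:~R) = - (x * sin (k%:~R * x))).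
  by field.
Qed.

(** The Fourier coefficients of the sawtooth are of size [1 / k], and they are square
    summable by the Bessel inequality. *)
Lemma torus_japanese_inv2 : (\int[freq_measure R Torus]_y (japanese_inv2 y)%:E < +oo)%E.
Proof.
set nu := freq_measure R Torus; have [sL si] := saw_L2.
pose F := ft (space_measure R Torus) (@fphase R) saw.
have FL : L2 nu F.
  exact: (bessel_L2 (@measurable_fphase R) (@fourier_bessel R Torus) sL si).
have mF := measurable_normc_sq (L2_cmeasurable FL).
have mS : measurable ([set 0] : set (measurableTypeR R)) by exact: measurable_set1.
have m1 : measurable_fun setT (\1_[set 0] : measurableTypeR R -> R) by exact: measurable_indic.
apply: (@le_lt_trans _ _ (\int[nu]_y ((\1_[set 0] y : R)%:E + (nc (F y) ^+ 2)%:E))%E).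
  apply: ae_ge0_le_integral => //.
  - by move=> y _; rewrite lee_fin invr_ge0 addr_ge0// sqr_ge0.
  - by apply/measurable_EFinP; exact: measurable_japanese_inv2.
  - by move=> y _; rewrite -EFinD lee_fin addr_ge0// ?sqr_ge0// indicE.
  - by apply/measurable_EFinP; apply: measurable_funD.
  apply: filterS (freq_measure_integers R) => y [k _ <-] _; rewrite -EFinD lee_fin.
  rewrite /japanese_inv2; case: (eqVneq k 0) => [->|k0].
    rewrite indicE mem_set//= expr0n /= addr0 invr1 lerDl; exact: sqr_ge0.
  have kp : 1 <= (k%:~R : R) ^+ 2.
    have : 0 < k ^+ 2 by rewrite exprn_even_gt0.
    by rewrite gtz0_ge1 -(ler_int R) rmorphXn.
  apply: (@le_trans _ _ (((k%:~R : R) ^+ 2)^-1)).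
    by rewrite lef_pV2 ?posrE; lra.
  rewrite -[X in X <= _]add0r; apply: lerD; first by rewrite indicE.
  apply: (@le_trans _ _ (Im (F k%:~R) ^+ 2)); last by rewrite normc_sq lerDr sqr_ge0.
  rewrite saw_coefficient// exprMn -[X in X <= _]mul1r exprVn ler_wpM2r ?invr_ge0 ?sqr_ge0//.
  by rewrite exprn_ege1//; have := pi_ge2 R; lra.
rewrite ge0_integralD//.
- rewrite integral_indic// setIT; apply: lte_add_pinfty.
    have fin : (freq_measure R Torus [set (0 : int)%:~R : R] < +oo)%E.
      by rewrite freq_measure_set1 ltry.
    exact: fin.
  by move/L2_sqnorm : FL => [_ h]; exact: h.
- exact/measurable_EFinP.
- by move=> y _; rewrite lee_fin sqr_ge0.
- exact/measurable_EFinP.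
Qed.

Lemma integrable_japanese_inv2 M :
  (freq_measure R M).-integrable setT (EFin \o @japanese_inv2 R).
Proof.
apply/integrableP; split; first by apply/measurable_EFinP; exact: measurable_japanese_inv2.
under eq_integral => y _.
  rewrite /= ger0_norm; last by rewrite invr_ge0 addr_ge0// sqr_ge0.
  over.
by case: M; [exact: line_japanese_inv2|exact: torus_japanese_inv2].
Qed.

Lemma freq_box M n : (freq_measure R M (@box R n) < +oo)%E.
Proof.
set nu := freq_measure R M; have mB := @measurable_box R n.
have i := integrable_japanese_inv2 M.
have d0 : 0 < (1 + n%:R ^+ 2 : R) by rewrite ltr_pwDl// sqr_ge0.
have fin := integrableZl measurableT (1 + n%:R ^+ 2) i.
have /integrableP[_] := fin; apply: le_lt_trans.
have <- : (\int[freq_measure R M]_y (\1_(@box R n) y)%:E = nu (@box R n))%E.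
  by rewrite integral_indic// setIT.
apply: ge0_le_integral => //.
- by apply/measurable_EFinP; exact: measurable_indic.
- by apply: measurableT_comp => //; exact: measurable_int _ fin.
- move=> y _; rewrite -EFinM /= lee_fin indicE; case: (boolP (y \in _)) => [|_]; last exact: normr_ge0.
  rewrite inE /box /= in_itv/= -ler_norml => yn.
  have y0 : 0 < 1 + y ^+ 2 by rewrite ltr_pwDl// sqr_ge0.
  rewrite ger0_norm; last by rewrite mulr_ge0 ?(ltW d0)// invr_ge0 ltW.
  rewrite ler_pdivlMr// mul1r lerD2l -[X in X <= _]real_normK ?num_real//.
  by rewrite lerXn2r// nnegrE.
Qed.

End FrequencyDecay.

Section FourierTransform.
Variables (R : realType) (M : manifold).
Local Notation mu := (space_measure R M).
Local Notation nu := (freq_measure R M).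
Local Notation nrmx := (ipnorm (rip mu)).
Local Notation nrmf := (ipnorm (rip nu)).
Let rH := rip_semi_hilbert nu.
Let rHx := rip_semi_hilbert mu.
Let C0 : 0 <= 2 * pi :> R := ltW (two_pi_gt0 R).

Definition dft (f : Ltwo mu) : Ltwo nu := transform nu (@fphase R) (@box R) f.
Definition idft0 (a : Ltwo nu) : Ltwo mu := transform mu (@bphase R) (@box R) a.
Definition idft (a : Ltwo nu) : Ltwo mu := ((2 * pi)^-1)%:C *: idft0 a.

Lemma fourier_dft (f : Ltwo mu) : fourier M f = dft f :> (measurableTypeR R -> R[i]).
Proof.
by rewrite /dft (transformE (@measurable_fphase R) (@measurable_box R) (@space_box R M)
  (@box_cover R) C0 (@fourier_bessel R M)).
Qed.

Lemma dft_integrable (f : Ltwo mu) : cintegrable mu setT f ->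
  {ae nu, forall y, dft f y = ft mu (@fphase R) f y}.
Proof.
exact: (transform_integrable (@measurable_fphase R) (@measurable_box R) (@space_box R M)
  (@box_cover R) C0 (@fourier_bessel R M)).
Qed.

Lemma idft0_integrable (a : Ltwo nu) : cintegrable nu setT a ->
  {ae mu, forall x, idft0 a x = ft nu (@bphase R) a x}.
Proof.
exact: (transform_integrable (@measurable_bphase R) (@measurable_box R) (@freq_box R M)
  (@box_cover R) C0 (@inverse_fourier_bessel R M)).
Qed.

Lemma dft_adjoint (f : Ltwo mu) (a : Ltwo nu) : inner nu (dft f) a = inner mu f (idft0 a).
Proof.
exact: (transform_adjoint (@measurable_fphase R) (@measurable_bphase R)
  (@measurable_box R) (@space_box R M) (@box_cover R)
  (@measurable_box R) (@freq_box R M) (@box_cover R) C0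
  (@fourier_bessel R M) (@inverse_fourier_bessel R M)).
Qed.

Lemma dft_parseval (f h : Ltwo mu) : inner nu (dft f) (dft h) = (2 * pi)%:C * inner mu f h.
Proof.
have [chi [S [J [H A]]]] := @fourier_summability R M.
exact: (transform_parseval (@measurable_fphase R) (@measurable_bphase R)
  (@measurable_box R) (@space_box R M) (@box_cover R)
  (@measurable_box R) (@freq_box R M) (@box_cover R) C0
  (@fourier_bessel R M) (@inverse_fourier_bessel R M) H A).
Qed.

Lemma idft0K (f : Ltwo mu) : nrmx (idft0 (dft f) - (2 * pi)%:C *: f) = 0.
Proof.
have [chi [S [J [H A]]]] := @fourier_summability R M.
exact: (transform_inversion (@measurable_fphase R) (@measurable_bphase R)
  (@measurable_box R) (@space_box R M) (@box_cover R)
  (@measurable_box R) (@freq_box R M) (@box_cover R) C0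
  (@fourier_bessel R M) (@inverse_fourier_bessel R M) H A).
Qed.

Lemma dftK0 (a : Ltwo nu) : nrmf (dft (idft0 a) - (2 * pi)%:C *: a) = 0.
Proof.
have [chi [S [J [H A]]]] := @inverse_fourier_summability R M.
have m' : measurable_fun setT (fun z : measurableTypeR R * measurableTypeR R =>
    - bphase z.2 z.1).
  by have := @measurable_fphase R; congr (measurable_fun _ _); apply/funext => z;
    rewrite -bphaseN.
have b' : bessel mu nu (fun x xi => - bphase xi x) (2 * pi).
  by rewrite bphaseN; exact: fourier_bessel.
have := transform_inversion (@measurable_bphase R) m'
  (@measurable_box R) (@freq_box R M) (@box_cover R)
  (@measurable_box R) (@space_box R M) (@box_cover R) C0
  (@inverse_fourier_bessel R M) b' H A a.
by rewrite bphaseN.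
Qed.

Lemma nrm0_inner d (T : measurableType d) (m : {measure set T -> \bar R})
    (f g h : Ltwo m) : ipnorm (rip m) (f - g) = 0 -> inner m f h = inner m g h.
Proof.
move=> fg; apply/eqP; rewrite -subr_eq0 -innerBl; apply/eqP/Normc.eq0_normc/eqP.
by rewrite eq_le normc_ge0 andbT; apply: le_trans (inner_cauchy_schwarz _ _) _; rewrite fg mul0r.
Qed.

Lemma inner_nrm0 d (T : measurableType d) (m : {measure set T -> \bar R})
    (f g : Ltwo m) : (forall h : Ltwo m, inner m f h = inner m g h) -> ipnorm (rip m) (f - g) = 0.
Proof.
move=> fg; have : inner m (f - g) (f - g) = 0 by rewrite innerBl fg subrr.
by rewrite inner_self => /complexI /eqP; rewrite sqrf_eq0 => /eqP.
Qed.

Opaque dft idft0.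

Lemma dft_linear (c : R[i]) (f g : Ltwo mu) :
  nrmf (dft (c *: f + g) - (c *: dft f + dft g)) = 0.
Proof.
apply: inner_nrm0 => h.
transitivity (inner mu (c *: f + g : Ltwo mu) (idft0 h)); first exact: dft_adjoint.
transitivity (c * inner mu f (idft0 h) + inner mu g (idft0 h)).
  by apply: etrans (innerDl _ _ _) _; congr (_ + _); exact: innerZl.
apply: esym; apply: etrans (innerDl _ _ _) _; congr (_ + _); last exact: dft_adjoint.
by apply: etrans (innerZl _ _ _) _; congr (_ * _); exact: dft_adjoint.
Qed.

Lemma dft_idft (a : Ltwo nu) : nrmf (dft (idft a) - a) = 0.
Proof.
apply: inner_nrm0 => h; have p0 := two_pi_gt0 R.
rewrite dft_adjoint /idft innerZl -dft_adjoint (nrm0_inner _ (dftK0 a)) innerZl mulrA.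
by rewrite -rmorphM mulVf ?mul1r// gt_eqF.
Qed.

Lemma idft_dft (f : Ltwo mu) : nrmx (idft (dft f) - f) = 0.
Proof.
apply: inner_nrm0 => h; have p0 := two_pi_gt0 R.
rewrite /idft innerZl (nrm0_inner _ (idft0K f)) innerZl mulrA.
by rewrite -rmorphM mulVf ?mul1r// gt_eqF.
Qed.

Lemma idft_adjoint (a : Ltwo nu) (f : Ltwo mu) :
  inner mu (idft a) f = ((2 * pi)^-1)%:C * inner nu a (dft f).
Proof. by rewrite /idft innerZl (innerC f) -dft_adjoint -innerC. Qed.

Opaque idft.

Lemma idft_parseval (a b : Ltwo nu) :
  inner mu (idft a) (idft b) = ((2 * pi)^-1)%:C * inner nu a b.
Proof.
rewrite idft_adjoint; congr (_ * _); rewrite [LHS]innerC [RHS]innerC; congr conjc.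
exact: nrm0_inner (dft_idft b).
Qed.

Lemma nrm_dft (f : Ltwo mu) : nrmf (dft f) = Num.sqrt (2 * pi) * nrmx f.
Proof.
have E : nrmf (dft f) ^+ 2 = 2 * pi * nrmx f ^+ 2.
  by apply: complexI; rewrite -inner_self dft_parseval inner_self -rmorphM.
rewrite -[LHS]ger0_norm ?ipnorm_ge0// -sqrtr_sqr E sqrtrM ?C0// sqrtr_sqr.
by rewrite ger0_norm// ipnorm_ge0.
Qed.

Lemma nrm_idft (a : Ltwo nu) : nrmx (idft a) = Num.sqrt (2 * pi)^-1 * nrmf a.
Proof.
have E : nrmx (idft a) ^+ 2 = (2 * pi)^-1 * nrmf a ^+ 2.
  by apply: complexI; rewrite -inner_self idft_parseval inner_self -rmorphM.
rewrite -[LHS]ger0_norm ?ipnorm_ge0// -sqrtr_sqr E sqrtrM ?invr_ge0 ?C0// sqrtr_sqr.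
by rewrite ger0_norm// ipnorm_ge0.
Qed.

End FourierTransform.

Global Opaque dft idft0 idft.

Lemma eq_ler (R : realType) (x y : R) : x = y -> x <= y.
Proof. by move->. Qed.

Lemma measurable_inv_ge0 d (T : measurableType d) (R : realType) (h : T -> R) :
  measurable_fun setT h -> (forall x, 0 <= h x) -> measurable_fun setT (fun x => (h x)^-1).
Proof.
move=> mh h0; have -> : (fun x => (h x)^-1) = (@powR R ^~ (-1)) \o h.
  by apply/funext => x /=; rewrite powR_inv1.
by apply: measurableT_comp => //; exact: measurable_powR.
Qed.

(** * Translations of the frequency variable *)

Section Translations.
Variable R : realType.

Definition translate (c : R) (x : measurableTypeR R) : measurableTypeR R := x - c.

Lemma measurable_translate c : measurable_fun setT (translate c).
Proof. by apply: measurable_funB => //; exact: measurable_id. Qed.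

HB.instance Definition _ c := isMeasurableFun.Build _ _ _ _ (translate c)
  (measurable_translate c).

Definition translation_invariant (m : {measure set (measurableTypeR R) -> \bar R}) (c : R) :=
  forall A, measurable A -> m (translate c @^-1` A) = m A.

Lemma lebesgue_translation c : translation_invariant (@lebesgue_measure R) c.
Proof.
move=> A mA; apply/esym.
apply: (@lebesgue_measure_unique R (pushforward (@lebesgue_measure R) (translate c))) => //.
move=> _ [[a b]] _ <-.
rewrite -[RHS]/(lebesgue_measure (translate c @^-1` `]a, b]%classic)).
have -> : translate c @^-1` `]a, b]%classic = `](a + c), (b + c)]%classic.
  by apply/seteqP; split => x /=; rewrite !in_itv/= /translate ltrBrDr lerBlDr.
rewrite !lebesgue_measure_itv/= !lte_fin ltrD2r.
by case: ifP => _ //; rewrite -!EFinB; congr (_%:E); ring.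
Qed.

Lemma integers_translation (k : int) :
  translation_invariant (freq_measure R Torus) k%:~R.
Proof.
move=> A mA.
pose X := A `&` integers R; pose Y := translate k%:~R @^-1` A `&` integers R.
have XY : Y = (fun x : R => x + k%:~R) @` X.
  apply/seteqP; split => [x [/= Ax [l _ lx]]|_ [x [Ax [l _ lx]] <-]].
    exists (x - k%:~R); last by rewrite subrK.
    by split => //; exists (l - k) => //; rewrite intrB lx.
  by split; [rewrite /= /translate addrK|exists (l + k) => //; rewrite intrD lx].
have YX : X = (fun x : R => x - k%:~R) @` Y.
  rewrite XY image_comp; apply/seteqP; split => [x Xx|_ [x Xx <-]] /=.
    by exists x => //=; rewrite addrK.
  by rewrite addrK.
rewrite -[LHS]/(counting Y) -[RHS]/(counting X) /counting.
have [Xf|Xf] := pselect (finite_set X).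
  have Yf : finite_set Y by rewrite XY; exact: finite_image.
  rewrite !asboolT// XY fset_set_image//; congr (_%:R%:E).
  by rewrite finmap.card_imfset//; exact: addIr.
rewrite !asboolF//; apply: contra_not Xf => Yf.
by rewrite YX; exact: finite_image.
Qed.

(** On the torus only integer translations preserve the counting measure; but almost
    every frequency is an integer. *)
Lemma freq_translation M : {ae freq_measure R M, forall xi,
  translation_invariant (freq_measure R M) xi /\
  translation_invariant (freq_measure R M) (- xi)}.
Proof.
case: M; first by apply/aeW => xi; split; exact: lebesgue_translation.
apply: filterS (freq_measure_integers R) => _ [k _ <-].
by split; [|rewrite -intrN]; exact: integers_translation.
Qed.

End Translations.

Opaque inner rip cintegral expi Normc.normc space_measure freq_measure.

Section ShiftModulation.
Variables (R : realType) (M : manifold).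
Local Notation mu := (space_measure R M).
Local Notation nu := (freq_measure R M).
Local Notation nrmx := (ipnorm (rip mu)).
Local Notation nrmf := (ipnorm (rip nu)).
Let rH := rip_semi_hilbert nu.
Implicit Types (a b c d : Ltwo nu) (f g : Ltwo mu) (xi : R).

Definition shift xi a : Ltwo nu := toL2 nu (fun eta => a (translate xi eta)).

Lemma shift_sqnorm xi a : translation_invariant nu xi ->
  sqnorm nu (fun eta => a (translate xi eta)) = sqnorm nu a.
Proof.
move=> inv; apply: (ge0_integral_invariant (@measurable_translate R xi) inv
  (f := fun y => (nc (a y) ^+ 2)%:E)).
- by apply/measurable_EFinP; apply: measurable_normc_sq; exact: L2_cmeasurable (ltwoP _).
- by move=> y; rewrite lee_fin sqr_ge0.
Qed.

Lemma shiftE xi a : translation_invariant nu xi ->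
  shift xi a = (fun eta => a (translate xi eta)) :> (measurableTypeR R -> R[i]).
Proof.
move=> inv; apply: toL2E; apply/L2_sqnorm; split.
  apply: (cmeasurable_comp (L2_cmeasurable (ltwoP a))); exact: measurable_translate.
by rewrite shift_sqnorm//; have /L2_sqnorm[] := ltwoP a.
Qed.

Lemma nrm_shift xi a : translation_invariant nu xi -> nrmf (shift xi a) = nrmf a.
Proof.
move=> inv; rewrite /ipnorm; congr Num.sqrt; apply: EFin_inj.
by rewrite -!sqnorm_rip (shiftE a inv) shift_sqnorm.
Qed.

Lemma nrm_eq_fun (f g : Ltwo nu) : f = g :> (measurableTypeR R -> R[i]) -> nrmf f = nrmf g.
Proof. by move=> fg; apply: EFin_inj; rewrite -!L2norm_rip fg. Qed.

Lemma nrm_shiftB xi a b : translation_invariant nu xi ->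
  nrmf (shift xi a - shift xi b) = nrmf (a - b).
Proof.
move=> inv; rewrite -(nrm_shift (a - b) inv); apply: nrm_eq_fun.
apply/funext => y; rewrite (ltwoB (shift xi a) (shift xi b)) !shiftE//.
Qed.

Lemma ae_translate xi (Q : measurableTypeR R -> Prop) : translation_invariant nu xi ->
  {ae nu, forall y, Q y} -> {ae nu, forall y, Q (translate xi y)}.
Proof.
move=> inv [A [mA A0 QA]]; exists (translate xi @^-1` A); split.
- by rewrite -[X in measurable X]setTI; exact: measurable_translate.
- by apply: etrans (inv _ mA) _.
- by move=> y /= ny; exact: QA.
Qed.

Definition modulation xi (x : measurableTypeR R) : R[i] := expi (xi * x).

Lemma modulation_bounded xi : bounded_symbol (modulation xi).
Proof.
split; last by exists 1 => x; rewrite normc_expi.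
by have := expi_cmeasurable xi (0 : R); congr cmeasurable; apply/funext => x; rewrite addr0.
Qed.

Definition modul xi f : Ltwo mu := ltwo_mul (modulation xi) f.

Lemma modulE xi f : modul xi f = (fun x => expi (xi * x) * f x) :> (measurableTypeR R -> R[i]).
Proof. exact: ltwo_mulE (modulation_bounded xi). Qed.

Lemma nrm_modul xi f : nrmx (modul xi f) = nrmx f.
Proof. by apply: nrm_mul_unit; [exact: modulation_bounded|move=> x; rewrite normc_expi]. Qed.

Lemma modulB xi f g : modul xi f - modul xi g = modul xi (f - g).
Proof. by rewrite /modul (ltwo_mulB f g (modulation_bounded xi)). Qed.

Lemma modulNE xi f g : inner mu (modul (- xi) f) g = inner mu f (modul xi g).
Proof.
rewrite /modul inner_mul_adj; last exact: modulation_bounded.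
congr (inner mu f (ltwo_mul _ g)); apply/funext => x.
by rewrite /modulation conjc_expi mulNr opprK.
Qed.

Lemma modul_adj xi f g : inner mu (modul xi f) g = inner mu f (modul (- xi) g).
Proof. by have := modulNE (- xi) f g; rewrite opprK. Qed.

Lemma inner_modul xi f (g : measurableTypeR R -> R[i]) : inner mu (modul xi f) g =
  cintegral mu setT (fun x => expi (xi * x) * f x * conjc (g x)).
Proof. exact: inner_mull (modulation_bounded xi). Qed.

Opaque modul shift ipnorm.

Lemma nrm_dftB f g : nrmf (dft f - dft g) = Num.sqrt (2 * pi) * nrmx (f - g).
Proof.
rewrite -nrm_dft.
have E : nrmf (dft (f - g) - (dft f - dft g)) = 0.
  apply: inner_nrm0 => h.
  transitivity (inner mu (f - g : Ltwo mu) (idft0 h)); first exact: dft_adjoint.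
  transitivity (inner mu f (idft0 h) - inner mu g (idft0 h)); first exact: innerBl.
  transitivity (inner nu (dft f) h - inner nu (dft g) h); last exact: (esym (innerBl _ _ _)).
  by congr (_ - _); apply: esym; exact: dft_adjoint.
have := ler_ipnorm_dist rH (dft (f - g)) (dft f - dft g).
by rewrite E normr_le0 subr_eq0 => /eqP.
Qed.

Lemma dft_modul_integrable xi f : translation_invariant nu xi -> cintegrable mu setT f ->
  nrmf (dft (modul xi f) - shift xi (dft f)) = 0.
Proof.
move=> inv fi; apply: ltwo_eq_ae; rewrite (shiftE (dft f) inv).
have mi : cintegrable mu setT (modul xi f).
  rewrite modulE; have mx : measurable_fun setT (fun x : measurableTypeR R => xi * x).
    exact: mulrl_measurable.
  have := cintegrable_expi mx fi; congr (cintegrable _ _ _).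
  by apply/funext => x; rewrite mulrC.
have h1 := dft_integrable mi; have h2 := ae_translate inv (dft_integrable fi).
apply: (ae_imp2 h1 h2) => y e1 e2; apply: etrans e1 _; apply: esym; apply: etrans e2 _.
rewrite /ft modulE; apply: eq_cintegral => x _.
rewrite [RHS]mulrAC -expiD [LHS]mulrC; congr (expi _ * _).
by rewrite /fphase /translate; ring.
Qed.

Lemma dft_modul xi f : translation_invariant nu xi ->
  nrmf (dft (modul xi f) - shift xi (dft f)) = 0.
Proof.
move=> inv; apply/eqP; rewrite eq_le ipnorm_ge0 andbT.
pose fn n := ltwo_cut (@box R n) f.
apply: (@le0_cvg0 _ (fun n => 2 * Num.sqrt (2 * pi) * nrmx (fn n - f))).
  rewrite -[0](mulr0 (2 * Num.sqrt (2 * pi))); apply: cvgM; first exact: cvg_cst.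
  by apply: ltwo_cut_cvg; [exact: measurable_box|exact: box_cover].
move=> n.
have fi : cintegrable mu setT (fn n) by apply: cintegrable_cut; [exact: measurable_box|exact: space_box].
apply: le_trans (ipnorm_distD rH (dft (modul xi (fn n))) _ _) _.
have e1 : nrmf (dft (modul xi f) - dft (modul xi (fn n))) = Num.sqrt (2 * pi) * nrmx (fn n - f).
  by rewrite nrm_dftB modulB nrm_modul (ipnormBC (rip_semi_hilbert mu)).
have e2 : nrmf (dft (modul xi (fn n)) - shift xi (dft f)) <= Num.sqrt (2 * pi) * nrmx (fn n - f).
  apply: le_trans (ipnorm_distD rH (shift xi (dft (fn n))) _ _) _.
  have e3 := dft_modul_integrable inv fi.
  have e4 := etrans (nrm_shiftB (dft (fn n)) (dft f) inv) (nrm_dftB (fn n) f).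
  by apply: le_trans (lerD (eq_ler e3) (eq_ler e4)) _; rewrite add0r lexx.
apply: le_trans (lerD (lexx _) e2) _; rewrite e1 -mulrDl.
by rewrite -[X in (X + X) * _]mul1r -mulrDl.
Qed.

(** The Fourier coefficient at [xi] of a product of two functions; up to a constant it
    pairs [a] shifted by [xi] with [b]. *)
Definition pairing xi a b : R[i] := inner mu (modul xi (idft a)) (idft b).

Lemma pairing_shift xi a b : translation_invariant nu xi ->
  pairing xi a b = ((2 * pi)^-1)%:C * inner nu (shift xi a) b.
Proof.
move=> inv; rewrite /pairing (innerC (idft b)) idft_adjoint conjM conjc_real; congr (_ * _).
rewrite -(innerC b) (nrm0_inner b (dft_modul (idft a) inv)).
by apply: nrm0_inner; rewrite nrm_shiftB// dft_idft.
Qed.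

Lemma pairingBl xi a a' b : pairing xi (a - a') b = pairing xi a b - pairing xi a' b.
Proof.
have E c : pairing xi c b = ((2 * pi)^-1)%:C *
    inner nu c (dft (modul (- xi) (idft b))).
  by apply: etrans (modul_adj _ _ _) _; exact: idft_adjoint.
by rewrite !E (innerBl a a') mulrBr.
Qed.

Lemma pairingNC xi a b : pairing (- xi) b a = conjc (pairing xi a b).
Proof. by apply: etrans (modulNE xi (idft b) (idft a)) _; exact: innerC. Qed.

Lemma pairingBr xi a b b' : pairing xi a (b - b') = pairing xi a b - pairing xi a b'.
Proof.
have E c : pairing xi a c = conjc (pairing (- xi) c a) by rewrite pairingNC conjcK.
by rewrite !E pairingBl conjB.
Qed.

Lemma pairing_le xi a b : nc (pairing xi a b) <= (2 * pi)^-1 * (nrmf a * nrmf b).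
Proof.
apply: le_trans (inner_cauchy_schwarz _ _) _.
apply: le_trans (ler_pM (ipnorm_ge0 _ _) (ipnorm_ge0 _ _)
  (eq_ler (etrans (nrm_modul xi (idft a)) (nrm_idft a))) (eq_ler (nrm_idft b))) _.
rewrite mulrACA -expr2 sqr_sqrtr ?lexx//.
by rewrite invr_ge0; exact: ltW (two_pi_gt0 R).
Qed.

Lemma pairing_cmeasurable a b : cmeasurable (fun xi : measurableTypeR R => pairing xi a b) /\
  cmeasurable (fun xi : measurableTypeR R => pairing (- xi) a b).
Proof.
have key (a' b' : Ltwo nu) : cmeasurable (fun xi : measurableTypeR R => pairing xi a' b').
  pose ph (x xi : measurableTypeR R) : R := - fphase x xi.
  have mph : measurable_fun setT (fun z : measurableTypeR R * measurableTypeR R => ph z.1 z.2).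
    by apply: measurableT_comp => //; exact: measurable_fphase.
  have := @ft_cmeasurable _ _ _ _ _ mu ph mph _
    (cintegrable_cmeasurable (cintegrable_inner (ltwoP (idft a')) (ltwoP (idft b')))).
  congr cmeasurable; apply/funext => xi.
  rewrite /pairing inner_modul; apply: eq_cintegral => x _; rewrite /modulation mulrC mulrA; congr (expi _ * _ * _).
  by rewrite /ph opprK /fphase mulrC.
split; first exact: key.
have E : (fun xi : measurableTypeR R => pairing (- xi) a b) = (fun xi => conjc (pairing xi b a)).
  by apply/funext => xi; rewrite pairingNC.
by rewrite E; apply: cmeasurableJ; exact: key.
Qed.

End ShiftModulation.

Opaque pairing.

(** * The nonlinearity as a form on frequency space *)

Section Form.
Variables (R : realType) (M : manifold) (eps : R).
Hypothesis eps_gt0 : 0 < eps.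
Local Notation mu := (space_measure R M).
Local Notation nu := (freq_measure R M).
Local Notation nrmx := (ipnorm (rip mu)).
Local Notation nrmf := (ipnorm (rip nu)).
Let rH := rip_semi_hilbert nu.
Implicit Types (a b c d : Ltwo nu) (f g : Ltwo mu) (xi : R).

Definition smoother (xi : measurableTypeR R) : R := (1 + eps ^+ 2 * xi ^+ 2)^-1.

Lemma smoother_ge0 xi : 0 <= smoother xi.
Proof. by rewrite invr_ge0 addr_ge0// mulr_ge0 ?sqr_ge0. Qed.

Lemma measurable_smoother : measurable_fun setT smoother.
Proof.
apply: continuous_measurable_fun => y; apply: cvgV.
  by rewrite gt_eqF// ltr_pwDl// mulr_ge0 ?sqr_ge0.
apply: cvgD; first exact: cvg_cst.
apply: cvgM; first exact: cvg_cst.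
by under eq_fun do rewrite expr2; rewrite expr2; apply: cvgM; exact: cvg_id.
Qed.

Lemma integrable_smoother : nu.-integrable setT (EFin \o smoother).
Proof.
have c0 : 0 < 1 + eps ^- 2 by rewrite addr_gt0// invr_gt0 exprn_gt0.
apply: (@integrable_dominated _ _ _ nu smoother (fun y => (1 + eps ^- 2) * japanese_inv2 y)).
- exact: measurable_smoother.
- exact: (integrableZl measurableT (1 + eps ^- 2) (@integrable_japanese_inv2 R M)).
move=> y; rewrite ger0_norm ?smoother_ge0// /smoother /japanese_inv2.
have y0 : 0 <= y ^+ 2 by exact: sqr_ge0.
have e0 : 0 < eps ^+ 2 by rewrite exprn_gt0.
have d1 : 0 < 1 + eps ^+ 2 * y ^+ 2 by rewrite ltr_pwDl// mulr_ge0// ltW.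
have d2 : 0 < 1 + y ^+ 2 by rewrite ltr_pwDl.
rewrite ler_pdivlMr// mulrC ler_pdivrMr// mulrDl mul1r.
have -> : eps ^- 2 * (1 + eps ^+ 2 * y ^+ 2) = eps ^- 2 + y ^+ 2.
  by rewrite mulrDr mulr1 mulrA mulVf ?mul1r// gt_eqF.
have e1 : 0 <= eps ^- 2 by rewrite invr_ge0 ltW.
have e2 : 0 <= eps ^+ 2 * y ^+ 2 by rewrite mulr_ge0// ltW.
lra.
Qed.

Lemma integrable_smootherZ C : nu.-integrable setT (EFin \o (fun xi => smoother xi * C)).
Proof. exact: (integrableZr measurableT C integrable_smoother). Qed.

Definition smoother_mass : R := \int[nu]_xi smoother xi.

Lemma smoother_mass_ge0 : 0 <= smoother_mass.
Proof. by apply: Rintegral_ge0 => xi _; exact: smoother_ge0. Qed.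

Definition kernel_form a b c d xi : R[i] :=
  (smoother xi)%:C * (pairing (- xi) a b * pairing xi c d).

Definition form a b c d : R[i] := cintegral nu setT (kernel_form a b c d).

Lemma kernel_form_cmeasurable a b c d : cmeasurable (kernel_form a b c d).
Proof.
apply: cmeasurableM; first by apply: cmeasurable_real; exact: measurable_smoother.
by apply: cmeasurableM; [exact: (pairing_cmeasurable a b).2|exact: (pairing_cmeasurable c d).1].
Qed.

Lemma kernel_form_dominated a b c d (C : R) :
  (forall xi, nc (pairing (- xi) a b * pairing xi c d) <= C) ->
  cintegrable nu setT (kernel_form a b c d).
Proof.
move=> hC; apply: (@cintegrable_dominated _ _ _ nu _ (fun xi => smoother xi * C)
  (kernel_form_cmeasurable a b c d) (integrable_smootherZ C)).
move=> xi; rewrite /kernel_form Normc.normcM normc_real ger0_norm ?smoother_ge0//.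
by rewrite ler_wpM2l ?smoother_ge0.
Qed.

Lemma kernel_form_integrable a b c d : cintegrable nu setT (kernel_form a b c d).
Proof.
pose B a b := (2 * pi)^-1 * (nrmf a * nrmf b).
apply: (@kernel_form_dominated _ _ _ _ (B a b * B c d)) => xi.
rewrite Normc.normcM; apply: ler_pM; try exact: normc_ge0; exact: pairing_le.
Qed.

(** Almost every frequency only matters, so a bound on the pairings for the
    frequencies that act by translation controls the form. *)
Lemma form_le a b c d (C : R) : 0 <= C ->
  (forall xi, translation_invariant nu xi -> translation_invariant nu (- xi) ->
    nc (pairing (- xi) a b * pairing xi c d) <= C) ->
  nc (form a b c d) <= smoother_mass * C.
Proof.
move=> C0 hC.
apply: le_trans (le_normc_cintegral (kernel_form_integrable a b c d)) _.
have iC := integrable_smootherZ C.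
rewrite /smoother_mass -RintegralZr//; last exact: integrable_smoother.
have ik := cintegrable_normc (kernel_form_integrable a b c d).
rewrite /Rintegral fine_le//.
- exact: (integrable_fin_num _ ik).
- exact: (integrable_fin_num _ iC).
apply: ae_ge0_le_integral => //.
- by move=> xi _; rewrite lee_fin normc_ge0.
- exact: measurable_int _ ik.
- by move=> xi _; rewrite lee_fin mulr_ge0// smoother_ge0.
- exact: measurable_int _ iC.
apply: (ae_imp2 (freq_translation R M) (freq_translation R M)) => xi [i1 i2] _ _.
rewrite lee_fin.
rewrite /kernel_form Normc.normcM normc_real ger0_norm ?smoother_ge0//.
by rewrite ler_wpM2l ?smoother_ge0// hC.
Qed.

Lemma telescope3 (m paa pba pbb qa qb : R[i]) :
  m * (paa * qa) - m * (pbb * qb) =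
  m * ((paa - pba) * qa) + m * ((pba - pbb) * qa) + m * (pbb * (qa - qb)).
Proof. ring. Qed.

Lemma form_diff a b d : form a a a d - form b b b d =
  form (a - b) a a d + form b (a - b) a d + form b b (a - b) d.
Proof.
have i := kernel_form_integrable.
apply: etrans (esym (cintegralB (i a a a d) (i b b b d))) _.
transitivity (cintegral nu setT (fun x => kernel_form (a - b) a a d x +
    kernel_form b (a - b) a d x + kernel_form b b (a - b) d x)).
  apply: eq_cintegral => xi _; rewrite /kernel_form (pairingBl (- xi) a b a).
  rewrite (pairingBr (- xi) b a b) (pairingBl xi a b d); exact: telescope3.
apply: etrans (cintegralD (cintegrableD (i (a - b) a a d) (i b (a - b) a d)) (i b b (a - b) d)) _.
by congr (_ + _); exact: (cintegralD (i (a - b) a a d) (i b (a - b) a d)).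
Qed.

Lemma form_self_real a : Im (form a a a a) = 0.
Proof.
rewrite -[LHS]/(\int[nu]_xi Im (kernel_form a a a a xi)).
rewrite -[RHS](_ : \int[nu]_(xi in setT) (0 : R) = 0); last by rewrite /Rintegral integral0.
apply: eq_Rintegral => xi _; rewrite /kernel_form pairingNC mulrC [_ * pairing _ _ _]mulrC.
by rewrite mulJ_normc ImM /= !mulr0 !mul0r addr0.
Qed.

(** Through the inverse transform, so that a function of the frequency alone is the
    argument; inner_nonlin expresses it by the form. *)
Definition nonlin a : Ltwo nu := dft (toL2 mu (nonlinearity M eps (idft a))).

Let density f (x : measurableTypeR R) : R[i] := (Normc.normc (f x) ^+ 2)%:C.

Let density_integrable f : cintegrable mu setT (density f).
Proof.
have := cintegrable_inner (ltwoP f) (ltwoP f); congr (cintegrable _ _ _).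
by apply/funext => x; rewrite mulJ_normc.
Qed.

Let potential_symbol f (xi : measurableTypeR R) : R[i] :=
  (smoother xi)%:C * fourierL1 M (density f) xi.

Lemma fourierL1_density f xi : fourierL1 M (density f) xi = inner mu (modul (- xi) f) f.
Proof.
rewrite inner_modul; apply: eq_cintegral => x _.
by rewrite /density -mulJ_normc mulrC mulrA mulNr (mulrC xi).
Qed.

Lemma potential_symbol_integrable f : cintegrable nu setT (potential_symbol f).
Proof.
have m1 : cmeasurable (fourierL1 M (density f)).
  exact: (@ft_cmeasurable _ _ _ _ _ mu (@fphase R) (@measurable_fphase R) _
    (cintegrable_cmeasurable (density_integrable f))).
have mp : cmeasurable (potential_symbol f).
  by apply: cmeasurableM => //; apply: cmeasurable_real; exact: measurable_smoother.
apply: (@cintegrable_dominated _ _ _ nu _ (fun xi => smoother xi * (nrmx f * nrmx f)) mp (integrable_smootherZ (nrmx f * nrmx f))).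
move=> xi; rewrite Normc.normcM normc_real ger0_norm ?smoother_ge0//.
rewrite ler_wpM2l ?smoother_ge0// fourierL1_density.
apply: le_trans (inner_cauchy_schwarz _ _) _.
by apply: ler_pM (ipnorm_ge0 _ _) (ipnorm_ge0 _ _) (eq_ler (nrm_modul _ _)) (lexx _).
Qed.

Lemma potentialE f x : helmholtz_inv M eps (density f) x =
  ((2 * pi)^-1)%:C * ft nu (@bphase R) (potential_symbol f) x.
Proof.
congr (_ * _); apply: eq_cintegral => xi _.
by rewrite /bphase opprK.
Qed.

Lemma nonlinearity_L2 f : L2 mu (nonlinearity M eps f).
Proof.
have pi0 := potential_symbol_integrable f.
have mp : cmeasurable (helmholtz_inv M eps (density f)).
  rewrite (funext (potentialE f)); apply: cmeasurableM; first exact: cmeasurable_cst.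
  exact: (@ft_cmeasurable _ _ _ _ _ nu (@bphase R) (@measurable_bphase R) _
    (cintegrable_cmeasurable pi0)).
apply: (L2_mul_bounded (c := (2 * pi)^-1 * \int[nu]_xi nc (potential_symbol f xi)) (ltwoP f) mp).
move=> x; rewrite potentialE Normc.normcM normc_real ger0_norm.
  rewrite ler_wpM2l//; first by rewrite invr_ge0 ltW// two_pi_gt0.
  exact: (@ft_bounded _ _ _ _ _ nu (@bphase R) (@measurable_bphase R)).
by rewrite invr_ge0 ltW// two_pi_gt0.
Qed.

(** The potential is the inverse transform of an integrable function, so Fubini moves
    the frequency integral outside the pairing with [g]. *)
Lemma inner_nonlinearity f g : inner mu (nonlinearity M eps f) g = ((2 * pi)^-1)%:C *
  cintegral nu setT (fun xi => (smoother xi)%:C *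
    (inner mu (modul (- xi) f) f * inner mu (modul xi f) g)).
Proof.
have pi0 := potential_symbol_integrable f.
have fg := cintegrable_inner (ltwoP f) (ltwoP g).
pose ph (x xi : measurableTypeR R) : R := - fphase x xi.
have mph : measurable_fun setT (fun z : measurableTypeR R * measurableTypeR R => ph z.1 z.2).
  by apply: measurableT_comp => //; exact: measurable_fphase.
have D := @ft_duality _ _ _ _ _ mu nu ph mph _ _ fg pi0.
transitivity (((2 * pi)^-1)%:C * cintegral mu setT (fun x => f x * conjc (g x) *
    cintegral nu setT (fun xi => potential_symbol f xi * expi (- ph x xi)))).
  rewrite -cintegralZ.
    apply: eq_cintegral => x _; rewrite /nonlinearity potentialE.
    by rewrite -!mulrA; congr (_ * _); rewrite mulrC mulrA.
  apply: (cintegrable_dominated (g := fun x => nc (f x * conjc (g x)) *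
      \int[nu]_xi nc (potential_symbol f xi))).
  - apply: cmeasurableM; first exact: cintegrable_cmeasurable fg.
    exact: (@ft_cmeasurable _ _ _ _ _ nu (@bphase R) (@measurable_bphase R) _
      (cintegrable_cmeasurable pi0)).
  - exact: (integrableZr measurableT _ (cintegrable_normc fg)).
  - move=> x; rewrite Normc.normcM ler_wpM2l ?normc_ge0//.
    exact: (@ft_bounded _ _ _ _ _ nu (@bphase R) (@measurable_bphase R)).
congr (_ * _); rewrite -D; apply: eq_cintegral => xi _.
rewrite /potential_symbol fourierL1_density -mulrA; congr (_ * (_ * _)).
rewrite inner_modul; apply: eq_cintegral => x _.
by rewrite /ph opprK mulrC mulrA (mulrC xi).
Qed.

Lemma inner_dft_nonlinearity f a d : nrmx (f - idft a) = 0 ->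
  inner nu (dft (toL2 mu (nonlinearity M eps f))) d = form a a a d.
Proof.
move=> fa; have p0 := two_pi_gt0 R; have NL := nonlinearity_L2 f.
set h := toL2 mu _.
have E : inner nu (dft h) d = (2 * pi)%:C * inner mu h (idft d).
  rewrite (innerC (idft d)) (idft_adjoint d) conjM conjc_real mulrA -rmorphM.
  by rewrite mulfV ?gt_eqF// mul1r -(innerC d).
apply: etrans E _; rewrite /h (toL2E NL) inner_nonlinearity mulrA -rmorphM mulfV ?gt_eqF//.
rewrite mul1r; apply: eq_cintegral => xi _; congr (_ * (_ * _)).
  transitivity (inner mu (modul (- xi) (idft a)) f).
    by apply: nrm0_inner; rewrite modulB nrm_modul.
  rewrite (innerC f) [RHS]innerC; congr conjc; exact: nrm0_inner.
by apply: nrm0_inner; rewrite modulB nrm_modul.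
Qed.

Lemma inner_nonlin a d : inner nu (nonlin a) d = form a a a d.
Proof. by apply: inner_dft_nonlinearity; rewrite subrr ipnorm0//; exact: rip_semi_hilbert. Qed.

Lemma dft_nonlinearity f :
  nrmf (dft (toL2 mu (nonlinearity M eps f)) - nonlin (dft f)) = 0.
Proof.
apply: inner_nrm0 => d.
apply: etrans (@inner_dft_nonlinearity f (dft f) d _) (esym (inner_nonlin _ _)).
by rewrite (ipnormBC (rip_semi_hilbert mu)); exact: idft_dft.
Qed.

(** Conservation of mass: the potential is real. *)
Lemma nonlin_orthogonal a : rip nu ('i *: nonlin a) a = 0.
Proof.
transitivity (Re (inner nu ('i *: nonlin a) a)); first exact: erefl.
rewrite (innerZl 'i (nonlin a) a) inner_nonlin.
by rewrite ReM /= mul0r mul1r form_self_real subrr.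
Qed.

End Form.

Opaque kernel_form form nonlin.

(** * Tame estimates in weighted spaces *)

(** A bounded weight [w] that is even and quasi-subadditive can be distributed over
    the factors of a convolution; [C] is the only constant that enters. *)
Record weight (R : realType) (w : R -> R) (C : R) : Prop := Weight {
  weight_meas : measurable_fun setT (w : measurableTypeR R -> R);
  weight_bnd : exists B : R, forall x, w x <= B;
  weight_ge1 : forall x, 1 <= w x;
  weight_even : forall x, w (- x) = w x;
  weight_sub : forall x y, w (x + y) <= C * (w x + w y) }.

Section Tame.
Variables (R : realType) (M : manifold) (eps : R).
Hypothesis eps_gt0 : 0 < eps.
Variables (w : R -> R) (C : R).
Hypothesis W : weight w C.
Local Notation mu := (space_measure R M).
Local Notation nu := (freq_measure R M).
Local Notation nrmf := (ipnorm (rip nu)).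
Let rH := rip_semi_hilbert nu.
Implicit Types (a b c d : Ltwo nu) (xi : R).

Definition wsymbol (x : measurableTypeR R) : R[i] := (w x)%:C.
Definition weighted a : Ltwo nu := ltwo_mul wsymbol a.
Definition wnorm a : R := nrmf (weighted a).

Let w_gt0 x : 0 < w x.
Proof. exact: lt_le_trans ltr01 (weight_ge1 W x). Qed.

Let C_ge0 : 0 <= C.
Proof.
have := weight_sub W 0 0; rewrite addr0 => h.
have w0 := w_gt0 0; rewrite leNgt; apply/negP => C0.
have : C * (w 0 + w 0) <= 0 by rewrite mulr_le0_ge0 ?(ltW C0)// addr_ge0// ltW.
lra.
Qed.

Lemma wsymbol_bounded : bounded_symbol wsymbol.
Proof.
split; first by apply: cmeasurable_real; exact: weight_meas W.
have [B hB] := weight_bnd W; exists B => x.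
by rewrite normc_real ger0_norm// ltW.
Qed.

Lemma weightedE a : weighted a = (fun x => (w x)%:C * a x) :> (measurableTypeR R -> R[i]).
Proof. exact: ltwo_mulE wsymbol_bounded. Qed.

Lemma wnorm_ge0 a : 0 <= wnorm a.
Proof. exact: ipnorm_ge0. Qed.

Lemma weighted_adj a b : inner nu (weighted a) b = inner nu a (weighted b).
Proof.
rewrite /weighted inner_mul_adj; last exact: wsymbol_bounded.
by congr (inner nu a (ltwo_mul _ b)); apply/funext => x; rewrite /wsymbol conjc_real.
Qed.

Lemma nrm_le_wnorm a : nrmf a <= wnorm a.
Proof.
pose m (x : measurableTypeR R) : R[i] := ((w x)^-1)%:C.
have mb : bounded_symbol m.
  split; last by exists 1 => x; rewrite normc_real ger0_norm ?invr_ge0 ?(ltW (w_gt0 x))//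
    invf_le1 ?w_gt0// (weight_ge1 W).
  apply: cmeasurable_real; apply: measurable_inv_ge0; first exact: weight_meas W.
  by move=> x; exact: ltW.
have <- : nrmf (ltwo_mul m (weighted a)) = nrmf a.
  apply: nrm_eq_fun; rewrite (ltwo_mulE (weighted a) mb) weightedE.
  by apply/funext => x; rewrite mulrA -rmorphM mulVf ?mul1r// gt_eqF.
rewrite -[X in _ <= X]mul1r; apply: nrm_mul_le mb _ => x.
by rewrite normc_real ger0_norm ?invr_ge0 ?(ltW (w_gt0 x))// invf_le1 ?w_gt0// (weight_ge1 W).
Qed.

Let quotient_bounded xi : bounded_symbol (fun eta : measurableTypeR R =>
    (w eta / (w (translate xi eta) + w xi))%:C : R[i]) /\
  forall eta, nc ((w eta / (w (translate xi eta) + w xi))%:C : R[i]) <= C.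
Proof.
have le eta : nc ((w eta / (w (translate xi eta) + w xi))%:C : R[i]) <= C.
  have p : 0 < w (translate xi eta) + w xi by rewrite addr_gt0.
  rewrite normc_real ger0_norm; last by rewrite divr_ge0 ?(ltW p)// ltW.
  rewrite ler_pdivrMr//; apply: le_trans (weight_sub W _ _).
  by rewrite /translate subrK.
split => //; split; last by exists C.
apply: cmeasurable_real; apply: measurable_funM; first exact: weight_meas W.
apply: measurable_inv_ge0; last by move=> eta; rewrite addr_ge0// ltW.
apply: measurable_funD => //.
by apply: measurableT_comp; [exact: weight_meas W|exact: measurable_translate].
Qed.

Lemma pairing_weight_right xi c d : translation_invariant nu xi ->
  nc (pairing xi c (weighted d)) <=
  (2 * pi)^-1 * (C * (wnorm c + w xi * nrmf c) * nrmf d).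
Proof.
move=> inv; have p0 := two_pi_gt0 R; have [qb qC] := quotient_bounded xi.
rewrite (pairing_shift c (weighted d) inv) Normc.normcM normc_real.
rewrite ger0_norm ?invr_ge0 ?(ltW p0)//; apply: ler_wpM2l; first by rewrite invr_ge0 ltW.
rewrite -weighted_adj; apply: le_trans (inner_cauchy_schwarz _ _) _.
apply: ler_wpM2r; first exact: ipnorm_ge0.
set q := (fun eta => _) in qb.
have -> : nrmf (weighted (shift xi c)) =
    nrmf (ltwo_mul q (shift xi (weighted c) + (w xi)%:C *: shift xi c)).
  apply: nrm_eq_fun; rewrite weightedE (ltwo_mulE _ qb).
  apply/funext => eta; rewrite (ltwoD (shift xi (weighted c)) ((w xi)%:C *: shift xi c)).
  rewrite (ltwoZ (w xi)%:C (shift xi c)) !shiftE// weightedE /q -mulrDl mulrA -rmorphD -rmorphM.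
  by rewrite divfK// gt_eqF// addr_gt0.
apply: le_trans (nrm_mul_le _ qb qC) _; rewrite ler_wpM2l//.
apply: le_trans (ipnormD rH _ _) _; apply: lerD; first by rewrite (nrm_shift (weighted c) inv).
by rewrite (ipnormZ rH) (nrm_shift c inv) ger0_norm// ltW.
Qed.

Lemma pairing_weight_left xi a b : translation_invariant nu (- xi) ->
  w xi * nc (pairing (- xi) a b) <=
  (2 * pi)^-1 * (C * (wnorm a * nrmf b + nrmf a * wnorm b)).
Proof.
move=> inv; have p0 := two_pi_gt0 R.
pose q (eta : measurableTypeR R) : R[i] := (w xi / (w (translate (- xi) eta) + w eta))%:C.
have qC eta : nc (q eta) <= C.
  have p : 0 < w (translate (- xi) eta) + w eta by rewrite addr_gt0.
  rewrite normc_real ger0_norm; last by rewrite divr_ge0 ?(ltW p)// ltW.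
  rewrite ler_pdivrMr// -[w eta](weight_even W); apply: le_trans (weight_sub W _ _).
  by rewrite /translate opprK addrAC subrr add0r.
have qb : bounded_symbol q.
  split; last by exists C.
  apply: cmeasurable_real; apply: measurable_funM => //.
  apply: measurable_inv_ge0; last by move=> eta; rewrite addr_ge0// ltW.
  apply: measurable_funD; last exact: weight_meas W.
  by apply: measurableT_comp; [exact: weight_meas W|exact: measurable_translate].
rewrite (pairing_shift a b inv) Normc.normcM normc_real ger0_norm ?invr_ge0 ?(ltW p0)//.
rewrite mulrCA; apply: ler_wpM2l; first by rewrite invr_ge0 ltW.
rewrite -[X in X * _](ger0_norm (ltW (w_gt0 xi))) -normc_real -Normc.normcM -innerZl.
have qL : nrmf (ltwo_mul (fun x => conjc (q x)) b) <= C * nrmf b.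
  by apply: nrm_mul_le; [exact: bounded_symbolJ|move=> x; rewrite normc_conj].
have qwL : nrmf (ltwo_mul (fun x => conjc (q x)) (weighted b)) <= C * wnorm b.
  by apply: nrm_mul_le; [exact: bounded_symbolJ|move=> x; rewrite normc_conj].
have -> : inner nu ((w xi)%:C *: shift (- xi) a) b =
    inner nu (shift (- xi) (weighted a)) (ltwo_mul (fun x => conjc (q x)) b) +
    inner nu (shift (- xi) a) (ltwo_mul (fun x => conjc (q x)) (weighted b)).
  have e1 := inner_mul_adj (shift (- xi) (weighted a)) b qb.
  have e2 := inner_mul_adj (shift (- xi) a) (weighted b) qb.
  rewrite -e1 -e2 -weighted_adj.
  apply: etrans _ (innerDl _ _ _).
  apply: nrm0_inner; apply: ltwo_eq_ae; apply/aeW => eta.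
  rewrite (ltwoZ (w xi)%:C (shift (- xi) a)).
  rewrite (ltwoD (ltwo_mul q (shift (- xi) (weighted a))) (weighted (ltwo_mul q (shift (- xi) a)))).
  rewrite weightedE !(ltwo_mulE _ qb) !shiftE// weightedE /q.
  rewrite [X in _ = _ + X]mulrCA -mulrDr -mulrDl -rmorphD mulrA -rmorphM.
  by rewrite divfK// gt_eqF// addr_gt0.
apply: le_trans (normcD_le _ _) _.
apply: le_trans (lerD (inner_cauchy_schwarz _ _) (inner_cauchy_schwarz _ _)) _.
rewrite (nrm_shift (weighted a) inv) (nrm_shift a inv) mulrDr; apply: lerD.
  by rewrite mulrCA; apply: ler_wpM2l; [exact: ipnorm_ge0|].
by rewrite mulrCA; apply: ler_wpM2l; [exact: ipnorm_ge0|].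
Qed.

Lemma tame_arith (P Q k K na nb n wa wb wn nd wx : R) :
  0 <= P -> 0 <= k -> 0 <= K -> 0 <= na -> 0 <= nb -> 0 <= n -> 0 <= wa -> 0 <= wb ->
  0 <= wn -> 0 <= nd ->
  Q <= k * (K * (wn + wx * n) * nd) ->
  wx * P <= k * (K * (wa * nb + na * wb)) -> P <= k * (na * nb) ->
  P * Q <= k ^+ 2 * (K + K ^+ 2) * ((na * nb * wn + (wa * nb + na * wb) * n) * nd).
Proof.
move=> P0 k0 K0 na0 nb0 n0 wa0 wb0 wn0 nd0 h1 h2 h3.
apply: le_trans (ler_wpM2l P0 h1) _.
rewrite [X in X <= _](_ : _ = k * K * nd * (P * wn + (wx * P) * n)); last by ring.
apply: (@le_trans _ _ (k * K * nd * (k * (na * nb) * wn + k * (K * (wa * nb + na * wb)) * n))).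
  apply: ler_wpM2l; first by rewrite !mulr_ge0.
  by apply: lerD; apply: ler_wpM2r.
rewrite -subr_ge0 [X in 0 <= X](_ : _ = k ^+ 2 * nd *
    (K * ((wa * nb + na * wb) * n) + K ^+ 2 * (na * nb * wn))); last by ring.
apply: mulr_ge0; first by rewrite mulr_ge0// sqr_ge0.
apply: addr_ge0; apply: mulr_ge0 => //; rewrite ?sqr_ge0 ?mulr_ge0//.
by rewrite addr_ge0// mulr_ge0.
Qed.

Lemma tame_arith2 (T n na nb ne ka kb ke : R) :
  0 <= T -> 0 <= n -> 0 <= na -> 0 <= nb -> 0 <= ne -> 0 <= ka -> 0 <= kb -> 0 <= ke ->
  T * (ne * na * ka + (ke * na + ne * ka) * na) * n +
  T * (nb * ne * ka + (kb * ne + nb * ke) * na) * n +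
  T * (nb * nb * ke + (kb * nb + nb * kb) * ne) * n <=
  T * ((na ^+ 2 + na * nb + nb ^+ 2) * ke + 2 * (ka + kb) * (na + nb) * ne) * n.
Proof.
move=> T0 n0 na0 nb0 ne0 ka0 kb0 ke0; rewrite -subr_ge0.
rewrite [X in 0 <= X](_ : _ = T * n * (ne * (na * kb + ka * nb))); last by ring.
by apply: mulr_ge0; apply: mulr_ge0 => //; rewrite addr_ge0 ?mulr_ge0.
Qed.

Definition tame_const : R := smoother_mass M eps * ((2 * pi)^-1 ^+ 2 * (C + C ^+ 2)).

Lemma tame_const_ge0 : 0 <= tame_const.
Proof.
have p0 := two_pi_gt0 R; apply: mulr_ge0; first exact: smoother_mass_ge0.
by apply: mulr_ge0; [exact: sqr_ge0|apply: addr_ge0; [exact: C_ge0|exact: sqr_ge0]].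
Qed.

Opaque weighted.

(** In every product of pairings the weight falls on one of the three arguments,
    after which Cauchy-Schwarz and the integrability of the smoother conclude. *)
Lemma form_tame a b c d : nc (form eps a b c (weighted d)) <=
  tame_const * (nrmf a * nrmf b * wnorm c + (wnorm a * nrmf b + nrmf a * wnorm b) * nrmf c) * nrmf d.
Proof.
have p0 := two_pi_gt0 R.
have k0 : 0 <= (2 * pi)^-1 :> R by rewrite invr_ge0; exact: ltW.
have n0 x := ipnorm_ge0 (rip nu) x.
have S0 : 0 <= nrmf a * nrmf b * wnorm c + (wnorm a * nrmf b + nrmf a * wnorm b) * nrmf c.
  apply: addr_ge0; first by apply: mulr_ge0; [exact: mulr_ge0|exact: wnorm_ge0].
  apply: mulr_ge0 => //; apply: addr_ge0; apply: mulr_ge0 => //; exact: wnorm_ge0.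
have CC : 0 <= C + C ^+ 2 by apply: addr_ge0; [exact: C_ge0|exact: sqr_ge0].
rewrite /tame_const -mulrA -[X in _ <= X]mulrA; apply: (form_le eps_gt0).
  by apply: mulr_ge0; apply: mulr_ge0 => //; exact: sqr_ge0.
move=> xi i1 i2; rewrite Normc.normcM.
exact: (tame_arith (normc_ge0 _) k0 C_ge0 (n0 a) (n0 b) (n0 c) (wnorm_ge0 a) (wnorm_ge0 b)
  (wnorm_ge0 c) (n0 d) (pairing_weight_right c d i1) (pairing_weight_left a b i2)
  (pairing_le (- xi) a b)).
Qed.

Lemma sqr_le_mul (x K : R) : 0 <= x -> 0 <= K -> x ^+ 2 <= K * x -> x <= K.
Proof.
move=> x0 K0; have [->//|xn0] := eqVneq x 0.
by rewrite expr2 ler_pM2r// lt_neqAle eq_sym xn0.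
Qed.

(** The form is trilinear: its increment is a sum of three terms with one
    factor [a - b], each controlled by the tame estimate. *)
Lemma nonlin_tame a b : wnorm (nonlin eps a - nonlin eps b) <=
  tame_const * ((nrmf a ^+ 2 + nrmf a * nrmf b + nrmf b ^+ 2) * wnorm (a - b) +
    2 * (wnorm a + wnorm b) * (nrmf a + nrmf b) * nrmf (a - b)).
Proof.
have T0 := tame_const_ge0; have n0 x := ipnorm_ge0 (rip nu) x; have w0 := wnorm_ge0.
apply: sqr_le_mul; first exact: w0.
  apply: mulr_ge0 => //; apply: addr_ge0.
    apply: mulr_ge0 => //; apply: addr_ge0; last exact: sqr_ge0.
    by apply: addr_ge0; [exact: sqr_ge0|exact: mulr_ge0].
  apply: mulr_ge0 => //; apply: mulr_ge0; last exact: addr_ge0.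
  by apply: mulr_ge0 => //; exact: addr_ge0.
pose D : Ltwo nu := nonlin eps a - nonlin eps b; rewrite -/D.
have E : (wnorm D ^+ 2)%:C = form eps a a a (weighted (weighted D)) -
    form eps b b b (weighted (weighted D)).
  transitivity (inner nu (weighted D) (weighted D)); first by rewrite inner_self.
  apply: etrans (weighted_adj _ _) _; apply: etrans (innerBl _ _ _) _.
  by congr (_ - _); exact: inner_nonlin.
have -> : wnorm D ^+ 2 = nc (wnorm D ^+ 2)%:C.
  by rewrite normc_real ger0_norm// sqr_ge0.
rewrite E form_diff//.
apply: le_trans (normcD_le _ _) _; apply: le_trans (lerD (normcD_le _ _) (lexx _)) _.
apply: le_trans (lerD (lerD (form_tame _ _ _ _) (form_tame _ _ _ _)) (form_tame _ _ _ _)) _.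
exact: tame_arith2.
Qed.

End Tame.

(** * The free evolution *)

Section Phases.
Variable R : realType.

Lemma sin_le_id (x : R) : 0 <= x -> `|sin x| <= x.
Proof.
rewrite le_eqVlt => /orP[/eqP <-|x0]; first by rewrite sin0 normr0.
have [c _ E] := @MVT R sin cos 0 x x0 (fun y _ => is_derive_sin y)
  (continuous_subspaceT (@continuous_sin R)).
move: E; rewrite sin0 !subr0 => ->.
by rewrite normrM (gtr0_norm x0) ler_piMl ?cos_max// ltW.
Qed.

Lemma normc_expiB (x y : R) : nc (expi x - expi y) <= `|x - y|.
Proof.
have sq (z : R) : 2 - 2 * cos z = (2 * sin (z / 2)) ^+ 2.
  have zE : z = (z / 2) *+ 2 by rewrite mulr2n; field.
  rewrite {1}zE cos_mulr2n exprMn -[sin _ ^+ 2](addKr (cos (z / 2) ^+ 2)) cos2Dsin2.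
  rewrite -[_ *+ 2]mulr_natl; ring.
have E : nc (expi x - expi y) ^+ 2 = (2 * sin ((x - y) / 2)) ^+ 2.
  rewrite -sq normc_sq.
  have -> : cos (x - y) = cos x * cos y + sin x * sin y by rewrite cosB.
  have -> : Re (expi x - expi y) = cos x - cos y by [].
  have -> : Im (expi x - expi y) = sin x - sin y by [].
  have := cos2Dsin2 x; have := cos2Dsin2 y; rewrite !expr2; nra.
have h : `|2 * sin ((x - y) / 2)| <= `|x - y|.
  wlog xy : x y {E} / 0 <= x - y => [H|].
    have [|yx] := leP 0 (x - y); first exact: H.
    have := H y x; rewrite subr_ge0 => /(_ (ltW _)); rewrite -subr_lt0 => /(_ yx).
    by rewrite (distrC y x) -(opprB x y) mulNr sinN mulrN normrN.
  rewrite normrM ger0_norm// (ger0_norm xy).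
  have := sin_le_id (x := (x - y) / 2); lra.
rewrite -(ger0_norm (normc_ge0 _)) -sqrtr_sqr E sqrtr_sqr; exact: h.
Qed.

End Phases.

Lemma add3_le (R : realType) (x y z : R) : y <= z -> x + (y + x) <= 2 * x + z.
Proof. lra. Qed.

Section Evolution.
Variables (R : realType) (M : manifold) (eps : R).
Local Notation nu := (freq_measure R M).
Local Notation nrmf := (ipnorm (rip nu)).
Let rH := rip_semi_hilbert nu.
Implicit Types (a b : Ltwo nu) (t s : R).

Lemma dispersion_ge0 (x : R) : 0 <= dispersion eps x.
Proof.
apply: addr_ge0; last exact: sqr_ge0.
by apply: mulr_ge0; [exact: sqr_ge0|exact: exprn_even_ge0].
Qed.

Definition phase_symbol t (xi : measurableTypeR R) : R[i] := expi (t * dispersion eps xi).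

Lemma measurable_dispersion : measurable_fun setT (dispersion eps : measurableTypeR R -> R).
Proof.
apply: continuous_measurable_fun => y.
have c2 : (fun y : R => y ^+ 2) @ y --> y ^+ 2.
  by under eq_fun do rewrite expr2; rewrite expr2; apply: cvgM; exact: cvg_id.
apply: cvgD => //; apply: cvgM; first exact: cvg_cst.
have E (z : R) : z ^+ 4 = z ^+ 2 * z ^+ 2 by rewrite -exprD.
by under eq_fun do rewrite E; rewrite E; exact: cvgM.
Qed.

Lemma phase_symbol_bounded t : bounded_symbol (phase_symbol t).
Proof.
split; last by exists 1 => x; rewrite normc_expi.
apply: cmeasurable_expi; apply: measurable_funM => //; exact: measurable_dispersion.
Qed.

Definition ev t a : Ltwo nu := ltwo_mul (phase_symbol t) a.

Lemma ltwo_ext (f g : Ltwo nu) : f = g :> (measurableTypeR R -> R[i]) -> f = g.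
Proof. by move=> fg; apply: val_inj. Qed.

Lemma evE t a : ev t a = (fun xi => expi (t * dispersion eps xi) * a xi) :> (measurableTypeR R -> R[i]).
Proof. exact: ltwo_mulE (phase_symbol_bounded t). Qed.

Lemma evD s t a : ev s (ev t a) = ev (s + t) a.
Proof.
by apply: ltwo_ext; rewrite !evE; apply/funext => xi; rewrite mulrA -expiD mulrDl.
Qed.

Lemma ev0 a : ev 0 a = a.
Proof. by apply: ltwo_ext; rewrite evE; apply/funext => xi; rewrite mul0r expi0 mul1r. Qed.

Lemma evK t a : ev t (ev (- t) a) = a.
Proof. by rewrite evD subrr ev0. Qed.

Lemma evNK t a : ev (- t) (ev t a) = a.
Proof. by rewrite evD addNr ev0. Qed.

Lemma evB t a b : ev t (a - b) = ev t a - ev t b.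
Proof. exact: ltwo_mulB (phase_symbol_bounded t). Qed.

Lemma evZ t c a : ev t (c *: a) = c *: ev t a.
Proof.
apply: ltwo_ext; rewrite (ltwoZ c (ev t a)) !evE; apply/funext => xi.
by rewrite (ltwoZ c a) mulrCA.
Qed.

Lemma nrm_ev t a : nrmf (ev t a) = nrmf a.
Proof. by apply: nrm_mul_unit; [exact: phase_symbol_bounded|move=> x; rewrite normc_expi]. Qed.

Lemma ev_adj t a b : inner nu (ev t a) b = inner nu a (ev (- t) b).
Proof.
apply: etrans (inner_mul_adj a b (phase_symbol_bounded t)) _.
congr (inner nu a (ltwo_mul _ b)); apply/funext => x.
by rewrite /phase_symbol conjc_expi mulNr.
Qed.

Lemma rip_ev_adj t a b : rip nu (ev t a) b = rip nu a (ev (- t) b).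
Proof.
transitivity (Re (inner nu (ev t a) b)); first exact: erefl.
by rewrite ev_adj.
Qed.

Opaque ev.

Lemma ev_dist_cut t t0 n a : nrmf (ev t (ltwo_cut (@box R n) a) - ev t0 (ltwo_cut (@box R n) a)) <=
  `|t - t0| * dispersion eps n%:R * nrmf a.
Proof.
set c := ltwo_cut _ _.
pose q (xi : measurableTypeR R) : R[i] :=
  (phase_symbol t xi - phase_symbol t0 xi) * (\1_(@box R n) xi)%:C.
have K0 : 0 <= `|t - t0| * dispersion eps n%:R.
  by apply: mulr_ge0 => //; exact: dispersion_ge0.
have qC xi : nc (q xi) <= `|t - t0| * dispersion eps n%:R.
  rewrite Normc.normcM normc_real indicE; case: (boolP (xi \in _)) => [|_]; last by rewrite normr0 mulr0.
  rewrite inE /box /= in_itv/= -ler_norml => xin.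
  rewrite normr1 mulr1; apply: le_trans (normc_expiB _ _) _.
  rewrite -mulrBl normrM; apply: ler_wpM2l => //.
  have x2 : xi ^+ 2 <= n%:R ^+ 2.
    by rewrite -[X in X <= _]real_normK ?num_real// lerXn2r// nnegrE.
  rewrite (ger0_norm (dispersion_ge0 xi)) /dispersion.
  apply: lerD => //; apply: ler_wpM2l; first exact: sqr_ge0.
  have E (z : R) : z ^+ 4 = (z ^+ 2) ^+ 2 by rewrite -exprM.
  by rewrite !E; apply: lerXn2r => //; rewrite nnegrE; exact: sqr_ge0.
have qb : bounded_symbol q.
  split; last by eexists; exact: qC.
  apply: cmeasurableM; last by apply: cmeasurable_real; exact: measurable_indic (@measurable_box R n).
  by apply: cmeasurableB; [exact: (phase_symbol_bounded t).1|exact: (phase_symbol_bounded t0).1].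
have -> : nrmf (ev t c - ev t0 c) = nrmf (ltwo_mul q a).
  apply: nrm_eq_fun; rewrite (ltwoB (ev t c) (ev t0 c)) (ltwo_mulE a qb) !evE.
  by apply/funext => xi; rewrite /c (ltwo_cutE a (@measurable_box R n)) /q -mulrBl -mulrA.
exact: nrm_mul_le.
Qed.

Lemma ev_dist_le t t0 n a : nrmf (ev t a - ev t0 a) <=
  2 * nrmf (ltwo_cut (@box R n) a - a) +
  `|t - t0| * dispersion eps n%:R * nrmf a.
Proof.
set c := ltwo_cut _ _.
apply: le_trans (ipnorm_distD rH (ev t c) _ _) _.
have e1 : nrmf (ev t a - ev t c) = nrmf (c - a) by rewrite -evB nrm_ev (ipnormBC rH).
have e2 : nrmf (ev t c - ev t0 a) <= nrmf (ev t c - ev t0 c) + nrmf (c - a).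
  apply: le_trans (ipnorm_distD rH (ev t0 c) _ _) _.
  by rewrite -evB nrm_ev.
apply: le_trans (lerD (eq_ler e1) e2) _.
have := ev_dist_cut t t0 n a; rewrite -/c.
exact: add3_le.
Qed.

(** Strong continuity: high frequencies carry little mass, low ones move slowly. *)
Lemma ev_dist_small t0 a (e : R) : 0 < e ->
  exists2 dl : R, 0 < dl & forall t, `|t - t0| <= dl -> nrmf (ev t a - ev t0 a) <= e.
Proof.
move=> e0.
have /cvgrPdist_le /(_ (e / 4)) := ltwo_cut_cvg (mu := nu) a (@measurable_box R) (@box_cover R).
have e4 : 0 < e / 4 by rewrite divr_gt0.
move=> /(_ e4) [n _ /(_ n (leqnn n))] /=; rewrite sub0r normrN ger0_norm ?ipnorm_ge0// => hn.
pose K : R := dispersion eps n%:R * nrmf a + 1.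
have K0 : 0 < K.
  by apply: ltr_wpDl => //; apply: mulr_ge0; [exact: dispersion_ge0|exact: ipnorm_ge0].
exists (e / 2 / K); first by rewrite !divr_gt0.
move=> t td; apply: le_trans (ev_dist_le t t0 n a) _.
have h : `|t - t0| * dispersion eps n%:R * nrmf a <= e / 2.
  rewrite -mulrA; apply: (@le_trans _ _ (`|t - t0| * K)).
    by apply: ler_wpM2l => //; rewrite /K lerDl.
  by rewrite -ler_pdivlMr.
lra.
Qed.

End Evolution.

(** * The flow of the profile equation *)

Section Radial.
Variables (R : realType) (V : lmodType R[i]) (ip : V -> V -> R).
Hypothesis ipH : semi_hilbert ip.
Local Notation nrm := (ipnorm ip).

Definition ball_factor (r x : R) : R := if x <= r then 1 else r / x.
(** The radial retraction to the ball of radius [r]; it is Lipschitz and fixes the ball. *)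
Definition to_ball r f : V := (ball_factor r (nrm f))%:C *: f.

Lemma ball_factor_gt0 (r x : R) : 0 < r -> 0 < ball_factor r x.
Proof.
move=> r0; rewrite /ball_factor; case: ifP => // /negbT; rewrite -ltNge => rx.
by rewrite divr_gt0// (lt_trans r0).
Qed.

Lemma nrm_to_ball (r : R) f : 0 < r -> nrm (to_ball r f) <= r.
Proof.
move=> r0; rewrite /to_ball (ipnormZ ipH) (gtr0_norm (ball_factor_gt0 _ r0)).
rewrite /ball_factor; case: ifP => [h|/negbT]; first by rewrite mul1r.
by rewrite -ltNge => rx; rewrite divfK// gt_eqF// (lt_trans r0).
Qed.

Lemma ball_factor_dist (r x y : R) : 0 < r -> 0 <= x -> 0 <= y ->
  `|ball_factor r x - ball_factor r y| * y <= `|x - y|.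
Proof.
move=> r0 x0 y0; rewrite /ball_factor.
case: (leP x r) => xr; case: (leP y r) => yr.
- by rewrite subrr normr0 mul0r.
- have yp : 0 < y by apply: lt_trans yr.
  have h : r / y <= 1 by rewrite ler_pdivrMr// mul1r ltW.
  rewrite ger0_norm ?subr_ge0// mulrBl mul1r divfK ?gt_eqF//.
  by rewrite distrC ger0_norm; lra.
- have xp : 0 < x by apply: lt_trans xr.
  have h : r / x <= 1 by rewrite ler_pdivrMr// mul1r ltW.
  rewrite distrC ger0_norm ?subr_ge0// [X in _ <= X]ger0_norm; last by lra.
  apply: (@le_trans _ _ ((1 - r / x) * x)).
    by apply: ler_wpM2l; [rewrite subr_ge0|lra].
  by rewrite mulrBl mul1r divfK ?gt_eqF//; lra.
- have xp : 0 < x by apply: lt_trans xr.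
  have yp : 0 < y by apply: lt_trans yr.
  have -> : r / x - r / y = (r / x) * ((y - x) / y) by field; rewrite !gt_eqF.
  rewrite normrM -mulrA [`|(y - x) / y|]normf_div (gtr0_norm yp) divfK ?gt_eqF//.
  have h : `|r / x| <= 1.
    by rewrite (gtr0_norm (divr_gt0 r0 xp)) ler_pdivrMr// mul1r ltW.
  by rewrite (distrC x) ler_piMl.
Qed.

Lemma to_ball_lip (r : R) f g : 0 < r -> nrm (to_ball r f - to_ball r g) <= 2 * nrm (f - g).
Proof.
move=> r0.
have -> : to_ball r f - to_ball r g = (ball_factor r (nrm f))%:C *: (f - g) +
    (ball_factor r (nrm f) - ball_factor r (nrm g))%:C *: g.
  by rewrite /to_ball rmorphB scalerBr scalerBl addrA subrK.
apply: le_trans (ipnormD ipH _ _) _; rewrite !(ipnormZ ipH).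
have c1 : `|ball_factor r (nrm f)| <= 1.
  rewrite (gtr0_norm (ball_factor_gt0 _ r0)) /ball_factor; case: ifP => // /negbT.
  by rewrite -ltNge => h; rewrite ler_pdivrMr ?(lt_trans r0)// mul1r ltW.
have h1 : `|ball_factor r (nrm f)| * nrm (f - g) <= nrm (f - g).
  by rewrite ler_piMl// ipnorm_ge0.
have h2 := ball_factor_dist r0 (ipnorm_ge0 ip f) (ipnorm_ge0 ip g).
have h3 := ler_ipnorm_dist ipH f g.
by rewrite mulr2n mulrDl mul1r; apply: lerD => //; exact: le_trans h2 h3.
Qed.

Lemma to_ball_id (r : R) f : nrm f <= r -> to_ball r f = f.
Proof. by move=> h; rewrite /to_ball /ball_factor h scale1r. Qed.

End Radial.

Section Flow.
Variables (R : realType) (M : manifold) (eps : R).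
Hypothesis eps_gt0 : 0 < eps.
Local Notation leb := (@lebesgue_measure R).
Local Notation nu := (freq_measure R M).
Local Notation nrmf := (ipnorm (rip nu)).
Local Notation N := (nonlin eps).
Local Notation E := (ev eps).
Let rH := rip_semi_hilbert nu.
Implicit Types (a b f : Ltwo nu) (t s : R).

Lemma unit_weight : weight (fun=> 1 : R) 1.
Proof.
split => //; first by exists 1.
by move=> x y; rewrite mul1r lerDl.
Qed.

Lemma weighted_unit a : weighted (fun=> 1 : R) a = a.
Proof.
apply: ltwo_ext; rewrite (weightedE unit_weight); apply/funext => x.
by rewrite mul1r.
Qed.

Definition lip_const : R := tame_const M eps 1.

Lemma lip_const_ge0 : 0 <= lip_const.
Proof. exact: (tame_const_ge0 M eps unit_weight). Qed.

Lemma nonlin_wnorm (w : R -> R) (C : R) a : weight w C ->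
  wnorm w (N a) <= 3 * tame_const M eps C * nrmf a ^+ 2 * wnorm w a.
Proof.
move=> W; have T0 := tame_const_ge0 M eps W.
have a0 := ipnorm_ge0 (rip nu) a; have wa0 := wnorm_ge0 w a.
apply: sqr_le_mul; first exact: wnorm_ge0.
  by apply: mulr_ge0 => //; apply: mulr_ge0; [exact: mulr_ge0|exact: sqr_ge0].
have -> : wnorm w (N a) ^+ 2 = nc (form eps a a a (weighted w (weighted w (N a)))).
  have -> : form eps a a a (weighted w (weighted w (N a))) = (wnorm w (N a) ^+ 2)%:C.
    transitivity (inner nu (weighted w (N a)) (weighted w (N a))); last by rewrite inner_self.
    by apply: esym; apply: etrans (weighted_adj W _ _) _; exact: inner_nonlin.
  by rewrite normc_real ger0_norm// sqr_ge0.
apply: le_trans (form_tame eps_gt0 W _ _ _ _) _.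
rewrite le_eqVlt; apply/orP; left; apply/eqP.
rewrite -[nrmf (weighted w (N a))]/(wnorm w (N a)).
move: (wnorm w (N a)) (wnorm w a) (nrmf a) (tame_const M eps C) => x y z k; ring.
Qed.

Lemma wnorm_unit a : wnorm (fun=> 1 : R) a = nrmf a.
Proof. by rewrite /wnorm weighted_unit. Qed.

Lemma nonlin_nrm a : nrmf (N a) <= 3 * lip_const * nrmf a ^+ 3.
Proof.
by have := nonlin_wnorm a unit_weight; rewrite !wnorm_unit -/lip_const -mulrA -exprSr.
Qed.

(** The two summands of the tame estimate are merged: on a ball of the weighted
    norm all factors are at most [A]. *)
Lemma nonlin_wlip (w : R -> R) (C A : R) a b : weight w C ->
  wnorm w a <= A -> wnorm w b <= A ->
  wnorm w (N a - N b) <= 11 * tame_const M eps C * A ^+ 2 * wnorm w (a - b).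
Proof.
move=> W aA bA; have T0 := tame_const_ge0 M eps W.
apply: le_trans (nonlin_tame eps_gt0 W a b) _.
have h x : 0 <= nrmf x <= wnorm w x by rewrite ipnorm_ge0 (nrm_le_wnorm W).
have := h a; have := h b; have := h (a - b).
move: aA bA T0; move: (wnorm w a) (wnorm w b) (wnorm w (a - b)) (nrmf a) (nrmf b) (nrmf (a - b))
  (tame_const M eps C) => ka kb ke na nb ne T kaA kbA T0 /andP[ne0 nek] /andP[nb0 nbk] /andP[na0 nak].
have naA : na <= A by exact: le_trans kaA.
have nbA : nb <= A by exact: le_trans kbA.
have A0 : 0 <= A by exact: le_trans naA.
have ke0 : 0 <= ke by exact: le_trans nek.
have s1 : na ^+ 2 + na * nb + nb ^+ 2 <= 3 * A ^+ 2.
  have -> : 3 * A ^+ 2 = A * A + A * A + A * A by ring.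
  by rewrite !expr2; apply: lerD; [apply: lerD|]; apply: ler_pM.
have s2 : 2 * (ka + kb) * (na + nb) <= 8 * A ^+ 2.
  have -> : 8 * A ^+ 2 = (2 * (A + A)) * (A + A) by ring.
  apply: ler_pM; [|exact: addr_ge0| |exact: lerD].
    by rewrite mulr_ge0// addr_ge0// ?(le_trans na0 nak) ?(le_trans nb0 nbk).
  by rewrite ler_wpM2l//; exact: lerD.
rewrite [X in _ <= X](_ : _ = T * (11 * A ^+ 2 * ke)); last by ring.
apply: ler_wpM2l => //.
have -> : 11 * A ^+ 2 * ke = 3 * A ^+ 2 * ke + 8 * A ^+ 2 * ke by ring.
apply: lerD; first exact: ler_wpM2r.
apply: (@le_trans _ _ (8 * A ^+ 2 * ne)); first exact: ler_wpM2r.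
by apply: ler_wpM2l => //; rewrite mulr_ge0// sqr_ge0.
Qed.

(** Velocity of the profile: the nonlinearity conjugated by the free evolution. *)
Definition field t f : Ltwo nu := 'i *: E t (N (E (- t) f)).

Lemma nrm_i f : nrmf ('i *: f) = nrmf f.
Proof.
rewrite (nrm_scale 'i f) (_ : nc 'i = 1) ?mul1r//.
by rewrite -[LHS](ger0_norm (normc_ge0 _)) -sqrtr_sqr normc_sq /= expr0n add0r expr1n sqrtr1.
Qed.

Lemma coef_ge0 (k L r : R) : 0 <= k -> 0 <= L -> 0 <= k * L * r ^+ 2.
Proof. by move=> k0 L0; apply: mulr_ge0; [exact: mulr_ge0|exact: sqr_ge0]. Qed.

Lemma half_add (x y z : R) : x <= z / 2 -> y <= z / 2 -> x + y <= z.
Proof. lra. Qed.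

Lemma lip_arith (L r x : R) : 0 <= x -> 11 * L * r ^+ 2 * (2 * x) <= (22 * L * r ^+ 2 + 1) * x.
Proof. by move=> x0; rewrite -subr_ge0 (_ : _ - _ = x)//; ring. Qed.

Let cut_field r t f : Ltwo nu := 'i *: E t (N (to_ball (rip nu) r (E (- t) f))).

Let cut_field_lip (r : R) t f g : 0 < r ->
  nrmf (cut_field r t f - cut_field r t g) <= (22 * lip_const * r ^+ 2 + 1) * nrmf (f - g).
Proof.
move=> r0; rewrite /cut_field -scalerBr nrm_i -evB nrm_ev.
set p := to_ball _ _ _; set q := to_ball _ _ _.
have pr : nrmf p <= r by exact: nrm_to_ball.
have qr : nrmf q <= r by exact: nrm_to_ball.
have h := @nonlin_wlip _ _ r p q unit_weight; rewrite !wnorm_unit in h.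
apply: le_trans (h pr qr) _.
have l : nrmf (p - q) <= 2 * nrmf (f - g).
  by apply: le_trans (to_ball_lip rH _ _ r0) _; rewrite -evB nrm_ev.
have L0 := lip_const_ge0.
apply: (@le_trans _ _ (11 * lip_const * r ^+ 2 * (2 * nrmf (f - g)))).
  by apply: ler_wpM2l => //; exact: coef_ge0.
apply: lip_arith; exact: ipnorm_ge0.
Qed.

Let cut_field_bnd (r : R) t f : 0 < r -> nrmf (cut_field r t f) <= 3 * lip_const * r ^+ 3.
Proof.
move=> r0; rewrite /cut_field nrm_i nrm_ev; apply: le_trans (nonlin_nrm _) _.
apply: ler_wpM2l; first by rewrite mulr_ge0// lip_const_ge0.
by apply: lerXn2r; rewrite ?nnegrE ?ipnorm_ge0 ?(ltW r0)//; exact: nrm_to_ball.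
Qed.

Let cut_field_cts (r : R) f phi : 0 < r -> continuous (fun t => rip nu (cut_field r t f) phi).
Proof.
move=> r0 t0; apply/cvgrPdist_le => e e0.
set g := N (to_ball (rip nu) r (E (- t0) f)).
pose K := 22 * lip_const * r ^+ 2 + 1.
have K0 : 0 < K by apply: ltr_wpDl => //; apply: coef_ge0 => //; exact: lip_const_ge0.
pose P := nrmf phi + 1.
have P0 : 0 < P by rewrite ltr_wpDl// ipnorm_ge0.
pose e' := e / P / 2.
have e'0 : 0 < e' by rewrite !divr_gt0.
have [d1 d10 h1] := ev_dist_small eps t0 g e'0.
have [d2 d20 h2] := ev_dist_small eps (- t0) f (divr_gt0 e'0 K0).
have near1 : \forall t \near t0, `|t - t0| <= Num.min d1 d2.
  have m0 : 0 < Num.min d1 d2 by rewrite lt_min d10.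
  by apply: filterS (nbhsx_ballx t0 _ m0) => t /=; rewrite /ball /= distrC => /ltW.
apply: filterS near1 => t; rewrite le_min => /andP[t1 t2].
rewrite -(ipBl rH); apply: le_trans (ip_cauchy_schwarz rH _ _) _.
have step : nrmf (cut_field r t0 f - cut_field r t f) <= e / P.
  rewrite (ipnormBC rH) /cut_field -scalerBr nrm_i.
  apply: le_trans (ipnorm_distD rH (E t g) _ _) _.
  have l1 : nrmf (E t g - E t0 g) <= e' by exact: h1.
  have l2 : nrmf (E t (N (to_ball (rip nu) r (E (- t) f))) - E t g) <= e'.
    rewrite -evB nrm_ev.
    set p := to_ball _ _ _; rewrite /g; set q := to_ball _ _ _.
    have h := @nonlin_wlip _ _ r p q unit_weight; rewrite !wnorm_unit in h.
    apply: le_trans (h _ _) _; try exact: nrm_to_ball.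
    have l : nrmf (p - q) <= 2 * (e' / K).
      apply: le_trans (to_ball_lip rH _ _ r0) _; rewrite ler_wpM2l//.
      by apply: h2; rewrite opprK addrC distrC.
    have L0 := lip_const_ge0.
    apply: (@le_trans _ _ (11 * lip_const * r ^+ 2 * (2 * (e' / K)))).
      by apply: ler_wpM2l => //; exact: coef_ge0.
    have eK0 : 0 <= e' / K by apply: ltW; exact: divr_gt0.
    by apply: le_trans (lip_arith _ _ eK0) _; rewrite -/K mulrCA mulfV ?mulr1// gt_eqF.
  exact: half_add l2 l1.
apply: le_trans (ler_pM (ipnorm_ge0 _ _) (ipnorm_ge0 _ _) step (lexx _)) _.
rewrite -mulrA ler_piMr//; first exact: ltW.
by rewrite mulrC ler_pdivrMr// mul1r /P lerDl.
Qed.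

Let cut_field_orth r t f : 0 < r -> rip nu (cut_field r t f) f = 0.
Proof.
move=> r0; rewrite /cut_field -evZ rip_ev_adj.
set g := E (- t) f; have c0 := ball_factor_gt0 (nrmf g) r0.
have := nonlin_orthogonal eps_gt0 (to_ball (rip nu) r g).
rewrite {2}/to_ball (ipZr rH) => /eqP; rewrite mulf_eq0 (gt_eqF c0) /=.
by move=> /eqP.
Qed.

Definition profile T a0 (a : R -> Ltwo nu) : Prop :=
  weak_primitive (rip nu) T a0 (fun s => field s (a s)) a.

(** Picard iteration for the field precomposed with the retraction to a ball larger
    than the conserved norm. *)
Theorem flow_exists a0 : exists a : R -> Ltwo nu,
  [/\ exists B, forall s t, nrmf (a t - a s) <= B * `|t - s|,
      forall t, nrmf (a t) = nrmf a0,
      forall phi, continuous (fun s => rip nu (field s (a s)) phi) &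
      forall T, profile T a0 a].
Proof.
(* adding one keeps the radius positive when the datum vanishes *)
pose r := nrmf a0 + 1.
have r0 : 0 < r by rewrite ltr_wpDl// ipnorm_ge0.
have K0 : 0 < 22 * lip_const * r ^+ 2 + 1.
  by apply: ltr_wpDl => //; apply: coef_ge0 => //; exact: lip_const_ge0.
have Gl t f g := cut_field_lip t f g r0.
have Gb t f := cut_field_bnd t f r0.
have Gc f phi := @cut_field_cts r f phi r0.
have [a [aL aC aE]] := weak_ode_exists rH a0 K0 Gl Gb Gc.
have mass := weak_ode_norm rH Gb (fun t f => cut_field_orth t f r0) aL aC aE.
have fE s : cut_field r s (a s) = field s (a s).
  rewrite /cut_field /field to_ball_id// nrm_ev mass /r lerDl//.
have FE phi : (fun s => rip nu (cut_field r s (a s)) phi) =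
    (fun s => rip nu (field s (a s)) phi).
  by apply/funext => s; exact: (congr1 (fun f => rip nu f phi) (fE s)).
exists a; split; [by exists (3 * lip_const * r ^+ 3); exact: aL|exact: mass| |].
  by move=> phi; rewrite -(FE phi); exact: aC.
move=> T t tT phi; split; last first.
  apply: etrans (aE t phi) _.
  exact: (congr1 (fun h : R -> R => rip nu a0 phi + \int[leb]_(s in `[0, t]) h s) (FE phi)).
have h := @continuous_itv_integrable R _ 0 t (aC phi).
exact: (eq_ind _ (fun k : R -> R => leb.-integrable `[0, t] (EFin \o k)) h _ (FE phi)).
Qed.

End Flow.

(** * Bounds for the profile *)

Section ProfileBounds.
Variables (R : realType) (M : manifold) (eps : R).
Hypothesis eps_gt0 : 0 < eps.
Variables (w : R -> R) (C : R).
Hypothesis W : weight w C.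
Local Notation leb := (@lebesgue_measure R).
Local Notation nu := (freq_measure R M).
Local Notation nrmf := (ipnorm (rip nu)).
Local Notation E := (ev eps).
Let rH := rip_semi_hilbert nu.
Implicit Types (f g : Ltwo nu) (t s : R).

Lemma weightedB f g : weighted w (f - g) = weighted w f - weighted w g.
Proof. exact: ltwo_mulB (wsymbol_bounded W). Qed.

Lemma wnormB_le f g : wnorm w (f - g) <= wnorm w f + wnorm w g.
Proof. by rewrite /wnorm weightedB; exact: ipnormB rH _ _. Qed.

Lemma weightedZ c f : weighted w (c *: f) = c *: weighted w f.
Proof.
apply: ltwo_ext; rewrite (ltwoZ c (weighted w f)) !(weightedE W) (ltwoZ c f).
by apply/funext => x; rewrite mulrCA.
Qed.

Lemma wnormZ c f : wnorm w (c *: f) = nc c * wnorm w f.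
Proof. rewrite /wnorm weightedZ; exact: nrm_scale. Qed.

Lemma normc_i : nc ('i : R[i]) = 1.
Proof. by rewrite -[LHS](ger0_norm (normc_ge0 _)) -sqrtr_sqr normc_sq /= expr0n add0r expr1n sqrtr1. Qed.

Lemma weighted_ev t f : weighted w (E t f) = E t (weighted w f).
Proof.
apply: ltwo_ext; rewrite (weightedE W) !evE (weightedE W); apply/funext => x.
by rewrite mulrCA.
Qed.

Lemma wnorm_ev t f : wnorm w (E t f) = wnorm w f.
Proof. by rewrite /wnorm weighted_ev; exact: nrm_ev. Qed.

Lemma rip_weighted f g : rip nu f (weighted w g) = rip nu (weighted w f) g.
Proof.
transitivity (Re (inner nu f (weighted w g))); first exact: erefl.
rewrite -(weighted_adj W); exact: erefl.
Qed.

Lemma wnorm_sq f : rip nu f (weighted w (weighted w f)) = wnorm w f ^+ 2.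
Proof. by rewrite rip_weighted (ipnorm_sq rH). Qed.

Lemma wnorm_cs f g : `|rip nu g (weighted w (weighted w f))| <= wnorm w g * wnorm w f.
Proof. by rewrite rip_weighted; exact: ip_cauchy_schwarz rH _ _. Qed.

Lemma wnorm_bnd : exists2 B, 0 <= B & forall f, wnorm w f <= B * nrmf f.
Proof.
have [B hB] := weight_bnd W.
have w1 := weight_ge1 W.
exists B; first exact: le_trans ler01 (le_trans (w1 0) (hB 0)).
move=> f; apply: (nrm_mul_le _ (wsymbol_bounded W)).
by move=> x; rewrite normc_real ger0_norm// (le_trans ler01).
Qed.

Lemma field_wlip t (A : R) f g : wnorm w f <= A -> wnorm w g <= A ->
  wnorm w (field eps t f - field eps t g) <= 11 * tame_const M eps C * A ^+ 2 * wnorm w (f - g).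
Proof.
move=> fA gA; rewrite /field -scalerBr wnormZ normc_i mul1r -evB wnorm_ev.
apply: le_trans (nonlin_wlip eps_gt0 W (A := A) _ _) _; try by rewrite wnorm_ev.
by rewrite -evB wnorm_ev.
Qed.

Lemma field_wbnd t f : wnorm w (field eps t f) <= 3 * tame_const M eps C * nrmf f ^+ 2 * wnorm w f.
Proof.
rewrite /field wnormZ normc_i mul1r wnorm_ev; apply: le_trans (nonlin_wnorm eps_gt0 _ W) _.
by rewrite nrm_ev wnorm_ev.
Qed.

Definition lip_rate (A : R) : R := 11 * tame_const M eps C * A ^+ 2 + 1.

Lemma lip_rate_gt0 A : 0 < lip_rate A.
Proof.
have T0 := tame_const_ge0 M eps W.
have h : 0 <= 11 * tame_const M eps C * A ^+ 2 by apply: mulr_ge0; [exact: mulr_ge0|exact: sqr_ge0].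
exact: ltr_wpDl h ltr01.
Qed.

(** Both profiles solve the same equation, so their difference grows at the rate of
    the Lipschitz constant of the field on the ball of radius [A]. *)
Lemma profile_wlip (T A : R) a0 b0 (a b : R -> Ltwo nu) :
  profile eps T a0 a -> profile eps T b0 b ->
  (forall t, 0 <= t <= T -> wnorm w (a t) <= A) ->
  (forall t, 0 <= t <= T -> wnorm w (b t) <= A) ->
  forall t, 0 <= t <= T ->
    wnorm w (a t - b t) <= 2 * wnorm w (a0 - b0) * expR (2 * lip_rate A * t).
Proof.
move=> aP bP aA bA.
have abP := weak_primitiveB rH aP bP.
apply: (gronwall_weak (M := A + A) (lip_rate_gt0 A) (@wnorm_ge0 R M w) wnorm_sq wnorm_cs abP).
- move=> t tT; apply: le_trans (field_wlip t (aA t tT) (bA t tT)) _.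
  by apply: ler_wpM2r; [exact: wnorm_ge0|rewrite /lip_rate lerDl].
- move=> t tT; apply: le_trans (wnormB_le _ _) _.
  exact: lerD (aA t tT) (bA t tT).
Qed.

End ProfileBounds.

Section ProfileMass.
Variables (R : realType) (M : manifold) (eps : R).
Hypothesis eps_gt0 : 0 < eps.
Local Notation leb := (@lebesgue_measure R).
Local Notation nu := (freq_measure R M).
Local Notation nrmf := (ipnorm (rip nu)).
Let rH := rip_semi_hilbert nu.

(** The integrand may be unbounded a priori; but each pairing with [a t] is bounded
    by the integral of its weak derivative over the whole time interval. *)
Lemma profile_bounded (T : R) a0 (a : R -> Ltwo nu) : profile eps T a0 a ->
  exists K, forall t, 0 <= t <= T -> nrmf (a t) <= K.
Proof.
move=> aP.
suff h phi : exists C : R, forall f, [set f | exists2 t, 0 <= t <= T & a t = f] f -> `|rip nu f phi| <= C.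
  have [K hK] := uniform_boundedness rH h.
  by exists K => t tT; apply: hK; exists t.
have [T0|T0] := ltP T 0.
  by exists 0 => f [t /andP[t0 tT] _]; have := le_lt_trans (le_trans t0 tT) T0; rewrite ltxx.
have TT : 0 <= T <= T by rewrite T0 lexx.
have [iT _] := aP T TT phi.
set h := fun s => rip nu (field eps s (a s)) phi in iT.
exists (`|rip nu a0 phi| + \int[leb]_(s in `[0, T]) `|h s|) => _ [t tT <-].
have [it ->] := aP t tT phi; rewrite -/h in it *.
apply: le_trans (ler_normD _ _) _; apply: lerD => //.
apply: le_trans (le_normr_Rintegral _ it) _ => //.
have iaT : leb.-integrable `[0, T] (fun s => (`|h s|)%:E) := integrable_abse iT.
have iat : leb.-integrable `[0, t] (fun s => (`|h s|)%:E) := integrable_abse it.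
apply: fine_le; [exact: integrable_fin_num iat|exact: integrable_fin_num iaT|].
apply: ge0_subset_integral => //; first exact: measurable_int iaT.
  by move: tT => /andP[_ tT] s /=; rewrite !in_itv/= => /andP[-> st] /=; exact: le_trans st tT.
Qed.

(** The flow with the same initial value conserves the norm, and Gronwall in L2
    identifies it with the given profile. *)
Lemma profile_mass (T : R) a0 (a : R -> Ltwo nu) : profile eps T a0 a ->
  forall t, 0 <= t <= T -> nrmf (a t) = nrmf a0.
Proof.
move=> aP t tT; have [K hK] := profile_bounded aP.
have [b [_ bm _ bP]] := flow_exists eps_gt0 a0.
pose A := K + nrmf a0.
have aA s : 0 <= s <= T -> wnorm (fun=> 1 : R) (a s) <= A.
  move=> sT; rewrite wnorm_unit; apply: le_trans (hK s sT) _.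
  by rewrite /A lerDl; exact: ipnorm_ge0.
have K0 : 0 <= K by apply: le_trans (hK t tT); exact: ipnorm_ge0.
have bA s : 0 <= s <= T -> wnorm (fun=> 1 : R) (b s) <= A.
  by move=> sT; rewrite wnorm_unit bm /A lerDr.
have := profile_wlip eps_gt0 (unit_weight R) aP (bP T) aA bA tT.
rewrite !wnorm_unit subrr (ipnorm0 rH) mulr0 mul0r => h.
have h2 := le_trans (ler_ipnorm_dist rH (a t) (b t)) h.
move: h2; rewrite normr_le0 subr_eq0 bm => /eqP; exact.
Qed.

Variables (w : R -> R) (C : R).
Hypothesis W : weight w C.

Definition growth_rate (m : R) : R := 3 * tame_const M eps C * m ^+ 2 + 1.

Lemma growth_rate_gt0 m : 0 < growth_rate m.
Proof.
have T0 := tame_const_ge0 M eps W.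
have h : 0 <= 3 * tame_const M eps C * m ^+ 2 by apply: mulr_ge0; [exact: mulr_ge0|exact: sqr_ge0].
exact: ltr_wpDl h ltr01.
Qed.

Lemma field_wgrowth t (f : Ltwo nu) : wnorm w (field eps t f) <= growth_rate (nrmf f) * wnorm w f.
Proof.
apply: le_trans (field_wbnd eps_gt0 W t f) _.
by apply: ler_wpM2r; [exact: wnorm_ge0|rewrite /growth_rate lerDl].
Qed.

(** Mass conservation makes the field of linear growth in every weighted norm. *)
Lemma profile_wbound (T : R) a0 (a : R -> Ltwo nu) : profile eps T a0 a ->
  forall t, 0 <= t <= T ->
    wnorm w (a t) <= 2 * wnorm w a0 * expR (2 * growth_rate (nrmf a0) * t).
Proof.
move=> aP; have mass := profile_mass aP; have [B B0 hB] := wnorm_bnd M W.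
apply: (gronwall_weak (M := B * nrmf a0) (growth_rate_gt0 _) (@wnorm_ge0 R M w) (wnorm_sq W)
  (wnorm_cs W) aP).
  by move=> t tT; apply: le_trans (field_wgrowth t _) _; rewrite mass.
by move=> t tT; apply: le_trans (hB _) _; rewrite mass.
Qed.

End ProfileMass.

(** * Sobolev norms as suprema of bounded weights *)

(** Fatou for the squared moduli. *)
Lemma sqnorm_fatou d (T : measurableType d) (R : realType) (mu : {measure set T -> \bar R})
    (f : nat -> T -> R[i]) (f0 : T -> R[i]) (c : \bar R) :
  (forall n, cmeasurable (f n)) ->
  (forall x, (fun n => nc (f n x)) @ \oo --> nc (f0 x)) ->
  (forall n, (sqnorm mu (f n) <= c)%E) -> (sqnorm mu f0 <= c)%E.
Proof.
move=> mf ff0 fc.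
pose h n x := (nc (f n x) ^+ 2)%:E.
have mh n : measurable_fun setT (h n).
  by apply/measurable_EFinP; exact: measurable_normc_sq.
have -> : sqnorm mu f0 = (\int[mu]_x limn_einf (h ^~ x))%E.
  rewrite /sqnorm; apply: eq_integral => x _.
  have hx : (h ^~ x) @ \oo --> (nc (f0 x) ^+ 2)%:E.
    apply: cvg_EFin; first exact: nearW.
    rewrite /comp /h /= expr2; under eq_fun do rewrite /= expr2; apply: cvgM; exact: ff0.
  by rewrite is_cvg_limn_einfE ?(cvg_lim _ hx)//; apply: cvgP hx.
apply: le_trans (fatou mu measurableT mh _) _.
  by move=> n x _; rewrite lee_fin sqr_ge0.
exact: limn_einf_le.
Qed.

Section SobolevWeights.
Variables (R : realType) (M : manifold) (s : R).
Hypothesis s_ge0 : 0 <= s.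
Local Notation nu := (freq_measure R M).
Local Notation nrmf := (ipnorm (rip nu)).

Lemma japanese_ge1 (x : R) : 1 <= japanese x.
Proof. by rewrite -{1}sqrtr1 /japanese ler_wsqrtr// lerDl sqr_ge0. Qed.

Lemma japanese_sq (x : R) : japanese x ^+ 2 = 1 + x ^+ 2.
Proof. by rewrite sqr_sqrtr// addr_ge0// sqr_ge0. Qed.

Lemma japaneseD (x y : R) : japanese (x + y) <= japanese x + japanese y.
Proof.
have jx := japanese_ge1 x; have jy := japanese_ge1 y.
have x0 : 0 <= japanese x by lra.
have y0 : 0 <= japanese y by lra.
rewrite -(@ler_pXn2r _ 2)// ?nnegrE ?addr_ge0 ?sqrtr_ge0//.
rewrite sqrrD !japanese_sq.
suff h : x * y <= japanese x * japanese y by rewrite sqrrD; lra.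
apply: le_trans (ler_norm _) _; rewrite -(@ler_pXn2r _ 2)// ?nnegrE ?mulr_ge0//.
rewrite real_normK ?num_real// !exprMn !japanese_sq.
by apply: ler_pM; rewrite ?sqr_ge0// lerDr.
Qed.

Lemma measurable_japanese : measurable_fun setT (@japanese R : measurableTypeR R -> R).
Proof.
apply: continuous_measurable_fun => y; rewrite /japanese.
apply: (cvg_comp (fun x : R => 1 + x ^+ 2) Num.sqrt); last exact: sqrt_continuous.
by apply: cvgD; [exact: cvg_cst|under eq_fun do rewrite expr2; rewrite expr2; apply: cvgM; exact: cvg_id].
Qed.

Definition sobolev_symbol (x : R) : R := japanese x `^ s.
(** Truncation makes the weighted norms finite on L2, so that Gronwall applies to them. *)
Definition sobolev_weight (n : nat) (x : R) : R := Num.min (sobolev_symbol x) n.+1%:R.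

Lemma measurable_sobolev_symbol : measurable_fun setT (sobolev_symbol : measurableTypeR R -> R).
Proof.
have -> : sobolev_symbol = (@powR R ^~ s) \o @japanese R by [].
by apply: measurableT_comp; [exact: measurable_powR|exact: measurable_japanese].
Qed.

Lemma powR_ge1 (x : R) : 1 <= x -> 1 <= x `^ s.
Proof.
move=> x1; have x0 : 0 <= x := le_trans ler01 x1.
apply: (@le_trans _ _ (1 `^ s)); first by rewrite powR1.
by apply: ge0_ler_powR; rewrite ?nnegrE.
Qed.

Lemma sobolev_symbol_ge1 x : 1 <= sobolev_symbol x.
Proof. exact: powR_ge1 (japanese_ge1 x). Qed.

Lemma sobolev_weight_ge1 n x : 1 <= sobolev_weight n x.
Proof. by rewrite le_min sobolev_symbol_ge1 /= ler1n. Qed.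

(** The constant does not depend on [n], because truncation by a constant preserves
    quasi-subadditivity. *)
Lemma sobolev_weightP n : weight (sobolev_weight n) (2 `^ s).
Proof.
have c1 : 1 <= 2 `^ s :> R by apply: powR_ge1; lra.
have c0 : 0 <= 2 `^ s :> R by exact: powR_ge0.
split.
- apply: measurable_minr; [exact: measurable_sobolev_symbol|exact: measurable_cst].
- by exists n.+1%:R => x; rewrite ge_min lexx orbT.
- exact: sobolev_weight_ge1.
- by move=> x; rewrite /sobolev_weight /sobolev_symbol /japanese sqrrN.
- move=> x y; wlog yx : x y / japanese y <= japanese x => [H|].
    have [|/ltW xy] := leP (japanese y) (japanese x); first exact: H.
    by rewrite [x + y]addrC [X in _ * X]addrC; exact: H.
  have wy := le_trans ler01 (sobolev_weight_ge1 n y).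
  apply: (@le_trans _ _ (2 `^ s * sobolev_weight n x)); last by rewrite ler_wpM2l// lerDl.
  have j1 := japanese_ge1 x; have j2 := japanese_ge1 (x + y); have j3 := japaneseD x y.
  have S : sobolev_symbol (x + y) <= 2 `^ s * sobolev_symbol x.
    rewrite /sobolev_symbol -powRM//; last by lra.
    by apply: ge0_ler_powR; rewrite ?nnegrE//; lra.
  rewrite {2}/sobolev_weight minr_pMr// le_min; apply/andP; split.
    by rewrite ge_min S.
  by rewrite ge_min (ler_peMl _ c1)// orbT.
Qed.

Definition sobolev_norm (f : measurableTypeR R -> R[i]) : \bar R :=
  L2norm nu (fun xi => (sobolev_symbol xi)%:C * f xi).

Lemma cmeasurable_sobolev f : cmeasurable f -> cmeasurable (fun xi : measurableTypeR R => (sobolev_symbol xi)%:C * f xi).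
Proof. by move=> mf; apply: cmeasurableM mf; apply: cmeasurable_real; exact: measurable_sobolev_symbol. Qed.

Lemma sobolev_norm_ge n (f : Ltwo nu) (c : R) : (sobolev_norm f <= c%:E)%E ->
  wnorm (sobolev_weight n) f <= c.
Proof.
move=> fc; rewrite /wnorm (nrm_le (weighted (sobolev_weight n) f)) (weightedE (sobolev_weightP n)).
have mf := L2_cmeasurable (ltwoP f).
apply: le_trans fc; apply: le_L2norm.
- apply: cmeasurableM mf; apply: cmeasurable_real; exact: weight_meas (sobolev_weightP n).
- exact: cmeasurable_sobolev.
- move=> x; rewrite !Normc.normcM !normc_real; apply: ler_wpM2r; first exact: normc_ge0.
  rewrite !ger0_norm ?(le_trans ler01 (sobolev_weight_ge1 n x)) ?(le_trans ler01 (sobolev_symbol_ge1 x))//.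
  by rewrite ge_min lexx.
Qed.

Lemma sobolev_weight_cvg x : (sobolev_weight ^~ x) @ \oo --> sobolev_symbol x.
Proof.
apply: cvg_near_cst; exists (Num.truncn (sobolev_symbol x)).+1 => // n /= hn.
apply: min_idPl; apply: ltW; apply: lt_le_trans (truncnS_gt _) _.
by rewrite ler_nat; exact: leqW.
Qed.

(** Fatou, as the truncations increase. *)
Lemma sobolev_norm_le (f : Ltwo nu) (c : R) :
  (forall n, wnorm (sobolev_weight n) f <= c) -> (sobolev_norm f <= c%:E)%E.
Proof.
move=> fc; have c0 : 0 <= c by apply: le_trans (fc 0%N); exact: ipnorm_ge0.
rewrite /sobolev_norm L2norm_le//.
apply: (@sqnorm_fatou _ _ _ nu (fun n => weighted (sobolev_weight n) f)).
- by move=> n; exact: L2_cmeasurable (ltwoP _).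
- move=> x; under eq_fun do rewrite (weightedE (sobolev_weightP _)) Normc.normcM normc_real.
  rewrite Normc.normcM normc_real; apply: cvgM; last exact: cvg_cst.
  by apply: cvg_norm; exact: sobolev_weight_cvg.
- move=> n; rewrite -L2norm_le//; have := fc n.
  by rewrite /wnorm (nrm_le (weighted (sobolev_weight n) f)).
Qed.

End SobolevWeights.

Opaque weighted.

(** * Solutions and their profiles *)

Section Link.
Variables (R : realType) (M : manifold) (eps : R).
Hypothesis eps_gt0 : 0 < eps.
Local Notation leb := (@lebesgue_measure R).
Local Notation mu := (space_measure R M).
Local Notation nu := (freq_measure R M).
Local Notation nrmx := (ipnorm (rip mu)).
Local Notation nrmf := (ipnorm (rip nu)).
Local Notation E := (ev eps).
Local Notation N := (nonlin eps).
Let rH := rip_semi_hilbert nu.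
Let rHx := rip_semi_hilbert mu.
Implicit Types (f g : measurableTypeR R -> R[i]) (a : R -> Ltwo nu) (phi : Ltwo nu) (t : R).

(** The profile equation without the factor [i], paired with a test vector. *)
Definition pull a phi t : R[i] := inner nu (E t (N (E (- t) (a t)))) phi.

Lemma rip_field a phi t : rip nu (field eps t (a t)) phi = - Im (pull a phi t).
Proof.
transitivity (Re (inner nu ('i *: E t (N (E (- t) (a t)))) phi)); first exact: erefl.
rewrite innerZl /pull; move: (inner nu _ phi) => [x y].
by rewrite ReM /= mul0r sub0r mul1r.
Qed.

Lemma rip_field_rot a phi t : rip nu (field eps t (a t)) (- 'i *: phi) = - Re (pull a phi t).
Proof.
transitivity (Re (inner nu ('i *: E t (N (E (- t) (a t)))) (- 'i *: phi))); first exact: erefl.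
rewrite innerZl innerZr /pull; move: (inner nu _ phi) => [x y].
by rewrite !ReImE /=; ring.
Qed.

Lemma inner_i_re (h phi : Ltwo nu) : rip nu h (- 'i *: phi) = - Im (inner nu h phi).
Proof.
transitivity (Re (inner nu h (- 'i *: phi))); first exact: erefl.
rewrite innerZr; move: (inner nu h phi) => [x y].
by rewrite !ReImE /=; ring.
Qed.

Lemma Rintegral_opp (D : set (measurableTypeR R)) (h : R -> R) : measurable D ->
  leb.-integrable D (EFin \o h) -> \int[leb]_(x in D) (- h x) = - \int[leb]_(x in D) h x.
Proof.
move=> mD ih; rewrite -mulN1r -RintegralZl//; apply: eq_Rintegral => x _.
by rewrite mulN1r.
Qed.

Lemma integrable_opp (D : set (measurableTypeR R)) (h : R -> R) : measurable D ->
  leb.-integrable D (EFin \o h) -> leb.-integrable D (EFin \o (fun x => - h x)).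
Proof. by move=> mD ih; exact: (integrableN ih). Qed.

(** The real weak formulation, tested with phi and with -i phi, is the complex one. *)
Lemma profile_pairing (T : R) (a0 : Ltwo nu) a : profile eps T a0 a ->
  forall t phi, 0 <= t <= T ->
    cintegrable leb `[0, t] (pull a phi) /\
    cintegral leb `[0, t] (pull a phi) = - 'i * inner nu (a t - a0) phi.
Proof.
move=> aP t phi tT; have mD : measurable (`[0, t]%classic : set (measurableTypeR R)) by exact: measurable_itv.
have [i1 e1] := aP t tT phi; have [i2 e2] := aP t tT (- 'i *: phi).
have I1 : leb.-integrable `[0, t] (EFin \o (fun s => Im (pull a phi s))).
  have := integrable_opp mD i1; apply: eq_integrable => // s _.
  by rewrite /= rip_field opprK.
have I2 : leb.-integrable `[0, t] (EFin \o (fun s => Re (pull a phi s))).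
  have := integrable_opp mD i2; apply: eq_integrable => // s _.
  by rewrite /= rip_field_rot opprK.
split; first by split.
have E1 : \int[leb]_(s in `[0, t]) Im (pull a phi s) = - (rip nu (a t) phi - rip nu a0 phi).
  rewrite e1 addrAC subrr add0r -(Rintegral_opp mD i1); apply: eq_Rintegral => s _.
  by rewrite rip_field opprK.
have E2 : \int[leb]_(s in `[0, t]) Re (pull a phi s) =
    - (rip nu (a t) (- 'i *: phi) - rip nu a0 (- 'i *: phi)).
  rewrite e2 addrAC subrr add0r -(Rintegral_opp mD i2); apply: eq_Rintegral => s _.
  by rewrite rip_field_rot opprK.
have -> : cintegral leb `[0, t] (pull a phi) =
    (\int[leb]_(s in `[0, t]) Re (pull a phi s)) +i* (\int[leb]_(s in `[0, t]) Im (pull a phi s)).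
  by [].
rewrite E1 E2 !inner_i_re innerBl.
have -> : rip nu (a t) phi = Re (inner nu (a t) phi) by [].
have -> : rip nu a0 phi = Re (inner nu a0 phi) by [].
move: (inner nu (a t) phi) (inner nu a0 phi) => [x y] [x' y'].
by apply: complex_eqP; rewrite !ReImE /=; ring.
Qed.

Lemma pairing_profile (T : R) (a0 : Ltwo nu) a :
  (forall t phi, 0 <= t <= T ->
    cintegrable leb `[0, t] (pull a phi) /\
    inner nu (a t) phi = inner nu a0 phi + 'i * cintegral leb `[0, t] (pull a phi)) ->
  profile eps T a0 a.
Proof.
move=> h t tT phi; have [[_ I1] e] := h t phi tT.
have mD : measurable (`[0, t]%classic : set (measurableTypeR R)) by exact: measurable_itv.
have fE : (fun s => (rip nu (field eps s (a s)) phi)) = (fun s => - Im (pull a phi s)).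
  by apply/funext => s; exact: rip_field.
split.
  have := integrable_opp mD I1; apply: eq_integrable => // s _.
  by rewrite /= rip_field.
transitivity (Re (inner nu (a t) phi)); first exact: erefl.
have -> : \int[leb]_(s in `[0, t]) rip nu (field eps s (a s)) phi =
    - \int[leb]_(s in `[0, t]) Im (pull a phi s).
  by rewrite -(Rintegral_opp mD I1); apply: eq_Rintegral => s _; exact: rip_field.
rewrite e ReD ReM.
have -> : Im (cintegral leb `[0, t] (pull a phi)) = \int[leb]_(s in `[0, t]) Im (pull a phi s) by [].
have -> : rip nu a0 phi = Re (inner nu a0 phi) by [].
by rewrite /= mul0r sub0r mul1r.
Qed.

Lemma ltwo_extx (h k : Ltwo mu) : h = k :> (measurableTypeR R -> R[i]) -> h = k.
Proof. by move=> hk; apply: val_inj. Qed.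

Definition spec f : Ltwo nu := dft (toL2 mu f).

Lemma nrm_eq_trans (b c d : Ltwo nu) : nrmf (b - c) = 0 -> nrmf (c - d) = 0 -> nrmf (b - d) = 0.
Proof.
move=> bc cd; apply/eqP; rewrite eq_le ipnorm_ge0 andbT.
by apply: le_trans (ipnorm_distD rH c _ _) _; rewrite bc cd addr0.
Qed.

Lemma nrm_eq_ev t (b c : Ltwo nu) : nrmf (b - c) = 0 -> nrmf (E t b - E t c) = 0.
Proof. by rewrite -evB nrm_ev. Qed.

Lemma nrm_eq_nonlin (b c : Ltwo nu) : nrmf (b - c) = 0 -> nrmf (N b - N c) = 0.
Proof.
move=> bc; apply/eqP; rewrite eq_le ipnorm_ge0 andbT.
have h := @nonlin_wlip R M eps eps_gt0 _ _ (nrmf b + nrmf c) b c (unit_weight R).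
rewrite !wnorm_unit bc mulr0 in h.
by apply: h; [rewrite lerDl|rewrite lerDr]; exact: ipnorm_ge0.
Qed.

Lemma spec_ae f g : L2 mu f -> L2 mu g -> {ae mu, forall x, f x = g x} -> nrmf (spec f - spec g) = 0.
Proof.
move=> fL gL fg; have h : nrmx (toL2 mu f - toL2 mu g) = 0.
  by apply: ltwo_eq_ae; rewrite (toL2E fL) (toL2E gL).
by apply: etrans (nrm_dftB _ _) _; rewrite h mulr0.
Qed.

Lemma ae_spec f g : L2 mu f -> L2 mu g -> nrmf (spec f - spec g) = 0 -> {ae mu, forall x, f x = g x}.
Proof.
move=> fL gL fg.
have := ltwo_ae_eq (f := toL2 mu f) (g := toL2 mu g); rewrite (toL2E fL) (toL2E gL); apply.
have := nrm_dftB (toL2 mu f) (toL2 mu g); rewrite -/(spec f) -/(spec g) fg => /esym/eqP.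
rewrite mulf_eq0 => /orP[/eqP h|/eqP//].
by have := sqrtr_gt0 (2 * pi : R); rewrite h two_pi_gt0 ltxx.
Qed.

Lemma spec_lin (c : R[i]) f g : L2 mu f -> L2 mu g ->
  nrmf (spec (fun x => g x + c * f x) - (c *: spec f + spec g)) = 0.
Proof.
move=> fL gL; have -> : spec (fun x => g x + c * f x) = dft (c *: toL2 mu f + toL2 mu g).
  rewrite /spec; congr dft; apply: ltwo_extx.
  rewrite (ltwoD (c *: toL2 mu f) (toL2 mu g)) (ltwoZ c (toL2 mu f)) (toL2E fL) (toL2E gL).
  rewrite toL2E; first by apply/funext => x; rewrite addrC.
  by apply: L2_add => //; exact: L2_scale.
exact: dft_linear.
Qed.

Lemma inner_spec f (psi : Ltwo mu) : L2 mu f ->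
  inner mu f psi = ((2 * pi)^-1)%:C * inner nu (spec f) (dft psi).
Proof.
move=> fL; rewrite /spec dft_parseval (toL2E fL) mulrA -rmorphM mulVf ?mul1r//.
by rewrite gt_eqF// two_pi_gt0.
Qed.

Lemma inner_spec0 f (phi : Ltwo nu) : L2 mu f -> inner nu (spec f) phi = inner mu f (idft0 phi).
Proof. by move=> fL; rewrite /spec dft_adjoint (toL2E fL). Qed.

Lemma fourierE f : L2 mu f -> fourier M f = spec f.
Proof. by move=> fL; rewrite -{1}(toL2E fL) fourier_dft. Qed.

Lemma propagator_spec t g : L2 mu g ->
  L2 mu (propagator M eps t g) /\ nrmf (spec (propagator M eps t g) - E (- t) (spec g)) = 0.
Proof.
move=> gL; pose h := idft (E (- t) (spec g)).
have symE xi : expi (- (t * dispersion eps xi)) * spec g xi = E (- t) (spec g) xi.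
  by rewrite evE mulNr.
have hP : L2 mu h /\ {ae nu, forall xi, fourier M h xi = expi (- (t * dispersion eps xi)) * fourier M g xi}.
  split; first exact: ltwoP.
  rewrite fourier_dft (fourierE gL).
  have := ltwo_ae_eq (dft_idft (E (- t) (spec g))); rewrite -/h => ae.
  exact: (ae_imp2 ae ae (fun xi p _ => etrans p (esym (symE xi)))).
have [pL pae] := @xgetPex _ (fun=> 0) [set k | L2 mu k /\
  {ae nu, forall xi, fourier M k xi = expi (- (t * dispersion eps xi)) * fourier M g xi}]
  (ex_intro _ (h : measurableTypeR R -> R[i]) hP).
split; first exact: pL.
apply: ltwo_eq_ae; rewrite /propagator /multiplier; set k := xget _ _ in pL pae *.
rewrite (fourierE pL) (fourierE gL) in pae.
exact: (ae_imp2 pae pae (fun xi p _ => etrans p (symE xi))).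
Qed.

Lemma nonlinearity_spec f : L2 mu f ->
  L2 mu (nonlinearity M eps f) /\ nrmf (spec (nonlinearity M eps f) - N (spec f)) = 0.
Proof.
move=> fL; rewrite -(toL2E fL); split; first exact: nonlinearity_L2 eps_gt0 _.
have := dft_nonlinearity eps_gt0 (toL2 mu f).
have -> : spec (toL2 mu f) = dft (toL2 mu f) by rewrite /spec; congr dft; apply: ltwo_extx; exact: toL2E (ltwoP (toL2 mu f)).
exact.
Qed.

Lemma duhamel_spec t s f : L2 mu f ->
  L2 mu (propagator M eps (t - s) (nonlinearity M eps f)) /\
  nrmf (spec (propagator M eps (t - s) (nonlinearity M eps f)) - E (s - t) (N (spec f))) = 0.
Proof.
move=> fL; have [nL nE] := nonlinearity_spec fL; have [pL pE] := propagator_spec (t - s) nL.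
split; first exact: pL.
have -> : s - t = - (t - s) by rewrite opprB.
exact: nrm_eq_trans pE (nrm_eq_ev (- (t - s)) nE).
Qed.

(** Testing Duhamel with the inverse transform of [e^{- i t w} phi] removes the dependence
    of the integrand on the final time. *)
Lemma solution_profile (T : R) u0 u : L2 mu u0 -> is_solution M eps T u0 u ->
  profile eps T (spec u0) (fun t => E t (spec (u t))).
Proof.
move=> u0L uS; apply: pairing_profile => t phi tT.
have [uL [v [[vL FL vI] uE]]] := uS t tT.
(* its transform undoes the evolution up to time [t] *)
pose psi := idft0 (E (- t) phi).
have [vi ve] := vI psi (ltwoP psi).
have pE s : s \in (`[0, t]%classic : set R) ->
    inner mu (propagator M eps (t - s) (nonlinearity M eps (u s))) psi =
    pull (fun t => E t (spec (u t))) phi s.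
  rewrite inE /= in_itv/= => /andP[s0 st].
  have sT : 0 <= s <= T by rewrite s0 (le_trans st)//; case/andP: tT.
  have [sL _] := uS s sT; have [dL dE] := duhamel_spec t s sL.
  rewrite -(inner_spec0 _ dL) (nrm0_inner _ dE) ev_adj evD opprB.
  by rewrite addrAC subrr add0r /pull evNK ev_adj.
split.
  have [v1 v2] := vi; split.
    by apply: eq_integrable v1 => // s /pE ->.
  by apply: eq_integrable v2 => // s /pE ->.
have -> : cintegral leb `[0, t] (pull (fun t => E t (spec (u t))) phi) = inner mu v psi.
  by rewrite ve; apply: eq_cintegral => s sD; apply/esym/pE; rewrite inE.
have [pL pE0] := propagator_spec t u0L.
have wL : L2 mu (fun x => propagator M eps t u0 x + 'i * v x) by apply: L2_add => //; exact: L2_scale.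
apply: etrans (ev_adj _ _ _ _) _.
apply: etrans (nrm0_inner (E (- t) phi) (spec_ae uL wL uE)) _.
apply: etrans (nrm0_inner (E (- t) phi) (spec_lin 'i vL pL)) _.
apply: etrans (innerDl _ _ _) _.
apply: etrans (congr2 +%R (etrans (innerZl _ _ _) (congr1 (fun z => 'i * z) (inner_spec0 _ vL)))
  (nrm0_inner (E (- t) phi) pE0)) _.
rewrite addrC; apply: (congr1 (fun z => z + 'i * inner mu v psi)).
by apply: etrans (ev_adj _ _ _ _) _; rewrite opprK evK.
Qed.

Lemma cintegral_realZ (D : set (measurableTypeR R)) (r : R) (k : R -> R[i]) : measurable D ->
  cintegrable leb D k ->
  cintegrable leb D (fun s => r%:C * k s) /\ cintegral leb D (fun s => r%:C * k s) = r%:C * cintegral leb D k.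
Proof.
move=> mD [k1 k2].
have reE s : Re (r%:C * k s) = r * Re (k s) by rewrite ReM /= mul0r subr0.
have imE s : Im (r%:C * k s) = r * Im (k s) by rewrite ImM /= mul0r addr0.
split.
  split.
    by have := integrableZl mD r k1; apply: eq_integrable => // s _; rewrite reE EFinM.
  by have := integrableZl mD r k2; apply: eq_integrable => // s _; rewrite imE EFinM.
have -> : cintegral leb D (fun s => r%:C * k s) =
  (\int[leb]_(s in D) Re (r%:C * k s)) +i* (\int[leb]_(s in D) Im (r%:C * k s)) by [].
have -> : cintegral leb D k = (\int[leb]_(s in D) Re (k s)) +i* (\int[leb]_(s in D) Im (k s)) by [].
have e1 : \int[leb]_(s in D) Re (r%:C * k s) = r * \int[leb]_(s in D) Re (k s).
  by rewrite -RintegralZl//; apply: eq_Rintegral => s _; exact: reE.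
have e2 : \int[leb]_(s in D) Im (r%:C * k s) = r * \int[leb]_(s in D) Im (k s).
  by rewrite -RintegralZl//; apply: eq_Rintegral => s _; exact: imE.
rewrite e1 e2.
by apply: complex_eqP; rewrite !ReImE /=; ring.
Qed.

(** The integral in Duhamel is read off from the solution itself, and tested with
    [e^{i t w}] applied to the transform of the test function. *)
Lemma profile_solution (T : R) u0 u a : L2 mu u0 -> profile eps T (spec u0) a ->
  (forall t, 0 <= t <= T -> L2 mu (u t) /\ nrmf (spec (u t) - E (- t) (a t)) = 0) ->
  is_solution M eps T u0 u.
Proof.
move=> u0L aP ua t tT; have [uL uE] := ua t tT; split => //.
have [pL pE] := propagator_spec t u0L.
have mD : measurable (`[0, t]%classic : set (measurableTypeR R)) by exact: measurable_itv.
have wL : L2 mu (fun x => u t x + (-1) * propagator M eps t u0 x) by apply: L2_add => //; exact: L2_scale.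
(* the Duhamel integral, solved for from the equation *)
exists (fun x => - 'i * (u t x + (-1) * propagator M eps t u0 x)); split; last first.
  apply: aeW => x; rewrite mulrA mulrN -expr2 sqr_i opprK mul1r mulN1r.
  by rewrite addrCA subrr addr0.
have sT s : (`[0, t]%classic : set R) s -> 0 <= s <= T.
  by rewrite /= in_itv/= => /andP[-> st]; apply: le_trans st _; case/andP: tT.
split; first exact: L2_scale.
  by move=> s /sT /ua[sL _]; exact: (duhamel_spec t s sL).1.
move=> h hL; rewrite -(toL2E hL); set psi := toL2 mu h.
have [ci ce] := profile_pairing aP (E t (dft psi)) tT.
have FE s : (`[0, t]%classic : set R) s ->
    inner mu (propagator M eps (t - s) (nonlinearity M eps (u s))) psi =
    ((2 * pi)^-1)%:C * pull a (E t (dft psi)) s.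
  move=> /sT /ua[sL sE]; have [dL dE] := duhamel_spec t s sL.
  rewrite (inner_spec _ dL); congr (_ * _).
  have e2 := nrm_eq_trans dE (nrm_eq_ev (s - t) (nrm_eq_nonlin sE)).
  by rewrite (nrm0_inner _ e2) /pull ev_adj [RHS]ev_adj evD opprB (addrC (- s)).
have [zi ze] := cintegral_realZ ((2 * pi)^-1) mD ci.
split.
  have [z1 z2] := zi; split.
    by apply: eq_integrable z1 => // s; rewrite inE => /FE ->.
  by apply: eq_integrable z2 => // s; rewrite inE => /FE ->.
transitivity (cintegral leb `[0, t] (fun s => ((2 * pi)^-1)%:C * pull a (E t (dft psi)) s)); last first.
  by apply: eq_cintegral => s /FE ->.
rewrite ze ce inner_scalel//; last exact: ltwoP.
rewrite mulrCA; congr (_ * _); rewrite (inner_spec _ wL); congr (_ * _).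
apply: etrans (nrm0_inner (dft psi) (spec_lin (-1) pL uL)) _.
apply: etrans (innerDl _ _ _) _.
apply: etrans (congr2 +%R (etrans (innerZl _ _ _) (congr1 (fun z => -1 * z) (nrm0_inner (dft psi) pE)))
  (nrm0_inner (dft psi) uE)) _.
apply: etrans (congr2 (fun y z => -1 * y + z) (ev_adj _ _ _ _) (ev_adj _ _ _ _)) _.
by rewrite opprK innerBl mulN1r addrC.
Qed.

End Link.

(** * Uniqueness and Lipschitz dependence *)

Lemma sub_swap (V : zmodType) (a b c d : V) : a - b - (c - d) = (a - c) - (b - d).
Proof. by rewrite !opprB addrACA [RHS]addrACA (addrC (- b)). Qed.

Section WellPosed.
Variables (R : realType) (M : manifold) (eps s : R).
Hypotheses (eps_gt0 : 0 < eps) (s_ge0 : 0 <= s).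
Local Notation leb := (@lebesgue_measure R).
Local Notation mu := (space_measure R M).
Local Notation nu := (freq_measure R M).
Local Notation nrmx := (ipnorm (rip mu)).
Local Notation nrmf := (ipnorm (rip nu)).
Local Notation E := (ev eps).
Local Notation wt := (sobolev_weight s).
Let rH := rip_semi_hilbert nu.
Let W n : weight (wt n) (2 `^ s) := sobolev_weightP s_ge0 n.
Implicit Types (f g : measurableTypeR R -> R[i]) (t c : R).

Lemma wnorm_eq (w : R -> R) (C : R) (b d : Ltwo nu) : weight w C ->
  nrmf (b - d) = 0 -> wnorm w b = wnorm w d.
Proof.
move=> Ww bd; have [B B0 hB] := wnorm_bnd M Ww.
have h : wnorm w (b - d) <= 0 by apply: le_trans (hB _) _; rewrite bd mulr0.
have h2 := ler_ipnorm_dist rH (weighted w b) (weighted w d).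
rewrite -(weightedB Ww) in h2.
by have := le_trans h2 h; rewrite normr_le0 subr_eq0 => /eqP.
Qed.

Lemma L2_diff f g : L2 mu f -> L2 mu g -> L2 mu (fun x => f x - g x).
Proof. by move=> fL gL; exact: L2_sub. Qed.

Lemma spec_sub f g : L2 mu f -> L2 mu g ->
  nrmf (spec M (fun x => f x - g x) - (spec M f - spec M g)) = 0.
Proof.
move=> fL gL; have := spec_lin (-1) gL fL.
have -> : (fun x => f x + -1 * g x) = (fun x => f x - g x).
  by apply/funext => x; rewrite mulN1r.
by rewrite scaleN1r (addrC (- spec M g)).
Qed.

Lemma Hs_normE f : L2 mu f -> Hs_norm M s f = sobolev_norm M s (spec M f).
Proof. by move=> fL; rewrite /Hs_norm (fourierE fL). Qed.

Lemma Hs_norm_le f c : L2 mu f -> (forall n, wnorm (wt n) (spec M f) <= c) -> (Hs_norm M s f <= c%:E)%E.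
Proof. by move=> fL h; rewrite (Hs_normE fL); exact: (sobolev_norm_le s_ge0). Qed.

Lemma Hs_norm_ge f c n : L2 mu f -> (Hs_norm M s f <= c%:E)%E -> wnorm (wt n) (spec M f) <= c.
Proof. by move=> fL; rewrite (Hs_normE fL) => h; exact: (sobolev_norm_ge s_ge0). Qed.

Lemma Hs_norm_sub_le f g c : L2 mu f -> L2 mu g ->
  (forall n, wnorm (wt n) (spec M f - spec M g) <= c) -> (Hs_norm M s (fun x => f x - g x)%R <= c%:E)%E.
Proof.
move=> fL gL h; apply: Hs_norm_le; first exact: L2_diff.
by move=> n; rewrite (wnorm_eq (W n) (spec_sub fL gL)).
Qed.

Lemma Hs_norm_sub_ge f g c n : L2 mu f -> L2 mu g ->
  (Hs_norm M s (fun x => f x - g x)%R <= c%:E)%E -> wnorm (wt n) (spec M f - spec M g) <= c.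
Proof.
move=> fL gL h; rewrite -(wnorm_eq (W n) (spec_sub fL gL)).
by apply: Hs_norm_ge => //; exact: L2_diff.
Qed.

Lemma Hs_bound f : Hs M s f -> exists2 c, 0 <= c & (Hs_norm M s f <= c%:E)%E.
Proof.
move=> [fL]; have : (0 <= Hs_norm M s f)%E by exact: L2norm_ge0.
by case: (Hs_norm M s f) => [r|//|//]; rewrite lee_fin => r0 _; exists r.
Qed.

(** Mass conservation bounds both profiles, and Gronwall in L2 compares them. *)
Lemma solution_unique (T : R) u0 u v : L2 mu u0 ->
  is_solution M eps T u0 u -> is_solution M eps T u0 v ->
  forall t, 0 <= t <= T -> {ae mu, forall x, u t x = v t x}.
Proof.
move=> u0L uS vS t tT.
have uP := solution_profile eps_gt0 u0L uS; have vP := solution_profile eps_gt0 u0L vS.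
have um := profile_mass eps_gt0 uP; have vm := profile_mass eps_gt0 vP.
apply: ae_spec; [exact: (uS t tT).1|exact: (vS t tT).1|].
have uA r : 0 <= r <= T -> wnorm (fun=> 1 : R) (E r (spec M (u r))) <= nrmf (spec M u0).
  by move=> rT; rewrite (wnorm_unit (E r (spec M (u r)))); exact: (eq_ler (um r rT)).
have vA r : 0 <= r <= T -> wnorm (fun=> 1 : R) (E r (spec M (v r))) <= nrmf (spec M u0).
  by move=> rT; rewrite (wnorm_unit (E r (spec M (v r)))); exact: (eq_ler (vm r rT)).
have h := profile_wlip eps_gt0 (unit_weight R) uP vP uA vA tT.
have z : wnorm (fun=> 1 : R) (spec M u0 - spec M u0) = 0.
  by apply: etrans (wnorm_unit _) _; rewrite subrr; exact: ipnorm0 rH.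
rewrite z mulr0 mul0r (wnorm_unit (E t (spec M (u t)) - E t (spec M (v t)))) -evB nrm_ev in h.
by apply/eqP; rewrite eq_le ipnorm_ge0 andbT.
Qed.

Lemma growth_rate_le (m m' : R) (n : nat) : 0 <= m -> m <= m' ->
  growth_rate M eps (2 `^ s) m <= growth_rate M eps (2 `^ s) m'.
Proof.
move=> m0 mm; have T0 := tame_const_ge0 M eps (W n).
rewrite /growth_rate lerD2r; apply: ler_wpM2l; first exact: mulr_ge0.
by apply: lerXn2r => //; rewrite nnegrE// (le_trans m0).
Qed.

Definition sobolev_bound (T c : R) : R := 2 * c * expR (2 * growth_rate M eps (2 `^ s) c * T).

Lemma sobolev_bound_ge0 (T c : R) : 0 <= c -> 0 <= sobolev_bound T c.
Proof. by move=> c0; rewrite /sobolev_bound !mulr_ge0// expR_ge0. Qed.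

Lemma profile_sobolev (T c : R) (a0 : Ltwo nu) (a : R -> Ltwo nu) : profile eps T a0 a ->
  (forall n, wnorm (wt n) a0 <= c) ->
  forall n t, 0 <= t <= T -> wnorm (wt n) (a t) <= sobolev_bound T c.
Proof.
move=> aP a0c n t tT; have c0 : 0 <= c by apply: le_trans (a0c n); exact: wnorm_ge0.
apply: le_trans (profile_wbound eps_gt0 (W n) aP tT) _; rewrite /sobolev_bound.
apply: ler_pM => //.
- by rewrite mulr_ge0// wnorm_ge0.
- by rewrite ler_wpM2l.
have [t0 tT'] := andP tT.
rewrite ler_expR; apply: ler_pM => //.
  apply: mulr_ge0 => //; exact: ltW (growth_rate_gt0 M eps (W n) _).
rewrite ler_wpM2l//; apply: (growth_rate_le n); first exact: ipnorm_ge0.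
by apply: le_trans (a0c n); exact: nrm_le_wnorm (W n) _.
Qed.

Definition lip_bound (T A : R) : R := 2 * expR (2 * lip_rate M eps (2 `^ s) A * T).

Lemma lip_bound_gt0 T A : 0 < lip_bound T A.
Proof. by rewrite mulr_gt0// expR_gt0. Qed.

(** All data at distance less than one from [u0] have profiles in a common ball of
    every truncated norm, with radius and Lipschitz rate uniform in the truncation. *)
Lemma flow_lipschitz (T : R) u0 : Hs M s u0 -> exists2 L : R, 0 < L &
  forall v0 w0 v w, Hs M s v0 -> Hs M s w0 ->
    (Hs_norm M s (fun x => v0 x - u0 x)%R < 1%:E)%E ->
    (Hs_norm M s (fun x => w0 x - u0 x)%R < 1%:E)%E ->
    is_solution M eps T v0 v -> is_solution M eps T w0 w ->
    (CHs_norm M s T (fun t x => v t x - w t x)%R <= L%:E * Hs_norm M s (fun x => v0 x - w0 x)%R)%E.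
Proof.
move=> u0H; have [c c0 u0c] := Hs_bound u0H; have u0L := u0H.1.
(* data at distance at most one from [u0] have norm at most [1 + c] *)
pose A := sobolev_bound T (1 + c).
exists (lip_bound T A); first exact: lip_bound_gt0.
have data (v0 : measurableTypeR R -> R[i]) : Hs M s v0 -> (Hs_norm M s (fun x => v0 x - u0 x)%R < 1%:E)%E ->
    forall n, wnorm (wt n) (spec M v0) <= 1 + c.
  move=> [v0L _] /ltW h n.
  have h1 := Hs_norm_sub_ge n v0L u0L h; have h2 := Hs_norm_ge n u0L u0c.
  have e : spec M v0 = (spec M v0 - spec M u0) - (- spec M u0) by rewrite opprK subrK.
  have h3 : wnorm (wt n) (- spec M u0) <= c.
    by rewrite -scaleN1r (wnormZ (W n)) normc_opp (normc_real 1) normr1 mul1r.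
  rewrite e; exact: le_trans (wnormB_le (W n) _ _) (lerD h1 h3).
move=> v0 w0 v w v0H w0H v0u w0u vS wS.
have v0L := v0H.1; have w0L := w0H.1.
have vP := solution_profile eps_gt0 v0L vS; have wP := solution_profile eps_gt0 w0L wS.
have vA := profile_sobolev vP (data _ v0H v0u); have wA := profile_sobolev wP (data _ w0H w0u).
have : (0 <= Hs_norm M s (fun x => v0 x - w0 x)%R)%E by exact: L2norm_ge0.
case hd : (Hs_norm M s (fun x => v0 x - w0 x)%R) => [d| |//] => d0; last first.
  by rewrite gt0_muley ?leey// lte_fin lip_bound_gt0.
apply: ub_ereal_sup => _ /= [t tT' <-].
have tT : 0 <= t <= T by move: tT'; rewrite in_itv.
rewrite -EFinM; apply: Hs_norm_sub_le; [exact: (vS t tT).1|exact: (wS t tT).1|move=> n].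
have h := profile_wlip eps_gt0 (W n) (A := A) vP wP (vA n) (wA n) tT.
rewrite -(evB eps t) (wnorm_ev eps (W n)) in h; apply: le_trans h _.
have dn : wnorm (wt n) (spec M v0 - spec M w0) <= d.
  by apply: Hs_norm_sub_ge => //; rewrite hd.
rewrite /lip_bound [leRHS]mulrAC; apply: ler_pM.
- by rewrite mulr_ge0// wnorm_ge0.
- exact: expR_ge0.
- by rewrite ler_wpM2l.
rewrite ler_expR; case/andP: tT => t0 tT; apply: ler_wpM2l => //.
by rewrite mulr_ge0//; exact: ltW (lip_rate_gt0 M eps (W n) _).
Qed.

(** * Regular curves *)

(** The velocity of the profile is bounded in every weight because the field is
    tame; the squared increment is the integral of the velocity paired with it. *)
Lemma profile_lipschitz (T c : R) (a0 : Ltwo nu) (a : R -> Ltwo nu) :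
  (forall phi, continuous (fun r => rip nu (field eps r (a r)) phi)) ->
  profile eps T a0 a -> (forall n, wnorm (wt n) a0 <= c) ->
  exists2 L, 0 <= L & forall n t t', 0 <= t <= T -> 0 <= t' <= T ->
    wnorm (wt n) (a t - a t') <= L * `|t - t'|.
Proof.
move=> aC aP a0c; have aB := profile_sobolev aP a0c; have am := profile_mass eps_gt0 aP.
have c0 : 0 <= c by apply: le_trans (a0c 0%N); exact: wnorm_ge0.
pose L := growth_rate M eps (2 `^ s) (nrmf a0) * sobolev_bound T c.
have g0 := ltW (growth_rate_gt0 M eps (W 0%N) (nrmf a0)).
have L0 : 0 <= L by rewrite mulr_ge0// sobolev_bound_ge0.
exists L => // n t t' tT t'T; wlog tt : t t' tT t'T / t' <= t => [H|].
  have [|/ltW tt] := leP t' t; first exact: H.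
  have e : a t - a t' = (-1) *: (a t' - a t) by rewrite scaleN1r opprB.
  by rewrite e (wnormZ (W n)) normc_opp (normc_real 1) normr1 mul1r distrC; exact: H.
set x := a t - a t'.
apply: sqr_le_mul; [exact: wnorm_ge0|by rewrite mulr_ge0|].
rewrite -(wnorm_sq (W n)) {1}/x (ipBl rH).
set psi := weighted _ _.
have [_ e1] := aP t tT psi; have [_ e2] := aP t' t'T psi.
rewrite e1 e2 opprD addrACA subrr add0r; apply: le_trans (ler_norm _) _.
have h := @Rintegral_itv_dist R _ t t' (L * wnorm (wt n) x) (aC psi) tt _ _.
apply: le_trans (h _ _) _.
- move=> r /andP[tr rt]; have rT : 0 <= r <= T.
    by case/andP: tT => _ tT; case/andP: t'T => t'0 _; rewrite (le_trans t'0)//= (le_trans rt).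
  apply: le_trans (wnorm_cs (W n) _ _) _; apply: ler_wpM2r; first exact: wnorm_ge0.
  apply: le_trans (field_wgrowth eps_gt0 (W n) _ _) _; rewrite am//.
  by apply: ler_wpM2l => //; exact: aB.
- by rewrite mulr_ge0// wnorm_ge0.
by rewrite ger0_norm ?subr_ge0// mulrAC.
Qed.

(** The extension in time needed for the Bourgain norm: frozen outside [0, T], cut
    off by a tent. *)
Definition clamp (T t : R) : R := Num.max 0 (Num.min t T).
Definition tent (T t : R) : R := Num.max 0 (1 - `|t - clamp T t|).
Definition extend (T : R) (a : R -> Ltwo nu) t : Ltwo nu := (tent T t)%:C *: a (clamp T t).

Lemma clamp_cases T t : 0 <= T -> [\/ t <= 0 /\ clamp T t = 0, 0 <= t <= T /\ clamp T t = t
  | T <= t /\ clamp T t = T].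
Proof.
move=> T0; rewrite /clamp; have [tT|/ltW Tt] := leP t T; last first.
  by apply: Or33; split => //; apply/max_idPr.
have [t0|/ltW t0] := leP 0 t; first exact: Or32.
by apply: Or31.
Qed.

Lemma clampP T t : 0 <= T -> 0 <= clamp T t <= T.
Proof.
by move=> T0; have [[h ->]|[h ->]|[h ->]] := clamp_cases t T0; rewrite ?lexx ?T0.
Qed.

Lemma clamp_id T t : 0 <= t <= T -> clamp T t = t.
Proof. by move=> /andP[t0 tT]; rewrite /clamp (min_idPl tT) (max_idPr t0). Qed.

Lemma clamp_lip T t t' : 0 <= T -> `|clamp T t - clamp T t'| <= `|t - t'|.
Proof.
move=> T0; rewrite ler_norml; have := ler_norm (t - t'); have := ler_norm (- (t - t')); rewrite normrN.
have [[h ->]|[/andP[h h1] ->]|[h ->]] := clamp_cases t T0;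
  have [[k ->]|[/andP[k k1] ->]|[k ->]] := clamp_cases t' T0; lra.
Qed.

Lemma max0_cases (x : R) : 0 <= x /\ Num.max 0 x = x \/ x <= 0 /\ Num.max 0 x = 0.
Proof. by have [h|/ltW h] := leP 0 x; [left|right]. Qed.

Lemma tent01 T t : 0 <= tent T t <= 1.
Proof.
rewrite /tent; have := normr_ge0 (t - clamp T t); move: `|_| => y y0.
have [[h ->]|[h ->]] := max0_cases (1 - y); lra.
Qed.

Lemma tent_lip T t t' : 0 <= T -> `|tent T t - tent T t'| <= 2 * `|t - t'|.
Proof.
move=> T0; have c := clamp_lip t t' T0.
have h : `| `|t - clamp T t| - `|t' - clamp T t'| | <= 2 * `|t - t'|.
  apply: le_trans (ler_dist_dist _ _) _.
  have -> : t - clamp T t - (t' - clamp T t') = (t - t') - (clamp T t - clamp T t') by ring.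
  by apply: le_trans (ler_normB _ _) _; lra.
move: h; rewrite /tent; set p := `|t - clamp T t|; set q := `|t' - clamp T t'|.
rewrite !ler_norml => /andP[h1 h2].
have [[k ->]|[k ->]] := max0_cases (1 - p); have [[k' ->]|[k' ->]] := max0_cases (1 - q); lra.
Qed.

Lemma tent_in T t : 0 <= t <= T -> tent T t = 1.
Proof. by move=> h; rewrite /tent (clamp_id h) subrr normr0 subr0; apply/max_idPr; rewrite ler01. Qed.

Lemma tent_out T t : 0 <= T -> ~~ (-1 <= t <= T + 1) -> tent T t = 0.
Proof.
move=> T0; rewrite negb_and -!ltNge => h; apply/max_idPl.
rewrite subr_le0; have := ler_norm (t - clamp T t); have := ler_norm (- (t - clamp T t)); rewrite normrN.
case/orP: h => h; have [[k ->]|[/andP[k k1] ->]|[k ->]] := clamp_cases t T0; lra.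
Qed.

(** The bounds are uniform in the truncation [n], so they amount to bounds in the
    Sobolev space of order [s]. *)
Record regular_curve (T K L : R) (A : R -> Ltwo nu) : Prop := RegularCurve {
  curve_out : forall t, ~~ (-1 <= t <= T + 1) -> A t = 0;
  curve_bnd : forall n t, wnorm (wt n) (A t) <= K;
  curve_lip : forall n t t', wnorm (wt n) (A t - A t') <= L * `|t - t'| }.

Lemma extend_regular (T K L : R) a : 0 <= T -> 0 <= L ->
  (forall n t, 0 <= t <= T -> wnorm (wt n) (a t) <= K) ->
  (forall n t t', 0 <= t <= T -> 0 <= t' <= T -> wnorm (wt n) (a t - a t') <= L * `|t - t'|) ->
  regular_curve T K (L + 2 * K) (extend T a).
Proof.
move=> T0 L0 aK aL; split.
- by move=> t h; rewrite /extend tent_out// scale0r.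
- move=> n t; rewrite /extend (wnormZ (W n)) normc_real.
  have /andP[h0 h1] := tent01 T t; rewrite ger0_norm//.
  apply: le_trans (aK n _ (clampP t T0)); rewrite ler_piMl//; exact: wnorm_ge0.
move=> n t t'.
have -> : extend T a t - extend T a t' = (tent T t)%:C *: (a (clamp T t) - a (clamp T t')) -
    (tent T t' - tent T t)%:C *: a (clamp T t').
  by rewrite /extend rmorphB scalerBr scalerBl opprB addrA subrK.
apply: le_trans (wnormB_le (W n) _ _) _; rewrite !(wnormZ (W n)) !normc_real mulrDl; apply: lerD.
  have /andP[h0 h1] := tent01 T t; rewrite ger0_norm//.
  apply: (@le_trans _ _ (wnorm (wt n) (a (clamp T t) - a (clamp T t')))).
    by rewrite ler_piMl//; exact: wnorm_ge0.
  apply: le_trans (aL n _ _ (clampP t T0) (clampP t' T0)) _.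
  by apply: ler_wpM2l => //; exact: clamp_lip t t' T0.
rewrite mulrAC; apply: ler_pM => //; first exact: wnorm_ge0.
  by rewrite distrC; exact: tent_lip t t' T0.
exact: aK n _ (clampP t' T0).
Qed.

Lemma extend_in (T : R) a t : 0 <= t <= T -> extend T a t = a t.
Proof. by move=> tT; rewrite /extend (tent_in tT) (clamp_id tT) scale1r. Qed.

(** The curve itself is Lipschitz; for the free evolution applied to the fixed
    vector [A t0], the full Sobolev weight can be put on [A t0] at once. *)
Lemma evolution_sobolev_continuous (T K L : R) A t0 : regular_curve T K L A ->
  forall e, 0 < e -> exists2 dl, 0 < dl & forall t n, `|t - t0| <= dl ->
    wnorm (wt n) (E (- t) (A t) - E (- t0) (A t0)) <= e.
Proof.
move=> AR e e0; have aS := sobolev_norm_le s_ge0 (fun n => curve_bnd AR n t0).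
pose b : Ltwo nu := toL2 nu (fun xi => (sobolev_symbol s xi)%:C * A t0 xi).
have bL : L2 nu (fun xi => (sobolev_symbol s xi)%:C * A t0 xi).
  split; first by apply: cmeasurable_sobolev; exact: L2_cmeasurable (ltwoP _).
  exact: le_lt_trans aS (ltry _).
have e2 : 0 < e / 2 by rewrite divr_gt0.
have L0 : 0 <= L.
  by have := curve_lip AR 0%N 1 0; rewrite subr0 normr1 mulr1; apply: le_trans; exact: wnorm_ge0.
have L1 : 0 < L + 1 by rewrite ltr_wpDl.
have [d d0 hd] := ev_dist_small eps (- t0) b e2.
exists (Num.min d (e / 2 / (L + 1))); first by rewrite lt_min d0 divr_gt0.
move=> t n; rewrite le_min => /andP[td tL].
have eE : E (- t) (A t) - E (- t0) (A t0) =
    E (- t) (A t - A t0) - (E (- t0) (A t0) - E (- t) (A t0)).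
  by rewrite evB opprB addrA subrK.
rewrite eE; apply: le_trans (wnormB_le (W n) _ _) _; apply: half_add.
  rewrite (wnorm_ev eps (W n)); apply: le_trans (curve_lip AR n t t0) _.
  apply: (@le_trans _ _ ((L + 1) * `|t - t0|)); first by rewrite ler_wpM2r// lerDl.
  by rewrite mulrC -ler_pdivlMr.
have tb : `|- t - - t0| <= d by rewrite opprK addrC distrC.
have := hd (- t) tb; rewrite (ipnormBC rH); apply: le_trans.
rewrite /wnorm (nrm_le (weighted (wt n) _)) -(L2norm_rip (E (- t0) b - E (- t) b)).
apply: le_L2norm; [exact: L2_cmeasurable (ltwoP _)|exact: L2_cmeasurable (ltwoP _)|].
move=> xi; rewrite (weightedE (W n)) (ltwoB (E (- t0) (A t0)) (E (- t) (A t0)))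
  (ltwoB (E (- t0) b) (E (- t) b)) !evE /b (toL2E bL).
have -> z1 z2 (k y : R[i]) : z1 * (k * y) - z2 * (k * y) = k * (z1 * y - z2 * y) by ring.
rewrite !Normc.normcM !normc_real; apply: ler_wpM2r; first exact: normc_ge0.
have s1 := sobolev_symbol_ge1 s_ge0 xi; have w1 := sobolev_weight_ge1 s_ge0 n xi.
by rewrite !ger0_norm ?(le_trans ler01)// ge_min lexx.
Qed.

Lemma cvg0_ereal (F : set_system R) (h : R -> \bar R) : Filter F -> (forall t, (0 <= h t)%E) ->
  (forall e : R, 0 < e -> \forall t \near F, (h t <= e%:E)%E) -> h @ F --> 0%E.
Proof.
move=> FF h0 hs; apply/fine_cvgP; split.
  apply: filterS (hs 1 ltr01) => t ht.
  by rewrite ge0_fin_numE//; exact: le_lt_trans ht (ltry _).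
apply/cvgrPdist_le => e e0; apply: filterS (hs e e0) => t /=.
have := h0 t; case: (h t) => [r|//|//]; rewrite !lee_fin => r0 re.
by rewrite sub0r normrN ger0_norm.
Qed.

Lemma CHs_curve (T K L : R) (A : R -> Ltwo nu) (u : R -> measurableTypeR R -> R[i]) :
  regular_curve T K L A ->
  (forall t, L2 mu (u t) /\ nrmf (spec M (u t) - E (- t) (A t)) = 0) -> CHs M s T u.
Proof.
move=> AR uA; have dif t t0 n : wnorm (wt n) (spec M (u t) - spec M (u t0)) =
    wnorm (wt n) (E (- t) (A t) - E (- t0) (A t0)).
  apply: (wnorm_eq (W n)).
  have -> : spec M (u t) - spec M (u t0) - (E (- t) (A t) - E (- t0) (A t0)) =
    (spec M (u t) - E (- t) (A t)) - (spec M (u t0) - E (- t0) (A t0)).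
    exact: sub_swap.
  apply/eqP; rewrite eq_le ipnorm_ge0 andbT; apply: le_trans (ipnormB rH _ _) _.
  by rewrite (uA t).2 (uA t0).2 addr0.
split.
  move=> t tT; split; first exact: (uA t).1.
  apply: (@le_lt_trans _ _ K%:E); last exact: ltry.
  apply: Hs_norm_le; first exact: (uA t).1.
  by move=> n; rewrite (wnorm_eq (W n) (uA t).2) (wnorm_ev eps (W n)); exact: curve_bnd AR n t.
move=> t0 tT; apply: cvg0_ereal => [t|e e0]; first exact: L2norm_ge0.
have [dl dl0 hdl] := evolution_sobolev_continuous t0 AR e0.
apply: cvg_within; apply: filterS (nbhsx_ballx (t0 : R) _ dl0) => t /=.
rewrite /ball /= distrC => /ltW tdl.
apply: Hs_norm_sub_le; [exact: (uA t).1|exact: (uA t0).1|move=> n].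
by rewrite dif; exact: hdl.
Qed.

End WellPosed.

(** * Jointly measurable versions of curves in L2 *)

Section JointVersion.
Context d (X : measurableType d) (R : realType).
Variable mu : {sigma_finite_measure set X -> \bar R}.
Local Notation leb := (@lebesgue_measure R).
Local Notation nrm := (ipnorm (rip mu)).
Let rH := rip_semi_hilbert mu.

Lemma cmeasurable_sum d' (Y : measurableType d') (N : nat) (F : nat -> Y -> R[i]) :
  (forall k, cmeasurable (F k)) -> cmeasurable (fun z => \sum_(k < N) F k z).
Proof.
move=> mF; elim: N => [|N IH].
  have -> : (fun z => \sum_(k < 0) F k z) = (fun=> 0) by apply/funext => z; rewrite big_ord0.
  exact: cmeasurable_cst.
have -> : (fun z => \sum_(k < N.+1) F k z) = (fun z => \sum_(k < N) F k z + F N z).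
  by apply/funext => z; rewrite big_ord_recr.
exact: cmeasurableD.
Qed.

Lemma measurable_indic_snd (D : set (measurableTypeR R)) : measurable D ->
  measurable_fun setT (fun z : X * measurableTypeR R => \1_D z.2 : R).
Proof.
move=> mD; have -> : (fun z : X * measurableTypeR R => \1_D z.2 : R) = \1_D \o snd by [].
by apply: measurableT_comp; [exact: measurable_indic|exact: measurable_snd].
Qed.

(** Tonelli, on a bounded set of times. *)
Lemma slices_L2 (F : X * measurableTypeR R -> R[i]) (B c : R) : cmeasurable F ->
  (forall t x, ~~ (-1 <= t <= B) -> F (x, t) = 0) ->
  (forall t, (sqnorm mu (fun x => F (x, t)) <= c%:E)%E) -> L2 (mu \x leb)%E F.
Proof.
move=> mF F_out F_le.
have c0 : 0 <= c by rewrite -lee_fin; apply: le_trans (F_le 0); exact: sqnorm_ge0.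
apply/L2_sqnorm; split => //.
have mF2 : measurable_fun setT (fun z => (nc (F z) ^+ 2)%:E).
  by apply/measurable_EFinP; exact: measurable_normc_sq.
have F0 z : (0 <= (nc (F z) ^+ 2)%:E)%E by rewrite lee_fin sqr_ge0.
have mD : measurable (`[-1, B]%classic : set (measurableTypeR R)) by exact: measurable_itv.
have mI : measurable_fun setT (\1_(`[-1, B]%classic : set (measurableTypeR R)) : measurableTypeR R -> R).
  exact: measurable_indic mD.
rewrite /sqnorm (@fubini_tonelli2 _ _ _ _ _ mu leb _ mF2 F0).
apply: (@le_lt_trans _ _ (\int[leb]_t (c%:E * (\1_(`[-1, B]%classic : set (measurableTypeR R)) t)%:E))%E).
  apply: ge0_le_integral => //.
  - by move=> t _; apply: integral_ge0.
  - exact: measurable_fun_fubini_tonelli_G.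
  - by apply/measurable_EFinP; apply: measurable_funM; [exact: measurable_cst|exact: mI].
  move=> t _; rewrite /fubini_G indicE mem_setE in_itv/=.
  have [tB|tB] := boolP (-1 <= t <= B); last first.
    rewrite mule0 (eq_integral (fun=> 0%E)) ?integral0// => x _.
    by rewrite (F_out _ _ tB) Normc.normc0 expr0n.
  by rewrite mule1; exact: F_le.
have mE : measurable_fun setT (fun t : measurableTypeR R =>
    (\1_(`[-1, B]%classic : set (measurableTypeR R)) t : R)%:E) by apply/measurable_EFinP; exact: mI.
rewrite (ge0_integralZl leb measurableT mE) ?lee_fin//.
rewrite integral_indic// setIT; apply: lte_mul_pinfty; rewrite ?lee_fin//.
by rewrite /= lebesgue_measure_itv/=; case: ifP => _ //; exact: ltry.
Qed.

Lemma geometric_step (p x y : R) : x <= 2^-1 * p -> y <= p -> 0 < p -> x + y <= 2 * p.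
Proof. lra. Qed.

Variables (g : R -> Ltwo mu) (B : R).
Hypothesis g_unif : forall e, 0 < e ->
  exists2 h, 0 < h & forall t t', `|t - t'| <= h -> nrm (g t - g t') <= e.

Let pow_gt0 n : 0 < 2^-1 ^+ n :> R.
Proof. by rewrite exprn_gt0// invr_gt0. Qed.

Let step_of n : {h : R | 0 < h & forall t t', `|t - t'| <= h -> nrm (g t - g t') <= 2^-1 ^+ n}.
Proof. by apply: cid2; apply: g_unif; exact: pow_gt0. Qed.

Let h n : R := s2val (step_of n).
Let h_gt0 n : 0 < h n := s2valP (step_of n).
Let h_dist n t t' : `|t - t'| <= h n -> nrm (g t - g t') <= 2^-1 ^+ n := s2valP' (step_of n) t t'.

Let node n (k : nat) : R := -1 + k%:R * h n.
Let cell n k : set (measurableTypeR R) := `[node n k, node n k + h n[%classic.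
Let index n (t : R) : nat := Num.truncn ((t + 1) / h n).
Let count n : nat := (index n B).+1.

Let cellP n k t : -1 <= t -> (t \in cell n k) = (k == index n t).
Proof.
move=> t1; have q0 : 0 <= (t + 1) / h n by rewrite divr_ge0 ?(ltW (h_gt0 n))//; lra.
have -> : (t \in cell n k) = (k%:R <= (t + 1) / h n < k.+1%:R).
  rewrite /cell mem_setE in_itv/= /node ler_pdivlMr// ltr_pdivrMr// -[k.+1]addn1 natrD mulrDl mul1r.
  by congr (_ && _); apply/idP/idP; lra.
apply/idP/eqP => [/truncn_def //|->]; exact: truncn_itv.
Qed.

Let steps n (z : X * measurableTypeR R) : R[i] :=
  \sum_(k < count n) (\1_(cell n k) z.2)%:C * g (node n k) z.1.

Let steps_cmeasurable n : cmeasurable (steps n).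
Proof.
apply: (@cmeasurable_sum _ _ (count n) (fun k z => (\1_(cell n k) z.2)%:C * g (node n k) z.1)) => k.
apply: cmeasurableM.
  by apply: cmeasurable_real; apply: measurable_indic_snd; exact: measurable_itv.
have mg := L2_cmeasurable (ltwoP (g (node n k))).
exact: (cmeasurable_comp mg (@measurable_fst _ _ X (measurableTypeR R))).
Qed.

Let stepsE n t x : -1 <= t <= B -> steps n (x, t) = g (node n (index n t)) x.
Proof.
move=> /andP[t1 tB]; have lt : (index n t < count n)%N.
  by rewrite ltnS; apply: le_truncn; rewrite ler_pM2r ?invr_gt0// lerD2r.
rewrite /steps (bigD1 (Ordinal lt))//= big1 ?addr0.
  by rewrite indicE (cellP _ _ t1) eqxx mul1r.
move=> k kn; rewrite indicE (cellP _ _ t1).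
case: eqP => [e|_]; last by rewrite mul0r.
by case/negP: kn; apply/eqP/val_inj.
Qed.

Let node_dist n t : -1 <= t -> nrm (g (node n (index n t)) - g t) <= 2^-1 ^+ n.
Proof.
move=> t1; apply: h_dist.
have : t \in cell n (index n t) by rewrite cellP.
by rewrite mem_setE in_itv/= => /andP[h1 h2]; rewrite ler_norml; apply/andP; split; lra.
Qed.

Definition joint_version (z : X * measurableTypeR R) : R[i] :=
  (\1_(`[-1, B]%classic : set (measurableTypeR R)) z.2)%:C * pointwise_limit steps z.

Lemma joint_version_cmeasurable : cmeasurable joint_version.
Proof.
apply: cmeasurableM; last exact: cmeasurable_pointwise_limit steps_cmeasurable.
by apply: cmeasurable_real; apply: measurable_indic_snd; exact: measurable_itv.
Qed.

Lemma joint_version_out t x : ~~ (-1 <= t <= B) -> joint_version (x, t) = 0.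
Proof. by move=> tB; rewrite /joint_version indicE mem_setE in_itv/= (negbTE tB) mul0r. Qed.

(** In every slice the step functions converge fast, so their pointwise limit is the curve. *)
Lemma joint_version_slice t : -1 <= t <= B ->
  L2 mu (fun x => joint_version (x, t)) /\ {ae mu, forall x, joint_version (x, t) = g t x}.
Proof.
move=> tB; have /andP[t1 _] := tB.
pose v n : Ltwo mu := g (node n (index n t)).
have jE x : joint_version (x, t) = pointwise_limit (fun n => v n : X -> R[i]) x.
  rewrite /joint_version indicE mem_setE in_itv/= tB mul1r.
  rewrite /pointwise_limit; congr (fine (limn_esup _) +i* fine (limn_esup _));
    by apply/funext => n; rewrite (stepsE n x tB).
have mv n : cmeasurable (v n : X -> R[i]) by exact: L2_cmeasurable (ltwoP _).
have vd n : (L2norm mu (fun x => v n.+1 x - v n x)%R <= (2 * 2^-1 ^+ n)%:E)%E.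
  rewrite -(ltwoB (v n.+1) (v n)) -nrm_le; apply: le_trans (ipnorm_distD rH (g t) _ _) _.
  rewrite (ipnormBC rH (g t)); have h1 := node_dist n.+1 t1; have h2 := node_dist n t1.
  by rewrite exprS in h1; exact: geometric_step h1 h2 (pow_gt0 n).
have lim := fast_L2_limit (C := 2) (ler0n _ 2) mv vd.
set p := pointwise_limit _ in lim *.
have mp : cmeasurable p by exact: cmeasurable_pointwise_limit.
have dL n : L2 mu (fun x => v n x - p x).
  by split; [exact: cmeasurableB|exact: le_lt_trans (lim n) (ltry _)].
have pL : L2 mu p.
  have -> : p = (fun x => v 0%N x - (v 0%N x - p x)) by apply/funext => x; rewrite opprB addrCA subrr addr0.
  by apply: L2_sub => //; exact: ltwoP.
split; first by have -> : (fun x => joint_version (x, t)) = p by apply/funext => x; exact: jE.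
have z : nrm (toL2 mu p - g t) = 0.
  apply/eqP; rewrite eq_le ipnorm_ge0 andbT; apply: (@le0_geometric _ _ 5) => n.
  apply: le_trans (ipnorm_distD rH (v n) _ _) _; rewrite (ipnormBC rH _ (v n)).
  have h1 : nrm (v n - toL2 mu p) <= 2 * 2 * 2^-1 ^+ n.
    by rewrite nrm_le (ltwoB (v n) (toL2 mu p)) (toL2E pL); exact: lim.
  apply: le_trans (lerD h1 (node_dist n t1)) _; lra.
have ae := ltwo_ae_eq z; rewrite (toL2E pL) in ae.
exact: (ae_imp2 ae ae (fun x e _ => etrans (jE x) e)).
Qed.

Lemma joint_version_L2 (K : R) : (forall t, nrm (g t) <= K) -> L2 (mu \x leb)%E joint_version.
Proof.
move=> gK; have K0 : 0 <= K by apply: le_trans (gK 0); exact: ipnorm_ge0.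
apply: (@slices_L2 _ B (K ^+ 2)) => [|t x|t].
- exact: joint_version_cmeasurable.
- exact: joint_version_out.
have [tB|tB] := boolP (-1 <= t <= B); last first.
  have -> : (fun x => joint_version (x, t)) = (fun=> 0).
    by apply/funext => x; exact: joint_version_out.
  by rewrite sqnorm_cst0 lee_fin sqr_ge0.
have [jL jE] := joint_version_slice tB.
rewrite -L2norm_le// (ae_eq_L2norm (L2_cmeasurable jL) (L2_cmeasurable (ltwoP (g t))) jE).
by rewrite -nrm_le.
Qed.

End JointVersion.

Lemma modulus_budget (R : realType) (e x q l : R) : 0 <= x -> x * (l + q + 1) <= e / 2 ->
  l * x + (e / 2 + x * q) <= e.
Proof. by rewrite !mulrDr mulr1 (mulrC l); lra. Qed.

Section Realization.
Variables (R : realType) (M : manifold) (eps s : R).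
Hypotheses (eps_gt0 : 0 < eps) (s_ge0 : 0 <= s).
Local Notation leb := (@lebesgue_measure R).
Local Notation mu := (space_measure R M).
Local Notation nu := (freq_measure R M).
Local Notation nrmx := (ipnorm (rip mu)).
Local Notation nrmf := (ipnorm (rip nu)).
Local Notation E := (ev eps).
Local Notation wt := (sobolev_weight s).
Let rH := rip_semi_hilbert nu.
Let W n : weight (wt n) (2 `^ s) := sobolev_weightP s_ge0 n.

Lemma nrm_idftB (a b : Ltwo nu) : nrmx (idft a - idft b) <= nrmf (a - b).
Proof.
have e := nrm_dftB (idft a) (idft b).
have u : nrmf (dft (idft a) - dft (idft b)) <= nrmf (a - b).
  apply: le_trans (ipnorm_distD rH a _ _) _; rewrite dft_idft add0r.
  apply: le_trans (ipnorm_distD rH b _ _) _.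
  by rewrite (ipnormBC rH b (dft (idft b))) dft_idft addr0.
have s1 : 1 <= Num.sqrt (2 * pi) :> R.
  by rewrite -{1}sqrtr1 ler_wsqrtr//; have := @pi_ge2 R; lra.
apply: le_trans u; rewrite e ler_peMl//; exact: ipnorm_ge0.
Qed.

Variables (T K L : R) (A : R -> Ltwo nu).
Hypotheses (T_ge0 : 0 <= T) (AR : regular_curve s T K L A).

(** The truncated Sobolev norms dominate the L2 norm. *)
Lemma curve_nrm t : nrmf (A t) <= K.
Proof. exact: le_trans (nrm_le_wnorm (W 0%N) _) (curve_bnd AR 0%N t). Qed.

Lemma curve_nrm_lip t t' : nrmf (A t - A t') <= L * `|t - t'|.
Proof. exact: le_trans (nrm_le_wnorm (W 0%N) _) (curve_lip AR 0%N t t'). Qed.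

Let K_ge0 : 0 <= K.
Proof. by apply: le_trans (curve_nrm 0); exact: ipnorm_ge0. Qed.

Let L_ge0 : 0 <= L.
Proof.
by have := curve_nrm_lip 1 0; rewrite subr0 normr1 mulr1; apply: le_trans; exact: ipnorm_ge0.
Qed.

Let tail n t : R := nrmf (ltwo_cut (@box R n) (A t) - A t).

Let tail_dist n t t' : tail n t <= tail n t' + 2 * (L * `|t - t'|).
Proof.
have l := curve_nrm_lip t t'.
have c : nrmf (ltwo_cut (@box R n) (A t) - ltwo_cut (@box R n) (A t')) <= nrmf (A t - A t').
  have sb := bounded_symbol_indic R (@measurable_box R n).
  rewrite -(ltwo_mulB (A t) (A t') sb) -[leRHS]mul1r; apply: (nrm_mul_le _ sb) => x.
  by rewrite normc_real indicE; case: (_ \in _); rewrite ?normr1 ?normr0.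
rewrite /tail; apply: le_trans (ipnorm_distD rH (ltwo_cut (@box R n) (A t')) _ _) _.
apply: le_trans (lerD (le_trans c l) (ipnorm_distD rH (A t') _ _)) _.
rewrite (ipnormBC rH (A t') (A t)).
by move: l; move: (nrmf _) (nrmf _) => x y; move: (L * _) => z; lra.
Qed.

Lemma near_forall_lt (P : nat -> nat -> Prop) N : (forall k, \forall n \near \oo, P k n) ->
  \forall n \near \oo, forall k, (k < N)%N -> P k n.
Proof.
move=> h; elim: N => [|N IH]; first by apply: nearW.
apply: filterS2 IH (h N) => n h1 h2 k; rewrite ltnS leq_eqVlt => /orP[/eqP ->//|]; exact: h1.
Qed.

(** A Lipschitz curve with compact support is tight: a finite net of times suffices. *)
Lemma curve_tight e : 0 < e -> exists n, forall t, tail n t <= e.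
Proof.
move=> e0; pose h := e / 2 / (2 * (L + 1)).
have L1 : 0 < 2 * (L + 1) by rewrite mulr_gt0// ltr_wpDl.
have h0 : 0 < h by rewrite !divr_gt0.
(* the first node represents all times outside the support *)
pose node k : R := -2 + k%:R * h.
pose N := (Num.truncn ((T + 3) / h)).+1.
have e2 : 0 < e / 2 by rewrite divr_gt0.
have [n _ hn] : \forall n \near \oo, forall k, (k < N)%N -> tail n (node k) <= e / 2.
  apply: near_forall_lt => k.
  have /cvgrPdist_le /(_ _ e2) := ltwo_cut_cvg (mu := nu) (A (node k)) (@measurable_box R) (@box_cover R).
  apply: filterS => n; rewrite sub0r normrN ger0_norm//; exact: ipnorm_ge0.
have {}hn := hn n (leqnn n).
exists n => t; wlog tT : t / -2 <= t <= T + 1 => [H|].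
  have [|h1] := boolP (-2 <= t <= T + 1); first exact: H.
  have h2 : ~~ (-1 <= t <= T + 1) by apply: contra h1 => /andP[k1 ->]; rewrite andbT; lra.
  have -> : tail n t = tail n (-2).
    by rewrite /tail (curve_out AR h2) (curve_out AR (t := -2))//; apply/negP => /andP[]; lra.
  by apply: H; apply/andP; split; [exact: lexx|have := T_ge0; lra].
case/andP: tT => t2 tT.
have q0 : 0 <= (t + 2) / h by rewrite divr_ge0 ?(ltW h0)//; lra.
have /andP[k1 k2] := truncn_itv q0; set k := Num.truncn _ in k1 k2.
have kN : (k < N)%N.
  by rewrite ltnS; apply: le_truncn; rewrite ler_pM2r ?invr_gt0//; lra.
have kd : `|t - node k| <= h.
  rewrite ler_pdivlMr// in k1; rewrite ltr_pdivrMr// -[k.+1]addn1 natrD mulrDl mul1r in k2.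
  by rewrite /node ler_norml; apply/andP; split; lra.
apply: le_trans (tail_dist n t (node k)) _.
have d : 2 * (L * `|t - node k|) <= e / 2.
  apply: (@le_trans _ _ (2 * (L + 1) * h)).
    rewrite mulrA; apply: ler_pM => //; first by rewrite mulr_ge0.
    by rewrite ler_wpM2l// lerDl.
  by rewrite /h mulrC divfK// gt_eqF.
have := hn k kN; lra.
Qed.

(** Tightness makes the strong continuity of the free evolution uniform along the curve. *)
Lemma evolution_uniform e : 0 < e -> exists2 h, 0 < h & forall t t', `|t - t'| <= h ->
  nrmx (idft (E (- t) (A t)) - idft (E (- t') (A t'))) <= e.
Proof.
move=> e0; have e4 : 0 < e / 4 by rewrite divr_gt0.
have [n hn] := curve_tight e4.
pose Q := L + dispersion eps n%:R * K + 1.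
have Q0 : 0 < Q by apply: ltr_wpDl => //; rewrite addr_ge0// mulr_ge0// dispersion_ge0.
exists (e / 2 / Q); first by rewrite !divr_gt0.
move=> t t' tt; apply: le_trans (nrm_idftB _ _) _.
apply: le_trans (ipnorm_distD rH (E (- t) (A t')) _ _) _.
have l1 : nrmf (E (- t) (A t) - E (- t) (A t')) <= L * `|t - t'|.
  by rewrite -evB nrm_ev; exact: curve_nrm_lip.
have l2 : nrmf (E (- t) (A t') - E (- t') (A t')) <= e / 2 + `|t - t'| * (dispersion eps n%:R * K).
  apply: le_trans (ev_dist_le eps (- t) (- t') n (A t')) _; apply: lerD.
    by have := hn t'; rewrite /tail; lra.
  rewrite opprK addrC distrC mulrA; apply: ler_wpM2l; last exact: curve_nrm.
  by rewrite mulr_ge0// dispersion_ge0.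
apply: le_trans (lerD l1 l2) _.
have h3 : `|t - t'| * Q <= e / 2 by rewrite -ler_pdivlMr.
exact: modulus_budget (normr_ge0 _) h3.
Qed.

(** The inverse transform is only defined almost everywhere for each time; the
    jointly measurable version of the curve removes the ambiguity. *)
Lemma curve_realization : exists w : measurableTypeR R * measurableTypeR R -> R[i],
  [/\ L2 (spacetime_measure R M) w,
      forall t x, ~~ (-1 <= t <= T + 1) -> w (x, t) = 0 &
      forall t, L2 mu (fun x => w (x, t)) /\ nrmf (spec M (fun x => w (x, t)) - E (- t) (A t)) = 0].
Proof.
pose g t : Ltwo mu := idft (E (- t) (A t)).
pose w := joint_version (T + 1) (g := g) evolution_uniform.
have out t x : ~~ (-1 <= t <= T + 1) -> w (x, t) = 0 by exact: joint_version_out.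
exists w; split => //.
  apply: (@joint_version_L2 _ _ _ _ g (T + 1) evolution_uniform K) => t.
  rewrite /g nrm_idft nrm_ev; apply: le_trans (curve_nrm t).
  rewrite ler_piMl ?ipnorm_ge0//.
  rewrite -{2}sqrtr1 ler_wsqrtr// invf_le1 ?two_pi_gt0//; have := @pi_ge2 R; lra.
move=> t; have [tT|tT] := boolP (-1 <= t <= T + 1).
  have [wL wE] := joint_version_slice evolution_uniform tT.
  split => //.
  have gE := spec_ae wL (ltwoP (g t)) wE.
  apply: (nrm_eq_trans gE); rewrite /spec.
  have -> : toL2 mu (g t) = g t by apply: ltwo_extx; exact: toL2E (ltwoP (g t)).
  exact: dft_idft.
have -> : (fun x => w (x, t)) = (fun=> 0) by apply/funext => x; exact: out.
split; first exact: L2_cst0.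
rewrite (curve_out AR tT).
have z : nrmf (E (- t) 0) = 0 by rewrite nrm_ev; exact: ipnorm0 rH.
apply/eqP; rewrite eq_le ipnorm_ge0 andbT; apply: le_trans (ipnormB rH _ _) _.
rewrite z addr0 /spec.
have -> : toL2 mu (fun=> 0) = 0 by apply: ltwo_extx; rewrite toL2E ?ltwo0//; exact: L2_cst0.
by rewrite nrm_dft (ipnorm0 (rip_semi_hilbert mu)) mulr0.
Qed.

End Realization.

(** * The space-time transform of a regular curve *)

Section BoundedSupport.
Context d (X : measurableType d) (R : realType) (m : {measure set X -> \bar R}).

Lemma bounded_support (D : set X) (f : X -> R[i]) (c : R) : measurable D -> (m D < +oo)%E ->
  cmeasurable f -> (forall x, nc (f x) <= c * \1_D x) -> L2 m f /\ cintegrable m setT f.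
Proof.
move=> mD finD mf fc.
have fE : f = (fun x => f x * (\1_D x)%:C).
  apply/funext => x; have := fc x; rewrite indicE; case: (x \in D); first by move=> _; rewrite mulr1.
  rewrite mulr0 => f0; rewrite mulr0; apply: Normc.eq0_normc; apply/eqP.
  by rewrite eq_le f0 normc_ge0.
have c0 x : nc (f x) <= `|c|.
  apply: le_trans (fc x) _; rewrite indicE; case: (_ \in _); rewrite ?mulr1 ?mulr0//.
  exact: ler_norm.
split; rewrite fE.
  exact: L2_mul_bounded (L2_indic mD finD) mf c0.
exact: cintegrableMb mf c0 (cintegrable_indic mD finD).
Qed.

End BoundedSupport.

Section ProductMeasure.
Local Open Scope ereal_scope.
Context d1 d2 (T1 : measurableType d1) (T2 : measurableType d2) (R : realType).
Variables (m1 : {sigma_finite_measure set T1 -> \bar R}) (m2 : {sigma_finite_measure set T2 -> \bar R}).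

(** The product measure, named so that its sigma-finiteness is found by inference. *)
Definition stproduct : set (T1 * T2) -> \bar R := m1 \x m2.

HB.instance Definition _ := Measure.on stproduct.

Lemma sigma_finite_stproduct : sigma_finite setT stproduct.
Proof.
have /sigma_finiteP[F [TF ndF Foo]] := sigma_finiteT m1.
have /sigma_finiteP[G [TG ndG Goo]] := sigma_finiteT m2.
exists (fun n => F n `*` G n).
  apply/seteqP; split => // -[x y] _.
  have [n _ Fnx] : (\bigcup_n F n) x by rewrite -TF.
  have [k _ Gky] : (\bigcup_n G n) y by rewrite -TG.
  exists (maxn n k) => //; split.
    exact: (subsetPset _ _ (ndF _ _ (leq_maxl n k))) Fnx.
  exact: (subsetPset _ _ (ndG _ _ (leq_maxr n k))) Gky.
move=> k; have [mF Fk] := Foo k; have [mG Gk] := Goo k.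
split; first exact: measurableX.
rewrite /stproduct product_measure1E//; apply: lte_mul_pinfty => //.
by rewrite ge0_fin_numE.
Qed.

HB.instance Definition _ := Measure_isSigmaFinite.Build _ _ _ stproduct sigma_finite_stproduct.

End ProductMeasure.

Transparent inner.

Section SpacetimePairing.
Variable R : realType.
Local Notation MT := (measurableTypeR R).
Variables mu nu : {sigma_finite_measure set MT -> \bar R}.
Local Notation leb := (@lebesgue_measure R).
Local Notation sp := (stproduct mu leb).
Local Notation fq := (stproduct nu leb).
Hypothesis mu_box : forall n, (mu (@box R n) < +oo)%E.
Hypothesis nu_box : forall n, (nu (@box R n) < +oo)%E.

Definition stphase (z zeta : MT * MT) : R := z.1 * zeta.1 + z.2 * zeta.2.
Definition stbox (n : nat) : set (MT * MT) := @box R n `*` @box R n.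

Lemma measurable_stphase : measurable_fun setT (fun q : (MT * MT) * (MT * MT) => stphase q.1 q.2).
Proof.
have m11 : measurable_fun setT (fun q : (MT * MT) * (MT * MT) => q.1.1).
  exact: (measurableT_comp (@measurable_fst _ _ MT MT) measurable_fst).
have m12 : measurable_fun setT (fun q : (MT * MT) * (MT * MT) => q.1.2).
  exact: (measurableT_comp (@measurable_snd _ _ MT MT) measurable_fst).
have m21 : measurable_fun setT (fun q : (MT * MT) * (MT * MT) => q.2.1).
  exact: (measurableT_comp (@measurable_fst _ _ MT MT) measurable_snd).
have m22 : measurable_fun setT (fun q : (MT * MT) * (MT * MT) => q.2.2).
  exact: (measurableT_comp (@measurable_snd _ _ MT MT) measurable_snd).
by apply: measurable_funD; apply: measurable_funM.
Qed.

Lemma measurable_stphaseN : measurable_fun setT (fun q : (MT * MT) * (MT * MT) => - stphase q.2 q.1).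
Proof.
apply: measurableT_comp => //.
have -> : (fun q : (MT * MT) * (MT * MT) => stphase q.2 q.1) = (fun q => stphase q.1 q.2).
  by apply/funext => q; rewrite /stphase !(mulrC q.2.1) !(mulrC q.2.2).
exact: measurable_stphase.
Qed.

Lemma measurable_stbox n : measurable (stbox n).
Proof. by apply: measurableX; exact: measurable_box. Qed.

Lemma stbox_cover z : \forall n \near \oo, stbox n z.
Proof. by apply: filterS2 (box_cover z.1) (box_cover z.2) => n. Qed.

Lemma sp_stbox n : (sp (stbox n) < +oo)%E.
Proof.
have -> : stproduct mu leb (stbox n) = (mu (@box R n) * leb (@box R n))%E.
  by rewrite /stproduct product_measure1E//; exact: measurable_box.
by apply: lte_mul_pinfty => //; [rewrite ge0_fin_numE// mu_box|exact: lebesgue_box].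
Qed.

Lemma fq_stbox n : (fq (stbox n) < +oo)%E.
Proof.
have -> : stproduct nu leb (stbox n) = (nu (@box R n) * leb (@box R n))%E.
  by rewrite /stproduct product_measure1E//; exact: measurable_box.
by apply: lte_mul_pinfty => //; [rewrite ge0_fin_numE// nu_box|exact: lebesgue_box].
Qed.

Definition stadjoint (Phi : MT * MT -> R[i]) : MT * MT -> R[i] :=
  ft fq (fun zeta z => - stphase z zeta) Phi.

(** The adjunction is Fubini for the truncations of [w], and both sides are
    continuous under the convergence of the truncations. *)
Lemma spacetime_pairing (w psi : Ltwo sp) (g : MT * MT -> R[i]) (Phi : Ltwo fq) :
  cintegrable fq setT Phi -> is_plancherel sp fq stphase stbox w g ->
  (forall z, w z * conjc (stadjoint Phi z) = w z * conjc (psi z)) ->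
  inner fq g Phi = inner sp w psi.
Proof.
move=> PhiI [gL gcvg] wpsi.
pose G n zeta := cintegral sp (stbox n) (fun z => w z * expi (- stphase z zeta)).
pose c n : Ltwo sp := ltwo_cut (stbox n) w.
have GE n : G n = ft sp stphase (c n).
  apply/funext => zeta; rewrite /G /ft (cintegral_mkcond sp _ (measurable_stbox n)).
  apply: eq_cintegral => z _; rewrite /c (ltwo_cutE w (measurable_stbox n)).
  by rewrite mulrC mulrA.
have cI n : cintegrable sp setT (c n) by apply: cintegrable_cut; [exact: measurable_stbox|exact: sp_stbox].
have mG n : cmeasurable (G n).
  rewrite GE; apply: (ft_cmeasurable sp measurable_stphase); exact: L2_cmeasurable (ltwoP (c n)).
have adj n : inner fq (G n) Phi = inner sp (c n) psi.
  rewrite GE; apply: etrans (ft_adjoint measurable_stphase measurable_stphaseN (cI n) PhiI) _.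
  rewrite /inner; apply: eq_cintegral => z _; rewrite /c (ltwo_cutE w (measurable_stbox n)).
  by rewrite -!mulrA -/(stadjoint Phi z) wpsi.
apply/eqP; rewrite -subr_eq0; apply/eqP/Normc.eq0_normc/eqP; rewrite eq_le normc_ge0 andbT.
apply/ler_addgt0Pr => e e0; rewrite add0r.
(* the error of the truncation is paired with [Phi] on one side and [psi] on the other *)
pose Q := ipnorm (rip fq) Phi + ipnorm (rip sp) psi + 1.
have p1 := ipnorm_ge0 (rip fq) Phi; have p2 := ipnorm_ge0 (rip sp) psi.
have Q0 : 0 < Q by rewrite /Q; lra.
have eQ : 0 < e / Q by rewrite divr_gt0.
have n1 : \forall n \near \oo, (L2norm fq (fun xi => g xi - G n xi)%R <= (e / Q)%:E)%E.
  have /fine_cvgP[fin /cvgrPdist_le /(_ _ eQ)] := gcvg.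
  apply: filterS2 fin => n fn /=; rewrite sub0r normrN ger0_norm ?fine_ge0 ?L2norm_ge0//.
  by rewrite -lee_fin fineK.
have n2 : \forall n \near \oo, ipnorm (rip sp) (c n - w) <= e / Q.
  have /cvgrPdist_le /(_ _ eQ) := ltwo_cut_cvg (mu := sp) w measurable_stbox stbox_cover.
  by apply: filterS => n; rewrite sub0r normrN ger0_norm// ipnorm_ge0.
have [n [h1 h2]] : exists n, (L2norm fq (fun xi => g xi - G n xi)%R <= (e / Q)%:E)%E /\
    ipnorm (rip sp) (c n - w) <= e / Q.
  by have [n _ hn] := filterI n1 n2; exists n; exact: hn n (leqnn n).
have dL : L2 fq (fun xi => g xi - G n xi).
  by split; [apply: cmeasurableB => //; exact: gL.1|exact: le_lt_trans h1 (ltry _)].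
have GL : L2 fq (G n).
  have -> : G n = (fun xi => g xi - (g xi - G n xi)) by apply/funext => xi; rewrite opprB addrCA subrr addr0.
  exact: L2_sub.
have e1 : inner fq g Phi = inner fq (toL2 fq (fun xi => g xi - G n xi)) Phi + inner fq (G n) Phi.
  rewrite (toL2E dL) -(inner_addl dL GL (ltwoP Phi)).
  by apply: eq_cintegral => xi _; rewrite subrK.
have e2 : inner sp (c n) psi = inner sp (c n - w : Ltwo sp) psi + inner sp w psi.
  by rewrite innerBl subrK.
rewrite e1 adj e2 addrA addrK; apply: le_trans (normcD_le _ _) _.
have b1 := inner_cauchy_schwarz (toL2 fq (fun xi => g xi - G n xi)) Phi.
have b2 := inner_cauchy_schwarz (c n - w) psi.
have d1 : ipnorm (rip fq) (toL2 fq (fun xi => g xi - G n xi)) <= e / Q by rewrite nrm_le (toL2E dL).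
have b3 := ler_wpM2r p1 d1; have b4 := ler_wpM2r p2 h2.
apply: le_trans (lerD (le_trans b1 b3) (le_trans b2 b4)) _.
rewrite -mulrDr; apply: (@le_trans _ _ (e / Q * Q)); last by rewrite divfK// gt_eqF.
by apply: ler_wpM2l; [exact: ltW|rewrite /Q lerDl].
Qed.

Lemma spacetime_slices (w psi : Ltwo sp) :
  cintegrable leb setT (fun t => cintegral mu setT (fun x => w (x, t) * conjc (psi (x, t)))) /\
  inner sp w psi = cintegral leb setT (fun t => cintegral mu setT (fun x => w (x, t) * conjc (psi (x, t)))).
Proof.
have ci : cintegrable (mu \x leb)%E setT (fun z => w z * conjc (psi z)).
  exact: cintegrable_inner (ltwoP w) (ltwoP psi).
split; first exact: cintegrable_partial (cintegrable_swap ci).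
by apply: etrans (cFubini ci); rewrite (cintegral_prod ci).
Qed.

End SpacetimePairing.

Section Hat.
Variables (R : realType) (M : manifold) (eps : R).
Local Notation MT := (measurableTypeR R).
Local Notation leb := (@lebesgue_measure R).
Local Notation mu := (space_measure R M).
Local Notation nu := (freq_measure R M).
Local Notation fq := (stproduct nu leb).
Local Notation E := (ev eps).
Implicit Types (Phi : MT * MT -> R[i]) (t : R).

(** Bounded with bounded support, so that every integral against it is absolutely
    convergent. *)
Definition test_function (m : nat) (C : R) Phi : Prop :=
  cmeasurable Phi /\ forall z, nc (Phi z) <= C * \1_(stbox (R := R) m) z.

(** The inverse transform in time of a function of the two frequencies. *)
Definition hat Phi t : MT -> R[i] :=
  fun xi => cintegral leb setT (fun tau => Phi (xi, tau) * expi (t * tau)).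

Lemma test_function_L2 m C Phi : test_function m C Phi -> L2 fq Phi /\ cintegrable fq setT Phi.
Proof.
move=> [mPhi bPhi]; apply: (bounded_support _ _ mPhi bPhi); first exact: measurable_stbox.
exact: (fq_stbox (@freq_box R M)).
Qed.

Lemma indic_stbox m (x y : MT) : \1_(stbox (R := R) m) (x, y) = \1_(@box R m) x * \1_(@box R m) y :> R.
Proof. by rewrite !indicE in_setX /=; case: (_ \in _); case: (_ \in _); rewrite ?mulr1 ?mulr0. Qed.

Lemma slice_bounded m C Phi xi : test_function m C Phi ->
  L2 leb (fun tau => Phi (xi, tau)) /\ cintegrable leb setT (fun tau => Phi (xi, tau)).
Proof.
move=> [mPhi bPhi].
have mS : cmeasurable (fun tau : MT => Phi (xi, tau)).
  exact: (cmeasurable_comp mPhi (measurable_pair1 xi)).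
refine (@bounded_support _ MT R leb (@box R m) (fun tau => Phi (xi, tau)) (C * \1_(@box R m) xi) (@measurable_box R m) (lebesgue_box R m) mS _) => tau.
by apply: le_trans (bPhi _) _; rewrite indic_stbox mulrA.
Qed.

Lemma slice_expi_integrable m C Phi xi t : test_function m C Phi ->
  cintegrable leb setT (fun tau => Phi (xi, tau) * expi (t * tau)).
Proof.
move=> Pt; apply: cintegrable_expi; last exact: (slice_bounded xi Pt).2.
by apply: measurable_funM.
Qed.

Lemma hat_cmeasurable Phi : cmeasurable Phi -> cmeasurable (fun z : MT * MT => hat Phi z.2 z.1).
Proof.
move=> mPhi.
apply: (cmeasurable_partial_cintegral leb (f := fun q : (MT * MT) * MT => Phi (q.1.1, q.2) * expi (q.1.2 * q.2))).
have m11 : measurable_fun setT (fun q : (MT * MT) * MT => q.1.1).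
  exact: (measurableT_comp (@measurable_fst _ _ MT MT) measurable_fst).
have m12 : measurable_fun setT (fun q : (MT * MT) * MT => q.1.2).
  exact: (measurableT_comp (@measurable_snd _ _ MT MT) measurable_fst).
have m2 : measurable_fun setT (fun q : (MT * MT) * MT => q.2) by exact: measurable_snd.
apply: cmeasurableM; last by apply: cmeasurable_expi; exact: measurable_funM.
exact: (cmeasurable_comp mPhi (measurable_fun_pair m11 m2)).
Qed.

Definition box_length (m : nat) : R := \int[leb]_tau \1_(@box R m) tau.

Lemma hat_bound m C Phi t xi : test_function m C Phi ->
  nc (hat Phi t xi) <= C * box_length m * \1_(@box R m) xi.
Proof.
move=> Pt; have [mPhi bPhi] := Pt; have sI := slice_expi_integrable xi t Pt.
have iI : leb.-integrable setT (EFin \o (\1_(@box R m) : MT -> R)).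
  refine (proj1 (@cintegrable_indic _ MT R leb (@box R m) (@measurable_box R m) (lebesgue_box R m))).
have iJ : leb.-integrable setT (EFin \o (fun tau : MT => C * \1_(@box R m) xi * \1_(@box R m) tau)).
  exact: (integrableZl measurableT _ iI).
apply: le_trans (le_normc_cintegral_dom (cintegrable_cmeasurable sI) iJ _) _.
  by move=> tau; rewrite Normc.normcM normc_expi mulr1 -mulrA -indic_stbox; exact: bPhi.
by rewrite RintegralZl// /box_length [leRHS]mulrAC.
Qed.

Lemma hat_slice m C Phi t : test_function m C Phi ->
  L2 nu (hat Phi t) /\ cintegrable nu setT (hat Phi t).
Proof.
move=> Pt; apply: (bounded_support (@measurable_box R m) (@freq_box R M m) _ (fun xi => hat_bound t xi Pt)).
exact: (cmeasurable_comp (hat_cmeasurable Pt.1) (measurable_pair2 t)).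
Qed.

Lemma stadjoint_hat m C Phi (x t : MT) : test_function m C Phi ->
  stadjoint nu Phi (x, t) = ft nu (@bphase R) (hat Phi t) x.
Proof.
move=> Pt; have [_ PI] := test_function_L2 Pt.
have ci' : cintegrable fq setT (fun z : MT * MT => Phi z * expi (- (- stphase (x, t) z))).
  apply: cintegrable_expi => //; rewrite /stphase /=.
  apply: measurableT_comp => //; apply: measurableT_comp => //.
  by apply: measurable_funD; apply: measurable_funM.
have ci : cintegrable (nu \x leb)%E setT (fun z : MT * MT => Phi z * expi (- (- stphase (x, t) z))) := ci'.
apply: etrans (esym (cintegral_prod ci)) _; apply: eq_cintegral => xi _.
rewrite /hat mulrC -cintegralZ; last exact: slice_expi_integrable Pt.
apply: eq_cintegral => tau _; rewrite /stphase /bphase /fphase !opprK /= expiD.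
by rewrite mulrCA.
Qed.

(** The Bessel inequality of the line, read with Lebesgue measure on both sides. *)
Lemma line_bessel (f : MT -> R[i]) : L2 leb f -> cintegrable leb setT f ->
  (sqnorm leb (fun t : MT => cintegral leb setT (fun tau => (f tau * expi (t * tau))%R)) <=
   (2 * pi)%:E * sqnorm leb f)%E.
Proof.
move=> fL fI.
have nuE A : measurable A -> freq_measure R Line A = leb A by [].
have muE A : measurable A -> space_measure R Line A = leb A.
  by move=> mA; apply: etrans (_ : leb (A `&` setT) = _); [|rewrite setIT].
have sqE h : sqnorm (freq_measure R Line) h = sqnorm leb h by exact: (eq_measure_int nuE).
have sqE' h : sqnorm (space_measure R Line) h = sqnorm leb h by exact: (eq_measure_int muE).
have fL' : L2 (freq_measure R Line) f.
  by apply/L2_sqnorm; rewrite sqE; apply/L2_sqnorm.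
have fI' : cintegrable (freq_measure R Line) setT f.
  by case: fI => i1 i2; split; exact: (eq_measure_integrable nuE).
have := @inverse_fourier_bessel R Line f fL' fI'; rewrite sqE sqE'.
have -> // : ft (freq_measure R Line) (@bphase R) f =
  (fun t : MT => cintegral leb setT (fun tau => f tau * expi (t * tau))).
apply/funext => t; rewrite /ft (eq_measure_cintegral nuE).
by apply: eq_cintegral => tau _; rewrite /bphase opprK.
Qed.

Lemma measurable_hat_sqnorm Phi : cmeasurable Phi ->
  measurable_fun setT (fun t : MT => sqnorm nu (hat Phi t)).
Proof.
move=> mPhi; have mF : measurable_fun setT (fun z : MT * MT => (nc (hat Phi z.2 z.1) ^+ 2)%:E).
  by apply/measurable_EFinP; apply: measurable_normc_sq; exact: hat_cmeasurable.
have F0 z : (0 <= (nc (hat Phi z.2 z.1) ^+ 2)%:E)%E by rewrite lee_fin sqr_ge0.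
have -> : (fun t : MT => sqnorm nu (hat Phi t)) = fubini_G nu (fun z => (nc (hat Phi z.2 z.1) ^+ 2)%:E) by [].
exact: measurable_fun_fubini_tonelli_G.
Qed.

Lemma hat_bessel m C Phi : test_function m C Phi ->
  (\int[leb]_t sqnorm nu (hat Phi t) <= (2 * pi)%:E * sqnorm fq Phi)%E.
Proof.
move=> Pt; have [mPhi _] := Pt.
have mF : measurable_fun setT (fun z : MT * MT => (nc (hat Phi z.2 z.1) ^+ 2)%:E).
  by apply/measurable_EFinP; apply: measurable_normc_sq; exact: hat_cmeasurable.
have F0 z : (0 <= (nc (hat Phi z.2 z.1) ^+ 2)%:E)%E by rewrite lee_fin sqr_ge0.
have mP : measurable_fun setT (fun z : MT * MT => (nc (Phi z) ^+ 2)%:E).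
  by apply/measurable_EFinP; exact: measurable_normc_sq.
have P0 z : (0 <= (nc (Phi z) ^+ 2)%:E)%E by rewrite lee_fin sqr_ge0.
have p0 := two_pi_gt0 R.
rewrite -(fubini_tonelli (m1 := nu) (m2 := leb) _ mF F0).
have -> : sqnorm fq Phi = (\int[nu]_xi fubini_F leb (fun z : MT * MT => (nc (Phi z) ^+ 2)%:E) xi)%E.
  exact: (@fubini_tonelli1 _ _ _ _ _ nu leb _ mP P0).
rewrite -ge0_integralZl ?lee_fin ?(ltW p0)//; first last.
- by move=> xi _; apply: integral_ge0.
- exact: measurable_fun_fubini_tonelli_F.
apply: ge0_le_integral => //.
- by move=> xi _; apply: integral_ge0.
- exact: (@measurable_fun_fubini_tonelli_F _ _ _ _ _ leb _ mF F0).
- by apply: measurable_funeM; exact: measurable_fun_fubini_tonelli_F.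
move=> xi _; have [sL sI] := slice_bounded xi Pt; exact: line_bessel sL sI.
Qed.

End Hat.

Section SymbolLimit.
Variable R : realType.

Lemma expi_re_le (x : R) : `|cos x - 1| <= `|x|.
Proof.
have h := normc_expiB x 0; rewrite subr0 expi0 in h; apply: le_trans h.
exact: (normRe_le (expi x - 1)).
Qed.

(** The mean value theorem, applied to the real and the imaginary part. *)
Lemma expi_taylor (x : R) : nc (expi x - 1 - 'i * x%:C) <= 2 * x ^+ 2.
Proof.
wlog x0 : x / 0 < x => [H|].
  have [|x0|<-] := ltgtP 0 x; first exact: H; last first.
    by rewrite expi0 subrr mulr0 subrr Normc.normc0 expr0n mulr0.
  have := H (- x); rewrite oppr_gt0 sqrrN => /(_ x0); apply: le_trans.
  rewrite -normc_conj !conjB conjc_expi conjM; apply: eq_ler; congr nc.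
  by apply: complex_eqP; rewrite !ReImE /=; ring.
have [c cx Ec] := @MVT R cos (fun y => - sin y) 0 x x0 (fun y _ => is_derive_cos y)
  (continuous_subspaceT (@continuous_cos R)).
have [c' cx' Es] := @MVT R sin cos 0 x x0 (fun y _ => is_derive_sin y)
  (continuous_subspaceT (@continuous_sin R)).
rewrite cos0 subr0 in Ec; rewrite sin0 !subr0 in Es.
have x0' := ltW x0.
have -> : expi x - 1 - 'i * x%:C = (cos x - 1)%:C + 'i * (sin x - x)%:C.
  rewrite (_ : expi x = cos x +i* sin x)//.
  by apply: complex_eqP; rewrite !ReImE /=; ring.
apply: le_trans (normcD_le _ _) _.
rewrite Normc.normcM normc_i mul1r !normc_real Ec Es.
move: cx cx'; rewrite !in_itv/= => /andP[c0 cx] /andP[c0' cx'].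
have -> : cos c' * x - x = (cos c' - 1) * x by ring.
rewrite !normrM normrN (ger0_norm x0').
have s1 := sin_le_id (ltW c0); have s2 := expi_re_le c'; rewrite (gtr0_norm c0') in s2.
have h1 : `|sin c| * x <= x ^+ 2 by rewrite expr2 ler_wpM2r// (le_trans s1)// ltW.
have h2 : `|cos c' - 1| * x <= x ^+ 2 by rewrite expr2 ler_wpM2r// (le_trans s2)// ltW.
by apply: le_trans (lerD h1 h2) _; rewrite mulrDl mul1r.
Qed.

Definition quotient_symbol (h sigma : R) : R[i] := 1 - (h^-1)%:C * (1 - expi (h * sigma)).

Lemma quotient_symbol_dist (h sigma : R) : 0 < h ->
  nc (quotient_symbol h sigma - (1 + 'i * sigma%:C)) <= h * (2 * sigma ^+ 2).
Proof.
move=> h0; have hn : h != 0 by rewrite gt_eqF.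
have -> : quotient_symbol h sigma - (1 + 'i * sigma%:C) =
    (h^-1)%:C * (expi (h * sigma) - 1 - 'i * (h * sigma)%:C).
  have e : sigma = h^-1 * (h * sigma) by rewrite mulrA mulVf// mul1r.
  rewrite /quotient_symbol {2}e; move: (expi _) => [a b].
  by apply: complex_eqP; rewrite !ReImE /=; ring.
rewrite Normc.normcM normc_real gtr0_norm ?invr_gt0//.
apply: le_trans (ler_wpM2l _ (expi_taylor _)) _; first by rewrite invr_ge0 ltW.
by apply: eq_ler; field.
Qed.

Lemma quotient_symbol_le (h sigma : R) : 0 < h -> nc (quotient_symbol h sigma) <= 1 + 2 / h.
Proof.
move=> h0; apply: le_trans (normcD_le _ _) _.
rewrite (normc_real 1) normr1 lerD2l normc_opp Normc.normcM normc_real gtr0_norm ?invr_gt0// mulrC.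
apply: ler_wpM2r; first by rewrite invr_ge0 ltW.
apply: le_trans (normcD_le _ _) _; rewrite normc_opp normc_expi (normc_real 1) normr1.
by rewrite -[1 + 1]/(2 : R).
Qed.

Lemma normc_one_i (sigma : R) : nc (1 + 'i * sigma%:C) = japanese sigma.
Proof.
rewrite -[LHS](ger0_norm (normc_ge0 _)) -sqrtr_sqr normc_sq !ReImE /japanese /=.
by congr Num.sqrt; ring.
Qed.

(** The difference quotient of the exponential tends to its derivative [i sigma]. *)
Lemma quotient_symbol_cvg (sigma : R) :
  (fun k => nc (quotient_symbol (k.+1%:R^-1 : R) sigma)) @ \oo --> japanese sigma.
Proof.
rewrite -normc_one_i; apply/cvgrPdist_le => e e0.
have h : (fun k => k.+1%:R^-1 * (2 * sigma ^+ 2) : R) @ \oo --> (0 * (2 * sigma ^+ 2) : R).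
  by apply: cvgMl; exact: cvg_harmonic.
rewrite mul0r in h; have /cvgrPdist_le /(_ e e0) := h.
apply: filterS => k; rewrite sub0r normrN; apply: le_trans.
have kp : 0 < k.+1%:R^-1 :> R by rewrite invr_gt0.
apply: le_trans (le_trans (quotient_symbol_dist sigma kp) (ler_norm _)).
rewrite distrC ler_norml; apply/andP; split.
  have := normcD_le (quotient_symbol k.+1%:R^-1 sigma) (- (quotient_symbol k.+1%:R^-1 sigma - (1 + 'i * sigma%:C))).
  by rewrite opprB addrC subrK -(opprB (quotient_symbol _ _)) normc_opp; lra.
have := normcD_le (quotient_symbol k.+1%:R^-1 sigma - (1 + 'i * sigma%:C)) (1 + 'i * sigma%:C).
by rewrite subrK; lra.
Qed.

End SymbolLimit.

(** The constants match the factor [2 pi] of Plancherel in time, so that exactly half of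
    the energy is spent when [p = pi]. *)
Lemma amgm_budget (R : realType) (p D x : R) : 0 < p -> D * x <= p * D ^+ 2 + (4 * p)^-1 * x ^+ 2.
Proof.
move=> p0; have h := sqr_ge0 (2 * p * D - x).
have q0 : 0 < (4 * p)^-1 by rewrite invr_gt0 mulr_gt0.
rewrite -subr_ge0.
have -> : p * D ^+ 2 + (4 * p)^-1 * x ^+ 2 - D * x = (4 * p)^-1 * (2 * p * D - x) ^+ 2.
  by field; rewrite gt_eqF.
by rewrite mulr_ge0// ltW.
Qed.

Opaque inner.

(** * Membership in the Bourgain space *)

Section Bourgain.
Variables (R : realType) (M : manifold) (eps s : R).
Hypotheses (eps_gt0 : 0 < eps) (s_ge0 : 0 <= s).
Local Notation MT := (measurableTypeR R).
Local Notation leb := (@lebesgue_measure R).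
Local Notation mu := (space_measure R M).
Local Notation nu := (freq_measure R M).
Local Notation sp := (stproduct mu leb).
Local Notation fq := (stproduct nu leb).
Local Notation nrmf := (ipnorm (rip nu)).
Local Notation E := (ev eps).
Local Notation wt := (sobolev_weight s).
Let rH := rip_semi_hilbert nu.
Let W n : weight (wt n) (2 `^ s) := sobolev_weightP s_ge0 n.

Variables (T K L : R) (A : R -> Ltwo nu).
Hypotheses (T_ge0 : 0 <= T) (AR : regular_curve s T K L A).
Variable w : MT * MT -> R[i].
Hypothesis wL : L2 sp w.
Hypothesis w_out : forall t x, ~~ (-1 <= t <= T + 1) -> w (x, t) = 0.
Hypothesis w_slice : forall t, L2 mu (fun x => w (x, t)) /\
  nrmf (spec M (fun x => w (x, t)) - E (- t) (A t)) = 0.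
Variable g : MT * MT -> R[i].
Hypothesis gP : is_plancherel sp fq (@stphase R) (@stbox R) w g.

Let gL : L2 fq g := gP.1.

Definition kpair (B : R -> Ltwo nu) (Phi : MT * MT -> R[i]) (t : MT) : R[i] :=
  inner nu (E (- t) (B t)) (toL2 nu (hat Phi t)).

(** Bessel in space, as the transform in time is bounded on a box. *)
Lemma adjoint_slice_le m C Phi : test_function m C Phi -> exists c, forall t,
  (sqnorm mu (fun x => stadjoint nu Phi (x, t)) <= c%:E)%E.
Proof.
move=> Pt; pose q (xi : MT) : R[i] := (C * box_length R m)%:C * (\1_(@box R m) xi)%:C.
have qL : L2 nu q by apply: L2_scale; exact: L2_indic (@measurable_box R m) (@freq_box R M m).
have [mq qfin] := (L2_sqnorm nu q).1 qL.
exists (2 * pi * fine (sqnorm nu q)) => t.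
have -> : (fun x => stadjoint nu Phi (x, t)) = ft nu (@bphase R) (hat Phi t).
  by apply/funext => x; exact: stadjoint_hat Pt.
have [hL hI] := hat_slice M t Pt.
apply: le_trans (@inverse_fourier_bessel R M _ hL hI) _.
rewrite (EFinM (2 * pi)) fineK; last by rewrite ge0_fin_numE// sqnorm_ge0.
apply: lee_wpmul2l; first by rewrite lee_fin ltW// two_pi_gt0.
apply: le_sqnorm => //; first exact: L2_cmeasurable hL.
move=> xi; rewrite Normc.normcM !normc_real indicE.
have := hat_bound t xi Pt; rewrite indicE; case: (xi \in _) => /=; rewrite ?mulr1 ?mulr0.
  by rewrite normr1 mulr1 => h; exact: le_trans h (ler_norm _).
by rewrite normr0 mulr0.
Qed.

(** The adjoint of a test function is, slice by slice in time, an inverse transform in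
    space; Plancherel in space brings the slices of [w] to the frequency side. *)
Lemma test_pairing m C Phi : test_function m C Phi ->
  cintegrable leb setT (kpair A Phi) /\ inner fq g Phi = cintegral leb setT (kpair A Phi).
Proof.
move=> Pt; have [PL PI] := test_function_L2 M Pt; have [mPhi _] := Pt.
(* the adjoint of a test function need not decay in time; [w] vanishes outside the interval *)
pose psi (z : MT * MT) : R[i] := (\1_(`[-1, T + 1]%classic : set MT) z.2)%:C * stadjoint nu Phi z.
have mst : cmeasurable (stadjoint nu Phi) by exact: (ft_cmeasurable fq (@measurable_stphaseN R) mPhi).
have psiL : L2 sp psi.
  have [c hc] := adjoint_slice_le Pt.
  apply: (@slices_L2 _ _ _ mu psi (T + 1) c).
  - apply: cmeasurableM mst; apply: cmeasurable_real; apply: measurable_indic_snd.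
    exact: measurable_itv.
  - by move=> t x h; rewrite /psi indicE mem_setE in_itv/= (negbTE h) mul0r.
  move=> t; apply: le_trans (hc t).
  have ms : cmeasurable (fun x : MT => stadjoint nu Phi (x, t)).
    exact: (cmeasurable_comp mst (measurable_pair2 t)).
  have mp : cmeasurable (fun x : MT => psi (x, t)).
    change (cmeasurable (fun x : MT => (\1_(`[-1, T + 1]%classic : set MT) t)%:C * stadjoint nu Phi (x, t))).
    apply: (@cmeasurableM _ MT R (fun=> (\1_(`[-1, T + 1]%classic : set MT) t)%:C) _ _ ms).
    exact: cmeasurable_cst.
  apply: le_sqnorm => // x; rewrite /psi Normc.normcM normc_real indicE.
  by case: (_ \in _); rewrite ?normr1 ?mul1r// normr0 mul0r normc_ge0.
have PIt : cintegrable fq setT (toL2 fq Phi) by rewrite (toL2E PL).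
have gPt : is_plancherel sp fq (@stphase R) (@stbox R) (toL2 sp w) g by rewrite (toL2E wL).
have in_out z : w z * conjc (stadjoint nu Phi z) = w z * conjc (psi z).
  case: z => x t; rewrite /psi indicE mem_setE in_itv/=.
  by have [|h] := boolP (-1 <= t <= T + 1); rewrite ?mul1r// (w_out _ h) !mul0r.
have pw z : toL2 sp w z * conjc (stadjoint nu (toL2 fq Phi) z) = toL2 sp w z * conjc (toL2 sp psi z).
  by rewrite (toL2E wL) (toL2E PL) (toL2E psiL).
have pair := spacetime_pairing (@space_box R M) PIt gPt pw.
have [si se] := spacetime_slices (toL2 sp w) (toL2 sp psi).
have slice t : cintegral mu setT (fun x => toL2 sp w (x, t) * conjc (toL2 sp psi (x, t))) = kpair A Phi t.
  rewrite (toL2E wL) (toL2E psiL).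
  have [hL hI] := hat_slice M t Pt.
  have hI' : cintegrable nu setT (toL2 nu (hat Phi t)) by rewrite (toL2E hL).
  have ae := idft0_integrable hI'; rewrite (toL2E hL) in ae.
  have mft : cmeasurable (ft nu (@bphase R) (hat Phi t)).
    exact: (@ft_cmeasurable _ _ _ _ _ nu (@bphase R) (@measurable_bphase R) _ (L2_cmeasurable hL)).
  transitivity (inner mu (fun x => w (x, t)) (ft nu (@bphase R) (hat Phi t))).
    by apply: eq_cintegral => x _; rewrite -in_out (stadjoint_hat M x t Pt).
  have mi := L2_cmeasurable (ltwoP (idft0 (M := M) (toL2 nu (hat Phi t)))).
  rewrite -(ae_eq_innerr mi mft (L2_cmeasurable (w_slice t).1) ae).
  rewrite -(inner_spec0 _ (w_slice t).1); exact: nrm0_inner (w_slice t).2.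
have e : (fun t => cintegral mu setT (fun x => toL2 sp w (x, t) * conjc (toL2 sp psi (x, t)))) = kpair A Phi.
  by apply/funext => t; exact: slice.
by move: pair; rewrite se e (toL2E PL); rewrite e in si.
Qed.

Definition modulated (h : R) (Phi : MT * MT -> R[i]) (z : MT * MT) : R[i] :=
  expi (h * (z.2 + dispersion eps z.1)) * Phi z.

Lemma measurable_modulation : measurable_fun setT (fun z : MT * MT => z.2 + dispersion eps z.1).
Proof.
apply: measurable_funD; first exact: measurable_snd.
exact: (measurableT_comp (measurable_dispersion eps) measurable_fst).
Qed.

Lemma modulated_test m C h Phi : test_function m C Phi -> test_function m C (modulated h Phi).
Proof.
move=> [mPhi bPhi]; split; last by move=> z; rewrite Normc.normcM normc_expi mul1r.
apply: cmeasurableM mPhi; apply: cmeasurable_expi; apply: measurable_funM => //.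
exact: measurable_modulation.
Qed.

Lemma hat_modulated m C h Phi t : test_function m C Phi ->
  toL2 nu (hat (modulated h Phi) t) = E h (toL2 nu (hat Phi (t + h))).
Proof.
move=> Pt; apply: ltwo_ext.
rewrite evE (toL2E (hat_slice M t (modulated_test h Pt)).1) (toL2E (hat_slice M (t + h) Pt).1).
apply/funext => xi; rewrite /hat -cintegralZ; last exact: slice_expi_integrable Pt.
apply: eq_cintegral => tau _; rewrite /modulated /= mulrDl mulrDr !expiD; ring.
Qed.

(** Modulation of the test function is translation of the profile in time. *)
Lemma modulated_pairing m C h Phi : test_function m C Phi ->
  cintegrable leb setT (kpair (fun t => A (t - h)) Phi) /\
  inner fq g (modulated h Phi) = cintegral leb setT (kpair (fun t => A (t - h)) Phi).
Proof.
move=> Pt; have [ki ke] := test_pairing (modulated_test h Pt).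
have kE : kpair (fun t => A (t - h)) Phi = kpair A (modulated h Phi) \o translate h.
  apply/funext => t; rewrite /comp /kpair /translate (hat_modulated h (t - h) Pt) subrK.
  have e : E (- t) (A (t - h)) = E (- h) (E (- (t - h)) (A (t - h))).
    by rewrite evD; congr (E _ _); ring.
  by rewrite e [LHS]ev_adj opprK.
have inv := lebesgue_translation h.
rewrite kE; split.
  case: ki => k1 k2; split.
    exact: (integrable_invariant (@measurable_translate R h) inv k1).
  exact: (integrable_invariant (@measurable_translate R h) inv k2).
by rewrite (cintegral_invariant (@measurable_translate R h) inv ki).
Qed.

Definition quotient_curve (h : R) (t : R) : Ltwo nu := A t - (h^-1)%:C *: (A t - A (t - h)).

Definition quotient_test (h : R) (Phi : MT * MT -> R[i]) (z : MT * MT) : R[i] :=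
  quotient_symbol h (z.2 + dispersion eps z.1) * Phi z.

(** A difference quotient of translates of the profile corresponds to a multiplier
    close to [1 + i sigma]. *)
Lemma quotient_pairing m C h Phi : test_function m C Phi ->
  cintegrable leb setT (kpair (quotient_curve h) Phi) /\
  inner fq g (quotient_test h Phi) = cintegral leb setT (kpair (quotient_curve h) Phi).
Proof.
move=> Pt; have [i0 e0] := test_pairing Pt; have [i1 e1] := modulated_pairing h Pt.
set k0 := kpair A Phi in i0 e0; set k1 := kpair _ Phi in i1 e1.
have kE : kpair (quotient_curve h) Phi = (fun t => k0 t - (h^-1)%:C * (k0 t - k1 t)).
  apply/funext => t; rewrite /kpair /quotient_curve.
  by rewrite (evB eps (- t)) (evZ eps (- t)) (evB eps (- t)) innerBl innerZl innerBl.
have d1 := cintegrableB i0 i1; have d2 := cintegrableZ ((h^-1)%:C) d1.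
have PL := (test_function_L2 M Pt).1; have ML := (test_function_L2 M (modulated_test h Pt)).1.
have j0 := cintegrable_inner gL PL; have j1 := cintegrable_inner gL ML.
have f1 := cintegrableB j0 j1; have f2 := cintegrableZ ((h^-1)%:C) f1.
rewrite kE; split; first exact: cintegrableB i0 d2.
rewrite (cintegralB i0 d2) (cintegralZ _ d1) (cintegralB i0 i1) -e0 -e1.
transitivity (cintegral fq setT (fun z => g z * conjc (Phi z) -
    (h^-1)%:C * (g z * conjc (Phi z) - g z * conjc (modulated h Phi z)))).
  apply: eq_cintegral => z _; rewrite /quotient_test /quotient_symbol /modulated.
  rewrite mulrBl mul1r conjB -!mulrA conjM conjc_real mulrBl mul1r conjB; ring.
by rewrite (cintegralB j0 f2) (cintegralZ _ f1) (cintegralB j0 j1).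
Qed.

Lemma quotient_curve_bound h n t : 0 < h <= 1 ->
  wnorm (wt n) (quotient_curve h t) <= (K + L) * \1_(`[-1, T + 2]%classic : set MT) t.
Proof.
move=> /andP[h0 h1]; rewrite indicE mem_setE in_itv/=.
have [tI|tI] := boolP (-1 <= t <= T + 2).
  rewrite mulr1; apply: le_trans (wnormB_le (W n) _ _) _; apply: lerD; first exact: curve_bnd AR n t.
  rewrite (wnormZ (W n)) normc_real gtr0_norm ?invr_gt0// mulrC ler_pdivrMr//.
  apply: le_trans (curve_lip AR n _ _) _.
  by rewrite opprB addrCA subrr addr0 gtr0_norm.
have o1 : A t = 0 by apply: (curve_out AR); apply: contra tI => /andP[-> h2] /=; lra.
have o2 : A (t - h) = 0.
  by apply: (curve_out AR); apply: contra tI => /andP[h2 h3]; apply/andP; split; lra.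
rewrite mulr0 /quotient_curve o1 o2 subrr scaler0 subr0.
have -> : (0 : Ltwo nu) = 0%:C *: 0 by rewrite scaler0.
by rewrite (wnormZ (W n)) (normc_real 0) normr0 mul0r.
Qed.

Definition weighted_test n (Phi : MT * MT -> R[i]) (z : MT * MT) : R[i] := (wt n z.1)%:C * Phi z.

Lemma weighted_test_function n m C Phi : 0 <= C -> test_function m C Phi ->
  test_function m (n.+1%:R * C) (weighted_test n Phi).
Proof.
move=> C0 [mPhi bPhi]; split.
  apply: cmeasurableM mPhi; apply: cmeasurable_real.
  exact: (measurableT_comp (weight_meas (W n)) measurable_fst).
move=> z; rewrite Normc.normcM normc_real -mulrA; apply: ler_pM => //; first exact: normc_ge0.
rewrite ger0_norm; last exact: le_trans ler01 (sobolev_weight_ge1 s_ge0 n _).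
by rewrite ge_min lexx orbT.
Qed.

Lemma hat_weighted n m C Phi t : 0 <= C -> test_function m C Phi ->
  toL2 nu (hat (weighted_test n Phi) t) = weighted (wt n) (toL2 nu (hat Phi t)).
Proof.
move=> C0 Pt; apply: ltwo_ext; rewrite (weightedE (W n)).
rewrite (toL2E (hat_slice M t (weighted_test_function n C0 Pt)).1) (toL2E (hat_slice M t Pt).1).
apply/funext => xi; rewrite /hat -cintegralZ; last exact: slice_expi_integrable Pt.
by apply: eq_cintegral => tau _; rewrite /weighted_test /= mulrA.
Qed.

Definition bourgain_bound : R := pi * (K + L) ^+ 2 * (T + 3).

(** Testing against the difference quotient costs half of the energy of the test function. *)
Lemma quotient_energy h n m C (Theta : MT * MT -> R[i]) (Y : R) : 0 < h <= 1 -> 0 <= C ->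
  test_function m C Theta -> sqnorm fq Theta = Y%:E ->
  nc (inner fq g (quotient_test h (weighted_test n Theta))) <= bourgain_bound + 2^-1 * Y.
Proof.
move=> h01 C0 Tt ThY; have Pt := weighted_test_function n C0 Tt.
have [ki ->] := quotient_pairing h Pt.
pose N2 (t : MT) : R := nrmf (toL2 nu (hat Theta t)) ^+ 2.
have N2E t : (N2 t)%:E = sqnorm nu (hat Theta t).
  by rewrite -(toL2E (hat_slice M t Tt).1) sqnorm_rip /N2 (ipnorm_sq rH).
have p0 : 0 < (pi : R) by exact: pi_gt0.
have bes := hat_bessel M Tt; rewrite ThY in bes.
have mN : measurable_fun setT (EFin \o N2).
  by rewrite (_ : EFin \o N2 = (fun t => sqnorm nu (hat Theta t))); [exact: (measurable_hat_sqnorm M Tt.1)|apply/funext => t; exact: N2E].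
have iN : leb.-integrable setT (EFin \o N2).
  apply/integrableP; split => //.
  apply: (@le_lt_trans _ _ (\int[leb]_t sqnorm nu (hat Theta t))%E); last exact: le_lt_trans bes (ltry _).
  by rewrite le_eqVlt; apply/orP; left; apply/eqP; apply: eq_integral => t _; rewrite -N2E /= ger0_norm// sqr_ge0.
have iN_le : \int[leb]_t N2 t <= 2 * pi * Y.
  rewrite /Rintegral -lee_fin fineK; last exact: integrable_fin_num iN.
  have -> : (\int[leb]_x (N2 x)%:E = \int[leb]_t sqnorm nu (hat Theta t))%E.
    by apply: eq_integral => t _; exact: N2E.
  by rewrite EFinM.
have mI : measurable (`[-1, T + 2]%classic : set MT) by exact: measurable_itv.
have lI : leb (`[-1, T + 2]%classic : set MT) = (T + 3)%:E.
  rewrite lebesgue_measure_itv/= lte_fin ifT; last by have := T_ge0; lra.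
  by congr (_%:E); ring.
have fI := ltry (T + 3); rewrite -lI in fI.
have iI : leb.-integrable setT (EFin \o (\1_(`[-1, T + 2]%classic : set MT) : MT -> R)).
  exact: (proj1 (@cintegrable_indic _ MT R leb _ mI fI)).
pose c1 : R := pi * (K + L) ^+ 2; pose c2 : R := (4 * pi)^-1.
have i1 : leb.-integrable setT (EFin \o (fun t : MT => c1 * \1_(`[-1, T + 2]%classic : set MT) t)).
  exact: (integrableZl measurableT c1 iI).
have i2 : leb.-integrable setT (EFin \o (fun t => c2 * N2 t)).
  exact: (integrableZl measurableT c2 iN).
have i12 : leb.-integrable setT (EFin \o (fun t => c1 * \1_(`[-1, T + 2]%classic : set MT) t + c2 * N2 t)).
  exact: (integrableD measurableT i1 i2).
have c20 : 0 <= c2 by rewrite invr_ge0 mulr_ge0// ltW.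
apply: le_trans (le_normc_cintegral_dom (cintegrable_cmeasurable ki) i12 _) _.
  move=> t; rewrite /kpair (hat_weighted n t C0 Tt).
  rewrite -(weighted_adj (W n)); apply: le_trans (inner_cauchy_schwarz _ _) _.
  rewrite -/(wnorm (wt n) _) (wnorm_ev eps (W n)).
  have hb := quotient_curve_bound n t h01; have n0 := ipnorm_ge0 (rip nu) (toL2 nu (hat Theta t)).
  apply: le_trans (ler_wpM2r n0 hb) _.
  have := amgm_budget (K + L) (nrmf (toL2 nu (hat Theta t))) p0.
  rewrite /N2 indicE; case: (_ \in _); rewrite ?mulr1 //= mulr0 mul0r => _.
  by rewrite mulr0 add0r mulr_ge0// sqr_ge0.
rewrite (RintegralD measurableT i1 i2) RintegralZl// RintegralZl//.
have -> : \int[leb]_x \1_(`[-1, T + 2]%classic : set MT) x = T + 3.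
  by rewrite /Rintegral integral_indic// setIT; exact: (congr1 fine lI).
rewrite /bourgain_bound; apply: lerD => //.
apply: le_trans (ler_wpM2l c20 iN_le) _.
by apply: eq_ler; rewrite /c2; move: (pi : R) p0 => p p0; field; rewrite gt_eqF.
Qed.

Definition cut_set (k : nat) (z : MT * MT) : R := \1_(stbox (R := R) k) z * \1_[set y : R | y <= k%:R] (nc (g z)).

(** The truncation of the multiplied transform itself: testing against it yields
    its own energy. *)
Definition energy_test (k : nat) (z : MT * MT) : R[i] :=
  conjc (quotient_symbol k.+1%:R^-1 (z.2 + dispersion eps z.1)) * (wt k z.1)%:C * g z * (cut_set k z)%:C.

Lemma cut_set_sq k z : cut_set k z * cut_set k z = cut_set k z.
Proof. by rewrite /cut_set !indicE; case: (_ \in _); case: (_ \in _); rewrite ?mulr1 ?mulr0 ?mul0r. Qed.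

Lemma measurable_quotient_symbol (h : R) :
  cmeasurable (fun z : MT * MT => quotient_symbol h (z.2 + dispersion eps z.1)).
Proof.
apply: cmeasurableB; first exact: cmeasurable_cst.
apply: cmeasurableM; first exact: cmeasurable_cst.
apply: cmeasurableB; first exact: cmeasurable_cst.
apply: cmeasurable_expi; apply: measurable_funM => //; exact: measurable_modulation.
Qed.

Lemma energy_test_function k : exists2 C, 0 <= C & test_function k C (energy_test k).
Proof.
pose Q : R := 1 + 2 / k.+1%:R^-1.
have kp : 0 < k.+1%:R^-1 :> R by rewrite invr_gt0.
have Q0 : 0 <= Q by rewrite addr_ge0// divr_ge0// ltW.
have mg := L2_cmeasurable gL.
exists (Q * k.+1%:R * k%:R); first by rewrite !mulr_ge0.
split.
  apply: cmeasurableM.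
    apply: cmeasurableM mg; apply: cmeasurableM.
      exact: (cmeasurableJ (measurable_quotient_symbol _)).
    by apply: cmeasurable_real; exact: (measurableT_comp (weight_meas (W k)) measurable_fst).
  apply: cmeasurable_real; apply: measurable_funM.
    exact: measurable_indic (@measurable_stbox R k).
  have mD : measurable ([set y | y <= k%:R] : set R) by rewrite -set_itvNyc; exact: measurable_itv.
  exact: (measurableT_comp (measurable_indic mD) (measurable_normc mg)).
move=> z; rewrite /energy_test /cut_set !Normc.normcM normc_conj !normc_real.
rewrite !indicE; case: (_ \in stbox k) => /=; last by rewrite mul0r normr0 !mulr0.
rewrite mul1r mulr1; have [gk|_] := boolP (nc (g z) \in [set y | y <= k%:R]); last first.
  by rewrite normr0 mulr0 !mulr_ge0.
rewrite normr1 mulr1; apply: ler_pM.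
- by apply: mulr_ge0 => //; exact: normc_ge0.
- exact: normc_ge0.
- apply: ler_pM => //; [exact: normc_ge0|exact: quotient_symbol_le|].
  rewrite ger0_norm; last exact: le_trans ler01 (sobolev_weight_ge1 s_ge0 k _).
  by rewrite ge_min lexx orbT.
by move: gk; rewrite inE.
Qed.

(** Half of the energy is absorbed in the left side; it is finite since the
    test function is bounded with bounded support. *)
Lemma energy_test_le k : (sqnorm fq (energy_test k) <= (2 * bourgain_bound)%:E)%E.
Proof.
have [C C0 Tt] := energy_test_function k.
have [TL _] := test_function_L2 M Tt.
pose th := toL2 fq (energy_test k).
pose Y := ipnorm (rip fq) th ^+ 2.
have YE : sqnorm fq (energy_test k) = Y%:E.
  by rewrite -{1}(toL2E TL) sqnorm_rip /Y (ipnorm_sq (rip_semi_hilbert fq)).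
have h01 : 0 < (k.+1%:R^-1 : R) <= 1.
  by rewrite invr_gt0 ltr0n/= invf_le1 ?ltr0n// ler1n.
have := quotient_energy k h01 C0 Tt YE.
have -> : inner fq g (quotient_test k.+1%:R^-1 (weighted_test k (energy_test k))) = (Y)%:C.
  rewrite /Y -inner_self /th (toL2E TL); apply: eq_cintegral => z _.
  have hE : energy_test k z * (cut_set k z)%:C = energy_test k z.
    by rewrite /energy_test -!mulrA -rmorphM /= cut_set_sq.
  have cE : conjc (energy_test k z) = conjc (energy_test k z) * (cut_set k z)%:C.
    by rewrite -{1}hE conjM conjc_real.
  rewrite /quotient_test /weighted_test conjM conjM conjc_real [in LHS]cE.
  move: (conjc (energy_test k z)) => e; rewrite /energy_test.
  move: (conjc (quotient_symbol _ _)) => q; ring.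
rewrite normc_real ger0_norm ?sqr_ge0// => hY.
rewrite YE lee_fin; lra.
Qed.

Lemma cut_set_cvg z : (cut_set ^~ z) @ \oo --> (1 : R).
Proof.
have b := stbox_cover z.
have n : \forall k \near \oo, nc (g z) <= k%:R.
  exists (Num.truncn (nc (g z))).+1 => // k /= hk; apply: ltW; apply: lt_le_trans (truncnS_gt _) _.
  by rewrite ler_nat.
apply: cvg_near_cst; apply: filterS2 b n => k bk nk.
by rewrite /cut_set !indicE !mem_set// mulr1.
Qed.

(** The tested multipliers tend to the Sobolev weight times [1 + i sigma], whose
    modulus is [<sigma>]; the bounds on the truncations pass to the limit. *)
Lemma transform_energy : (sqnorm fq (fun z => ((sobolev_symbol s z.1 *
  japanese (z.2 + dispersion eps z.1))%:C * g z)%R) <= (2 * bourgain_bound)%:E)%E.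
Proof.
apply: (sqnorm_fatou (f := energy_test)); last exact: energy_test_le.
  by move=> k; have [C _ [mT _]] := energy_test_function k.
move=> z; have c := cut_set_cvg z.
have e k : nc (energy_test k z) = nc (quotient_symbol k.+1%:R^-1 (z.2 + dispersion eps z.1)) *
    `|wt k z.1| * nc (g z) * `|cut_set k z|.
  by rewrite /energy_test !Normc.normcM normc_conj !normc_real.
under eq_fun do rewrite e.
have -> : nc ((sobolev_symbol s z.1 * japanese (z.2 + dispersion eps z.1))%:C * g z) =
    japanese (z.2 + dispersion eps z.1) * `|sobolev_symbol s z.1| * nc (g z) * `|1|.
  rewrite Normc.normcM normc_real normrM normr1 mulr1 [`|_| * `|_|]mulrC.
  by rewrite (ger0_norm (le_trans ler01 (japanese_ge1 _))).
apply: cvgM; last exact: cvg_norm.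
apply: cvgMl; apply: cvgM; first exact: quotient_symbol_cvg.
apply: cvg_norm; exact: sobolev_weight_cvg.
Qed.

End Bourgain.

Section Membership.
Variables (R : realType) (M : manifold) (eps s : R).
Hypotheses (eps_gt0 : 0 < eps) (s_ge0 : 0 <= s).
Local Notation MT := (measurableTypeR R).
Local Notation mu := (space_measure R M).
Local Notation nu := (freq_measure R M).

(** If no space-time transform existed, its representative would be zero by
    convention; otherwise the energy estimate applies to the representative. *)
Lemma regular_curve_Xsb (T K L : R) (A : R -> Ltwo nu) (w : MT * MT -> R[i]) :
  0 <= T -> regular_curve s T K L A -> L2 (spacetime_measure R M) w ->
  (forall t x, ~~ (-1 <= t <= T + 1) -> w (x, t) = 0) ->
  (forall t, L2 mu (fun x => w (x, t)) /\
    ipnorm (rip nu) (spec M (fun x => w (x, t)) - ev eps (- t) (A t)) = 0) ->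
  (Xsb_norm M eps s 1 w < +oo)%E.
Proof.
move=> T0 AR wL wout wsl.
have [[g gP]|no] := pselect (exists g, is_plancherel (spacetime_measure R M)
    (spacetime_freq_measure R M) (fun z zeta => z.1 * zeta.1 + z.2 * zeta.2)
    (fun n => `[- n%:R, n%:R]%classic `*` `[- n%:R, n%:R]%classic) w g); last first.
  have z : spacetime_fourier M w = (fun=> 0).
    by rewrite /spacetime_fourier /plancherel xgetPN// => g gP; apply: no; exists g.
  rewrite /Xsb_norm z.
  have -> : (fun z : MT * MT => (japanese z.1 `^ s * japanese (z.2 + dispersion eps z.1) `^ 1)%:C * (0 : R[i])) = (fun=> 0).
    by apply/funext => y; rewrite mulr0.
  by apply: (L2_cst0 _).2.
have {}gP := xgetPex (fun=> 0) (ex_intro _ g gP).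
rewrite -[xget _ _]/(spacetime_fourier M w) in gP.
have := transform_energy s_ge0 T0 AR wL wout wsl gP.
rewrite /Xsb_norm.
have -> : (fun z : MT * MT => (japanese z.1 `^ s * japanese (z.2 + dispersion eps z.1) `^ 1)%:C * spacetime_fourier M w z) =
   (fun z => (sobolev_symbol s z.1 * japanese (z.2 + dispersion eps z.1))%:C * spacetime_fourier M w z).
  by apply/funext => z; rewrite powRr1// sqrtr_ge0.
move=> h; rewrite -sqnorm_lty; exact: le_lt_trans h (ltry _).
Qed.

End Membership.

(** * Well-posedness *)

Section Main.
Variables (R : realType) (M : manifold) (eps s : R).
Hypotheses (eps_gt0 : 0 < eps) (s_ge0 : 0 <= s).

(** The flow of the profile equation, extended in time, realised in space and time, and
    read back through the equivalence of the two formulations. *)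
Lemma solution_exists (T : R) u0 : 0 < T -> Hs M s u0 ->
  exists u, solves_in_class M eps s 1 T u0 u.
Proof.
move=> T0 u0H; have u0L := u0H.1; have [c c0 u0c] := Hs_bound u0H.
have [a [_ _ aC aP]] := flow_exists eps_gt0 (spec M u0).
have aP' := aP T.
have a0c n : wnorm (sobolev_weight s n) (spec M u0) <= c by exact: (Hs_norm_ge s_ge0 n u0L u0c).
have aK := profile_sobolev eps_gt0 s_ge0 aP' a0c.
have [L L0 aL] := profile_lipschitz eps_gt0 s_ge0 aC aP' a0c.
have AR := extend_regular s_ge0 (ltW T0) L0 aK aL.
have [w [wL wout wsl]] := curve_realization eps s_ge0 (ltW T0) AR.
exists (fun t x => w (x, t)); split.
- exact: (CHs_curve s_ge0 AR wsl).
- apply: le_lt_trans (regular_curve_Xsb s_ge0 (ltW T0) AR wL wout wsl).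
  apply: ereal_inf_lbound; exists w => //; split => //.
  by apply: aeW => -[x t].
- apply: (profile_solution eps_gt0 u0L aP') => t tT; have [wtL wtE] := wsl t.
  by split => //; rewrite (extend_in a tT) in wtE.
Qed.

(** The Lipschitz estimate with [u] itself as the second solution. *)
Lemma flow_continuous (T : R) u0 u : 0 < T -> Hs M s u0 -> is_solution M eps T u0 u ->
  forall e : R, 0 < e -> exists2 delta : R, 0 < delta &
  forall v0 v, Hs M s v0 -> is_solution M eps T v0 v ->
    (Hs_norm M s (fun x => v0 x - u0 x)%R < delta%:E)%E ->
    (CHs_norm M s T (fun t x => v t x - u t x)%R <= e%:E)%E.
Proof.
move=> T0 u0H uS e e0; have [L L0 lip] := flow_lipschitz eps_gt0 s_ge0 T u0H.
have eL : 0 < e / L by rewrite divr_gt0.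
exists (Num.min 1 (e / L)); first by rewrite lt_min ltr01.
move=> v0 v v0H vS hd.
have d1 : (Hs_norm M s (fun x => v0 x - u0 x)%R < 1%:E)%E.
  by apply: lt_le_trans hd _; rewrite lee_fin ge_min lexx.
have d2 : (Hs_norm M s (fun x => v0 x - u0 x)%R <= (e / L)%:E)%E.
  by apply: ltW; apply: lt_le_trans hd _; rewrite lee_fin ge_min lexx orbT.
have z : (Hs_norm M s (fun x => u0 x - u0 x)%R < 1%:E)%E.
  apply: (@le_lt_trans _ _ 0%:E); last by rewrite lte_fin.
  apply: (Hs_norm_sub_le s_ge0 u0H.1 u0H.1) => n.
  rewrite subrr; have [B B0 hB] := wnorm_bnd M (sobolev_weightP s_ge0 n).
  by apply: le_trans (hB 0) _; rewrite (ipnorm0 (rip_semi_hilbert _)) mulr0.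
apply: le_trans (lip _ _ _ _ v0H u0H d1 z vS uS) _.
apply: (@le_trans _ _ (L%:E * (e / L)%:E)%E).
  by apply: lee_wpmul2l => //; rewrite lee_fin ltW.
by rewrite -EFinM lee_fin mulrC divfK// gt_eqF.
Qed.

End Main.

Theorem theorem1p1 (R : realType) (M : manifold) (eps s : R)
  (eps_gt0 : 0 < eps) (s_ge0 : 0 <= s) :
  exists b : R, [/\ 2^-1 < b,
    globally_well_posed M eps s b &
    locally_lipschitz_flow M eps s b].
Proof.
(* [b = 1]: profiles are Lipschitz in time *)
exists 1; split.
- by rewrite invf_lt1// ltr1n.
- split.
  + exact: solution_exists.
  + by move=> T u0 u v _ [u0L _] _ uS _ vS; exact: (solution_unique eps_gt0 u0L uS vS).
  + move=> T u0 u T0 u0H [_ _ uS] e e0.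
    have [d d0 hd] := flow_continuous eps_gt0 s_ge0 T0 u0H uS e0.
    by exists d => // v0 v v0H [_ _ vS]; exact: hd.
- move=> T u0 T0 u0H; have [L L0 lip] := flow_lipschitz eps_gt0 s_ge0 T u0H.
  exists 1, L; split => // v0 w0 v w v0H w0H dv dw [_ _ vS] [_ _ wS].
  exact: (lip v0 w0 v w v0H w0H dv dw vS wS).
Qed.
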